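(* Let $m\in\{1,2,\dots,N\}$ and $\alpha>0$. There exists a self-similar solution $V(t,x)=t^{-1/\alpha}g\big(\tfrac{x}{\sqrt t}\big)$ of the equation $u_t-\Delta u+|u|^\alpha u=0$ on $(0,\infty)\times\Omega_m$ such that $g\in C_0^{b,u}(\Omega_m)$, $g\ge0$, and $$\alpha^{-1/\alpha}e^{\Delta_m}h\le g\le(\alpha\epsilon)^{-1/\alpha}e^{(1-\epsilon)\Delta_m}h$$ for all $0<\epsilon<1$, where $h(x)=1$ is the constant function on $\Omega_m$. The self-similar solution $V$ is characterized by $$V=\lim_{\lambda\to\infty}\Gamma_\lambda^{2/\alpha}v,$$ where $v$ is the solution of the same equation with initial value $v_0=h$, and where the limit is uniform on compact subsets of $(0,\infty)\times\overline{\Omega_m}$.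
   Context: $N\ge1$ is an integer. $\Omega_m=\{x\in\mathbb R^N: x_1>0,\dots,x_m>0\}$. $C_0^{b,u}(\Omega_m)$ is the space of bounded uniformly continuous functions on $\Omega_m$ which are zero on $\partial\Omega_m$ (not necessarily tending to $0$ at infinity), a closed subspace of $L^\infty(\Omega_m)$. The heat semigroup on $\Omega_m$ is $e^{t\Delta_m}\psi(x)=\int_{\Omega_m}K_t(x,y)\psi(y)\,dy$, $t>0$, with $$K_t(x,y)=(4\pi t)^{-N/2}\prod_{j=m+1}^N e^{-\frac{|x_j-y_j|^2}{4t}}\prod_{i=1}^m\Big[e^{-\frac{|x_i-y_i|^2}{4t}}-e^{-\frac{|x_i+y_i|^2}{4t}}\Big].$$ For $v_0\in L^\infty(\Omega_m)$, the solution with initial value $v_0$ is the unique $v\in C((0,\infty);C_0^{b,u}(\Omega_m))$ satisfying $v(t)=e^{t\Delta_m}v_0-\int_0^te^{(t-s)\Delta_m}(|v(s)|^\alpha v(s))\,ds$ for $t>0$ (existence and uniqueness known); it is a classical solution on $(0,\infty)\times\Omega_m$ and $\|v(t)-e^{t\Delta_m}v_0\|_{L^\infty(\Omega_m)}\to0$ as $t\to0$. Dilations: $\Gamma_\lambda^{2/\alpha}v(t,x)=\lambda^{2/\alpha}v(\lambda^2t,\lambda x)$, $\lambda>0$. A solution $V$ is self-similar if $\Gamma_\lambda^{2/\alpha}V=V$ for all $\lambda>0$, equivalently $V(t,x)=t^{-1/\alpha}g(x/\sqrt t)$ with profile $g=V(1,\cdot)$. *)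

(* Defs.v *)
From HB Require Import structures.
From mathcomp Require Import all_boot all_order all_algebra.
From mathcomp Require Import all_classical all_reals all_analysis.

Set Implicit Arguments.
Unset Strict Implicit.
Unset Printing Implicit Defensive.
Import Order.TTheory GRing.Theory Num.Theory.
Import numFieldNormedType.Exports.

Local Open Scope classical_set_scope.
Local Open Scope ring_scope.

(* Lebesgue measure on R^n, carried by n.-tuple R with its product
   sigma-algebra: the unit mass for n = 0, then the image of the product
   of Lebesgue measure on R and the n-dimensional one under (r, y) |-> r :: y.
   [lebesgue_tuple_box] below computes it on boxes. *)
Section lebesgue_tuple.
Context {R : realType}.

Definition tuple_cons n (p : R * n.-tuple R) : n.+1.-tuple R :=
  [tuple of p.1 :: p.2].

Lemma measurable_tuple_cons n : measurable_fun setT (@tuple_cons n).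
Proof. by apply: measurable_cons. Qed.

Section step.
Variables (n : nat) (mu : {sigma_finite_measure set (n.-tuple R) -> \bar R}).

Definition lebesgue_tupleS : set (n.+1.-tuple R) -> \bar R :=
  pushforward (@lebesgue_measure R \x mu)%E (@tuple_cons n).

Let lebesgue_tupleS0 : lebesgue_tupleS set0 = 0%E.
Proof. by rewrite /lebesgue_tupleS /pushforward preimage_set0 measure0. Qed.

Let lebesgue_tupleS_ge0 A : (0 <= lebesgue_tupleS A)%E.
Proof. exact: (measure_ge0 (lebesgue_measure \x mu)%E). Qed.

Let lebesgue_tupleS_sigma_additive : semi_sigma_additive lebesgue_tupleS.
Proof.
move=> F mF tF mUF; rewrite /lebesgue_tupleS /pushforward preimage_bigcup.
have mcons := @measurable_tuple_cons n.
apply: measure_semi_sigma_additive.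
- by move=> k; rewrite -[X in measurable X]setTI; exact: mcons.
- apply/trivIsetP => /= i j _ _ ij; rewrite -preimage_setI.
  by move/trivIsetP : tF => /(_ _ _ _ _ ij) ->//; rewrite preimage_set0.
- by rewrite -preimage_bigcup -[X in measurable X]setTI; exact: mcons.
Qed.

HB.instance Definition _ := isMeasure.Build _ _ _ lebesgue_tupleS
  lebesgue_tupleS0 lebesgue_tupleS_ge0 lebesgue_tupleS_sigma_additive.

Let lebesgue_tupleS_sigma_finite : sigma_finite setT lebesgue_tupleS.
Proof.
have /sigma_finiteP[F [TF ndF Foo]] := sigma_finiteT (@lebesgue_measure R).
have /sigma_finiteP[G [TG ndG Goo]] := sigma_finiteT mu.
pose uncons (y : n.+1.-tuple R) : R * n.-tuple R :=
  (thead y, [tuple of behead y]).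
have tuple_consK p : uncons (tuple_cons p) = p.
  by case: p => r y; rewrite /uncons /tuple_cons /= theadE; congr pair;
    exact/val_inj.
have muncons : measurable_fun setT uncons.
  by apply: measurable_fun_pair; [exact: measurable_tnth|exact: measurable_behead].
exists (fun k => uncons @^-1` (F k `*` G k)).
  rewrite -preimage_bigcup (_ : \bigcup_k _ = setT) ?preimage_setT//.
  apply/seteqP; split=> // -[r y] _ /=.
  have [i _ Fir] : (\bigcup_k F k) r by rewrite -TF.
  have [j _ Gjy] : (\bigcup_k G k) y by rewrite -TG.
  exists (maxn i j) => //; split => /=.
  - by move: r Fir; exact/subsetPset/ndF/leq_maxl.
  - by move: y Gjy; exact/subsetPset/ndG/leq_maxr.
move=> k; have [mFk Fkoo] := Foo k; have [mGk Gkoo] := Goo k; split.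
  by rewrite -[X in measurable X]setTI; apply: muncons => //; exact: measurableX.
rewrite /lebesgue_tupleS /pushforward -comp_preimage.
rewrite (_ : uncons \o _ = id); last by rewrite funeqE => p /=; rewrite tuple_consK.
by rewrite preimage_id product_measure1E// lte_mul_pinfty// ge0_fin_numE.
Qed.

HB.instance Definition _ := Measure_isSigmaFinite.Build _ _ _
  lebesgue_tupleS lebesgue_tupleS_sigma_finite.

End step.

Fixpoint lebesgue_tuple n : {sigma_finite_measure set (n.-tuple R) -> \bar R} :=
  match n with
  | 0%N => dirac [tuple]
  | k.+1 => lebesgue_tupleS (lebesgue_tuple k)
  end.

Lemma measurable_tuple_box n (A : 'I_n -> set R) :
  (forall i, measurable (A i)) ->
  measurable [set y : n.-tuple R | forall i, A i (tnth y i)].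
Proof.
move=> mA.
rewrite (_ : mkset _ = \bigcap_(i in [set: 'I_n]) ((@tnth n R)^~ i @^-1` A i)).
  apply: fin_bigcap_measurable => // i _.
  by rewrite -[X in measurable X]setTI; exact: measurable_tnth.
by apply/seteqP; split=> y /= Ay i; [move=> _|]; exact: Ay.
Qed.

Lemma lebesgue_tuple_box n (A : 'I_n -> set R) :
  (forall i, measurable (A i)) ->
  lebesgue_tuple n [set y | forall i, A i (tnth y i)] =
  (\prod_(i < n) lebesgue_measure (A i))%E.
Proof.
elim: n A => [|n IHn] A mA.
  rewrite big_ord0 /= diracE mem_set//=.
  by move=> [].
rewrite big_ord_recl /= /lebesgue_tupleS /pushforward.
pose B i := A (lift ord0 i).
have mB i : measurable (B i) by exact: mA.
rewrite (_ : _ @^-1` _ =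
    A ord0 `*` [set y : n.-tuple R | forall i, B i (tnth y i)]).
  rewrite product_measure1E; [|exact: (mA ord0)|exact: (measurable_tuple_box mB)].
  by rewrite (IHn B mB).
apply/seteqP; split=> -[r y] /=.
  move=> Ay; split; first by have := Ay ord0; rewrite tnth0.
  by move=> i; have := Ay (lift ord0 i); rewrite tnthS.
move=> [Ar Ay] i; case: (unliftP ord0 i) => [j|] ->; last by rewrite tnth0.
by rewrite tnthS; exact: Ay.
Qed.

End lebesgue_tuple.

(* A function on Omega_m, or on its closure, is represented by a function on
   all of R^N of which only the values on that set matter; in the same way
   only positive times matter for a function of (t, x). *)
Section sectorial_heat.
Context {R : realType} {N : nat}.
Implicit Types (m : nat) (alpha t lambda : R).
Implicit Types (x y : 'rV[R]_N) (f psi : 'rV[R]_N -> R).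
Implicit Types (u v : R -> 'rV[R]_N -> R).

Definition Omega m : set 'rV[R]_N :=
  [set x | forall i : 'I_N, (i < m)%N -> 0 < x 0 i].

Definition C0bu m f :=
  [/\ (exists M : R, forall x, closure (Omega m) x -> `|f x| <= M),
      (forall e : R, 0 < e -> exists2 d : R, 0 < d &
        forall x y, closure (Omega m) x -> closure (Omega m) y ->
          `|x - y| < d -> `|f x - f y| < e)
    & (forall x, (closure (Omega m) `\` (Omega m)°) x -> f x = 0)].

Definition continuous_C0bu m u :=
  (forall t, 0 < t -> C0bu m (u t)) /\
  (forall t, 0 < t -> {uniform closure (Omega m), u @ t --> u t}).

Definition heat_kernel m t x y : R :=
  (4 * pi * t) `^ (- (N%:R / 2)) *
  (\prod_(j < N | (m <= j)%N) expR (- (`|x 0 j - y 0 j| ^+ 2 / (4 * t)))) *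
  (\prod_(i < N | (i < m)%N)
     (expR (- (`|x 0 i - y 0 i| ^+ 2 / (4 * t))) -
      expR (- (`|x 0 i + y 0 i| ^+ 2 / (4 * t))))).

Definition row_of_tuple (y : N.-tuple R) : 'rV[R]_N := \row_i tnth y i.

Definition heat m t psi x : R :=
  \int[lebesgue_tuple N]_(y in row_of_tuple @^-1` Omega m)
    (heat_kernel m t x (row_of_tuple y) * psi (row_of_tuple y)).

Definition absorption alpha (r : R) : R := `|r| `^ alpha * r.

(* The integrability clause says that the double integral in the Duhamel
   formula converges absolutely; without it the formula could hold
   through the default value 0 of a divergent integral. *)
Definition mild_solution alpha m psi v :=
  continuous_C0bu m v /\
  forall t x, 0 < t -> Omega m x ->
    (lebesgue_measure \x lebesgue_tuple N)%E.-integrable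
      (`]0, t[%classic `*` (row_of_tuple @^-1` Omega m))
      (fun p => (heat_kernel m (t - p.1) x (row_of_tuple p.2) *
                 absorption alpha (v p.1 (row_of_tuple p.2)))%:E) /\
    v t x = heat m t psi x -
      \int[lebesgue_measure]_(s in `]0, t[)
        heat m (t - s) (fun y => absorption alpha (v s y)) x.

Definition partial (i : 'I_N) f x : R := 'D_(delta_mx 0 i) f x.

Definition dt u t x : R := derive1 (u^~ x) t.

Definition laplacian f x : R := \sum_(i < N) partial i (partial i f) x.

Definition C12 (D : set (R * 'rV[R]_N)) u :=
  [/\ (forall t x, D (t, x) ->
        [/\ derivable (u^~ x) t 1,
            forall i : 'I_N, derivable (u t) x (delta_mx 0 i)
          & forall i j : 'I_N, derivable (partial i (u t)) x (delta_mx 0 j)]),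
      {within D, continuous (fun p => u p.1 p.2)},
      {within D, continuous (fun p => dt u p.1 p.2)},
      (forall i, {within D, continuous (fun p => partial i (u p.1) p.2)})
    & (forall i j,
        {within D, continuous (fun p => partial j (partial i (u p.1)) p.2)})].

Definition classical_solution alpha m u :=
  C12 (`]0, +oo[%classic `*` Omega m) u /\
  forall t x, 0 < t -> Omega m x ->
    dt u t x - laplacian (u t) x + absorption alpha (u t x) = 0.

(* Solutions on (0, oo) without reference to an initial value, which may be
   singular: the integral equation is required from every positive time. *)
Definition solution alpha m u :=
  [/\ continuous_C0bu m u,
      classical_solution alpha m u
    & forall tau, 0 < tau ->
        mild_solution alpha m (u tau) (fun t => u (tau + t))].

Definition dilation alpha lambda u : R -> 'rV[R]_N -> R :=
  fun t x => lambda `^ (2 / alpha) * u (lambda ^+ 2 * t) (lambda *: x).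

Definition self_similar alpha m u :=
  forall lambda, 0 < lambda -> forall t x, 0 < t -> closure (Omega m) x ->
    dilation alpha lambda u t x = u t x.

Definition cvg_locally_uniformly m (w : R -> R -> 'rV[R]_N -> R) u :=
  forall K : set (R * 'rV[R]_N), compact K ->
    K `<=` `]0, +oo[%classic `*` closure (Omega m) ->
    {uniform K, (fun lambda (p : R * 'rV[R]_N) => w lambda p.1 p.2) @ +oo -->
                (fun p => u p.1 p.2)}.

End sectorial_heat.

(* Main.v *)
From HB Require Import structures.
From mathcomp Require Import all_boot all_order all_algebra.
From mathcomp Require Import all_classical all_reals all_analysis.
From mathcomp Require Import measurable_realfun ring lra zify.
Require Import Defs.
Set Implicit Arguments.
Unset Strict Implicit.
Unset Printing Implicit Defensive.
Import Order.TTheory GRing.Theory Num.Theory.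
Import numFieldNormedType.Exports.
Local Open Scope classical_set_scope.
Local Open Scope ring_scope.

(* On functions that are odd in each of the first [m] coordinates the Dirichlet
   semigroup of [Omega m] coincides with the heat semigroup of the whole space,
   and the constant [1] on [Omega m] becomes the sign function [sgm]. The
   solution [v] issued from [sgm] is obtained by monotone iteration, which also
   gives [(1 + alpha t)^(-1/alpha) e^(t Delta) sgm <= v <= (1 + alpha t)^(-1/alpha)]
   on [Omega m]. By comparison the dilations of [v] increase with the parameter;
   their limit [V] satisfies [0 <= V <= (alpha t)^(-1/alpha)], solves the equation
   from every positive time by dominated convergence, and is invariant under
   dilations. The two bounds on the profile are the lower bound of [v] in the
   limit and the comparison of [V] with the heat flow started at time [eps].
   Since [v <= V] and a dilation of [V] is [V] again, comparison also gives
   [V (l^-2/alpha + t) <= dilation l v t <= V t], so that the convergence is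
   locally uniform by the equicontinuity of [V] in time.
   A mild solution is classical because, after multiplication by a cut-off in
   time and the substitution [s = t - sigma^2/2], the Duhamel integral may be
   differentiated twice; the time derivative is then found by expanding the
   Gaussian increments to second order. *)

(** * Integration *)

(** [V] has no initial value: as t tends to 0 it is controlled only by (alpha t)^(-1/alpha), the
    solution of y' = - y^(1+alpha) that starts from infinity. Every argument about [V] therefore
    restarts at a positive time tau, with constants that depend on tau. The final clause meets a
    similar difficulty, since it quantifies over all mild solutions [v] issued from 1: the
    definition bounds [v] at each positive time but not uniformly as t tends to 0, and it prescribes
    [v] on the closed sector only. Uniqueness thus works with an odd extension of [v] and relies on
    the absolute convergence of the Duhamel integral. The semigroup is handled as a Gaussian
    expectation and not through its kernel. Scaling, time 0 and the semigroup law then concern the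
    Gaussian law alone, and derivatives are obtained by differentiating the density in its mean,
    which needs no smoothness of the data. The Dirichlet kernel returns where signs on the sector
    matter, because the whole-space kernel says nothing about the sign of the evolution of an odd
    function. *)

Section measure_tools.
Context {R : realType}.

Section one_measure.
Context d (T : measurableType d) (mu : {measure set T -> \bar R}).
Implicit Types (D : set T) (f g : T -> R).

Lemma integrable_bounded D f (C : R) : measurable D -> (mu D < +oo)%E ->
  measurable_fun D f -> (forall x, D x -> `|f x| <= C) ->
  mu.-integrable D (EFin \o f).
Proof.
move=> mD D_fin mf fC; apply: measurable_bounded_integrable => //.
exists C; split; first exact: num_real.
by move=> M CM x Dx; apply: le_trans (ltW CM); exact: fC.
Qed.

Lemma integrable_dominated D f g : measurable D -> measurable_fun D f ->
  mu.-integrable D (EFin \o g) -> (forall x, D x -> `|f x| <= g x) ->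
  mu.-integrable D (EFin \o f).
Proof.
move=> mD mf ig fg; apply: le_integrable ig => //.
  exact/measurable_EFinP.
by move=> x Dx; rewrite /= lee_fin; apply: le_trans (fg _ Dx) (ler_norm _).
Qed.

Lemma normr_Rintegral_le D f (C : R) : measurable D -> (mu D < +oo)%E ->
  measurable_fun D f -> (forall x, D x -> `|f x| <= C) ->
  `|\int[mu]_(x in D) f x| <= C * fine (mu D).
Proof.
move=> mD D_fin mf fC.
have fi := integrable_bounded mD D_fin mf fC.
rewrite (le_trans (le_normr_Rintegral mD fi))// -Rintegral_cst//.
apply: le_Rintegral => //.
- by apply: (@integrable_bounded _ _ C) => //; [exact: measurableT_comp|move=> x Dx; rewrite normr_id fC].
- by apply: (@integrable_bounded _ _ `|C|) => // x Dx.
Qed.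

Lemma normr_Rintegral_dominated D f g : measurable D -> measurable_fun D f ->
  mu.-integrable D (EFin \o g) -> (forall x, D x -> `|f x| <= g x) ->
  `|\int[mu]_(x in D) f x| <= \int[mu]_(x in D) g x.
Proof.
move=> mD mf ig fg; have fi := integrable_dominated mD mf ig fg.
rewrite (le_trans (le_normr_Rintegral mD fi))//.
apply: le_Rintegral => //.
by apply: integrable_dominated ig _ => //; [exact: measurableT_comp|move=> x Dx; rewrite normr_id fg].
Qed.

End one_measure.

Section two_measures.
Context d1 d2 (T1 : measurableType d1) (T2 : measurableType d2).
Variables (m1 : {sigma_finite_measure set T1 -> \bar R}).
Variables (m2 : {sigma_finite_measure set T2 -> \bar R}).
Implicit Types f : T1 * T2 -> R.

(** The inner integral may be undefined or infinite on a null set of [x], where [fine] returns a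
    default value; so the passage from the extended-valued Fubini theorem is an almost everywhere
    equality. *)
Lemma Rintegral12 f : (m1 \x m2)%E.-integrable setT (EFin \o f) ->
  \int[m1]_x \int[m2]_y f (x, y) = \int[(m1 \x m2)%E]_z f z.
Proof.
move=> fi; rewrite /Rintegral -(integral12_prod_meas1 fi); congr fine.
apply: ae_eq_integral => //.
- apply/measurable_EFinP/measurableT_comp => //.
  exact: (measurable_fubini_F fi).
- exact: (measurable_fubini_F fi).
- apply: filterS (ae_integrable1 fi) => x fxi _.
  by rewrite fineK//; exact: integrable_fin_num.
Qed.

Lemma Rintegral21 f : (m1 \x m2)%E.-integrable setT (EFin \o f) ->
  \int[m2]_y \int[m1]_x f (x, y) = \int[(m1 \x m2)%E]_z f z.
Proof.
move=> fi; rewrite /Rintegral -(integral21_prod_meas1 fi); congr fine.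
apply: ae_eq_integral => //.
- apply/measurable_EFinP/measurableT_comp => //.
  exact: (measurable_fubini_G fi).
- exact: (measurable_fubini_G fi).
- apply: filterS (ae_integrable2 fi) => x fxi _.
  by rewrite fineK//; exact: integrable_fin_num.
Qed.

Lemma Rintegral12_in (D1 : set T1) (D2 : set T2) f :
  measurable D1 -> measurable D2 ->
  (m1 \x m2)%E.-integrable (D1 `*` D2) (EFin \o f) ->
  \int[m1]_(x in D1) \int[m2]_(y in D2) f (x, y) = \int[(m1 \x m2)%E]_(z in D1 `*` D2) f z.
Proof.
move=> mD1 mD2 /integrable_mkcond fi.
rewrite Rintegral_mkcond [in RHS]Rintegral_mkcond -Rintegral12; last first.
  by rewrite -restrict_EFin; apply: fi; exact: measurableX.
apply: eq_Rintegral => x _.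
rewrite /(_ \_ _); case: ifPn => xD1; last first.
  rewrite (@eq_Rintegral _ _ _ _ _ (cst 0)) ?Rintegral_cst ?mul0r//.
  by move=> y _; rewrite /patch in_setX (negbTE xD1).
rewrite Rintegral_mkcond; apply: eq_Rintegral => y _.
by rewrite /patch in_setX xD1.
Qed.

Lemma Rintegral21_in (D1 : set T1) (D2 : set T2) f :
  measurable D1 -> measurable D2 ->
  (m1 \x m2)%E.-integrable (D1 `*` D2) (EFin \o f) ->
  \int[m2]_(y in D2) \int[m1]_(x in D1) f (x, y) = \int[(m1 \x m2)%E]_(z in D1 `*` D2) f z.
Proof.
move=> mD1 mD2 /integrable_mkcond fi.
rewrite Rintegral_mkcond [in RHS]Rintegral_mkcond -Rintegral21; last first.
  by rewrite -restrict_EFin; apply: fi; exact: measurableX.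
apply: eq_Rintegral => y _.
rewrite /(_ \_ _); case: ifPn => yD2; last first.
  rewrite (@eq_Rintegral _ _ _ _ _ (cst 0)) ?Rintegral_cst ?mul0r//.
  by move=> x _; rewrite /patch in_setX (negbTE yD2) andbF.
rewrite Rintegral_mkcond; apply: eq_Rintegral => x _.
by rewrite /patch in_setX yD2 andbT.
Qed.

Lemma Rintegral_fubini (D1 : set T1) (D2 : set T2) f :
  measurable D1 -> measurable D2 ->
  (m1 \x m2)%E.-integrable (D1 `*` D2) (EFin \o f) ->
  \int[m1]_(x in D1) \int[m2]_(y in D2) f (x, y) =
  \int[m2]_(y in D2) \int[m1]_(x in D1) f (x, y).
Proof. by move=> mD1 mD2 fi; rewrite Rintegral12_in// Rintegral21_in. Qed.

(** No integrability is assumed: Tonelli gives measurability of the integrals of the positive and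
    negative parts separately, and subtraction and [fine] are measurable on all extended reals.
    Later sections can thus use parametric integrals before any bound is known. *)
Lemma measurable_Rintegral2 (D2 : set T2) f : measurable D2 ->
  measurable_fun setT f ->
  measurable_fun setT (fun x => \int[m2]_(y in D2) f (x, y)).
Proof.
move=> mD2 mf.
have mg : measurable_fun setT (EFin \o (f \_ (setT `*` D2))).
  apply/measurable_EFinP/(measurable_restrictT _ _).1 => //; first exact: measurableX.
  exact: measurable_funTS.
rewrite (_ : (fun _ => _) = fine \o (fun x =>
  (\int[m2]_y (EFin \o (f \_ (setT `*` D2))) (x, y))%E)); last first.
  apply/funext => x /=; rewrite Rintegral_mkcond /Rintegral.
  congr fine; apply: eq_integral => y _ /=.
  by rewrite /patch in_setX in_setT.
apply: measurableT_comp => //.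
rewrite (_ : (fun _ => _) = (fun x => (\int[m2]_y ((EFin \o (f \_ (setT `*` D2)))^\+%E (x, y)) -
   \int[m2]_y ((EFin \o (f \_ (setT `*` D2)))^\-%E (x, y)))%E)); last first.
  apply/funext => x; rewrite [LHS]integralE.
  under eq_integral do rewrite funepos_comp/=.
  by under [X in (_ - X)%E = _]eq_integral do rewrite funeneg_comp/=.
apply: emeasurable_funB.
  by apply: (@measurable_fun_fubini_tonelli_F _ _ _ _ _ m2) => //; exact: measurable_funepos.
by apply: (@measurable_fun_fubini_tonelli_F _ _ _ _ _ m2) => //; exact: measurable_funeneg.
Qed.

End two_measures.
End measure_tools.

Section density.
Context {R : realType} d (T : measurableType d).
Variables (mu nu : {measure set T -> \bar R}) (p : T -> R).
Hypotheses (mp : measurable_fun setT p) (p0 : forall x, 0 <= p x).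
Hypothesis nuE : forall A, measurable A -> nu A = (\int[mu]_(x in A) (p x)%:E)%E.

Import HBNNSimple.

(** Both sides commute with the increasing limit of the simple functions [h n]; for a simple
    function the identity is [nuE] on each level set. *)
Lemma ge0_integral_density (f : T -> \bar R) : measurable_fun setT f ->
  (forall x, 0 <= f x)%E ->
  (\int[nu]_x f x = \int[mu]_x (f x * (p x)%:E))%E.
Proof.
move=> mf f0; pose h := nnsfun_approx measurableT mf.
have hf x : EFin \o h ^~ x @ \oo --> f x.
  by apply: cvg_nnsfun_approx.
have mh n : measurable_fun setT (EFin \o h n) by exact/measurable_EFinP.
have mpE : measurable_fun setT (EFin \o p) by exact/measurable_EFinP.
transitivity (limn (fun n => \int[nu]_x (h n x)%:E)%E).
  rewrite -monotone_convergence//.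
  - by apply: eq_integral => x _; apply/esym/cvg_lim => //; exact: hf.
  - by move=> n x _; rewrite lee_fin.
  - by move=> x _ a b ab; rewrite lee_fin; exact/lefP/nd_nnsfun_approx.
transitivity (limn (fun n => \int[mu]_x ((h n x)%:E * (p x)%:E)))%E; last first.
  rewrite -monotone_convergence//.
  - apply: eq_integral => x _; apply/cvg_lim => //.
    by apply: cvgeZr => //; exact: hf.
  - by move=> n; apply: emeasurable_funM mpE; exact: mh.
  - by move=> n x _; rewrite mule_ge0// lee_fin.
  - move=> x _ a b ab; rewrite lee_pmul ?lee_fin//.
    exact/lefP/nd_nnsfun_approx.
congr (limn _); apply/funext => n.
under eq_integral do rewrite fimfunE -fsumEFin//.
have hpE x : ((h n x)%:E * (p x)%:E = \sum_(i \in range (h n))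
    ((i * \1_(h n @^-1` [set i]) x)%:E * (p x)%:E))%E.
  rewrite fimfunE -fsumEFin// ge0_mule_fsuml// => i.
  by rewrite nnfun_muleindic_ge0.
under [RHS]eq_integral do rewrite hpE.
rewrite ge0_integral_fsum//; last 2 first.
- by move=> y; exact/measurable_EFinP/measurable_funM.
- by move=> y x _; rewrite nnfun_muleindic_ge0.
rewrite ge0_integral_fsum//; last 2 first.
- move=> y; apply: emeasurable_funM => //.
  exact/measurable_EFinP/measurable_funM.
- by move=> y x _; rewrite mule_ge0 ?nnfun_muleindic_ge0// lee_fin.
apply: eq_fsbigr => r _.
rewrite integralZl_indic_nnsfun// integral_indic// setIT nuE//.
under [RHS]eq_integral do rewrite EFinM -muleA.
have [r0|r0] := leP 0 r; last first.
  rewrite preimage_nnfun0// integral_set0 mule0.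
  by rewrite integral0_eq// => x _; rewrite indicE in_set0 mul0e mule0.
rewrite ge0_integralZl//; last 2 first.
- apply: emeasurable_funM => //; exact/measurable_EFinP.
- by move=> x _; rewrite mule_ge0// lee_fin.
congr (_ * _)%E; rewrite integral_mkcond; apply: eq_integral => x _.
rewrite restrict_EFin/= /patch indicE; case: ifPn => /= _.
  by rewrite mul1e.
by rewrite mul0e.
Qed.
End density.

Section lebesgue_affine.
Context {R : realType}.
Notation mu := (@lebesgue_measure R).

Let affine (c a : R) : measurableTypeR R -> measurableTypeR R := fun x => c * x + a.

Let measurable_affine c a : measurable_fun setT (affine c a).
Proof. by apply: measurable_funD => //; apply: measurable_funM. Qed.

(** The image of Lebesgue measure under x |-> c x + a, multiplied by c, has the right value on
    half-open intervals, hence is Lebesgue measure. *)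
Lemma ge0_integral_affine (c a : R) (f : R -> \bar R) : 0 < c ->
  measurable_fun setT f -> (forall x, 0 <= f x)%E ->
  (\int[mu]_x f x = c%:E * \int[mu]_x f (c * x + a)%R)%E.
Proof.
move=> c0 mf f0.
have c00 : 0 <= c by exact: ltW.
pose nu : {measure set (measurableTypeR R) -> \bar R} :=
  mscale (NngNum c00) (measure_function_pushforward__canonical__measure_function_Measure mu (measurable_affine c a)).
transitivity (\int[nu]_x f x)%E.
  apply: eq_measure_integral => A mA _.
  apply: lebesgue_measure_unique => //= _ [[u v]] _ <-.
  rewrite /mscale/= /pushforward.
  rewrite (_ : _ @^-1` _ = `](u - a) / c, (v - a) / c]%classic); last first.
    apply/seteqP; split=> x /=; rewrite !in_itv/= /affine.
      by move=> /andP[ux xv]; rewrite ltr_pdivrMr// ler_pdivlMr// mulrC; lra.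
    by rewrite ltr_pdivrMr// ler_pdivlMr// mulrC => /andP[ux xv]; lra.
  rewrite !lebesgue_measure_itv/= !lte_fin ltr_pM2r ?invr_gt0// ltrD2r.
  case: ifPn => _; last by rewrite mule0.
  by rewrite -!EFinB -EFinM; congr (_%:E); field; lra.
by rewrite ge0_integral_mscale//= ge0_integral_pushforward.
Qed.

Lemma ge0_integral_oppr (f : R -> \bar R) :
  measurable_fun setT f -> (forall x, 0 <= f x)%E ->
  (\int[mu]_x f x = \int[mu]_x f (- x)%R)%E.
Proof.
move=> mf f0.
transitivity (\int[pushforward mu (-%R : _ -> measurableTypeR R)]_x f x)%E.
  by apply: eq_measure_integral => A mA _; exact/esym/lebesgue_measureN.
by rewrite ge0_integral_pushforward.
Qed.
End lebesgue_affine.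

(** * Gaussian measures *)

Section gaussian_line.
Context {R : realType}.
Notation mu := (@lebesgue_measure R).
Notation N1 := (@normal_prob R 0 1).

(** Transfer principle: an equality of laws, tested on nonnegative functions, passes to real
    integrals through positive and negative parts. It serves convolution, resampling, coordinate
    projections and reflections alike. *)
Lemma Rintegral_law d1 d2 d3 (T1 : measurableType d1) (T2 : measurableType d2)
    (S : measurableType d3) (m1 : {measure set T1 -> \bar R})
    (m2 : {measure set T2 -> \bar R}) (g1 : T1 -> S) (g2 : T2 -> S) :
  (forall f : S -> \bar R, measurable_fun setT f -> (forall x, 0 <= f x)%E ->
    \int[m1]_x f (g1 x) = \int[m2]_x f (g2 x))%E ->
  forall F : S -> R, measurable_fun setT F ->
  \int[m1]_x F (g1 x) = \int[m2]_x F (g2 x).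
Proof.
move=> h F mF; have mFE : measurable_fun setT (EFin \o F) by exact/measurable_EFinP.
rewrite /Rintegral; congr fine.
rewrite integralE [RHS]integralE.
under eq_integral do rewrite (funepos_comp (EFin \o F) g1)/=.
under [X in (_ - X)%E = _]eq_integral do rewrite (funeneg_comp (EFin \o F) g1)/=.
under [X in _ = (X - _)%E]eq_integral do rewrite (funepos_comp (EFin \o F) g2)/=.
under [X in _ = (_ - X)%E]eq_integral do rewrite (funeneg_comp (EFin \o F) g2)/=.
by congr (_ - _)%E; apply: h => //; [exact: measurable_funepos|exact: measurable_funeneg].
Qed.

Lemma integrable_law d1 d2 d3 (T1 : measurableType d1) (T2 : measurableType d2)
    (S : measurableType d3) (m1 : {measure set T1 -> \bar R})
    (m2 : {measure set T2 -> \bar R}) (g1 : T1 -> S) (g2 : T2 -> S) :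
  measurable_fun setT g1 ->
  (forall f : S -> \bar R, measurable_fun setT f -> (forall x, 0 <= f x)%E ->
    \int[m1]_x f (g1 x) = \int[m2]_x f (g2 x))%E ->
  forall F : S -> R, measurable_fun setT F ->
  m2.-integrable setT (EFin \o (F \o g2)) -> m1.-integrable setT (EFin \o (F \o g1)).
Proof.
move=> mg1 h F mF /integrableP[_ i2]; apply/integrableP; split.
  by apply/measurable_EFinP; exact: measurableT_comp.
rewrite (h (fun x => `|(F x)%:E|)%E)//.
by apply: measurableT_comp => //; exact/measurable_EFinP.
Qed.

Lemma ge0_integral_normal (f : R -> \bar R) : measurable_fun setT f ->
  (forall x, 0 <= f x)%E ->
  (\int[N1]_z f z = \int[mu]_z (f z * (normal_pdf 0 1 z)%:E))%E.
Proof.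
move=> mf f0; apply: ge0_integral_density => //; first exact: measurable_normal_pdf.
by move=> x; exact: normal_pdf_ge0.
Qed.

Lemma normal_pdf_affine (x a z : R) : 0 < a ->
  normal_pdf x a (a * z + x) = a^-1 * normal_pdf 0 1 z.
Proof.
move=> a0; rewrite !normal_pdfE ?oner_eq0 ?gt_eqF// /normal_fun mulrA; congr (_ * expR _).
  rewrite /normal_peak -mulrnAr -[in RHS]mulrnAr expr1n mul1r sqrtrM ?sqr_ge0// sqrtr_sqr gtr0_norm//.
  by rewrite invfM.
by rewrite addrK subr0 exprMn expr1n -mulrnAr; field; rewrite gt_eqF.
Qed.

Lemma ge0_integral_normal_affine (f : R -> \bar R) (x a : R) : 0 < a ->
  measurable_fun setT f -> (forall y, 0 <= f y)%E ->
  (\int[N1]_z f (x + a * z)%R = \int[mu]_y (f y * (normal_pdf x a y)%:E))%E.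
Proof.
move=> a0 mf f0.
rewrite (@ge0_integral_affine _ a x (fun y => f y * (normal_pdf x a y)%:E)%E)//; last 2 first.
- by apply: emeasurable_funM => //; apply/measurable_EFinP; exact: measurable_normal_pdf.
- by move=> y; rewrite mule_ge0// lee_fin normal_pdf_ge0.
have mg : measurable_fun [set: R] (fun z => f (x + a * z)%R).
  apply: measurableT_comp => //; apply: measurable_funD => //; exact: measurable_funM.
rewrite ge0_integral_normal//.
rewrite -ge0_integralZl//; last 3 first.
- apply: emeasurable_funM => //; last first.
    by apply/measurable_EFinP; apply: measurableT_comp; [exact: measurable_normal_pdf|apply: measurable_funD => //; exact: measurable_funM].
  apply: measurableT_comp => //; apply: measurable_funD => //; exact: measurable_funM.
- by move=> y _; rewrite mule_ge0// lee_fin normal_pdf_ge0.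
- by rewrite lee_fin ltW.
apply: eq_integral => z _; rewrite normal_pdf_affine// addrC EFinM.
rewrite muleCA; congr (_ * _)%E.
by rewrite -!EFinM mulrA divff ?mul1r// gt_eqF.
Qed.

Lemma normal_pdf_center (m s x : R) : s != 0 ->
  normal_pdf m s x = normal_pdf 0 s (x - m).
Proof. by move=> s0; rewrite !normal_pdfE// /normal_fun subr0. Qed.

(** Completing the square in z: the joint density of Z and Y = a Z + b W is the density of Y times
    the conditional density of Z given Y, which is again normal. *)
Lemma normal_pdf_conv (a b y z : R) : 0 < a -> 0 < b ->
  normal_pdf (a * z) b y * normal_pdf 0 1 z =
  normal_pdf 0 (Num.sqrt (a ^+ 2 + b ^+ 2)) y *
  normal_pdf (a * y / (a ^+ 2 + b ^+ 2)) (b / Num.sqrt (a ^+ 2 + b ^+ 2)) z.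
Proof.
move=> a0 b0; set c2 := a ^+ 2 + b ^+ 2.
have c20 : 0 < c2 by rewrite addr_gt0// exprn_gt0.
have c0 : 0 < Num.sqrt c2 by rewrite sqrtr_gt0.
have cE : Num.sqrt c2 ^+ 2 = c2 by rewrite sqr_sqrtr// ltW.
rewrite !normal_pdfE ?oner_eq0 ?gt_eqF// ?divr_gt0//.
rewrite /normal_fun mulrACA [RHS]mulrACA -!expRD; congr (_ * expR _).
  rewrite /normal_peak -!invfM -!sqrtrM; last 2 first.
  - by rewrite mulrn_wge0// mulr_ge0 ?sqr_ge0 ?pi_ge0.
  - by rewrite mulrn_wge0// mulr_ge0 ?sqr_ge0 ?pi_ge0.
  by congr (Num.sqrt _)^-1; rewrite expr_div_n cE; field; rewrite gt_eqF.
rewrite expr_div_n cE !subr0; rewrite /c2; field.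
by rewrite -/c2 !gt_eqF.
Qed.

(** After Tonelli the variable z occurs only in the conditional density of [normal_pdf_conv], whose
    total mass is 1. *)
Lemma ge0_integral_normal_conv (f : R -> \bar R) (a b : R) : 0 < a -> 0 < b ->
  measurable_fun setT f -> (forall y, 0 <= f y)%E ->
  (\int[N1]_z \int[N1]_w f (a * z + b * w)%R =
   \int[N1]_z f (Num.sqrt (a ^+ 2 + b ^+ 2) * z)%R)%E.
Proof.
move=> a0 b0 mf f0; set c := Num.sqrt _.
have c0 : 0 < c by rewrite sqrtr_gt0 addr_gt0// exprn_gt0.
have mpdf2 : measurable_fun [set: R * R] (fun p => normal_pdf (a * p.1) b p.2).
  rewrite (_ : (fun _ => _) = (fun p => normal_pdf 0 b (p.2 - a * p.1))); last first.
    by apply/funext => p; rewrite normal_pdf_center ?gt_eqF.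
  apply: measurableT_comp; first exact: measurable_normal_pdf.
  by apply: measurable_funB => //; apply: measurable_funM.
have mk : measurable_fun [set: R * R] (fun p => f p.2 * (normal_pdf (a * p.1) b p.2)%:E)%E.
  by apply: emeasurable_funM; [exact: measurableT_comp|exact/measurable_EFinP].
transitivity (\int[N1]_z \int[mu]_y (f y * (normal_pdf (a * z) b y)%:E))%E.
  by apply: eq_integral => z _; rewrite ge0_integral_normal_affine.
have k0 (p : R * R) : (0 <= f p.2 * (normal_pdf (a * p.1) b p.2)%:E)%E.
  by rewrite mule_ge0// lee_fin normal_pdf_ge0.
rewrite (@fubini_tonelli _ _ _ _ _ N1 mu _ mk k0)/=.
transitivity (\int[N1]_z f (0 + c * z)%R)%E; last by under eq_integral do rewrite add0r.
rewrite ge0_integral_normal_affine//; apply: eq_integral => y _.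
have mq : measurable_fun [set: R] (fun z => (normal_pdf (a * z) b y)%:E).
  apply/measurable_EFinP; under eq_fun do rewrite normal_pdf_center ?gt_eqF//.
  apply: measurableT_comp; first exact: measurable_normal_pdf.
  by apply: measurable_funB => //; apply: measurable_funM.
rewrite ge0_integralZl//; last by move=> z _; rewrite lee_fin normal_pdf_ge0.
congr (_ * _)%E; rewrite ge0_integral_normal//; last first.
  by move=> z; rewrite lee_fin normal_pdf_ge0.
under eq_integral do rewrite -EFinM normal_pdf_conv// EFinM.
rewrite ge0_integralZl//.
- by rewrite integral_normal_pdf mule1.
- by apply/measurable_EFinP; exact: measurable_normal_pdf.
- by move=> z _; rewrite lee_fin normal_pdf_ge0.
- by rewrite lee_fin normal_pdf_ge0.
Qed.

End gaussian_line.

(** * The standard Gaussian law on tuples *)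

Section gaussian_tuple.
Context {R : realType}.
Notation mu := (@lebesgue_measure R).
Notation N1 := (@normal_prob R 0 1).

Section step.
Variables (n : nat) (m : probability (n.-tuple R) R).

Definition gaussS : set (n.+1.-tuple R) -> \bar R :=
  pushforward (N1 \x m)%E (@tuple_cons R n).

HB.instance Definition _ := Measure.copy gaussS
  (measure_function_pushforward__canonical__measure_function_Measure
    (N1 \x m)%E (@measurable_tuple_cons R n)).

Let gaussST : gaussS setT = 1%E.
Proof. by rewrite /gaussS /pushforward preimage_setT -setXTT product_measure1E// -[LHS]/(N1 setT * m setT)%E !probability_setT mule1. Qed.

HB.instance Definition _ := Measure_isProbability.Build _ _ _ gaussS gaussST.

End step.

(** Built by the same recursion as [lebesgue_tuple], so that densities and symmetries are compared
    by induction on the first coordinate. *)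
Fixpoint gauss n : probability (n.-tuple R) R :=
  match n with
  | 0%N => dirac [tuple]
  | k.+1 => gaussS (gauss k)
  end.

Definition taff n (x : 'I_n -> R) (a : R) (z : n.-tuple R) : n.-tuple R :=
  [tuple x i + a * tnth z i | i < n].

Definition tcomb n (a b : R) (y z : n.-tuple R) : n.-tuple R :=
  [tuple a * tnth y i + b * tnth z i | i < n].

Definition tset n (i : 'I_n) (z : n.-tuple R) (w : R) : n.-tuple R :=
  [tuple if j == i then w else tnth z j | j < n].

Definition tflip n (i : 'I_n) (z : n.-tuple R) : n.-tuple R :=
  [tuple if j == i then - tnth z j else tnth z j | j < n].

Lemma measurable_mktuple d (T : measurableType d) n (f : T -> 'I_n -> R) :
  (forall i, measurable_fun setT (f ^~ i)) ->
  measurable_fun setT (fun x => [tuple f x i | i < n]).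
Proof.
move=> mf; apply/measurable_fun_tnthP => i.
rewrite (_ : _ \o _ = f ^~ i); first exact: mf.
by apply/funext => x /=; rewrite tnth_mktuple.
Qed.

Lemma measurable_tnth_comp d (T : measurableType d) n (f : T -> n.-tuple R) i :
  measurable_fun setT f -> measurable_fun setT (fun x => tnth (f x) i).
Proof. by move=> /measurable_fun_tnthP/(_ i). Qed.

Lemma measurable_taff n x a : measurable_fun setT (@taff n x a).
Proof.
apply: measurable_mktuple => i; apply: measurable_funD => //.
by apply: measurable_funM => //; exact: measurable_tnth.
Qed.

Lemma measurable_tset n i : measurable_fun setT (fun p => @tset n i p.1 p.2).
Proof.
apply: measurable_mktuple => j; case: (j == i); first exact: measurable_snd.
by apply: measurable_tnth_comp; exact: measurable_fst.
Qed.

Lemma measurable_tcomb_comp d (T : measurableType d) n a b (u v : T -> n.-tuple R) :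
  measurable_fun setT u -> measurable_fun setT v ->
  measurable_fun setT (fun x => tcomb a b (u x) (v x)).
Proof.
move=> mu_ mv; apply: measurable_mktuple => j; apply: measurable_funD.
  by apply: measurable_funM => //; exact: measurable_tnth_comp.
by apply: measurable_funM => //; exact: measurable_tnth_comp.
Qed.

Lemma measurable_tcomb n a b : measurable_fun setT (fun p => @tcomb n a b p.1 p.2).
Proof.
apply: measurable_mktuple => j; apply: measurable_funD.
  by apply: measurable_funM => //; apply: measurable_tnth_comp; exact: measurable_fst.
by apply: measurable_funM => //; apply: measurable_tnth_comp; exact: measurable_snd.
Qed.

Lemma measurable_tcomb1 n a b y : measurable_fun setT (@tcomb n a b y).
Proof.
apply: measurable_mktuple => j; apply: measurable_funD => //.
by apply: measurable_funM => //; exact: measurable_tnth.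
Qed.

Lemma measurable_tflip n i : measurable_fun setT (@tflip n i).
Proof.
apply: measurable_mktuple => j; case: (j == i); last exact: measurable_tnth.
by apply: measurableT_comp => //; exact: measurable_tnth.
Qed.

Lemma tnthS_cons n (r : R) (y : n.-tuple R) (i : 'I_n) :
  tnth (tuple_cons (r, y)) (lift ord0 i) = tnth y i.
Proof. by rewrite tnthS. Qed.

Lemma tnth0_cons n (r : R) (y : n.-tuple R) :
  tnth (tuple_cons (r, y)) ord0 = r.
Proof. by rewrite tnth0. Qed.

Lemma taff_cons n x a r (y : n.-tuple R) :
  taff x a (tuple_cons (r, y)) = tuple_cons (x ord0 + a * r, taff (x \o lift ord0) a y).
Proof.
apply: eq_from_tnth => i; rewrite tnth_mktuple.
case: (unliftP ord0 i) => [j|] ->; rewrite ?tnthS_cons ?tnth0_cons//.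
by rewrite tnth_mktuple.
Qed.

Lemma tcomb_cons n a b r s (y z : n.-tuple R) :
  tcomb a b (tuple_cons (r, y)) (tuple_cons (s, z)) =
  tuple_cons (a * r + b * s, tcomb a b y z).
Proof.
apply: eq_from_tnth => i; rewrite tnth_mktuple.
case: (unliftP ord0 i) => [j|] ->; rewrite ?tnthS_cons ?tnth0_cons//.
by rewrite tnth_mktuple.
Qed.

Lemma tset_cons0 n r (y : n.-tuple R) w :
  tset ord0 (tuple_cons (r, y)) w = tuple_cons (w, y).
Proof.
apply: eq_from_tnth => i; rewrite tnth_mktuple.
by case: (unliftP ord0 i) => [j|] ->; rewrite ?tnthS_cons ?tnth0_cons// eqxx.
Qed.

Lemma tset_consS n i r (y : n.-tuple R) w :
  tset (lift ord0 i) (tuple_cons (r, y)) w = tuple_cons (r, tset i y w).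
Proof.
apply: eq_from_tnth => j; rewrite tnth_mktuple.
case: (unliftP ord0 j) => [k|] ->; rewrite ?tnthS_cons ?tnth0_cons//.
by rewrite tnth_mktuple (inj_eq lift_inj).
Qed.

Lemma tflip_cons0 n r (y : n.-tuple R) :
  tflip ord0 (tuple_cons (r, y)) = tuple_cons (- r, y).
Proof.
apply: eq_from_tnth => i; rewrite tnth_mktuple.
by case: (unliftP ord0 i) => [j|] ->; rewrite ?tnthS_cons ?tnth0_cons// eqxx.
Qed.

Lemma tflip_consS n i r (y : n.-tuple R) :
  tflip (lift ord0 i) (tuple_cons (r, y)) = tuple_cons (r, tflip i y).
Proof.
apply: eq_from_tnth => j; rewrite tnth_mktuple.
case: (unliftP ord0 j) => [k|] ->; rewrite ?tnthS_cons ?tnth0_cons//.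
by rewrite tnth_mktuple (inj_eq lift_inj).
Qed.

Let mcons n : measurable_fun [set: measurableTypeR R * n.-tuple R] (@tuple_cons R n)
  := @measurable_tuple_cons R n.

Local Open Scope ereal_scope.

Section tonelli.
Variable n : nat.
Variable f : n.+1.-tuple R -> \bar R.
Hypotheses (mf : measurable_fun setT f) (f0 : forall x, 0 <= f x).

Lemma measurable_cons_section r : measurable_fun setT (fun y => f (tuple_cons (r, y))).
Proof.
apply: measurableT_comp => //; apply: measurableT_comp; first exact: measurable_tuple_cons.
exact: measurable_pair1.
Qed.

Lemma measurable_cons_comp : measurable_fun setT (fun p => f (tuple_cons p)).
Proof. by apply: measurableT_comp => //; exact: measurable_tuple_cons. Qed.

Lemma measurable_integral_cons (m : {sigma_finite_measure set (n.-tuple R) -> \bar R}) :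
  measurable_fun setT (fun r => \int[m]_y f (tuple_cons (r, y))).
Proof.
by apply: (@measurable_fun_fubini_tonelli_F _ _ _ _ _ m (fun p => f (tuple_cons p))) => //; exact: measurable_cons_comp.
Qed.

Lemma ge0_integral_gaussS :
  \int[gauss n.+1]_z f z = \int[N1]_r \int[gauss n]_y f (tuple_cons (r, y)).
Proof.
have := @ge0_integral_pushforward _ _ _ _ _ _ (@mcons n)
  (N1 \x gauss n) _ f measurableT mf (fun x _ => f0 x).
rewrite preimage_setT => fE; apply: (etrans fE).
by rewrite (@fubini_tonelli1 _ _ _ _ _ N1 (gauss n) (fun p => f (tuple_cons p)))//; exact: measurable_cons_comp.
Qed.

Lemma ge0_integral_lebesgue_tupleS :
  \int[lebesgue_tuple n.+1]_z f z =
  \int[mu]_r \int[lebesgue_tuple n]_y f (tuple_cons (r, y)).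
Proof.
have := @ge0_integral_pushforward _ _ _ _ _ _ (@mcons n)
  (mu \x lebesgue_tuple n) _ f measurableT mf (fun x _ => f0 x).
rewrite preimage_setT => fE; apply: (etrans fE).
by rewrite (@fubini_tonelli1 _ _ _ _ _ mu (lebesgue_tuple n) (fun p => f (tuple_cons p)))//; exact: measurable_cons_comp.
Qed.

Lemma ge0_integral_cons_swap (m : {sigma_finite_measure set (measurableTypeR R) -> \bar R})
   (m' : {sigma_finite_measure set (n.-tuple R) -> \bar R}) :
  \int[m]_r \int[m']_y f (tuple_cons (r, y)) = \int[m']_y \int[m]_r f (tuple_cons (r, y)).
Proof.
by rewrite (@fubini_tonelli _ _ _ _ _ m m' (fun p => f (tuple_cons p)))//; exact: measurable_cons_comp.
Qed.

End tonelli.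

Lemma ge0_integral_lebesgue_tuple_flip n (i : 'I_n) (f : n.-tuple R -> \bar R) :
  measurable_fun setT f -> (forall x, 0 <= f x) ->
  \int[lebesgue_tuple n]_z f (tflip i z) = \int[lebesgue_tuple n]_z f z.
Proof.
elim: n i f => [[]//|n IH] i f mf f0.
rewrite ge0_integral_lebesgue_tupleS//; last first.
  by apply: measurableT_comp => //; exact: measurable_tflip.
rewrite ge0_integral_lebesgue_tupleS//.
case: (unliftP ord0 i) => [j|] ->; last first.
  rewrite [RHS]ge0_integral_oppr; last 2 first.
  - exact: measurable_integral_cons.
  - by move=> r; apply: integral_ge0.
  apply: eq_integral => r _; apply: eq_integral => y _.
  by rewrite tflip_cons0.
apply: eq_integral => r _.
rewrite -(IH j (fun y => f (tuple_cons (r, y))))//; last exact: measurable_cons_section.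
by apply: eq_integral => y _; rewrite tflip_consS.
Qed.

(** The Lebesgue density of the law of x + a Z for a standard Gaussian vector Z. *)
Definition gdens n (x : 'I_n -> R) (a : R) (y : n.-tuple R) : R :=
  (\prod_(i < n) normal_pdf (x i) a (tnth y i))%R.

Lemma measurable_gdens n x a : measurable_fun setT (@gdens n x a).
Proof.
apply: measurable_prod => i _; apply: measurableT_comp; first exact: measurable_normal_pdf.
exact: measurable_tnth.
Qed.

Lemma gdens_ge0 n x a y : (0 <= @gdens n x a y)%R.
Proof. by apply: prodr_ge0 => i _; exact: normal_pdf_ge0. Qed.

Lemma gdens_cons n x a r y : @gdens n.+1 x a (tuple_cons (r, y)) =
  (normal_pdf (x ord0) a r * gdens (x \o lift ord0) a y)%R.
Proof.
rewrite /gdens big_ord_recl tnth0_cons; congr (_ * _)%R.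
by apply: eq_bigr => i _; rewrite tnthS_cons.
Qed.

Lemma ge0_integral_gauss_affine n x (a : R) (f : n.-tuple R -> \bar R) : (0 < a)%R ->
  measurable_fun setT f -> (forall x, 0 <= f x) ->
  \int[gauss n]_z f (taff x a z) = \int[lebesgue_tuple n]_y (f y * (gdens x a y)%:E).
Proof.
move=> a0; elim: n x f => [|n IH] x f mf f0.
  rewrite /= !integral_dirac//; last 2 first.
  - apply: emeasurable_funM => //; apply/measurable_EFinP; exact: measurable_gdens.
  - by apply: measurableT_comp => //; exact: measurable_taff.
  rewrite !diracT !mul1e /gdens big_ord0 mule1; congr f.
  by apply: eq_from_tnth => -[].
rewrite ge0_integral_gaussS//; last by apply: measurableT_comp => //; exact: measurable_taff.
have mfg : measurable_fun setT (fun y => f y * (gdens x a y)%:E).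
  by apply: emeasurable_funM => //; apply/measurable_EFinP; exact: measurable_gdens.
have fg0 y : 0 <= f y * (gdens x a y)%:E by rewrite mule_ge0// lee_fin gdens_ge0.
rewrite ge0_integral_lebesgue_tupleS//.
pose G r := \int[lebesgue_tuple n]_y (f (tuple_cons (r, y)) * (gdens (x \o lift ord0) a y)%:E).
have mG : measurable_fun setT G.
  apply: (@measurable_fun_fubini_tonelli_F _ _ _ _ _ (lebesgue_tuple n)
    (fun p => f (tuple_cons p) * (gdens (x \o lift ord0) a p.2)%:E)) => //.
    apply: emeasurable_funM; first exact: measurable_cons_comp.
    by apply/measurable_EFinP; apply: measurableT_comp; [exact: measurable_gdens|exact: measurable_snd].
  by move=> p; rewrite mule_ge0// lee_fin gdens_ge0.
have G0 r : 0 <= G r.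
  by apply: integral_ge0 => y _; rewrite mule_ge0// lee_fin gdens_ge0.
transitivity (\int[N1]_r G (x ord0 + a * r)%R).
  apply: eq_integral => r _; rewrite /G -(IH _ (fun y => f (tuple_cons (x ord0 + a * r, y)%R)))//.
    by apply: eq_integral => y _; rewrite taff_cons.
  exact: measurable_cons_section.
rewrite ge0_integral_normal_affine//; apply: eq_integral => r _.
rewrite /G -ge0_integralZr//.
- by apply: eq_integral => y _; rewrite gdens_cons EFinM -muleA; congr (_ * _); rewrite muleC.
- apply: emeasurable_funM; first exact: measurable_cons_section.
  by apply/measurable_EFinP; exact: measurable_gdens.
- by move=> y _; rewrite mule_ge0// lee_fin gdens_ge0.
- by rewrite lee_fin normal_pdf_ge0.
Qed.

Lemma ge0_integral_gauss_conv n (a b : R) (f : n.-tuple R -> \bar R) :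
  (0 < a)%R -> (0 < b)%R ->
  measurable_fun setT f -> (forall x, 0 <= f x) ->
  \int[gauss n]_y \int[gauss n]_z f (tcomb a b y z) =
  \int[gauss n]_z f (taff (fun=> 0%R) (Num.sqrt (a ^+ 2 + b ^+ 2)) z).
Proof.
move=> a0 b0; set c := Num.sqrt _; elim: n f => [|n IH] f mf f0.
  have mft : measurable_fun setT (fun q : 0.-tuple R * 0.-tuple R => f (tcomb a b q.1 q.2)).
    by apply: measurableT_comp => //; exact: measurable_tcomb.
  rewrite /= !integral_dirac//.
  - rewrite !diracT !mul1e; congr f.
    by apply: eq_from_tnth => -[].
  - by apply: measurableT_comp => //; exact: measurable_taff.
  - by apply: measurableT_comp => //; exact: measurable_tcomb1.
  - exact: (@measurable_fun_fubini_tonelli_F _ _ _ _ _ (gauss 0) _ mft).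
have mft (y : n.+1.-tuple R) : measurable_fun setT (fun z => f (tcomb a b y z)).
  by apply: measurableT_comp => //; exact: measurable_tcomb1.
rewrite ge0_integral_gaussS//; last 2 first.
- apply: (@measurable_fun_fubini_tonelli_F _ _ _ _ _ (gauss n.+1) (fun p => f (tcomb a b p.1 p.2))) => //.
  by apply: measurableT_comp => //; exact: measurable_tcomb.
- by move=> x; exact: integral_ge0.
transitivity (\int[N1]_r \int[N1]_s \int[gauss n]_z f (tuple_cons (a * r + b * s, taff (fun=> 0) c z)%R)).
  apply: eq_integral => r _.
  transitivity (\int[gauss n]_y \int[N1]_s \int[gauss n]_z f (tuple_cons (a * r + b * s, tcomb a b y z)%R)).
    apply: eq_integral => y _; rewrite (ge0_integral_gaussS (mft _))//.
    by apply: eq_integral => s _; apply: eq_integral => z _; rewrite tcomb_cons.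
  (* The order of integration is head, tail, head, tail. Exchanging the middle two brings the tails
     together for the induction hypothesis, and the heads together for the one-dimensional
     convolution. *)
  rewrite (@fubini_tonelli _ _ _ _ _ (gauss n) N1 (fun p => \int[gauss n]_z f (tuple_cons (a * r + b * p.2, tcomb a b p.1 z)%R)))/=; last 2 first.
  - apply: (@measurable_fun_fubini_tonelli_F _ _ _ _ _ (gauss n) (fun q => f (tuple_cons (a * r + b * q.1.2, tcomb a b q.1.1 q.2)%R))) => //.
    apply: measurableT_comp => //; apply: measurableT_comp; first exact: measurable_tuple_cons.
    apply: measurable_fun_pair.
      by apply: measurable_funD => //; apply: measurable_funM => //; apply: measurableT_comp => //; exact: measurable_snd.
    apply: measurable_tcomb_comp; last exact: measurable_snd.
    by apply: measurableT_comp => //; exact: measurable_fst.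
  - by move=> p; exact: integral_ge0.
  apply: eq_integral => s _; rewrite (IH (fun y => f (tuple_cons (a * r + b * s, y)%R)))//.
  exact: measurable_cons_section.
have mftc : measurable_fun [set: R * n.-tuple R] (fun p => f (tuple_cons (p.1, taff (fun=> 0%R) c p.2))).
  apply: measurableT_comp => //; apply: measurableT_comp; first exact: measurable_tuple_cons.
  apply: measurable_fun_pair => //.
  by apply: measurableT_comp; [exact: measurable_taff|exact: measurable_snd].
rewrite (ge0_integral_normal_conv (f := fun u => \int[gauss n]_z f (tuple_cons (u, taff (fun=> 0%R) c z))))//.
- rewrite ge0_integral_gaussS//; last by apply: measurableT_comp => //; exact: measurable_taff.
  by apply: eq_integral => r _; apply: eq_integral => z _; rewrite taff_cons add0r.
- exact: (@measurable_fun_fubini_tonelli_F _ _ _ _ _ (gauss n) (fun p => f (tuple_cons (p.1, taff (fun=> 0%R) c p.2)))).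
- by move=> u; exact: integral_ge0.
Qed.

Lemma integral_normal_cst (k : \bar R) : \int[N1]_r cst k r = k.
Proof.
rewrite integral_cst// [X in _ * X](_ : _ = 1) ?mule1//.
exact: (@probability_setT _ _ _ N1).
Qed.

(** Redrawing one coordinate independently does not change a product law. This is how facts about
    [N1] are applied to a single coordinate of the vector. *)
Lemma ge0_integral_gauss_resample n (i : 'I_n) (f : n.-tuple R -> \bar R) :
  measurable_fun setT f -> (forall x, 0 <= f x) ->
  \int[gauss n]_z f z = \int[gauss n]_z \int[N1]_w f (tset i z w).
Proof.
elim: n i f => [[]//|n IH] i f mf f0.
rewrite (ge0_integral_gaussS mf f0) [RHS]ge0_integral_gaussS; last 2 first.
- apply: (@measurable_fun_fubini_tonelli_F _ _ _ _ _ N1 (fun p => f (tset i p.1 p.2))) => //.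
  by apply: measurableT_comp => //; exact: measurable_tset.
- by move=> z; exact: integral_ge0.
case: (unliftP ord0 i) => [j|] ->; last first.
  rewrite ge0_integral_cons_swap//.
  set K := LHS.
  transitivity (\int[N1]_r cst K r).
    by rewrite integral_normal_cst.
  apply: eq_integral => r _; apply: eq_integral => y _; apply: eq_integral => w _.
  by rewrite tset_cons0.
apply: eq_integral => r _.
rewrite (IH j (fun y => f (tuple_cons (r, y))))//; last exact: measurable_cons_section.
by apply: eq_integral => y _; apply: eq_integral => w _; rewrite tset_consS.
Qed.

End gaussian_tuple.

(** * Moments of the normal law and differentiation in the mean *)

Section gaussian_moments.
Context {R : realType}.
Notation mu := (@lebesgue_measure R).
Notation N1 := (@normal_prob R 0 1).

(** From 1 + r <= exp r at r = z^2/4 follows z^2 exp(- z^2/2) <= 4 exp(- z^2/4), a multiple of the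
    normal density of variance 2. *)
Lemma integrable_normal_sqr : N1.-integrable setT (EFin \o (fun z : R => z ^+ 2)).
Proof.
apply/integrableP; split; first by apply/measurable_EFinP; exact: measurable_funX.
have s2 : Num.sqrt 2 != 0 :> R by rewrite sqrtr_eq0 -ltNge.
rewrite ge0_integral_normal//; last first.
  by apply: measurableT_comp => //; apply/measurable_EFinP; exact: measurable_funX.
pose c : R := 4 * (normal_peak 1 / normal_peak (Num.sqrt 2)).
have c0 : 0 <= c by rewrite !mulr_ge0 ?invr_ge0 ?normal_peak_ge0.
apply: (@le_lt_trans _ _ (\int[mu]_z (c%:E * (normal_pdf 0 (Num.sqrt 2) z)%:E)))%E.
  apply: ge0_le_integral => //=.
  - by move=> z _; rewrite mule_ge0// lee_fin normal_pdf_ge0.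
  - apply: emeasurable_funM.
      by apply/measurable_EFinP; apply: measurableT_comp => //; exact: measurable_funX.
    by apply/measurable_EFinP; exact: measurable_normal_pdf.
  - by apply/measurable_EFinP; apply: measurable_funM => //; exact: measurable_normal_pdf.
  move=> z _; rewrite -EFinM lee_fin !normal_pdfE ?oner_eq0//.
  rewrite /normal_fun /c !subr0 expr1n sqr_sqrtr// ger0_norm ?sqr_ge0//.
  rewrite [leRHS](_ : _ = normal_peak 1 * (4 * expR (- z ^+ 2 / (2 *+ 2)))); last first.
    by field; rewrite gt_eqF// normal_peak_gt0.
  rewrite mulrCA ler_pM2l ?normal_peak_gt0 ?oner_eq0//.
  have -> : - z ^+ 2 / 2 = - z ^+ 2 / (2 *+ 2) - z ^+ 2 / 4 by field.
  rewrite expRD mulrCA [leRHS]mulrC ler_pM2l ?expR_gt0// expRN.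
  rewrite ler_pdivrMr ?expR_gt0//.
  by have := expR_ge1Dx (z ^+ 2 / 4); lra.
rewrite ge0_integralZl//.
- by rewrite integral_normal_pdf mule1 ltry.
- by apply/measurable_EFinP; exact: measurable_normal_pdf.
- by move=> z _; rewrite lee_fin normal_pdf_ge0.
Qed.

Lemma integrable_normal_lin (A B : R) (f : R -> R) : measurable_fun setT f ->
  (forall z, `|f z| <= A + B * z ^+ 2) -> N1.-integrable setT (EFin \o f).
Proof.
move=> mf fAB; apply: (@integrable_dominated R _ (measurableTypeR R) N1 setT f (fun z => A + B * z ^+ 2)) => //.
rewrite (_ : _ \o _ = (EFin \o cst A) \+ (EFin \o (fun z => B * z ^+ 2)%R))%E//.
apply: integrableD => //.
  by apply: (@integrable_bounded _ _ _ _ _ _ `|A|) => //; rewrite -ge0_fin_numE// fin_num_measure.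
rewrite (_ : _ \o _ = (fun z => B%:E * (z ^+ 2)%R%:E)%E)//.
apply: integrableZl => //; exact: integrable_normal_sqr.
Qed.

Lemma normr_le_sqr (z : R) : `|z| <= 2^-1 + 2^-1 * z ^+ 2.
Proof.
have [z0|z0] := ler0P z.
  by have := sqr_ge0 (z + 1); nra.
by have := sqr_ge0 (z - 1); nra.
Qed.

Lemma integrable_normal_id : N1.-integrable setT (EFin \o (fun z : R => z)).
Proof. by apply: (@integrable_normal_lin 2^-1 2^-1) => // z; exact: normr_le_sqr. Qed.

Lemma Rintegral_normal_opp (F : R -> R) : measurable_fun setT F ->
  \int[N1]_z F (- z) = \int[N1]_z F z.
Proof.
move=> mF; apply: (@Rintegral_law _ _ _ _ _ _ _ N1 N1 (fun z => - z) id) => //.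
move=> f mf f0; rewrite !ge0_integral_normal//; last exact: measurableT_comp.
rewrite [RHS](@ge0_integral_oppr _ (fun z => f z * (normal_pdf 0 1 z)%:E)%E).
- by apply: eq_integral => z _; rewrite !normal_pdfE ?oner_eq0// /normal_fun !subr0 sqrrN.
- by apply: emeasurable_funM => //; apply/measurable_EFinP; exact: measurable_normal_pdf.
- by move=> z; rewrite mule_ge0// lee_fin normal_pdf_ge0.
Qed.

Lemma Rintegral_normal_id : \int[N1]_z z = 0.
Proof.
have := @Rintegral_normal_opp (fun z => z) (@measurable_id _ _ _).
under eq_Rintegral do rewrite -mulN1r.
rewrite RintegralZl//; last exact: integrable_normal_id.
by move=> ?; lra.
Qed.

Lemma Rintegral_normal_affine (F : R -> R) (x a : R) : 0 < a -> measurable_fun setT F ->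
  \int[N1]_z F (x + a * z) = \int[mu]_y (F y * normal_pdf x a y).
Proof.
move=> a0 mF; have mFE : measurable_fun setT (EFin \o F) by exact/measurable_EFinP.
rewrite /Rintegral; congr fine; rewrite integralE [RHS]integralE.
congr (_ - _)%E.
  transitivity (\int[N1]_z (EFin \o F)^\+%E (x + a * z)%R)%E.
    by apply: eq_integral => z _; rewrite !funeposE.
  rewrite ge0_integral_normal_affine//; last exact: measurable_funepos.
  apply: eq_integral => y _; rewrite !funeposE/= -!EFin_max -EFinM.
  by rewrite maxr_pMl ?normal_pdf_ge0// mul0r.
transitivity (\int[N1]_z (EFin \o F)^\-%E (x + a * z)%R)%E.
  by apply: eq_integral => z _; rewrite !funenegE.
rewrite ge0_integral_normal_affine//; last exact: measurable_funeneg.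
apply: eq_integral => y _; rewrite !funenegE/= -!EFin_max -EFinM.
by rewrite maxr_pMl ?normal_pdf_ge0// mul0r mulNr.
Qed.

Lemma is_derive_normal_pdf (a y r : R) : a != 0 ->
  is_derive r 1 (fun r => normal_pdf r a y) ((y - r) / a ^+ 2 * normal_pdf r a y).
Proof.
move=> a0.
rewrite (_ : (fun _ => _) = (fun r => normal_peak a * expR (- (y - r) ^+ 2 / (a ^+ 2 *+ 2)))); last first.
  by apply/funext => r'; rewrite normal_pdfE.
have dg : is_derive r 1 (fun r : R => - (y - r) ^+ 2 / (a ^+ 2 *+ 2)) ((y - r) / a ^+ 2).
  apply: is_derive_eq.
  by rewrite /GRing.scale/=; field.
have := is_derive1_comp (is_derive_expR _) dg.
move=> /(@is_deriveZ _ _ _ _ (normal_peak a)).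
rewrite (_ : normal_peak a *: _ = (y - r) / a ^+ 2 * normal_pdf r a y) //.
by rewrite normal_pdfE// /normal_fun /GRing.scale/=; ring.
Qed.

Lemma Rintegral_derive (f F : R -> R) (a b : R) : a < b ->
  (forall x, a <= x <= b -> is_derive x 1 F (f x)) ->
  (forall x, a <= x <= b -> {for x, continuous f}) ->
  \int[mu]_(x in `[a, b]) f x = F b - F a.
Proof.
move=> ab dF cf; rewrite /Rintegral.
have cF x : a <= x <= b -> {for x, continuous F}.
  by move=> /dF[dFx _]; apply: differentiable_continuous; exact/derivable1_diffP.
rewrite (@continuous_FTC2 _ _ F)//=.
- apply: continuous_in_subspaceT => x /set_mem /=.
  by rewrite in_itv/= => xab; exact: cf.
- split.
  + by move=> x; rewrite in_itv/= => /andP[ax xb]; apply: ex_derive; apply: dF; rewrite !ltW.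
  + by apply: cvg_at_right_filter; apply: cF; rewrite lexx ltW.
  + by apply: cvg_at_left_filter; apply: cF; rewrite lexx ltW.
- move=> x; rewrite in_itv/= => /andP[ax xb].
  by rewrite derive1E; apply: derive_val; apply: dF; rewrite !ltW.
Qed.

(** The shift is moved from [phi] to the density [normal_pdf r a y], whose derivative in the mean r
    is (y - r)/a^2 times itself; the fundamental theorem of calculus in r and Fubini do the rest.
    Thus [phi] need not be differentiable, and this formula is the source of all smoothing
    estimates. Linear growth is allowed so that it also applies to the identity. *)
Lemma Rintegral_normal_shift (phi : R -> R) (a h A B : R) : 0 < a -> 0 < h ->
  measurable_fun setT phi -> (forall u, `|phi u| <= A + B * `|u|) -> 0 <= A -> 0 <= B ->
  \int[N1]_z phi (h + a * z) - \int[N1]_z phi (a * z) =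
  \int[mu]_(r in `[0, h]) (a^-1 * \int[N1]_z (z * phi (r + a * z))).
Proof.
move=> a0 h0 mphi phiAB A0 B0; have an0 : a != 0 by rewrite gt_eqF.
pose p r y : R := normal_pdf r a y.
pose q r y : R := (y - r) / a ^+ 2 * p r y.
have mp : measurable_fun setT (fun z : R * R => p z.1 z.2).
  rewrite (_ : (fun _ => _) = (fun z => normal_pdf 0 a (z.2 - z.1))); last first.
    by apply/funext => z; rewrite /p normal_pdf_center.
  by apply: measurableT_comp; [exact: measurable_normal_pdf|exact: measurable_funB].
have mq : measurable_fun setT (fun z : R * R => q z.1 z.2).
  by apply: measurable_funM => //; apply: measurable_funM => //; exact: measurable_funB.
have mphir r : measurable_fun setT (fun z => phi (r + a * z)).
  by apply: measurableT_comp => //; apply: measurable_funD => //; exact: measurable_funM.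
have bnd r z : `|phi (r + a * z)| <= A + B * `|r| + B * a * `|z|.
  apply: (le_trans (phiAB _)).
  rewrite -!addrA lerD2l -mulrA -mulrDr ler_wpM2l// (le_trans (ler_normD _ _))//.
  by rewrite normrM (gtr0_norm a0).
have bndz r z : `|z * phi (r + a * z)| <= (A + B * `|r|) / 2 + ((A + B * `|r|) / 2 + B * a) * z ^+ 2.
  have c0 : 0 <= A + B * `|r| by rewrite addr_ge0// mulr_ge0.
  rewrite normrM; apply: (le_trans (ler_wpM2l _ (bnd r z))) => //.
  rewrite mulrDr mulrCA -expr2 real_normK ?num_real// mulrC.
  have := ler_wpM2l c0 (normr_le_sqr z); lra.
have int1 r : N1.-integrable setT (EFin \o (fun z => z * phi (r + a * z))).
  by apply: (integrable_normal_lin _ (bndz r)); exact: measurable_funM.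
have int0 r : N1.-integrable setT (EFin \o (fun z => phi (r + a * z))).
  have d0 : 0 <= B * a by rewrite mulr_ge0// ltW.
  apply: (@integrable_normal_lin (A + B * `|r| + B * a / 2) (B * a / 2)) => // z.
  apply: (le_trans (bnd r z)); have := ler_wpM2l d0 (normr_le_sqr z); lra.
have qE r : a^-1 * \int[N1]_z (z * phi (r + a * z)) = \int[mu]_y (phi y * q r y).
  transitivity (\int[N1]_z (fun y => (y - r) / a * phi y / a) (r + a * z)).
    rewrite -RintegralZl//.
    by apply: eq_Rintegral => z _; field.
  rewrite (@Rintegral_normal_affine (fun y => (y - r) / a * phi y / a))//; last first.
    by do ! [apply: measurable_funM => //]; apply: measurable_funB.
  by apply: eq_Rintegral => y _; rewrite /q /p; field.
under [RHS]eq_Rintegral do rewrite qE.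
rewrite (@Rintegral_fubini _ _ _ _ _ mu mu `[0, h]%classic setT (fun z => phi z.2 * q z.1 z.2))//; last first.
  pose g : R * R -> R := (fun z => phi z.2 * q z.1 z.2) \_ (`[0, h]%classic `*` setT).
  have mg : measurable_fun setT (EFin \o g).
    apply/measurable_EFinP/(measurable_restrictT _ _).1 => //; first exact: measurableX.
    apply: measurable_funTS; apply: measurable_funM => //.
    by apply: measurableT_comp => //; exact: measurable_snd.
  apply/integrable_mkcond; first exact: measurableX.
  rewrite restrict_EFin; apply/integrable12ltyP => //.
  have c0 : 0 <= A + B * h by rewrite addr_ge0// mulr_ge0// ltW.
  (* Integrability for Fubini: the bound [bndz] taken at r = h dominates it for every r in [0, h],
     so the inner integrals stay below the constant a^-1 [K]. *)
  pose K : \bar R := (\int[N1]_z ((A + B * h) / 2 + ((A + B * h) / 2 + B * a) * z ^+ 2)%:E)%E.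
  have pos z : 0 <= (A + B * h) / 2 + ((A + B * h) / 2 + B * a) * z ^+ 2.
    rewrite addr_ge0 ?divr_ge0// mulr_ge0 ?sqr_ge0// addr_ge0 ?divr_ge0//.
    by rewrite mulr_ge0// ltW.
  have Kfin : (K < +oo)%E.
    rewrite /K; apply: integrable_lty => //.
    apply: (@integrable_normal_lin ((A + B * h) / 2) ((A + B * h) / 2 + B * a)) => //.
      by apply: measurable_funD => //; apply: measurable_funM => //; exact: measurable_funX.
    by move=> z; rewrite ger0_norm.
  have K0 : (0 <= K)%E.
    by apply: integral_ge0 => ? _; rewrite lee_fin pos.
  apply: (@le_lt_trans _ _ (\int[mu]_(r in `[0%R, h]) ((a^-1)%:E * K)))%E; last first.
    rewrite integral_cst//= lebesgue_measure_itv/= lte_fin h0 -EFinB.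
    have -> : K = (fine K)%:E by rewrite fineK// ge0_fin_numE.
    by rewrite -!EFinM ltry.
  rewrite [leRHS]integral_mkcond; apply: ge0_le_integral => //.
  - by move=> r _; apply: integral_ge0.
  - apply: (@measurable_fun_fubini_tonelli_F _ _ _ _ _ mu (fun z => `|(EFin \o g) z|%E)) => //.
    exact: measurableT_comp.
  - by apply/(measurable_restrictT _ _).1.
  move=> r _; rewrite /patch; case: ifPn => rI; last first.
    rewrite integral0_eq// => y _.
    by rewrite /g /patch/= in_setX (negbTE rI)/= normr0.
  have /andP[r0 rh] : 0 <= r <= h by move: rI; rewrite inE/= in_itv.
  pose f : R -> R := fun y => `|(y - r) / a * phi y / a|.
  have mf : measurable_fun setT f.
    by apply: measurableT_comp => //; do ! [apply: measurable_funM => //]; apply: measurable_funB.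
  have -> : (\int[mu]_y `|(EFin \o g) (r, y)| = \int[mu]_y ((f y)%:E * (normal_pdf r a y)%:E))%E.
    apply: eq_integral => y _; rewrite /g/= /patch in_setX rI in_setT/= -EFinM; congr (_%:E).
    rewrite /f -[X in _ = _ * X]ger0_norm ?normal_pdf_ge0// -normrM; congr `|_|.
    by rewrite /q /p; field.
  rewrite -(@ge0_integral_normal_affine _ (EFin \o f))//; last 2 first.
  - exact/measurable_EFinP.
  - by move=> y; rewrite lee_fin normr_ge0.
  rewrite /K -ge0_integralZl//; last 3 first.
  - apply/measurable_EFinP; apply: measurable_funD => //; apply: measurable_funM => //; exact: measurable_funX.
  - by move=> z _; rewrite lee_fin pos.
  - by rewrite lee_fin invr_ge0 ltW.
  apply: ge0_le_integral => //.
  - by move=> z _; rewrite lee_fin normr_ge0.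
  - apply/measurable_EFinP; apply: measurableT_comp => //; apply: measurable_funD => //.
  - apply/measurable_EFinP; apply: measurable_funM => //.
    by apply: measurable_funD => //; apply: measurable_funM => //; exact: measurable_funX.
  move=> z _; rewrite -EFinM lee_fin /f.
  have -> : (r + a * z - r) / a * phi (r + a * z) / a = a^-1 * (z * phi (r + a * z)) by field.
  rewrite normrM gtr0_norm ?invr_gt0// ler_pM2l ?invr_gt0//.
  apply: (le_trans (bndz r z)); rewrite ger0_norm//.
  have : B * r <= B * h by rewrite ler_wpM2l.
  have := sqr_ge0 z; nra.
have ipdf r : mu.-integrable setT (EFin \o (fun y => phi y * p r y)).
  apply/integrableP; split; first by apply/measurable_EFinP; apply: measurable_funM => //; exact: measurable_normal_pdf.
  have /integrableP[_] := int0 r; apply: le_lt_trans.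
  pose f := (fun y => `|phi y|%:E : \bar R).
  rewrite -[leRHS]/(\int[N1]_z f (r + a * z)%R)%E ge0_integral_normal_affine//; last 2 first.
  - by apply/measurable_EFinP; apply: measurableT_comp.
  - by move=> y; rewrite lee_fin normr_ge0.
  rewrite le_eqVlt; apply/orP; left; apply/eqP.
  apply: eq_integral => y _; rewrite /= normrM -EFinM.
  by rewrite [X in _ * X]ger0_norm ?normal_pdf_ge0.
have cp y (r : R) : {for r, continuous (fun r => p r y)}.
  have [dp _] := is_derive_normal_pdf y r an0.
  by apply: differentiable_continuous; exact/derivable1_diffP.
have cq y : continuous (fun r => q r y).
  move=> r; apply: cvgM; last exact: cp.
  by apply: cvgM; [apply: cvgB; [exact: cvg_cst|exact: cvg_id]|exact: cvg_cst].
transitivity (\int[mu]_y (phi y * (p h y - p 0 y))); last first.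
  apply: eq_Rintegral => y _.
  have <- := @Rintegral_derive (fun r => q r y) (fun r => p r y) 0 h h0
    (fun r _ => is_derive_normal_pdf y r an0) (fun r _ => cq y r).
  rewrite -RintegralZl//.
  apply: continuous_compact_integrable; first exact: segment_compact.
  by apply: continuous_subspaceT; exact: cq.
under [RHS]eq_Rintegral do rewrite mulrBr.
rewrite RintegralB//; congr (_ - _); first by rewrite Rintegral_normal_affine.
rewrite -(@Rintegral_normal_affine phi 0 a)//.
by apply: eq_Rintegral => z _; rewrite add0r.
Qed.

(** The shift formula for the identity with a = h = 1: the left side is 1, and the right side is the
    second moment because the first moment vanishes. *)
Lemma Rintegral_normal_sqr : \int[N1]_z z ^+ 2 = 1.
Proof.
have bnd (u : R) : `|id u| <= 0 + 1 * `|u| by rewrite add0r mul1r.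
have := Rintegral_normal_shift ltr01 ltr01 (@measurable_id _ _ _) bnd (lexx _) ler01.
have E1 r : \int[N1]_z (z * id (r + 1 * z)) = \int[N1]_z z ^+ 2 :> R.
  transitivity (\int[N1]_z (r * z + z ^+ 2)).
    by apply: eq_Rintegral => z _ /=; ring.
  rewrite RintegralD//.
  - by rewrite RintegralZl// ?Rintegral_normal_id ?mulr0 ?add0r//; exact: integrable_normal_id.
  - apply: (integrable_normal_lin (A := `|r| / 2) (B := `|r| / 2)) => [|z]; first exact: measurable_funM.
    by rewrite normrM; have := ler_wpM2l (normr_ge0 r) (normr_le_sqr z); lra.
  - exact: integrable_normal_sqr.
under [in X in _ = X -> _]eq_Rintegral do rewrite E1 invr1 mul1r.
rewrite [X in _ = X -> _]Rintegral_cst//= lebesgue_measure_itv/= lte_fin ltr01 oppr0 adde0 mulr1 => <-.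
rewrite RintegralD//; last 2 first.
- by apply: (@integrable_bounded _ _ _ _ _ _ 1) => // [|x _]; rewrite ?normr1// -ge0_fin_numE// fin_num_measure.
- by rewrite (_ : *%R 1 = id); [exact: integrable_normal_id|apply/funext => z; rewrite mul1r].
rewrite addrK Rintegral_cst// mul1r; apply/esym.
by rewrite [X in _ = fine X](_ : _ = 1%E)//; exact: (@probability_setT _ _ _ N1).
Qed.

End gaussian_moments.

Lemma product_measure_lty {R : realType} d1 d2 (T1 : measurableType d1)
    (T2 : measurableType d2) (m1 : {sigma_finite_measure set T1 -> \bar R})
    (m2 : {sigma_finite_measure set T2 -> \bar R}) (D1 : set T1) (D2 : set T2) :
  measurable D1 -> measurable D2 -> (m1 D1 < +oo)%E -> (m2 D2 < +oo)%E ->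
  ((m1 \x m2)%E (D1 `*` D2) < +oo)%E.
Proof.
move=> mD1 mD2 f1 f2; rewrite product_measure1E//.
by rewrite -ge0_fin_numE ?mule_ge0// fin_numM// ge0_fin_numE.
Qed.

Section gaussian_tuple_real.
Context {R : realType}.
Notation N1 := (@normal_prob R 0 1).
Variable n : nat.
Implicit Types (F : n.-tuple R -> R) (i : 'I_n).

Lemma gauss_fin : (gauss n [set: n.-tuple R] < +oo)%E.
Proof. by rewrite -ge0_fin_numE// fin_num_measure. Qed.

Lemma normal_fin : (N1 [set: measurableTypeR R] < +oo)%E.
Proof. by rewrite -ge0_fin_numE// fin_num_measure. Qed.

Lemma integrable_gauss_bounded F (C : R) : measurable_fun setT F ->
  (forall z, `|F z| <= C) -> (gauss n).-integrable setT (EFin \o F).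
Proof. by move=> mF FC; apply: (integrable_bounded (C := C)) => //; exact: gauss_fin. Qed.

Lemma normr_Rintegral_gauss F (C : R) : measurable_fun setT F ->
  (forall z, `|F z| <= C) -> `|\int[gauss n]_z F z| <= C.
Proof.
move=> mF FC; have := normr_Rintegral_le measurableT gauss_fin mF (fun z _ => FC z).
by rewrite [X in fine X](_ : _ = 1%E) ?mulr1//; exact: (@probability_setT _ _ _ (gauss n)).
Qed.

Lemma Rintegral_gauss_cst (c : R) : \int[gauss n]_z c = c.
Proof.
rewrite Rintegral_cst// [X in fine X](_ : _ = 1%E) ?mulr1//.
exact: (@probability_setT _ _ _ (gauss n)).
Qed.

Let tset_law i (f : n.-tuple R -> \bar R) : measurable_fun setT f -> (forall x, 0 <= f x)%E ->
  (\int[gauss n \x N1]_p f (tset i p.1 p.2) = \int[gauss n]_z f z)%E.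
Proof.
move=> mf f0; rewrite (@fubini_tonelli1 _ _ _ _ _ (gauss n) N1)//=.
  by rewrite -ge0_integral_gauss_resample.
by apply: measurableT_comp => //; exact: measurable_tset.
Qed.

Lemma Rintegral_gauss_resample i F : measurable_fun setT F ->
  (gauss n).-integrable setT (EFin \o F) ->
  \int[gauss n]_z F z = \int[gauss n]_z \int[N1]_w F (tset i z w).
Proof.
move=> mF iF.
transitivity (\int[(gauss n \x N1)%E]_p F (tset i p.1 p.2)).
  by apply/esym; apply: (Rintegral_law (g2 := id) (tset_law i)).
rewrite -Rintegral12//.
have mts : measurable_fun [set: n.-tuple R * measurableTypeR R] (fun p => tset i p.1 p.2).
  exact: measurable_tset.
exact: (integrable_law (g2 := id) mts (tset_law i) mF iF).
Qed.

Lemma ge0_integral_gauss_coord i (f : R -> \bar R) : measurable_fun setT f ->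
  (forall x, 0 <= f x)%E ->
  (\int[gauss n]_z f (tnth z i) = \int[N1]_w f w)%E.
Proof.
move=> mf f0; rewrite (ge0_integral_gauss_resample i)//; last first.
  by apply: measurableT_comp => //; exact: measurable_tnth.
under eq_integral do under eq_integral do rewrite tnth_mktuple eqxx.
rewrite integral_cst// [X in (_ * X)%E](_ : _ = 1%E) ?mule1//.
exact: (@probability_setT _ _ _ (gauss n)).
Qed.

Lemma integrable_gauss_coord i (f : R -> R) : measurable_fun setT f ->
  N1.-integrable setT (EFin \o f) ->
  (gauss n).-integrable setT (EFin \o (fun z => f (tnth z i))).
Proof.
move=> mf fi.
exact: (integrable_law (g2 := id : measurableTypeR R -> R)
  (@measurable_tnth _ _ n i) (@ge0_integral_gauss_coord i) mf fi).
Qed.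

Lemma Rintegral_gauss_coord i (f : R -> R) : measurable_fun setT f ->
  \int[gauss n]_z f (tnth z i) = \int[N1]_w f w.
Proof.
move=> mf.
exact: (Rintegral_law (g2 := id : measurableTypeR R -> R) (@ge0_integral_gauss_coord i) mf).
Qed.

Lemma Rintegral_gauss_conv (a b : R) F (C : R) : 0 < a -> 0 < b ->
  measurable_fun setT F -> (forall z, `|F z| <= C) ->
  \int[gauss n]_y \int[gauss n]_z F (tcomb a b y z) =
  \int[gauss n]_z F (taff (fun=> 0) (Num.sqrt (a ^+ 2 + b ^+ 2)) z).
Proof.
move=> a0 b0 mF FC.
have mFt : measurable_fun setT (fun p => F (tcomb a b p.1 p.2)).
  by apply: measurableT_comp => //; exact: measurable_tcomb.
rewrite (@Rintegral12 _ _ _ _ _ (gauss n) (gauss n) (fun p => F (tcomb a b p.1 p.2))); last first.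
  apply: (integrable_bounded (C := C)) => //.
  by rewrite -setXTT; apply: product_measure_lty => //; exact: gauss_fin.
apply: (Rintegral_law (g2 := taff (fun=> 0) (Num.sqrt (a ^+ 2 + b ^+ 2)))) => // f mf f0.
rewrite (@fubini_tonelli1 _ _ _ _ _ (gauss n) (gauss n))//=.
  by rewrite ge0_integral_gauss_conv.
by apply: measurableT_comp => //; exact: measurable_tcomb.
Qed.

Lemma Rintegral_lebesgue_tuple_flip i F : measurable_fun setT F ->
  \int[lebesgue_tuple n]_z F (tflip i z) = \int[lebesgue_tuple n]_z F z.
Proof.
move=> mF; apply: (Rintegral_law (g1 := tflip i) (g2 := id)) => //.
exact: ge0_integral_lebesgue_tuple_flip.
Qed.

Lemma gdens0_flip (i : 'I_n) (a : R) z : a != 0 -> gdens (fun=> 0) a (tflip i z) = gdens (fun=> 0) a z.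
Proof.
move=> a0; apply: eq_bigr => j _; rewrite tnth_mktuple; case: (j == i) => //.
by rewrite !normal_pdfE// /normal_fun !subr0 sqrrN.
Qed.

Lemma taff01 (z : n.-tuple R) : taff (fun=> 0) 1 z = z.
Proof. by apply: eq_from_tnth => j; rewrite tnth_mktuple add0r mul1r. Qed.

Lemma ge0_integral_gauss_flip i (f : n.-tuple R -> \bar R) : measurable_fun setT f ->
  (forall x, 0 <= f x)%E ->
  (\int[gauss n]_z f (tflip i z) = \int[gauss n]_z f z)%E.
Proof.
move=> mf f0.
have gE (g : n.-tuple R -> \bar R) : measurable_fun setT g -> (forall x, 0 <= g x)%E ->
   (\int[gauss n]_z g z = \int[lebesgue_tuple n]_z (g z * (gdens (fun=> 0) 1 z)%:E))%E.
  move=> mg g0; rewrite -ge0_integral_gauss_affine//.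
  by apply: eq_integral => z _; rewrite taff01.
have mft : measurable_fun setT (fun z => f (tflip i z)).
  by apply: measurableT_comp => //; exact: measurable_tflip.
rewrite !gE// -[RHS](ge0_integral_lebesgue_tuple_flip i).
- by apply: eq_integral => z _; rewrite gdens0_flip// oner_eq0.
- by apply: emeasurable_funM => //; apply/measurable_EFinP; exact: measurable_gdens.
- by move=> z; rewrite mule_ge0// lee_fin gdens_ge0.
Qed.

Lemma Rintegral_gauss_flip i F : measurable_fun setT F ->
  \int[gauss n]_z F (tflip i z) = \int[gauss n]_z F z.
Proof.
move=> mF; apply: (Rintegral_law (g1 := tflip i) (g2 := id)) => //.
exact: ge0_integral_gauss_flip.
Qed.

Lemma Rintegral_gauss_affine x (a : R) F : 0 < a -> measurable_fun setT F ->
  \int[gauss n]_z F (taff x a z) = \int[lebesgue_tuple n]_y (F y * gdens x a y).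
Proof.
move=> a0 mF; have mFE : measurable_fun setT (EFin \o F) by exact/measurable_EFinP.
rewrite /Rintegral; congr fine; rewrite integralE [RHS]integralE.
congr (_ - _)%E.
  transitivity (\int[gauss n]_z (EFin \o F)^\+%E (taff x a z))%E.
    by apply: eq_integral => z _; rewrite !funeposE.
  rewrite ge0_integral_gauss_affine//; last exact: measurable_funepos.
  apply: eq_integral => y _; rewrite !funeposE/= -!EFin_max -EFinM.
  by rewrite maxr_pMl ?gdens_ge0// mul0r.
transitivity (\int[gauss n]_z (EFin \o F)^\-%E (taff x a z))%E.
  by apply: eq_integral => z _; rewrite !funenegE.
rewrite ge0_integral_gauss_affine//; last exact: measurable_funeneg.
apply: eq_integral => y _; rewrite !funenegE/= -!EFin_max -EFinM.
by rewrite maxr_pMl ?gdens_ge0// mul0r mulNr.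
Qed.

Lemma integrable_gdens x (a : R) : 0 < a ->
  (lebesgue_tuple n).-integrable setT (EFin \o (@gdens R n x a)).
Proof.
move=> a0; apply/integrableP; split; first by apply/measurable_EFinP; exact: measurable_gdens.
have := @ge0_integral_gauss_affine R n x a (cst 1%E) a0 (measurable_cst _) (fun=> lee01).
under [X in _ = X -> _]eq_integral do rewrite /= mul1e -[gdens _ _ _]ger0_norm ?gdens_ge0//.
move=> <-; rewrite integral_cst// mul1e; exact: gauss_fin.
Qed.

End gaussian_tuple_real.

(** * The heat semigroup *)

Section heat_operator.
Context {R : realType} {N : nat}.
Notation E := 'rV[R]_N.
Notation row := (@row_of_tuple R N).
Notation gN := (@gauss R N).
Implicit Types (phi psi : E -> R) (x y : E) (t s a b : R).

(** Row vectors carry the topology and tuples the measure, so measurability on the space is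
    expressed through [row]. *)
Definition mfun_row phi := measurable_fun setT (phi \o row).

Lemma row_tuple_of x : row [tuple x ord0 i | i < N] = x.
Proof. by apply/rowP => i; rewrite mxE tnth_mktuple. Qed.

Lemma measurable_row_comp d (T : measurableType d) phi (f : T -> E) :
  mfun_row phi -> (forall i, measurable_fun setT (fun q => f q ord0 i)) ->
  measurable_fun setT (fun q => phi (f q)).
Proof.
move=> mphi mf.
rewrite (_ : (fun _ => _) = (phi \o row) \o (fun q => [tuple f q ord0 i | i < N])).
  by apply: measurableT_comp => //; exact: measurable_mktuple.
by apply/funext => q /=; rewrite row_tuple_of.
Qed.

(* The expectation of [phi (x + sqrt (2 t) Z)] for a standard Gaussian vector [Z];
   at [t = 0] this is [phi x], and no density is involved. *)
Definition heatop t phi x : R :=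
  \int[gN]_z phi (x + Num.sqrt (2 * t) *: row z).

Lemma row_taff x a z : row (taff (x ord0) a z) = x + a *: row z.
Proof. by apply/rowP => i; rewrite !mxE tnth_mktuple. Qed.

Lemma row_tcomb a b (p q : N.-tuple R) : row (tcomb a b p q) = a *: row p + b *: row q.
Proof. by apply/rowP => i; rewrite !mxE tnth_mktuple. Qed.

Lemma measurable_heat_arg phi x a : mfun_row phi ->
  measurable_fun setT (fun z => phi (x + a *: row z)).
Proof.
move=> mphi; apply: measurable_row_comp => // i.
rewrite (_ : (fun _ => _) = (fun z => x ord0 i + a * tnth z i)); last first.
  by apply/funext => z; rewrite !mxE.
by apply: measurable_funD => //; apply: measurable_funM => //; exact: measurable_tnth.
Qed.

Lemma heatop_integrable phi (C : R) x a : mfun_row phi -> (forall y, `|phi y| <= C) ->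
  gN.-integrable setT (EFin \o (fun z => phi (x + a *: row z))).
Proof.
by move=> mphi phiC; apply: (integrable_gauss_bounded (C := C)) => //; exact: measurable_heat_arg.
Qed.

Lemma heatop_bound t phi (C : R) x : mfun_row phi -> (forall y, `|phi y| <= C) ->
  `|heatop t phi x| <= C.
Proof. by move=> mphi phiC; apply: normr_Rintegral_gauss => //; exact: measurable_heat_arg. Qed.

Lemma heatop0 phi : heatop 0 phi = phi.
Proof.
apply/funext => x; rewrite /heatop mulr0 sqrtr0.
under eq_Rintegral do rewrite scale0r addr0.
exact: Rintegral_gauss_cst.
Qed.

Lemma heatop_cst t (c : R) x : heatop t (cst c) x = c.
Proof. exact: Rintegral_gauss_cst. Qed.

Lemma heatopZ t (c : R) phi (C : R) x : mfun_row phi -> (forall y, `|phi y| <= C) ->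
  heatop t (fun y => c * phi y) x = c * heatop t phi x.
Proof. by move=> mphi phiC; rewrite /heatop RintegralZl//; exact: heatop_integrable. Qed.

Lemma heatopD t phi psi (C C' : R) x : mfun_row phi -> (forall y, `|phi y| <= C) ->
  mfun_row psi -> (forall y, `|psi y| <= C') ->
  heatop t (fun y => phi y + psi y) x = heatop t phi x + heatop t psi x.
Proof.
move=> mphi phiC mpsi psiC; rewrite /heatop RintegralD//.
  exact: heatop_integrable.
exact: heatop_integrable.
Qed.

Lemma heatopB t phi psi (C C' : R) x : mfun_row phi -> (forall y, `|phi y| <= C) ->
  mfun_row psi -> (forall y, `|psi y| <= C') ->
  heatop t (fun y => phi y - psi y) x = heatop t phi x - heatop t psi x.
Proof.
move=> mphi phiC mpsi psiC; rewrite /heatop RintegralB//.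
  exact: heatop_integrable.
exact: heatop_integrable.
Qed.

Lemma heatop_semigroup s t phi (C : R) : 0 <= s -> 0 <= t ->
  mfun_row phi -> (forall y, `|phi y| <= C) ->
  heatop s (heatop t phi) = heatop (s + t) phi.
Proof.
rewrite le_eqVlt => /predU1P[<- _ _ _|s0]; first by rewrite heatop0 add0r.
rewrite le_eqVlt => /predU1P[<- _ _|t0]; first by rewrite heatop0 addr0.
move=> mphi phiC; apply/funext => x; rewrite /heatop.
pose F z := phi (x + row z).
have mF : measurable_fun setT F.
  rewrite (_ : F = (fun z => phi (x + 1 *: row z))); first exact: measurable_heat_arg.
  by apply/funext => z; rewrite scale1r.
transitivity (\int[gN]_y \int[gN]_z F (tcomb (Num.sqrt (2 * s)) (Num.sqrt (2 * t)) y z)).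
  by apply: eq_Rintegral => y _; apply: eq_Rintegral => z _; rewrite /F row_tcomb addrA.
rewrite (@Rintegral_gauss_conv _ _ _ _ _ C) ?sqrtr_gt0 ?mulr_gt0//.
  apply: eq_Rintegral => z _; rewrite /F; congr (phi (_ + _)).
  apply/rowP => i; rewrite !mxE tnth_mktuple add0r.
  by rewrite !sqr_sqrtr ?mulr_ge0 ?ltW// -mulrDr.
by move=> z; exact: phiC.
Qed.

Lemma heatop_scale t (l : R) phi x : 0 <= l ->
  heatop t (fun y => phi (l *: y)) x = heatop (l ^+ 2 * t) phi (l *: x).
Proof.
move=> l0; rewrite /heatop; apply: eq_Rintegral => z _.
rewrite scalerDr scalerA mulrCA [X in _ = _ (_ + X *: _)]sqrtrM ?sqr_ge0//.
by rewrite sqrtr_sqr ger0_norm.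
Qed.

Definition flip (i : 'I_N) x : E := \row_j if j == i then - x ord0 j else x ord0 j.

Lemma row_flip i z : row (tflip i z) = flip i (row z).
Proof. by apply/rowP => j; rewrite !mxE tnth_mktuple. Qed.

Lemma flipD i x y : flip i (x + y) = flip i x + flip i y.
Proof. by apply/rowP => j; rewrite !mxE; case: (j == i); rewrite ?opprD. Qed.

Lemma flipZ i a x : flip i (a *: x) = a *: flip i x.
Proof. by apply/rowP => j; rewrite !mxE; case: (j == i); rewrite ?mulrN. Qed.

Lemma heatop_flip i t phi x : mfun_row phi ->
  heatop t phi (flip i x) = heatop t (phi \o flip i) x.
Proof.
move=> mphi; rewrite /heatop.
rewrite -(Rintegral_gauss_flip i) /=; last exact: measurable_heat_arg.
by apply: eq_Rintegral => z _; rewrite row_flip -flipZ -flipD.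
Qed.

End heat_operator.

Section row_vectors.
Context {R : realType} {N : nat}.
Notation E := 'rV[R]_N.
Notation dir i := (delta_mx ord0 i : 'rV[R]_N).

Lemma rV_norm_le (x : E) (e : R) : 0 <= e -> (forall i, `|x ord0 i| <= e) -> `|x| <= e.
Proof.
move=> e0 xe; rewrite /Num.norm/= mx_normrE; apply: bigmax_le => // -[i j] _ /=.
by rewrite ord1.
Qed.

Lemma rV_coord_le (x : E) i : `|x ord0 i| <= `|x|.
Proof.
rewrite [leRHS]/Num.norm/= mx_normrE.
exact: (@le_bigmax _ _ _ 0 (fun ij => `|x ij.1 ij.2|) (ord0, i)).
Qed.

(** The coordinates of y are changed into those of x one at a time; in the maximum norm each of the
    N steps has length at most |x - y|. *)
Lemma lipschitz_of_coord (phi : E -> R) (L : R) : 0 <= L ->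
  (forall x i h, `|phi (x + h *: dir i) - phi x| <= L * `|h|) ->
  forall x y, `|phi x - phi y| <= L * N%:R * `|x - y|.
Proof.
move=> L0 Lphi x y.
pose u k : E := \row_j if (j < k)%N then x ord0 j else y ord0 j.
suff H k : (k <= N)%N -> `|phi (u k) - phi y| <= L * k%:R * `|x - y|.
  have uN : u N = x by apply/rowP => j; rewrite mxE ltn_ord.
  by have := H N (leqnn N); rewrite uN.
elim: k => [_|k IH kN].
  have -> : u 0%N = y by apply/rowP => j; rewrite mxE ltn0.
  by rewrite subrr normr0 mulr0 mul0r.
pose i := Ordinal kN.
have uS : u k.+1 = u k + (x ord0 i - y ord0 i) *: dir i.
  apply/rowP => j; rewrite !mxE eqxx/=.
  have [->|ji] := eqVneq j i; first by rewrite /= ltnSn ltnn mulr1 addrC subrK.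
  rewrite mulr0 addr0 ltnS leq_eqVlt.
  suff -> : (nat_of_ord j == k) = false by [].
  by apply: contraNF ji => /eqP jk; apply/eqP/val_inj.
have step : `|phi (u k.+1) - phi (u k)| <= L * `|x - y|.
  rewrite uS (le_trans (Lphi _ _ _))// ler_wpM2l//.
  by rewrite (le_trans _ (rV_coord_le (x - y) i))// !mxE.
have -> : phi (u k.+1) - phi y = (phi (u k.+1) - phi (u k)) + (phi (u k) - phi y) by ring.
rewrite (le_trans (ler_normD _ _))// -natr1.
have := IH (ltnW kN); lra.
Qed.

End row_vectors.

(** * Measurability in time and space *)

Section joint_measurability.
Context {R : realType} {N : nat}.
Notation E := 'rV[R]_N.
Notation row := (@row_of_tuple R N).
Implicit Types H : R -> E -> R.

Definition mfun2 H :=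
  measurable_fun [set: R * N.-tuple R] (fun p => H p.1 (row p.2)).

Lemma measurable_row_comp2 d (T : measurableType d) H (a : T -> R) (f : T -> E) :
  mfun2 H -> measurable_fun setT a ->
  (forall i, measurable_fun setT (fun q => f q ord0 i)) ->
  measurable_fun setT (fun q => H (a q) (f q)).
Proof.
move=> mH ma mf.
rewrite (_ : (fun _ => _) = (fun p => H p.1 (row p.2)) \o
    (fun q => (a q, [tuple f q ord0 i | i < N]))).
  apply: measurableT_comp => //; apply: measurable_fun_pair => //.
  exact: measurable_mktuple.
by apply/funext => q /=; rewrite row_tuple_of.
Qed.

Lemma mfun2_section H t : mfun2 H -> mfun_row (H t).
Proof.
move=> mH; apply: (measurable_row_comp2 (a := fun=> t)) => // i.
rewrite (_ : (fun _ => _) = (fun z => tnth z i)); first exact: measurable_tnth.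
by apply/funext => z; rewrite mxE.
Qed.

(** Rounding is upwards, so that a nonpositive time stays nonpositive. *)
Let dscr n (r : R) : R := (Num.ceil (r * n.+1%:R))%:~R / n.+1%:R.

Let dscr_near n r : `|r - dscr n r| <= n.+1%:R^-1.
Proof.
have n0 : 0 < n.+1%:R :> R by rewrite ltr0n.
have -> : r - dscr n r = (r * n.+1%:R - (Num.ceil (r * n.+1%:R))%:~R) / n.+1%:R.
  by rewrite /dscr; field; rewrite gt_eqF// addrC natr1.
rewrite normrM [X in _ * X]ger0_norm ?invr_ge0// ler_piMl ?invr_ge0//.
have := ceil_itv (r * n.+1%:R); rewrite rmorphB/= ler_norml => /andP[h1 h2].
by apply/andP; split; lra.
Qed.

Let dscr_le0 n r : r <= 0 -> dscr n r <= 0.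
Proof.
move=> r0; rewrite /dscr -[leRHS](mul0r n.+1%:R^-1) ler_wpM2r ?invr_ge0//.
by rewrite lerz0 ceil_le0 -(mul0r n.+1%:R) ler_wpM2r.
Qed.

(** [H] may jump at time 0. Evaluated at rounded points it takes countably many values on measurable
    cells, hence is measurable; the limit is [H] by continuity at positive times, and at nonpositive
    times because all the approximants vanish there. *)
Lemma mfun2_continuous H :
  (forall t x, 0 < t -> {for (t, x), continuous (fun p : R * E => H p.1 p.2)}) ->
  (forall t x, t <= 0 -> H t x = 0) -> mfun2 H.
Proof.
move=> cH H0.
pose G n (q : int * {ffun 'I_N -> int}) : R :=
  H (q.1%:~R / n.+1%:R) (\row_i ((q.2 i)%:~R / n.+1%:R)).
pose c n (p : R * N.-tuple R) : int * {ffun 'I_N -> int} :=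
  (Num.ceil (p.1 * n.+1%:R), [ffun i => Num.ceil (tnth p.2 i * n.+1%:R)]).
apply: (measurable_fun_cvg (h := fun n p => G n (c n p))).
  move=> n _ Y mY; rewrite setTI.
  rewrite (_ : _ @^-1` _ = \bigcup_q ((c n @^-1` [set q]) `&` [set p | Y (G n q)])); last first.
    apply/seteqP; split=> p /=; first by exists (c n p).
    by move=> [q _ [<-]].
  apply: countable_bigcupT_measurable => // q.
  have [Yq|nYq] := pselect (Y (G n q)); last first.
    rewrite [X in measurable X](_ : _ = set0); first exact: measurable0.
    by apply/seteqP; split=> p //= [].
  have mI (k : int) : measurable [set r : R | Num.ceil (r * n.+1%:R) = k].
    rewrite (_ : mkset _ = `](k%:~R - 1) / n.+1%:R, k%:~R / n.+1%:R]%classic).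
      exact: measurable_itv.
    apply/seteqP; split=> r /=; rewrite in_itv/= ltr_pdivrMr// ler_pdivlMr//.
      by move=> <-; have := ceil_itv (r * n.+1%:R); rewrite rmorphB.
    by move=> h; apply/eqP; rewrite ceil_eq rmorphB.
  rewrite [X in measurable X](_ : _ = (fst @^-1` [set r : R | Num.ceil (r * n.+1%:R) = q.1]) `&`
    (snd @^-1` [set y : N.-tuple R | forall i, [set r : R | Num.ceil (r * n.+1%:R) = q.2 i] (tnth y i)])).
    apply: measurableI; rewrite -[X in measurable X]setTI.
      exact: measurable_fst.
    by apply: measurable_snd => //; exact: (measurable_tuple_box (fun i => mI (q.2 i))).
  apply/seteqP; split=> p /=.
    by move=> [<- _]; split => //= i; rewrite ffunE.
  case: q Yq => q1 q2 Yq [/= h1 h2]; split => //; congr pair => //.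
  by apply/ffunP => i; rewrite ffunE h2.
move=> p _ /=; case: p => t y.
have HE n : G n (c n (t, y)) = H (dscr n t) (\row_i dscr n (tnth y i)).
  by congr (H _ _); apply/rowP => i; rewrite !mxE /= ffunE.
have -> : (fun n => G n (c n (t, y))) = (fun n => H (dscr n t) (\row_i dscr n (tnth y i))).
  exact/funext.
have [t0|t0] := leP t 0.
  rewrite /= H0// (_ : (fun n => _) = cst 0); first exact: cvg_cst.
  by apply/funext => n; rewrite H0// dscr_le0.
have := @cvg_comp _ _ _ (fun n => (dscr n t, \row_i dscr n (tnth y i)))
  (fun p : R * E => H p.1 p.2) \oo _ _ _ (cH t (row y) t0).
apply.
have inv0 : (n.+1%:R^-1 : R) @[n --> \oo] --> 0.
  exact: cvg_harmonic.
have ct : dscr n t @[n --> \oo] --> t.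
  apply/cvgrPdist_le => e e0; near=> n.
  apply: (le_trans (dscr_near n t)).
  have : `|0 - n.+1%:R^-1| <= e by near: n; move/cvgrPdist_le : inv0; exact.
  by rewrite sub0r normrN ger0_norm.
have cy : (\row_i dscr n (tnth y i) : E) @[n --> \oo] --> row y.
  apply/cvgrPdist_le => e e0; near=> n.
  apply: rV_norm_le; first exact: ltW.
  move=> i; rewrite !mxE; apply: (le_trans (dscr_near n _)).
  have : `|0 - n.+1%:R^-1| <= e by near: n; move/cvgrPdist_le : inv0; exact.
  by rewrite sub0r normrN ger0_norm.
exact: (cvg_pair ct cy).
Unshelve. all: by end_near. Qed.

Lemma mfun_row_continuous (phi : E -> R) : continuous phi -> mfun_row phi.
Proof.
move=> cphi; pose H (t : R) x := if 0 < t then phi x else 0.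
have -> : phi = H 1 by apply/funext => x; rewrite /H ltr01.
apply: mfun2_section; apply: mfun2_continuous => [t x t0|t x t0]; last first.
  by rewrite /H ltNge t0.
have : (phi \o snd) p @[p --> (t, x)] --> phi x.
  by apply: continuous_comp; [exact: cvg_snd|exact: cphi].
move=> h; rewrite /prop_for /continuous_at /= {2}/H t0; apply: cvg_trans h.
apply: near_eq_cvg; near=> p; rewrite /H.
rewrite ifT//; near: p.
exists ([set r : R | 0 < r], setT) => //=; last by move=> [? ?] [].
by split; [exact: lt_nbhsr|exact: filterT].
Unshelve. all: by end_near. Qed.

End joint_measurability.

(** * Smoothing by the Gaussian average *)

Section heat_smoothing.
Context {R : realType} {N : nat}.
Notation mu := (@lebesgue_measure R).
Notation N1 := (@normal_prob R 0 1).
Notation E := 'rV[R]_N.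
Notation row := (@row_of_tuple R N).
Notation gN := (@gauss R N).
Notation dir i := (delta_mx ord0 i : 'rV[R]_N).
Implicit Types (phi psi : E -> R) (x y : E) (t s a b : R).

Lemma integrable_normal_abs : N1.-integrable setT (EFin \o (fun w : R => `|w|)).
Proof.
apply: (@integrable_normal_lin R 2^-1 2^-1 (fun w : R => `|w|)).
  exact: normr_measurable.
by move=> z; rewrite normr_id; exact: normr_le_sqr.
Qed.

Lemma Rintegral_normal_abs : \int[N1]_w `|w| <= 1.
Proof.
apply: (@le_trans _ _ (\int[N1]_w (2^-1 + 2^-1 * w ^+ 2))).
  apply: le_Rintegral => //.
  - exact: integrable_normal_abs.
  - apply: (@integrable_normal_lin R 2^-1 2^-1).
      by apply: measurable_funD => //; apply: measurable_funM => //; exact: measurable_funX.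
    by move=> z; rewrite ger0_norm// addr_ge0// mulr_ge0// sqr_ge0.
  - by move=> z _; exact: normr_le_sqr.
rewrite RintegralD//; last 2 first.
- by apply: (integrable_bounded (C := 2^-1)) => //; [exact: normal_fin|move=> _ _; rewrite ger0_norm].
- apply: (@integrable_normal_lin R 0 2^-1).
    by apply: measurable_funM => //; exact: measurable_funX.
  by move=> z; rewrite add0r ger0_norm// mulr_ge0// sqr_ge0.
rewrite RintegralZl//; last exact: integrable_normal_sqr.
rewrite Rintegral_normal_sqr Rintegral_cst// [X in fine X](_ : _ = 1%E); last exact: (@probability_setT _ _ _ N1).
by rewrite /= !mulr1; lra.
Qed.

Lemma integrable_gauss_abs_coord i : gN.-integrable setT (EFin \o (fun z => `|tnth z i|)).
Proof.
apply: (@integrable_gauss_coord _ _ i (fun w => `|w|)); first exact: measurableT_comp.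
exact: integrable_normal_abs.
Qed.

Lemma integrable_gauss_coord_bounded i (f : N.-tuple R -> R) (C : R) :
  measurable_fun setT f -> (forall z, `|f z| <= C) ->
  gN.-integrable setT (EFin \o (fun z => tnth z i * f z)).
Proof.
move=> mf fC.
apply: (@integrable_dominated _ _ _ gN _ _ (fun z => C * `|tnth z i|)) => //.
- by apply: measurable_funM => //; exact: measurable_tnth.
- rewrite (_ : _ \o _ = (fun z => C%:E * `|tnth z i|%:E)%E)//.
  by apply: integrableZl => //; exact: integrable_gauss_abs_coord.
- by move=> z _; rewrite normrM mulrC ler_wpM2r.
Qed.

Lemma normr_Rintegral_gauss_coord i (f : N.-tuple R -> R) (C : R) :
  measurable_fun setT f -> (forall z, `|f z| <= C) ->
  `|\int[gN]_z (tnth z i * f z)| <= C.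
Proof.
move=> mf fC; have C0 : 0 <= C by apply: le_trans (fC [tuple 0 | i < N]).
apply: (@le_trans _ _ (\int[gN]_z (C * `|tnth z i|))).
  apply: normr_Rintegral_dominated => //.
  - by apply: measurable_funM => //; exact: measurable_tnth.
  - rewrite (_ : _ \o _ = (fun z => C%:E * `|tnth z i|%:E)%E)//.
    by apply: integrableZl => //; exact: integrable_gauss_abs_coord.
  - by move=> z _; rewrite normrM mulrC ler_wpM2r.
rewrite RintegralZl//; last exact: integrable_gauss_abs_coord.
rewrite (@Rintegral_gauss_coord _ _ i (fun w => `|w|)); last exact: measurableT_comp.
by rewrite -[leRHS]mulr1 ler_wpM2l// Rintegral_normal_abs.
Qed.

Lemma row_tset i z (w : R) : row (tset i z w) = row (tset i z 0) + w *: dir i.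
Proof.
apply/rowP => j; rewrite !mxE !tnth_mktuple eqxx /=.
by case: (j == i); rewrite ?mulr1 ?add0r ?mulr0 ?addr0.
Qed.

Lemma measurable_dir_arg d (T : measurableType d) phi (r : T -> R) (z : T -> N.-tuple R) x a i :
  mfun_row phi -> measurable_fun setT r -> measurable_fun setT z ->
  measurable_fun setT (fun q => phi (x + r q *: dir i + a *: row (z q))).
Proof.
move=> mphi mr mz; apply: measurable_row_comp => // j.
rewrite (_ : (fun _ => _) = (fun q => x ord0 j + r q * dir i ord0 j + a * tnth (z q) j)); last first.
  by apply/funext => q; rewrite !mxE.
apply: measurable_funD; first by apply: measurable_funD => //; exact: measurable_funM.
by apply: measurable_funM => //; exact: measurable_tnth_comp.
Qed.

(** Resampling coordinate [i] turns the integrand into a function on a line, to which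
    [Rintegral_normal_shift] applies; Fubini moves the integral in r outside, and resampling is
    undone. *)
Lemma Rintegral_gauss_shift phi (C : R) x i (a h : R) : 0 < a -> 0 < h ->
  mfun_row phi -> (forall y, `|phi y| <= C) ->
  \int[gN]_z phi (x + h *: dir i + a *: row z) - \int[gN]_z phi (x + a *: row z) =
  \int[mu]_(r in `[0, h])
    (a^-1 * \int[gN]_z (tnth z i * phi (x + r *: dir i + a *: row z))).
Proof.
move=> a0 h0 mphi phiC; have C0 : 0 <= C by apply: le_trans (phiC 0).
(* The base point of that line: the argument with the noise in direction [i] removed. *)
pose y z := x + a *: row (tset i z 0).
have yE z w r : x + r *: dir i + a *: row (tset i z w) = y z + (r + a * w) *: dir i.
  by rewrite row_tset scalerDr scalerA scalerDl addrACA addrA [y z + _]addrAC -!addrA.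
have mF r : measurable_fun setT (fun z => phi (x + r *: dir i + a *: row z)).
  exact: (@measurable_dir_arg _ _ phi (fun=> r) id).
have iF r : gN.-integrable setT (EFin \o (fun z => phi (x + r *: dir i + a *: row z))).
  exact: (integrable_gauss_bounded (mF r) (fun z => phiC _)).
have E0 : \int[gN]_z phi (x + a *: row z) = \int[gN]_z phi (x + 0 *: dir i + a *: row z).
  by apply: eq_Rintegral => z _; rewrite scale0r addr0.
have mphi1 u : measurable_fun setT (fun w : R => phi (u + w *: dir i)).
  apply: measurable_row_comp => // j.
  rewrite (_ : (fun _ => _) = (fun w => u ord0 j + w * dir i ord0 j)); last first.
    by apply/funext => q; rewrite !mxE.
  by apply: measurable_funD => //; exact: measurable_funM.
have resample r : \int[gN]_z phi (x + r *: dir i + a *: row z) =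
    \int[gN]_z \int[N1]_w phi (y z + (r + a * w) *: dir i).
  rewrite (Rintegral_gauss_resample i (mF r) (iF r)).
  by apply: eq_Rintegral => z _; apply: eq_Rintegral => w _; rewrite yE.
have mjoint : measurable_fun [set: (N.-tuple R * R) * R]
    (fun q => phi (y q.1.1 + (q.1.2 + a * q.2) *: dir i)).
  rewrite (_ : (fun _ => _) = (fun q => phi (x + q.1.2 *: dir i + a *: row (tset i q.1.1 q.2)))).
    apply: measurable_dir_arg => //.
      by apply: measurableT_comp => //; exact: measurable_snd.
    apply: (@measurable_mktuple _ _ _ _ (fun q j => if j == i then q.2 else tnth q.1.1 j)) => j.
    case: (j == i); first exact: measurable_snd.
    apply: measurable_tnth_comp.
    by apply: measurableT_comp => //; exact: measurable_fst.
  by apply/funext => q; rewrite yE.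
have mK : measurable_fun [set: N.-tuple R * R]
    (fun q => a^-1 * \int[N1]_w (w * phi (y q.1 + (q.2 + a * w) *: dir i))).
  apply: measurable_funM => //.
  apply: (@measurable_Rintegral2 R _ _ (N.-tuple R * R)%type (measurableTypeR R) N1 setT
    (fun p => p.2 * phi (y p.1.1 + (p.1.2 + a * p.2) *: dir i))) => //.
  by apply: measurable_funM.
have Kbnd z r : `|a^-1 * \int[N1]_w (w * phi (y z + (r + a * w) *: dir i))| <= a^-1 * C.
  rewrite normrM gtr0_norm ?invr_gt0// ler_pM2l ?invr_gt0//.
  apply: (@le_trans _ _ (\int[N1]_w (C * `|w|))).
    apply: normr_Rintegral_dominated => //.
    - by apply: measurable_funM => //; apply: (measurableT_comp (mphi1 (y z))); apply: measurable_funD => //; exact: measurable_funM.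
    - apply: (@integrable_normal_lin R (C / 2) (C / 2)).
        by apply: measurable_funM => //; exact: measurableT_comp.
      move=> w; rewrite normrM normr_id (ger0_norm C0).
      by have := ler_wpM2l C0 (normr_le_sqr w); lra.
    - by move=> w _; rewrite normrM mulrC ler_wpM2r.
  rewrite RintegralZl//; last exact: integrable_normal_abs.
  by rewrite -[leRHS]mulr1 ler_wpM2l// Rintegral_normal_abs.
have iN r z : N1.-integrable setT (EFin \o (fun w => phi (y z + (r + a * w) *: dir i))).
  apply: (integrable_bounded (C := C)) => //; first exact: normal_fin.
  by apply: (measurableT_comp (mphi1 (y z))); apply: measurable_funD => //; exact: measurable_funM.
have mI r : measurable_fun setT (fun z => \int[N1]_w phi (y z + (r + a * w) *: dir i)).
  apply: (@measurable_Rintegral2 R _ _ (N.-tuple R) (measurableTypeR R) N1 setT (fun p => phi (y p.1 + (r + a * p.2) *: dir i))) => //.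
  have mpr : measurable_fun [set: N.-tuple R * R] (fun p => ((p.1, r), p.2)).
    by apply: measurable_fun_pair => //; apply: measurable_fun_pair.
  exact: (measurableT_comp mjoint mpr).
have iI r : gN.-integrable setT (EFin \o (fun z => \int[N1]_w phi (y z + (r + a * w) *: dir i))).
  apply: (integrable_gauss_bounded (C := C)) => // z.
  have := normr_Rintegral_le measurableT normal_fin _ (fun w _ => phiC (y z + (r + a * w) *: dir i)).
  rewrite [X in fine X](_ : _ = 1%E) ?mulr1; last exact: (@probability_setT _ _ _ N1).
  by apply; apply: (measurableT_comp (mphi1 (y z))); apply: measurable_funD => //; exact: measurable_funM.
rewrite E0 !resample -RintegralB//.
transitivity (\int[gN]_z \int[mu]_(r in `[0, h])
    (a^-1 * \int[N1]_w (w * phi (y z + (r + a * w) *: dir i)))).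
  apply: eq_Rintegral => z _.
  under [X in _ - X]eq_Rintegral do rewrite add0r.
  rewrite (@Rintegral_normal_shift _ (fun u => phi (y z + u *: dir i)) a h C 0)//.
  by move=> u; rewrite mul0r addr0.
rewrite (@Rintegral_fubini _ _ _ _ _ gN mu setT `[0, h]%classic
   (fun q => a^-1 * \int[N1]_w (w * phi (y q.1 + (q.2 + a * w) *: dir i))))//; last first.
  apply: (integrable_bounded (C := a^-1 * C)).
  - exact: measurableX.
  - apply: product_measure_lty => //; first exact: gauss_fin.
    by rewrite /= lebesgue_measure_itv/= lte_fin h0 -EFinB ltry.
  - exact: measurable_funTS.
  - by move=> q _; exact: Kbnd.
apply: eq_Rintegral => r _ /=.
have iW : gN.-integrable setT (EFin \o (fun z => tnth z i * phi (x + r *: dir i + a *: row z))).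
  exact: (integrable_gauss_coord_bounded i (mF r) (fun z => phiC _)).
have mW : measurable_fun setT (fun z : N.-tuple R => tnth z i * phi (x + r *: dir i + a *: row z)).
  by apply: measurable_funM => //; exact: measurable_tnth.
rewrite (Rintegral_gauss_resample i mW iW).
have E1 z : \int[N1]_w (tnth (tset i z w) i * phi (x + r *: dir i + a *: row (tset i z w))) =
   \int[N1]_w (w * phi (y z + (r + a * w) *: dir i)).
  by apply: eq_Rintegral => w _; rewrite tnth_mktuple eqxx yE.
under [in RHS]eq_Rintegral do rewrite E1.
rewrite RintegralZl//.
have mpr : measurable_fun setT (fun z : N.-tuple R => (z, r)) by exact: measurable_fun_pair.
have mZ := measurableT_comp mK mpr.
apply: (integrable_gauss_bounded (C := C)).
  rewrite (_ : (fun _ => _) = (fun z => a * (a^-1 * \int[N1]_w (w * phi (y z + (r + a * w) *: dir i))))).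
    by apply: measurable_funM.
  by apply/funext => z; rewrite mulrA divff ?mul1r// gt_eqF.
move=> z; have := Kbnd z r; rewrite normrM gtr0_norm ?invr_gt0//.
by rewrite ler_pM2l ?invr_gt0.
Qed.

(** The gradient bound of order t^(-1/2) for bounded data: in the shift formula a = sqrt (2 t) and a
    coordinate has mean absolute value at most 1. Negative [h] is reduced to positive by exchanging
    the two points. *)
Lemma heatop_lip_coord t phi (C : R) x i (h : R) : 0 < t -> mfun_row phi ->
  (forall y, `|phi y| <= C) ->
  `|heatop t phi (x + h *: dir i) - heatop t phi x| <= C / Num.sqrt (2 * t) * `|h|.
Proof.
move=> t0 mphi phiC; have C0 : 0 <= C by apply: le_trans (phiC 0).
have a0 : 0 < Num.sqrt (2 * t) by rewrite sqrtr_gt0 mulr_gt0.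
have main y k : 0 < k ->
    `|heatop t phi (y + k *: dir i) - heatop t phi y| <= C / Num.sqrt (2 * t) * k.
  move=> k0; rewrite /heatop (@Rintegral_gauss_shift _ C)//.
  have := @normr_Rintegral_le _ _ _ mu `[0, k]%classic (fun r => (Num.sqrt (2 * t))^-1 *
    \int[gN]_z (tnth z i * phi (y + r *: dir i + Num.sqrt (2 * t) *: row z)))
    (C / Num.sqrt (2 * t)).
  rewrite /= lebesgue_measure_itv/= lte_fin k0 oppr0 adde0/=; apply => //.
  - by rewrite ltry.
  - apply: measurable_funTS; apply: measurable_funM => //.
    apply: (@measurable_Rintegral2 R _ _ (measurableTypeR R) _ gN setT (fun p =>
      tnth p.2 i * phi (y + p.1 *: dir i + Num.sqrt (2 * t) *: row p.2))) => //.
    apply: measurable_funM; first by apply: measurable_tnth_comp; exact: measurable_snd.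
    exact: measurable_dir_arg.
  - move=> r _; rewrite normrM gtr0_norm ?invr_gt0// mulrC ler_pM2r ?invr_gt0//.
    apply: normr_Rintegral_gauss_coord => //.
    exact: (@measurable_dir_arg _ _ phi (fun=> r) id).
have [h0|h0|->] := ltgtP h 0.
- have xE : x = (x + h *: dir i) + (- h) *: dir i by rewrite scaleNr addrK.
  have hN : 0 < - h by rewrite oppr_gt0.
  by rewrite distrC; have := main (x + h *: dir i) (- h) hN; rewrite -xE (ltr0_norm h0).
- by rewrite (gtr0_norm h0); exact: main.
- by rewrite scale0r addr0 subrr normr0 mulr0.
Qed.

(** The mean displacement at scale 1; it is the constant in the sqrt t modulus of continuity in
    time. *)
Definition displ : R := \int[gN]_z `|row z|.

Lemma measurable_norm_row : measurable_fun setT (fun z : N.-tuple R => `|row z|).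
Proof. exact: (@mfun_row_continuous _ _ (fun x => `|x|) (@norm_continuous _ _)). Qed.

Lemma integrable_norm_row : gN.-integrable setT (EFin \o (fun z => `|row z|)).
Proof.
apply: (@integrable_dominated _ _ _ gN _ _ (fun z => \sum_(i < N) `|tnth z i|)) => //.
- exact: measurable_norm_row.
- rewrite (_ : _ \o _ = (fun z => \sum_(i < N) `|tnth z i|%:E)%E); last first.
    by apply/funext => z /=; rewrite sumEFin.
  by apply: integrable_sum => // i _; exact: integrable_gauss_abs_coord.
- move=> z _; rewrite normr_id; apply: rV_norm_le; first exact: sumr_ge0.
  by move=> i; rewrite mxE (bigD1 i)//= lerDl sumr_ge0.
Qed.

Lemma displ_ge0 : 0 <= displ.
Proof. exact: Rintegral_ge0. Qed.

Lemma heatop_sub t phi (L C : R) x : 0 <= t -> mfun_row phi -> (forall y, `|phi y| <= C) ->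
  (forall x y, `|phi x - phi y| <= L * `|x - y|) ->
  `|heatop t phi x - phi x| <= L * Num.sqrt (2 * t) * displ.
Proof.
move=> t0 mphi phiC phiL.
rewrite -[X in _ - X](Rintegral_gauss_cst N (phi x)) /heatop -RintegralB//; last 2 first.
- exact: heatop_integrable.
- exact: (integrable_gauss_bounded (C := `|phi x|)).
rewrite /displ -RintegralZl//; last exact: integrable_norm_row.
apply: normr_Rintegral_dominated => //.
- by apply: measurable_funB => //; exact: measurable_heat_arg.
- rewrite (_ : _ \o _ = (fun z => (L * Num.sqrt (2 * t))%:E * `|row z|%:E)%E)//.
  by apply: integrableZl => //; exact: integrable_norm_row.
move=> z _; apply: (le_trans (phiL _ _)).
by rewrite addrAC subrr add0r normrZ ger0_norm ?sqrtr_ge0// mulrA.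
Qed.

End heat_smoothing.

(** * Odd functions and the Dirichlet kernel *)

Section odd_functions.
Context {R : realType} {N : nat}.
Variable m : nat.
Notation E := 'rV[R]_N.
Notation row := (@row_of_tuple R N).
Notation Om := (@Omega R N m).
Implicit Types (phi psi : E -> R) (x y : E).

Definition oddm phi := forall i : 'I_N, (i < m)%N -> forall x, phi (flip i x) = - phi x.

Definition sgm x : R := \prod_(i < N | (i < m)%N) Num.sg (x ord0 i).

Definition absm x : E := \row_i if (i < m)%N then `|x ord0 i| else x ord0 i.

(** Odd reflection. As [sgm] vanishes when one of the first [m] coordinates does, values of [phi]
    off [Omega m] never contribute. *)
Definition oddext phi x := sgm x * phi (absm x).

Lemma oddm_oddext phi : oddm (oddext phi).
Proof.
move=> i im x; rewrite /oddext.
have -> : absm (flip i x) = absm x.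
  apply/rowP => j; rewrite !mxE; case: ifP => // jm.
  - by case: eqP => // ->; rewrite normrN.
  - by case: eqP => // ji; move: jm; rewrite ji im.
rewrite /sgm (bigD1 i)//= [in RHS](bigD1 i)//= !mxE eqxx sgrN !mulNr.
congr (- (_ * _ * _)); apply: eq_bigr => j /andP[_ ji].
by rewrite mxE (negbTE ji).
Qed.

Lemma oddm_eq0 phi x (i : 'I_N) : oddm phi -> (i < m)%N -> x ord0 i = 0 -> phi x = 0.
Proof.
move=> ophi im xi0; have := ophi i im x.
rewrite (_ : flip i x = x); first by lra.
by apply/rowP => j; rewrite mxE; case: eqP => // ->; rewrite xi0 oppr0.
Qed.

Lemma sgm_Omega x : Om x -> sgm x = 1.
Proof. by move=> Ox; rewrite /sgm big1// => i im; rewrite gtr0_sg// Ox. Qed.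

Lemma absm_Omega x : Om x -> absm x = x.
Proof.
move=> Ox; apply/rowP => i; rewrite mxE; case: ifP => // im.
by rewrite gtr0_norm// Ox.
Qed.

Lemma oddext_Omega phi x : Om x -> oddext phi x = phi x.
Proof. by move=> Ox; rewrite /oddext sgm_Omega// absm_Omega// mul1r. Qed.

Lemma sgm_absm x : sgm x = 0 \/ `|sgm x| = 1 /\ Om (absm x).
Proof.
have [x0|] := boolP [forall i : 'I_N, (i < m)%N ==> (x ord0 i != 0)].
  right; split.
    rewrite /sgm normr_prod big1// => i im; rewrite normr_sg.
    by move/forallP : x0 => /(_ i); rewrite im/= => ->.
  move=> i im; rewrite mxE im normr_gt0.
  by move/forallP : x0 => /(_ i); rewrite im.
rewrite negb_forall => /existsP[i]; rewrite negb_imply negbK => /andP[im /eqP xi0].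
by left; rewrite /sgm (bigD1 i)//= xi0 sgr0 mul0r.
Qed.

Lemma normr_oddext_le phi (C : R) : 0 <= C -> (forall x, Om x -> `|phi x| <= C) ->
  forall x, `|oddext phi x| <= C.
Proof.
move=> C0 phiC x; rewrite /oddext normrM.
by have [->|[-> Ox]] := sgm_absm x; rewrite ?normr0 ?mul0r// mul1r phiC.
Qed.

Lemma oddmE phi : oddm phi -> phi = oddext phi.
Proof.
move=> ophi; apply/funext => x.
(* The first k coordinates are folded one by one, each at the cost of one sign; the minimum stops
   the folding at [m]. *)
pose ab k : E := \row_i if (i < minn k m)%N then `|x ord0 i| else x ord0 i.
suff H k : (k <= N)%N ->
    phi x = (\prod_(i < N | (i < minn k m)%N) Num.sg (x ord0 i)) * phi (ab k).
  rewrite (H N (leqnn N)) /oddext /sgm; congr (_ * phi _).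
    by apply: eq_bigl => i; rewrite ltn_min ltn_ord.
  by apply/rowP => i; rewrite !mxE ltn_min ltn_ord.
elim: k => [_|k IH kN].
  rewrite big1 ?mul1r; last by move=> i; rewrite min0n ltn0.
  by congr phi; apply/rowP => i; rewrite mxE min0n ltn0.
rewrite (IH (ltnW kN)); have [km|mk] := ltnP k m; last first.
  rewrite (_ : ab k.+1 = ab k).
    by congr (_ * _); apply: eq_bigl => i; rewrite !ltn_min; lia.
  by apply/rowP => i; rewrite !mxE !ltn_min; congr (if _ then _ else _); lia.
pose i := Ordinal kN.
have -> : \prod_(j < N | (j < minn k.+1 m)%N) Num.sg (x ord0 j) =
    Num.sg (x ord0 i) * \prod_(j < N | (j < minn k m)%N) Num.sg (x ord0 j).
  rewrite (bigD1 i)/=; last by rewrite ltn_min ltnSn km.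
  congr (_ * _); apply: eq_bigl => j; rewrite !ltn_min -(inj_eq val_inj)/=; lia.
rewrite (minn_idPl (ltnW km)) -mulrA [RHS]mulrCA; congr (_ * _).
have [xi|xi|xi] := ltgtP (x ord0 i) 0.
- rewrite ltr0_sg// mulN1r -(ophi i)//.
  congr phi; apply/rowP => j; rewrite !mxE !ltn_min -(inj_eq val_inj)/=.
  have [jk|jk|jk] := ltngtP j k.
  + by rewrite (ltn_trans jk (ltnSn k)).
  + by rewrite [(j < k.+1)%N]ltnNge jk.
  + rewrite ltnS jk leqnn km/=.
    have ji : j = i by exact/val_inj.
    by rewrite ji ltr0_norm// opprK.
- rewrite gtr0_sg// mul1r.
  congr phi; apply/rowP => j; rewrite !mxE !ltn_min.
  have [jk|jk|jk] := ltngtP j k.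
  + by rewrite (ltn_trans jk (ltnSn k)).
  + by rewrite [(j < k.+1)%N]ltnNge jk.
  + rewrite ltnS jk leqnn km/=.
    have ji : j = i by exact/val_inj.
    by rewrite ji gtr0_norm.
- rewrite xi sgr0 mul0r (oddm_eq0 (i := i))//.
  by rewrite mxE ltn_min/= ltnn.
Qed.

Lemma oddm_bound phi (C : R) : oddm phi -> 0 <= C -> (forall x, Om x -> `|phi x| <= C) ->
  forall x, `|phi x| <= C.
Proof. by move=> ophi C0 phiC x; rewrite (oddmE ophi); exact: normr_oddext_le. Qed.

Lemma oddm_heatop t phi (C : R) : mfun_row phi -> (forall x, `|phi x| <= C) ->
  oddm phi -> oddm (heatop t phi).
Proof.
move=> mphi phiC ophi i im x; rewrite heatop_flip//.
rewrite (_ : phi \o flip i = (fun y => -1 * phi y)); last first.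
  by apply/funext => y /=; rewrite ophi// mulN1r.
by rewrite (heatopZ _ _ _ mphi phiC) mulN1r.
Qed.

Lemma measurable_sgm : mfun_row sgm.
Proof.
rewrite /mfun_row.
have -> : sgm \o row = (fun z => \prod_(i < N | (i < m)%N) Num.sg (tnth z i)).
  by apply/funext => z /=; apply: eq_bigr => i _; rewrite mxE.
pose s (r : R) := if 0 < r then 1 else if r < 0 then -1 else 0 : R.
have ms : measurable_fun setT s.
  apply: measurable_fun_ifT => //; last apply: measurable_fun_ifT => //.
    by apply: measurable_fun_ltr.
  by apply: measurable_fun_ltr.
have sE r : Num.sg r = s r by rewrite /s; case: sgrP => //.
under eq_fun do under eq_bigr do rewrite sE.
have -> : (fun z : N.-tuple R => \prod_(i < N | (i < m)%N) s (tnth z i)) =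
    (fun z => \prod_(i < N) if (i < m)%N then s (tnth z i) else 1).
  by apply/funext => z; rewrite big_mkcond.
apply: measurable_prod => i _; case: (i < m)%N => //.
by apply: measurableT_comp => //; exact: measurable_tnth.
Qed.

Lemma measurable_absm_coord (i : 'I_N) : measurable_fun setT (fun z => absm (row z) ord0 i).
Proof.
rewrite (_ : (fun _ => _) = fun z => if (i < m)%N then `|tnth z i| else tnth z i).
  case: (i < m)%N; last exact: measurable_tnth.
  by apply: measurableT_comp => //; exact: measurable_tnth.
by apply/funext => z; rewrite !mxE.
Qed.

Lemma mfun_row_oddext phi : mfun_row phi -> mfun_row (oddext phi).
Proof.
move=> mphi; apply: measurable_funM; first exact: measurable_sgm.
by apply: measurable_row_comp => // i; exact: measurable_absm_coord.
Qed.

Definition halfpos (j : nat) (z : N.-tuple R) := [forall i : 'I_N, (i < j)%N ==> (0 < tnth z i)].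

Let K1 (x : E) (a : R) (j : nat) (z : N.-tuple R) : R :=
  \prod_(i < N) if (i < j)%N
    then normal_pdf (x ord0 i) a (tnth z i) - normal_pdf (x ord0 i) a (- tnth z i)
    else normal_pdf (x ord0 i) a (tnth z i).

(** Interpolates between the two semigroups: at j = 0 the free Gaussian integrand on the whole
    space, at j = m the Dirichlet integrand on [Omega m]. Each step folds one coordinate onto its
    positive half-line. *)
Let F1 phi x a j z : R := if halfpos j z then K1 x a j z * phi (row z) else 0.

(** By oddness the value at the reflected point enters with a minus sign, which produces the image
    term of the kernel in coordinate [i]. *)
Let F1S phi x a (i : 'I_N) : oddm phi -> (i < m)%N -> forall z,
  F1 phi x a i.+1 z = if 0 < tnth z i then F1 phi x a i z + F1 phi x a i (tflip i z) else 0.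
Proof.
move=> ophi im z.
have ltS (j : 'I_N) : j != i -> (j < i.+1)%N = (j < i)%N.
  by rewrite -(inj_eq val_inj)/= ltnS [in RHS]ltn_neqAle => ->.
have hS : halfpos i.+1 z = (0 < tnth z i) && halfpos i z.
  apply/forallP/andP => [h|[zi /forallP h] j].
    split; first by have := h i; rewrite ltnSn.
    by apply/forallP => j; apply/implyP => ji; have := h j; rewrite ltnS ltnW.
  apply/implyP; rewrite ltnS leq_eqVlt => /predU1P[ji|ji]; last by have := h j; rewrite ji.
  by have -> : j = i by exact/val_inj.
have hf : halfpos i (tflip i z) = halfpos i z.
  apply: eq_forallb => j; rewrite tnth_mktuple.
  by have [->|//] := eqVneq j i; rewrite ltnn.
rewrite /F1 hS hf row_flip ophi//; case: ifP => [/andP[-> ->]|]; last first.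
  by case: (0 < tnth z i) => //= ->; rewrite addr0.
rewrite mulrN -mulrBl; congr (_ * _).
rewrite /K1 (bigD1 i)//= [X in _ = X - _](bigD1 i)//= [X in _ = _ - X](bigD1 i)//=.
rewrite ltnSn ltnn tnth_mktuple eqxx.
set A := \prod_(_ < N | _) _; set B := \prod_(_ < N | _) _; set D := \prod_(_ < N | _) _.
have -> : B = A.
  by apply: eq_bigr => j ji; rewrite ltS.
have -> : D = A.
  by apply: eq_bigr => j ji; rewrite !tnth_mktuple (negbTE ji) ltS.
by rewrite mulrBl.
Qed.

Let F1_0 phi x a z : F1 phi x a 0 z = phi (row z) * gdens (x ord0) a z.
Proof.
rewrite /F1 ifT; last by apply/forallP.
by rewrite mulrC; congr (_ * _); apply: eq_bigr.
Qed.

Let measurable_F1 phi x a j : mfun_row phi -> measurable_fun setT (F1 phi x a j).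
Proof.
move=> mphi; apply: measurable_fun_ifT => //; last first.
  apply: measurable_funM => //; apply: measurable_prod => i _.
  have mp : measurable_fun setT (fun z : N.-tuple R => normal_pdf (x ord0 i) a (tnth z i)).
    by apply: measurableT_comp; [exact: measurable_normal_pdf|exact: measurable_tnth].
  case: (i < j)%N => //; apply: measurable_funB => //.
  apply: measurableT_comp; first exact: measurable_normal_pdf.
  by apply: measurableT_comp => //; exact: measurable_tnth.
rewrite /halfpos.
rewrite (_ : (fun _ => _) = (fun z => \big[andb/true]_(i < N) ((i < j)%N ==> (0 < tnth z i)))); last first.
  by apply/funext => z; rewrite big_andE.
elim: (index_enum _) => [|i s IH].
  rewrite (_ : (fun _ => _) = cst true)//.
  by apply/funext => z; rewrite big_nil.
rewrite (_ : (fun _ => _) = (fun z => ((i < j)%N ==> (0 < tnth z i)) && \big[andb/true]_(i0 <- s) ((i0 < j)%N ==> (0 < tnth z i0)))); last first.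
  by apply/funext => z; rewrite big_cons.
apply: measurable_and => //; case: (i < j)%N => //=.
by apply: measurable_fun_ltr => //; exact: measurable_tnth.
Qed.

(** Induction on j: the integral is split by the sign of coordinate j into [P] and [Q], and [Q] is
    reflected. The hyperplane between the halves contributes nothing because an odd function
    vanishes on it. *)
Let F1_int phi x a (C : R) j : 0 < a -> (j <= m)%N -> (j <= N)%N -> mfun_row phi ->
  (forall y, `|phi y| <= C) -> oddm phi ->
  (lebesgue_tuple N).-integrable setT (EFin \o F1 phi x a j) /\
  \int[lebesgue_tuple N]_z F1 phi x a j z = \int[gauss N]_z phi (x + a *: row z).
Proof.
move=> a0; elim: j => [_ _|j IH jm jN] mphi phiC ophi.
  have E0 : F1 phi x a 0 = fun z => phi (row z) * gdens (x ord0) a z.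
    by apply/funext => z; exact: F1_0.
  rewrite E0; split.
    apply: (@integrable_dominated _ _ _ (lebesgue_tuple N) _ _ (fun z => C * gdens (x ord0) a z)) => //.
    - by apply: measurable_funM => //; exact: measurable_gdens.
    - rewrite (_ : _ \o _ = (fun z => C%:E * (gdens (x ord0) a z)%:E)%E)//.
      by apply: integrableZl => //; exact: integrable_gdens.
    - move=> z _; rewrite normrM [X in _ * X]ger0_norm ?gdens_ge0//.
      by rewrite ler_wpM2r// gdens_ge0.
  rewrite -(@Rintegral_gauss_affine _ _ (x ord0) a (phi \o row))//.
  by apply: eq_Rintegral => z _ /=; rewrite row_taff.
have [iF <-] := IH (ltnW jm) (ltnW jN) mphi phiC ophi.
pose i := Ordinal jN.
pose P z : R := if 0 < tnth z i then F1 phi x a j z else 0.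
pose Q z : R := if tnth z i < 0 then F1 phi x a j z else 0.
have mF := measurable_F1 x a j mphi.
have mP : measurable_fun setT P.
  by apply: measurable_fun_ifT => //; apply: measurable_fun_ltr => //; exact: measurable_tnth.
have mQ : measurable_fun setT Q.
  by apply: measurable_fun_ifT => //; apply: measurable_fun_ltr => //; exact: measurable_tnth.
have iP : (lebesgue_tuple N).-integrable setT (EFin \o P).
  apply: le_integrable iF => //; first exact/measurable_EFinP.
  by move=> z _; rewrite /P/= lee_fin; case: ifP => // _; rewrite normr0.
have iQ : (lebesgue_tuple N).-integrable setT (EFin \o Q).
  apply: le_integrable iF => //; first exact/measurable_EFinP.
  by move=> z _; rewrite /Q/= lee_fin; case: ifP => // _; rewrite normr0.
have iQf : (lebesgue_tuple N).-integrable setT (EFin \o (fun z => Q (tflip i z))).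
  exact: (integrable_law (g2 := id) (@measurable_tflip _ _ i) (@ge0_integral_lebesgue_tuple_flip _ _ i) mQ iQ).
have FS : F1 phi x a j.+1 = (fun z => P z + Q (tflip i z)).
  apply/funext => z; rewrite (@F1S phi x a i ophi jm) /P /Q tnth_mktuple eqxx oppr_lt0.
  by case: ifP => // _; rewrite addr0.
have FPQ z : F1 phi x a j z = P z + Q z.
  rewrite /P /Q; have [zi|zi|zi] := ltgtP (tnth z i) 0; rewrite ?addr0 ?add0r//.
  by rewrite /F1 (oddm_eq0 ophi (i := i))// ?mulr0 ?if_same// mxE.
rewrite FS; split.
  rewrite (_ : _ \o _ = (EFin \o P) \+ (EFin \o (fun z => Q (tflip i z))))%E//.
  exact: integrableD.
rewrite RintegralD// Rintegral_lebesgue_tuple_flip// -RintegralD//.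
by apply: eq_Rintegral => z _; rewrite FPQ.
Qed.

Hypothesis mN : (m <= N)%N.

Lemma heat_kernelE (t : R) (x y : E) : 0 < t ->
  heat_kernel m t x y = \prod_(i < N) if (i < m)%N
    then normal_pdf (x ord0 i) (Num.sqrt (2 * t)) (y ord0 i) -
         normal_pdf (x ord0 i) (Num.sqrt (2 * t)) (- y ord0 i)
    else normal_pdf (x ord0 i) (Num.sqrt (2 * t)) (y ord0 i).
Proof.
move=> t0; have a0 : Num.sqrt (2 * t) != 0 by rewrite gt_eqF// sqrtr_gt0 mulr_gt0.
have t4 : 0 < 4 * pi * t by rewrite !mulr_gt0// pi_gt0.
have pk : normal_peak (Num.sqrt (2 * t)) = (4 * pi * t) `^ (- 2^-1).
  rewrite /normal_peak powRN powR12_sqrt ?ltW//.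
  by rewrite sqr_sqrtr ?mulr_ge0 ?ltW//; congr (Num.sqrt _)^-1; ring.
have ex (u v : R) : normal_fun u (Num.sqrt (2 * t)) v = expR (- (`|u - v| ^+ 2 / (4 * t))).
  rewrite /normal_fun sqr_sqrtr ?mulr_ge0 ?ltW// real_normK ?num_real//.
  by congr expR; field; rewrite gt_eqF.
rewrite /heat_kernel.
have -> : (4 * pi * t) `^ (- (N%:R / 2)) = \prod_(i < N) (4 * pi * t) `^ (- 2^-1).
  rewrite prodr_const card_ord -powR_mulrn ?powR_ge0// -powRrM.
  by congr (_ `^ _); field.
rewrite [X in _ * X * _]big_mkcond [X in _ * X]big_mkcond -!big_split/=.
apply: eq_bigr => i _; rewrite leqNgt; case im : (i < m)%N => /=; rewrite ?mul1r ?mulr1.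
  by rewrite !normal_pdfE// -pk mulrBr; congr (_ * _ - _ * _); rewrite ex ?opprK.
by rewrite normal_pdfE// -pk ex.
Qed.

Lemma halfpos_Omega z : halfpos m z <-> (row @^-1` Om) z.
Proof.
split=> [/forallP h i im|h]; first by rewrite mxE; have := h i; rewrite im.
by apply/forallP => i; apply/implyP => im; have := h i im; rewrite mxE.
Qed.

Lemma measurable_Omega : measurable (row @^-1` Om).
Proof.
pose A (i : 'I_N) : set R := if (i < m)%N then `]0, +oo[%classic else setT.
rewrite (_ : _ @^-1` _ = [set y : N.-tuple R | forall i, A i (tnth y i)]).
  by apply: measurable_tuple_box => i; rewrite /A; case: ifP.
apply/seteqP; split=> z /=.
  move=> h i; rewrite /A; case: ifP => // im.
  by rewrite /= in_itv/= andbT; have := h i im; rewrite mxE.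
by move=> h i im; have := h i; rewrite /A im /= in_itv/= andbT mxE.
Qed.

Let F1_restrict phi x t : 0 < t -> F1 phi x (Num.sqrt (2 * t)) m =
  (fun z => heat_kernel m t x (row z) * phi (row z)) \_ (row @^-1` Om).
Proof.
move=> t0; apply/funext => z; rewrite /patch /F1.
have [h|h] := boolP (halfpos m z).
  rewrite mem_set; last exact/halfpos_Omega.
  rewrite heat_kernelE//; congr (_ * _); apply: eq_bigr => i _.
  by rewrite !mxE.
by rewrite memNset// => /halfpos_Omega; exact/negP.
Qed.

Lemma integrable_heat_kernel phi (C : R) t x : 0 < t -> mfun_row phi ->
  (forall y, `|phi y| <= C) -> oddm phi ->
  (lebesgue_tuple N).-integrable (row @^-1` Om)
    (EFin \o (fun z => heat_kernel m t x (row z) * phi (row z))).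
Proof.
move=> t0 mphi phiC ophi.
have a0 : 0 < Num.sqrt (2 * t) by rewrite sqrtr_gt0 mulr_gt0.
apply/integrable_mkcond; first exact: measurable_Omega.
rewrite restrict_EFin -F1_restrict//.
by have [] := F1_int x a0 (leqnn m) mN mphi phiC ophi.
Qed.

(* Method of images: on functions odd in the first [m] coordinates the
   Dirichlet semigroup of [Omega m] is the free one. *)
Lemma heat_heatop phi (C : R) t x : 0 < t -> mfun_row phi ->
  (forall y, `|phi y| <= C) -> oddm phi -> heat m t phi x = heatop t phi x.
Proof.
move=> t0 mphi phiC ophi.
have a0 : 0 < Num.sqrt (2 * t) by rewrite sqrtr_gt0 mulr_gt0.
rewrite /heatop -(proj2 (F1_int x a0 (leqnn m) mN mphi phiC ophi)).
by rewrite F1_restrict// /heat [LHS]Rintegral_mkcond.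
Qed.

Lemma eq_heat phi psi t x : (forall y, Om y -> phi y = psi y) -> heat m t phi x = heat m t psi x.
Proof.
move=> pp; apply: eq_Rintegral => z /set_mem /= zO; by rewrite pp.
Qed.

Lemma heat_oddext phi (C : R) t x : 0 < t -> 0 <= C -> mfun_row (oddext phi) ->
  (forall y, Om y -> `|phi y| <= C) -> heat m t phi x = heatop t (oddext phi) x.
Proof.
move=> t0 C0 mphi phiC; rewrite (eq_heat (psi := oddext phi)); last first.
  by move=> y Oy; rewrite oddext_Omega.
apply: (@heat_heatop _ C) => //; last exact: oddm_oddext.
exact: normr_oddext_le.
Qed.

Lemma heat_kernel_ge0 t x y : 0 < t -> (forall i : 'I_N, (i < m)%N -> 0 <= x ord0 i) ->
  Om y -> 0 <= heat_kernel m t x y.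
Proof.
move=> t0 x0 Oy; rewrite /heat_kernel !mulr_ge0 ?powR_ge0//.
  by apply: prodr_ge0 => i _; exact: expR_ge0.
apply: prodr_ge0 => i im; rewrite subr_ge0 ler_expR lerN2 ler_pM2r ?invr_gt0 ?mulr_gt0//.
rewrite !real_normK ?num_real//.
have xi : 0 <= x 0 i := x0 i im; have yi : 0 < y 0 i := Oy i im.
by have := mulr_ge0 xi (ltW yi); lra.
Qed.

(** The maximum principle. An odd function changes sign on the whole space; rewritten with the
    Dirichlet kernel, which is nonnegative on the sector, the integral sees [phi] on [Omega m]
    only. *)
Lemma heatop_ge0 phi (C : R) t x : 0 <= t -> mfun_row phi -> (forall y, `|phi y| <= C) ->
  oddm phi -> (forall y, Om y -> 0 <= phi y) -> Om x -> 0 <= heatop t phi x.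
Proof.
rewrite le_eqVlt => /predU1P[<- _ _ _ phi0 Ox|t0 mphi phiC ophi phi0 Ox].
  by rewrite heatop0 phi0.
rewrite -(heat_heatop x t0 mphi phiC ophi); apply: Rintegral_ge0 => z Oz.
rewrite mulr_ge0 ?phi0//; apply: heat_kernel_ge0 => // i im; exact/ltW/Ox.
Qed.

Lemma le_heatop phi psi (C C' : R) t x : 0 <= t ->
  mfun_row phi -> (forall y, `|phi y| <= C) -> oddm phi ->
  mfun_row psi -> (forall y, `|psi y| <= C') -> oddm psi ->
  (forall y, Om y -> phi y <= psi y) -> Om x -> heatop t phi x <= heatop t psi x.
Proof.
move=> t0 mphi phiC ophi mpsi psiC opsi pp Ox.
rewrite -subr_ge0 -(heatopB t x mpsi psiC mphi phiC).
apply: (@heatop_ge0 _ (C' + C)) => //.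
- exact: measurable_funB.
- by move=> y; rewrite (le_trans (ler_normB _ _))// lerD.
- by move=> i im y; rewrite ophi// opsi// opprB addrC opprK.
- by move=> y Oy; rewrite subr_ge0 pp.
Qed.

Lemma closure_Omega x : closure Om x <-> forall i : 'I_N, (i < m)%N -> 0 <= x ord0 i.
Proof.
split=> [clx i im|x0 B].
  rewrite leNgt; apply/negP => xi0.
  have /clx[y [/= Oy xy]] : nbhs x (ball x (- x ord0 i)).
    by apply: nbhsx_ballx; rewrite oppr_gt0.
  have yi := Oy i im; move: xy; rewrite -ball_normE/= => xy.
  have := le_lt_trans (rV_coord_le (x - y) i) xy; rewrite !mxE.
  by rewrite ltr_norml => /andP[]; lra.
move=> /nbhs_ballP[e /= e0 Be].
pose y : E := x + const_mx (e / 2).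
exists y; split => [i im|]; first by rewrite !mxE ltr_wpDl ?x0// divr_gt0.
apply: Be; rewrite -ball_normE/=.
apply: (@le_lt_trans _ _ (e / 2)); last by rewrite ltr_pdivrMr// ltr_pMr// ltrDl.
apply: rV_norm_le; first by rewrite divr_ge0// ltW.
by move=> i; rewrite !mxE opprD addNKr normrN ger0_norm// divr_ge0// ltW.
Qed.

Lemma interior_Omega x : Om x -> Om° x.
Proof.
move=> Ox; rewrite /interior.
apply: (@filter_forall _ _ (fun (i : 'I_N) (y : E) => (i < m)%N -> 0 < y ord0 i) (nbhs x)) => i.
have [im|] := boolP (i < m)%N; last by move=> _; exact: nearW.
have cx : (fun y : E => y ord0 i) @ x --> x ord0 i by exact: coord_continuous.
have h : nbhs (x ord0 i) [set r | 0 < r] by apply: lt_nbhsr; exact: Ox.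
exact: (@filterS _ (nbhs x) _ _ _ (fun (y : E) (y0 : 0 < y ord0 i) (_ : true) => y0) (cx _ h)).
Qed.

Lemma boundary_Omega x : (closure Om `\` Om°) x -> exists2 i : 'I_N, (i < m)%N & x ord0 i = 0.
Proof.
move=> [/closure_Omega x0 nx].
have [h|] := boolP [forall i : 'I_N, (i < m)%N ==> (x ord0 i != 0)].
  case: nx; apply: interior_Omega => i im.
  by rewrite lt_neqAle eq_sym x0// andbT; move/forallP : h => /(_ i); rewrite im.
rewrite negb_forall => /existsP[i]; rewrite negb_imply negbK => /andP[im /eqP xi].
by exists i.
Qed.

Lemma closure_Omega_cases x : closure Om x -> Om x \/ exists2 i : 'I_N, (i < m)%N & x ord0 i = 0.
Proof.
move=> clx; have [|nOx] := pselect (Om° x).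
  by move=> /interior_subset; left.
by right; apply: boundary_Omega.
Qed.

Lemma C0bu_lipschitz phi (C L : R) : oddm phi -> (forall x, `|phi x| <= C) ->
  (forall x y, `|phi x - phi y| <= L * `|x - y|) -> C0bu m phi.
Proof.
move=> ophi phiC phiL; split; first by exists C.
  move=> e e0; have L0 : 0 < `|L| + 1 by rewrite ltr_wpDl.
  exists (e / (`|L| + 1)); first by rewrite divr_gt0.
  move=> x y _ _ xy; apply: (le_lt_trans (phiL _ _)).
  apply: (@le_lt_trans _ _ ((`|L| + 1) * `|x - y|)).
    by rewrite ler_wpM2r// (le_trans (ler_norm _))// lerDl.
  by rewrite mulrC -ltr_pdivlMr.
by move=> x /boundary_Omega[i im xi]; exact: (oddm_eq0 ophi im xi).
Qed.

End odd_functions.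

(** * Duhamel integrals *)

Section interval_integrals.
Context {R : realType}.
Notation mu := (@lebesgue_measure R).
Implicit Types (f : R -> R) (a b c s t : R).

Lemma cvg_Rintegral d (T : measurableType d) (nu : {measure set T -> \bar R})
    (D : set T) (f_ : nat -> T -> R) (f g : T -> R) : measurable D ->
  (forall n, measurable_fun D (f_ n)) -> measurable_fun D f ->
  (forall x, D x -> f_ n x @[n --> \oo] --> f x) ->
  nu.-integrable D (EFin \o g) -> (forall x n, D x -> `|f_ n x| <= g x) ->
  \int[nu]_(x in D) f_ n x @[n --> \oo] --> \int[nu]_(x in D) f x.
Proof.
move=> mD mf_ mf f_f ig f_g.
have [|||||if_ _ ] := @dominated_convergence _ _ _ nu D mD (fun n => EFin \o f_ n) (EFin \o f) (EFin \o g).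
- by move=> n; exact/measurable_EFinP.
- exact/measurable_EFinP.
- by apply: aeW => x Dx; apply: cvg_EFin; [exact: nearW|exact: f_f].
- by [].
- by apply: aeW => x n Dx; rewrite lee_fin; exact: f_g.
by rewrite /Rintegral => h; apply: fine_cvg; rewrite fineK//; exact: integrable_fin_num.
Qed.

Lemma integrableDR d (T : measurableType d) (nu : {measure set T -> \bar R})
    (D : set T) (f g : T -> R) : measurable D ->
  nu.-integrable D (EFin \o f) -> nu.-integrable D (EFin \o g) ->
  nu.-integrable D (EFin \o (fun x => f x + g x)).
Proof. by move=> mD fi gi; exact: (integrableD mD fi gi). Qed.

Lemma integrableZR d (T : measurableType d) (nu : {measure set T -> \bar R})
    (D : set T) (f : T -> R) c : measurable D ->
  nu.-integrable D (EFin \o f) -> nu.-integrable D (EFin \o (fun x => c * f x)).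
Proof. by move=> mD fi; exact: (integrableZl mD c fi). Qed.

Lemma itv_oo_fin a b : (mu `]a, b[%classic < +oo)%E.
Proof.
rewrite lebesgue_measure_itv/=; case: ifP => // _.
by rewrite -EFinB ltry.
Qed.

Lemma itv_oo_fine a b : a <= b -> fine (mu `]a, b[%classic) = b - a.
Proof.
rewrite le_eqVlt => /predU1P[<-|ab].
  by rewrite lebesgue_measure_itv/= ltxx subrr.
by rewrite lebesgue_measure_itv/= lte_fin ab.
Qed.

Lemma integrable_itv f a b C : measurable_fun setT f ->
  (forall s, a < s < b -> `|f s| <= C) -> mu.-integrable `]a, b[ (EFin \o f).
Proof.
move=> mf fC; apply: (integrable_bounded (C := C)) => //; first exact: itv_oo_fin.
  exact: measurable_funTS.
Qed.

Lemma normr_Rintegral_itv f a b C : a <= b -> measurable_fun setT f ->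
  (forall s, a < s < b -> `|f s| <= C) -> `|\int[mu]_(s in `]a, b[) f s| <= C * (b - a).
Proof.
move=> ab mf fC; rewrite -(itv_oo_fine ab).
apply: normr_Rintegral_le => //; first exact: itv_oo_fin.
  exact: measurable_funTS.
Qed.

Lemma Rintegral_itv_cat f a b c : a <= b <= c -> mu.-integrable `]a, c[ (EFin \o f) ->
  \int[mu]_(s in `]a, c[) f s = \int[mu]_(s in `]a, b[) f s + \int[mu]_(s in `]b, c[) f s.
Proof.
move=> /andP[]; rewrite le_eqVlt => /predU1P[<- _ _|ab].
  by rewrite set_itvoo0 Rintegral_set0 add0r.
rewrite le_eqVlt => /predU1P[<- _|bc fi].
  by rewrite [in X in _ + X]set_itvoo0 Rintegral_set0 addr0.
have ib : mu.-integrable `]b, c[ (EFin \o f).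
  apply: integrableS fi => //; apply: subset_itvr; rewrite bnd_simp; exact: ltW.
have ia : mu.-integrable `]a, b[ (EFin \o f).
  apply: integrableS fi => //; apply: subset_itvl; rewrite bnd_simp; exact: ltW.
rewrite (Rintegral_itv_obnd_cbnd ib) -Rintegral_setU//.
- by rewrite -itv_bndbnd_setU// bnd_simp ltW.
- by rewrite -itv_bndbnd_setU// bnd_simp ltW.
- apply/disj_setPS => y [/=]; rewrite 2!in_itv/= => /andP[_ yx] /andP[].
  by rewrite leNgt yx.
Qed.

Lemma Rintegral_affine f a c : 0 < c -> measurable_fun setT f ->
  mu.-integrable setT (EFin \o f) ->
  \int[mu]_s f s = c * \int[mu]_s f (c * s + a).
Proof.
move=> c0 mf fi.
have ge (g : R -> R) : measurable_fun setT g -> (forall x, 0 <= g x) ->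
    \int[mu]_s g s = c * \int[mu]_s g (c * s + a).
  move=> mg g0; rewrite /Rintegral.
  rewrite (@ge0_integral_affine R c a (EFin \o g))//; last exact/measurable_EFinP.
  have : (0 <= \int[mu]_s (g (c * s + a)%R)%:E)%E by apply: integral_ge0 => *; rewrite lee_fin.
  case: (\int[mu]_s (g (c * s + a)%R)%:E)%E => [r||]//= _.
  by rewrite mulr_infty gtr0_sg// mul1e/= mulr0.
have maff (g : R -> R) : measurable_fun setT g -> measurable_fun setT (fun s => g (c * s + a)).
  by move=> mg; apply: (measurableT_comp mg); apply: measurable_funD => //; exact: measurable_funM.
have mnf : measurable_fun setT (fun s => `|f s|).
  by apply: measurableT_comp => //; exact: normr_measurable.
have mp : measurable_fun setT (fun s => f s + `|f s|) by exact: measurable_funD.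
have inf : mu.-integrable setT (EFin \o (fun s => `|f s|)) by exact: (integrable_norm fi).
have ip : mu.-integrable setT (EFin \o (fun s => f s + `|f s|)) by exact: (integrableD _ fi inf).
have iaff (g : R -> R) : measurable_fun setT g -> mu.-integrable setT (EFin \o g) ->
    mu.-integrable setT (EFin \o (fun s => g (c * s + a))).
  move=> mg gi; apply/integrableP; split; first by apply/measurable_EFinP; exact: maff.
  case/integrableP: gi => _; rewrite (@ge0_integral_affine R c a (fun x => `|(EFin \o g) x|%E))//; last first.
    by apply: measurableT_comp => //; exact/measurable_EFinP.
  have : (0 <= \int[mu]_s `|(g (c * s + a)%R)%:E|)%E by exact: integral_ge0.
  rewrite /=; case: (\int[mu]_s `|(g (c * s + a)%R)%:E|)%E => [r||]//= _.
    by rewrite !ltry.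
  by rewrite mulr_infty gtr0_sg// mul1e.
(* Both f + |f| and |f| are nonnegative, which reduces the claim to [ge]. *)
transitivity (\int[mu]_s ((f s + `|f s|) - `|f s|)).
  by apply: eq_Rintegral => s _; rewrite addrK.
rewrite RintegralB// (ge (fun s => f s + `|f s|))//; last first.
  by move=> s; have := lerNnormlW (lexx `|f s|); lra.
rewrite (ge (fun s => `|f s|))// -mulrBr -RintegralB//; [|exact: (iaff (fun s => f s + `|f s|))|exact: (iaff (fun s => `|f s|))].
by congr (_ * _); apply: eq_Rintegral => s _; rewrite addrK.
Qed.

Lemma Rintegral_affine_itv f a c t C : 0 < c -> measurable_fun setT f ->
  (forall s, a < s < a + c * t -> `|f s| <= C) ->
  \int[mu]_(s in `]a, a + c * t[) f s = c * \int[mu]_(s in `]0, t[) f (c * s + a).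
Proof.
move=> c0 mf fC; rewrite Rintegral_mkcond (@Rintegral_affine _ a c)//.
- rewrite [in RHS]Rintegral_mkcond; congr (_ * _); apply: eq_Rintegral => s _.
  rewrite /patch !mem_setE !in_itv/= ltrDr pmulr_rgt0//.
  by rewrite (addrC a) ltrD2r ltr_pM2l.
- by apply/(measurable_restrictT _ _).1 => //; exact: measurable_funTS.
- rewrite (_ : EFin \o _ = (EFin \o f) \_ `]a, a + c * t[%classic); last first.
    by apply/funext => s; rewrite /patch /=; case: ifP.
  by apply/(integrable_mkcond _ _).1 => //; exact: (integrable_itv mf fC).
Qed.

Lemma Rintegral_translate_itv f a t C : measurable_fun setT f ->
  (forall s, a < s < a + t -> `|f s| <= C) ->
  \int[mu]_(s in `]a, a + t[) f s = \int[mu]_(s in `]0, t[) f (a + s).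
Proof.
move=> mf fC; have := @Rintegral_affine_itv f a 1 t C ltr01 mf.
rewrite !mul1r => ->//; apply: eq_Rintegral => s _; by rewrite mul1r addrC.
Qed.

Lemma Rintegral_itv_mkcond f a b : \int[mu]_(s in `]a, b[) f s =
  \int[mu]_s (if a < s < b then f s else 0).
Proof.
rewrite Rintegral_mkcond; apply: eq_Rintegral => s _.
by rewrite /patch mem_setE in_itv.
Qed.

Lemma measurable_itv_cond d (T : measurableType d) (a b s : T -> R) (f : T -> R) :
  measurable_fun setT a -> measurable_fun setT b -> measurable_fun setT s ->
  measurable_fun setT f ->
  measurable_fun setT (fun q => if a q < s q < b q then f q else 0).
Proof.
move=> ma mb ms mf; apply: measurable_fun_ifT => //.
by apply: measurable_and; exact: measurable_fun_ltr.
Qed.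

Lemma continuous_itv_measurable f : continuous f -> measurable_fun setT f.
Proof. exact: continuous_measurable_fun. Qed.

(** Fubini on the triangle 0 < r < s < t, where the inner integral of [dchi] over (r, t) is chi t -
    chi r. This is the integration by parts behind [pmild_product]. *)
Lemma Rintegral_triangle (chi dchi k : R -> R) t C :
  0 < t -> (forall s : R, is_derive s 1 chi (dchi s)) -> continuous dchi ->
  measurable_fun setT k -> (forall s, 0 < s < t -> `|k s| <= C) ->
  \int[mu]_(s in `]0, t[) (dchi s * \int[mu]_(r in `]0, s[) k r) =
  \int[mu]_(r in `]0, t[) ((chi t - chi r) * k r).
Proof.
move=> t0 dc cc mk kC.
have [D Dd] : exists D, forall s, 0 <= s <= t -> `|dchi s| <= D.
  have hc : compact (dchi @` `[0, t]).
    by apply: continuous_compact; [exact: continuous_subspaceT|exact: segment_compact].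
  have [D [_ hD]] := compact_bounded hc.
  exists (D + 1) => s st; apply: (hD (D + 1)); first by rewrite ltrDl.
  by exists s => //=; rewrite in_itv.
have D0 : 0 <= D by apply: le_trans (Dd 0 _) => //; rewrite lexx ltW.
have C0 : 0 <= C by apply: le_trans (kC (t/2) _) => //; rewrite divr_gt0// gtr_pMr// invf_lt1// ltr1n.
have mdc := continuous_itv_measurable cc.
pose G (p : R * R) : R := if (0 < p.1 < t) && (0 < p.2 < p.1) then dchi p.1 * k p.2 else 0.
have mG : measurable_fun [set: R * R] G.
  apply: measurable_fun_ifT => //.
    apply: measurable_and; apply: measurable_and; apply: measurable_fun_ltr => //.
  by apply: measurable_funM; [exact: (measurableT_comp mdc)|exact: (measurableT_comp mk)].
transitivity (\int[mu]_(s in `]0, t[) \int[mu]_(r in `]0, t[) G (s, r)).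
  apply: eq_Rintegral => s; rewrite inE/= in_itv/= => /andP[s0 st].
  rewrite -RintegralZl//; last first.
    by apply: (@integrable_itv _ _ _ C) => // r /andP[r0 rs]; rewrite kC// r0 (lt_trans rs).
  rewrite !Rintegral_itv_mkcond; apply: eq_Rintegral => r _; rewrite /G/= s0 st/=.
  case: (ltP 0 r) => //= r0; case: (ltP r s) => rs; last by case: (ltP r t).
  by rewrite (lt_trans rs st).
rewrite (@Rintegral_fubini R _ _ _ _ mu mu); last 3 first.
- exact: measurable_itv.
- exact: measurable_itv.
- apply: (integrable_bounded (C := D * C)).
  + by apply: measurableX; exact: measurable_itv.
  + by apply: product_measure_lty; [exact: measurable_itv|exact: measurable_itv|exact: itv_oo_fin|exact: itv_oo_fin].
  + exact: measurable_funTS.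
  + move=> [s r] _; rewrite /G/=; case: ifP => [/andP[/andP[s0 st] /andP[r0 rs]]|_]; last first.
      by rewrite normr0 mulr_ge0.
    by rewrite normrM ler_pM// ?Dd ?kC ?(ltW s0) ?(ltW st)// r0 (lt_trans rs st).
apply: eq_Rintegral => r; rewrite inE/= in_itv/= => /andP[r0 rt].
have -> : chi t - chi r = \int[mu]_(s in `]r, t[) dchi s.
  rewrite -(@Rintegral_derive R dchi chi r t rt)//; last by move=> *; exact: cc.
  rewrite -Rintegral_itv_bndo_bndc; last first.
    apply: (integrable_bounded (C := D)) => //.
    - have : (mu `[r, t[%classic < +oo)%E by rewrite lebesgue_measure_itv/= lte_fin rt -EFinB ltry.
      exact.
    - exact: measurable_funTS.
    - by move=> s /=; rewrite in_itv/= => /andP[s1 s2]; rewrite Dd// (ltW s2) (le_trans (ltW r0) s1).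
  rewrite Rintegral_itv_obnd_cbnd//.
  by apply: (@integrable_itv _ _ _ D) => // s /andP[s1 s2]; rewrite Dd// (ltW s2) (ltW (lt_trans r0 s1)).
rewrite mulrC -RintegralZl//; last first.
  by apply: (@integrable_itv _ _ _ D) => // s /andP[s1 s2]; rewrite Dd// (ltW s2) (ltW (lt_trans r0 s1)).
rewrite !Rintegral_itv_mkcond; apply: eq_Rintegral => s _; rewrite /G/= r0/=.
rewrite mulrC; case: (ltP r s) => rs /=; last by rewrite andbF; case: ifP.
by rewrite (lt_trans r0 rs)/= andbT; case: (s < t).
Qed.

End interval_integrals.

(** * Mild solutions on the whole space *)

Section duhamel.
Context {R : realType} {N : nat}.
Notation mu := (@lebesgue_measure R).
Notation E := 'rV[R]_N.
Notation row := (@row_of_tuple R N).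
Notation gN := (@gauss R N).
Implicit Types (phi psi : E -> R) (x y : E) (H u : R -> E -> R) (s t tau T C : R).

Lemma measurable_sqrt : measurable_fun setT (Num.sqrt : R -> R).
Proof. by apply: continuous_measurable_fun; exact: sqrt_continuous. Qed.

Lemma measurable_heatop_comp d (T : measurableType d) H (a b : T -> R) (f : T -> E) :
  mfun2 H -> measurable_fun setT a -> measurable_fun setT b ->
  (forall i, measurable_fun setT (fun q => f q ord0 i)) ->
  measurable_fun setT (fun q => heatop (a q) (H (b q)) (f q)).
Proof.
move=> mH ma mb mf.
apply: (@measurable_Rintegral2 _ _ _ _ _ gN setT (fun p =>
  H (b p.1) (f p.1 + Num.sqrt (2 * a p.1) *: row p.2))) => //.
apply: measurable_row_comp2 => //; first by apply: measurableT_comp => //; exact: measurable_fst.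
move=> i; rewrite (_ : (fun _ => _) = (fun p => f p.1 ord0 i + Num.sqrt (2 * a p.1) * tnth p.2 i)); last first.
  by apply/funext => p; rewrite !mxE.
apply: measurable_funD; first by apply: (measurableT_comp (mf i)); exact: measurable_fst.
apply: measurable_funM; last by apply: measurable_tnth_comp; exact: measurable_snd.
apply: (measurableT_comp measurable_sqrt).
by apply: measurable_funM => //; apply: (measurableT_comp ma); exact: measurable_fst.
Qed.

Lemma row_coord_measurable (i : 'I_N) : measurable_fun setT (fun z => row z ord0 i).
Proof.
rewrite (_ : (fun _ => _) = (fun z => tnth z i)); first exact: measurable_tnth.
by apply/funext => z; rewrite mxE.
Qed.

Lemma mfun2_shift tau H : mfun2 H -> mfun2 (fun s => H (tau + s)).
Proof.
move=> mH; apply: (measurable_row_comp2 mH); first exact: measurable_funD.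
by move=> i; exact: (measurableT_comp (row_coord_measurable i)).
Qed.

Definition tbound T C H := forall s x, 0 < s < T -> `|H s x| <= C.

Definition duh H t x : R := \int[mu]_(s in `]0, t[) heatop (t - s) (H s) x.

Lemma tbound_ge0 T C H : 0 < T -> tbound T C H -> 0 <= C.
Proof.
move=> T0 HC; apply: le_trans (HC (T / 2) 0 _) => //.
by rewrite divr_gt0// gtr_pMr// invf_lt1// ltr1n.
Qed.

Lemma tboundS T T' C H : T <= T' -> tbound T' C H -> tbound T C H.
Proof. by move=> TT HC s x /andP[s0 sT]; apply: HC; rewrite s0 (lt_le_trans sT). Qed.

Lemma measurable_heatop_time H t x : mfun2 H ->
  measurable_fun setT (fun s => heatop (t - s) (H s) x).
Proof.
move=> mH; apply: measurable_heatop_comp => //.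
by apply: measurable_funB.
Qed.

Lemma heatop_time_bound H T C t x s : mfun2 H -> tbound T C H -> 0 < s < T ->
  `|heatop (t - s) (H s) x| <= C.
Proof. by move=> mH HC sT; apply: heatop_bound => [|y]; [exact: mfun2_section|exact: HC]. Qed.

Lemma integrable_duh H T C t x : mfun2 H -> tbound T C H ->
  mu.-integrable `]0, T[ (EFin \o (fun s => heatop (t - s) (H s) x)).
Proof.
move=> mH HC; apply: (@integrable_itv _ _ _ _ C); first exact: measurable_heatop_time.
by move=> s sT; exact: (@heatop_time_bound _ T).
Qed.

Lemma duhN H t C x : mfun2 H -> tbound t C H ->
  duh (fun s x => - H s x) t x = - duh H t x.
Proof.
move=> mH HC; rewrite /duh -mulN1r -RintegralZl//; last exact: integrable_duh HC.
apply: eq_Rintegral => s; rewrite inE/= in_itv/= => st.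
rewrite -(@heatopZ R N (t - s) (-1) (H s) C); last 2 first.
- exact: mfun2_section.
- by move=> y; exact: HC.
by congr (heatop _ _ _); apply/funext => y; rewrite mulN1r.
Qed.

Lemma duh_bound H C t x : 0 <= t -> mfun2 H -> tbound t C H -> `|duh H t x| <= C * t.
Proof.
move=> t0 mH HC; have := @normr_Rintegral_itv _ (fun s => heatop (t - s) (H s) x) 0 t C t0.
rewrite subr0; apply; first exact: measurable_heatop_time.
by move=> s sT; exact: (@heatop_time_bound _ t).
Qed.

Lemma mfun2_duh H : mfun2 H -> mfun2 (duh H).
Proof.
move=> mH.
rewrite /mfun2 (_ : (fun _ => _) = (fun p : R * N.-tuple R =>
  \int[mu]_s if 0 < s < p.1 then heatop (p.1 - s) (H s) (row p.2) else 0)); last first.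
  by apply/funext => p; rewrite /duh Rintegral_itv_mkcond.
apply: (@measurable_Rintegral2 R _ _ (R * N.-tuple R)%type _ mu setT (fun q => 
  if 0 < q.2 < q.1.1 then heatop (q.1.1 - q.2) (H q.2) (row q.1.2) else 0)) => //.
have m11 : measurable_fun [set: (R * N.-tuple R) * measurableTypeR R] (fun q => q.1.1).
  by apply: measurableT_comp.
apply: measurable_itv_cond => //.
apply: measurable_heatop_comp => //; first exact: measurable_funB.
move=> i; apply: (measurableT_comp (row_coord_measurable i)).
by apply: measurableT_comp; [exact: measurable_snd|exact: measurable_fst].
Qed.

Lemma mfun2_heatop phi : mfun_row phi -> mfun2 (fun t => heatop t phi).
Proof.
move=> mphi.
have h : mfun2 (fun _ : R => phi) by exact: (measurableT_comp mphi).
apply: (@measurable_heatop_comp _ (R * N.-tuple R)%type (fun _ => phi) (fun p => p.1)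
  (fun p => p.1) (fun p => row p.2) h measurable_fst measurable_fst) => i.
exact: (measurableT_comp (row_coord_measurable i)).
Qed.

Lemma heatop_duh H C a t x : 0 <= a -> 0 <= t -> mfun2 H -> tbound t C H ->
  heatop a (duh H t) x = \int[mu]_(s in `]0, t[) heatop (a + t - s) (H s) x.
Proof.
move=> a0 t0 mH HC; rewrite {1}/heatop /duh.
have mk : measurable_fun [set: N.-tuple R * measurableTypeR R] (fun p =>
    heatop (t - p.2) (H p.2) (x + Num.sqrt (2 * a) *: row p.1)).
  apply: measurable_heatop_comp => //; first exact: measurable_funB.
  move=> i; rewrite (_ : (fun _ => _) = (fun p : N.-tuple R * measurableTypeR R => x ord0 i + Num.sqrt (2 * a) * tnth p.1 i)); last first.
    by apply/funext => p; rewrite !mxE.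
  apply: measurable_funD => //; apply: measurable_funM => //.
  by apply: measurable_tnth_comp; exact: measurable_fst.
rewrite (@Rintegral_fubini R _ _ _ _ gN mu setT `]0, t[%classic (fun p =>
    heatop (t - p.2) (H p.2) (x + Num.sqrt (2 * a) *: row p.1))); last 3 first.
- exact: measurableT.
- exact: measurable_itv.
- apply: (integrable_bounded (C := C)).
  + by apply: measurableX => //; exact: measurable_itv.
  + by apply: product_measure_lty => //; [exact: gauss_fin|exact: itv_oo_fin].
  + exact: measurable_funTS.
  + move=> [z s] [_ /=]; rewrite in_itv/= => st; exact: (@heatop_time_bound _ t).
apply: eq_Rintegral => s; rewrite inE/= in_itv/= => st; have /andP[s0 s1] := st.
transitivity (heatop a (heatop (t - s) (H s)) x) => //.
rewrite (heatop_semigroup (C := C)) ?addrA//; first by rewrite subr_ge0 ltW.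
  exact: mfun2_section.
by move=> y; exact: HC.
Qed.

(* Mild solutions of [u_t - Delta u = H] on [(0, T)] and the whole space. *)
Definition pmild T phi H u := forall t x, 0 < t < T -> u t x = heatop t phi x + duh H t x.

Lemma heatop_pmild T phi H u B C a s x : mfun_row phi -> (forall y, `|phi y| <= B) ->
  mfun2 H -> tbound T C H -> pmild T phi H u -> 0 <= a -> 0 < s < T ->
  heatop a (u s) x = heatop (a + s) phi x + \int[mu]_(r in `]0, s[) heatop (a + s - r) (H r) x.
Proof.
move=> mphi phiB mH HC pu a0 /andP[s0 sT].
have HCs : tbound s C H by apply: tboundS HC; exact: ltW.
have -> : u s = (fun y => heatop s phi y + duh H s y) by apply/funext => y; rewrite pu// s0.
rewrite (heatopD _ (C := B) (C' := C * s)).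
- by rewrite (heatop_semigroup (C := B)) ?(ltW s0)// (heatop_duh (C := C))// ltW.
- exact: (mfun2_section _ (mfun2_heatop mphi)).
- by move=> y; exact: heatop_bound.
- exact: (mfun2_section _ (mfun2_duh mH)).
- by move=> y; apply: duh_bound => //; exact: ltW.
Qed.

(** The Duhamel integral is cut at tau. By the semigroup law the part before tau, together with the
    initial term, is the heat flow of [u tau]; the part after tau is translated. *)
Lemma pmild_restart T phi H u B C tau : mfun_row phi -> (forall y, `|phi y| <= B) ->
  mfun2 H -> tbound T C H -> pmild T phi H u -> 0 < tau < T ->
  pmild (T - tau) (u tau) (fun s => H (tau + s)) (fun s => u (tau + s)).
Proof.
move=> mphi phiB mH HC pu /andP[tau0 tauT] t x /andP[t0 tT].
have tT' : tau + t < T by rewrite addrC -ltrBrDr.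
have T0 : 0 < tau + t by rewrite addr_gt0.
have HC' : tbound (tau + t) C H by apply: tboundS HC; exact: ltW.
have tauT' : 0 < tau < T by rewrite tau0.
have -> : u (tau + t) x = heatop (tau + t) phi x + duh H (tau + t) x by apply: pu; rewrite T0.
have -> := @heatop_pmild T phi H u B C t tau x mphi phiB mH HC pu (ltW t0) tauT'.
rewrite (addrC t) -addrA; congr (_ + _).
rewrite {1}/duh (@Rintegral_itv_cat _ _ 0 tau).
- suff -> : \int[mu]_(s in `]tau, tau + t[) heatop (tau + t - s) (H s) x =
      duh (fun s => H (tau + s)) t x by [].
  rewrite (@Rintegral_translate_itv _ (fun s => heatop (tau + t - s) (H s) x) tau t C).
  + by apply: eq_Rintegral => s _; rewrite opprD addrACA subrr add0r.
  + exact: measurable_heatop_time.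
  + by move=> s /andP[s0 s1]; apply: (@heatop_time_bound _ (tau + t)) => //; rewrite s1 (lt_trans tau0).
- by rewrite ltW// ler_wpDr// ltW.
- exact: integrable_duh HC'.
Qed.

Lemma mfun2_scale (c : R -> R) H : measurable_fun setT c -> mfun2 H ->
  mfun2 (fun s x => c s * H s x).
Proof.
move=> mc mH; apply: measurable_funM => //.
by apply: (measurableT_comp mc); exact: measurable_fst.
Qed.

Lemma mfun2D H1 H2 : mfun2 H1 -> mfun2 H2 -> mfun2 (fun s x => H1 s x + H2 s x).
Proof. by move=> m1 m2; exact: measurable_funD. Qed.

Lemma continuous_itv_bound (f : R -> R) a b : continuous f ->
  exists2 D : R, 0 <= D & forall s, a <= s <= b -> `|f s| <= D.
Proof.
move=> cf.
have hc : compact (f @` `[a, b]).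
  by apply: continuous_compact; [exact: continuous_subspaceT|exact: segment_compact].
have [D [_ hD]] := compact_bounded hc.
exists (`|D| + 1) => // s st; apply: (hD (`|D| + 1)); last by exists s => //=; rewrite in_itv.
by rewrite (le_lt_trans (ler_norm _))// ltrDl.
Qed.

Lemma duhE_ext H1 H2 t x : (forall s, 0 < s < t -> H1 s = H2 s) -> duh H1 t x = duh H2 t x.
Proof.
move=> e; apply: eq_Rintegral => s; rewrite inE/= in_itv/= => st.
by rewrite e.
Qed.

(* The factor [chi] plays the role of an integrating factor. *)
Lemma pmild_product T phi H u B C Bu (chi dchi : R -> R) :
  (forall s : R, is_derive s 1 chi (dchi s)) -> continuous dchi ->
  mfun_row phi -> (forall y, `|phi y| <= B) -> mfun2 H -> tbound T C H ->
  mfun2 u -> tbound T Bu u -> pmild T phi H u ->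
  pmild T (fun x => chi 0 * phi x) (fun s x => dchi s * u s x + chi s * H s x)
    (fun t x => chi t * u t x).
Proof.
move=> dc cc mphi phiB mH HC mu_ uB pu t x tT; have /andP[t0 tT'] := tT.
have HCt : tbound t C H by apply: tboundS HC; exact: ltW.
have uBt : tbound t Bu u by apply: tboundS uB; exact: ltW.
have cchi : continuous chi by move=> s; apply/differentiable_continuous/derivable1_diffP; have [] := dc s.
have [D1 D10 Dd] := continuous_itv_bound 0 t cc.
have [D2 D20 Dc] := continuous_itv_bound 0 t cchi.
have mdc := continuous_itv_measurable cc; have mc := continuous_itv_measurable cchi.
have mX := mfun2_scale mdc mu_; have mY := mfun2_scale mc mH.
have in01 s : 0 < s < t -> 0 <= s <= t by move=> /andP[? ?]; rewrite !ltW.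
pose k s := heatop (t - s) (H s) x.
have mk : measurable_fun setT k by exact: measurable_heatop_time.
have kC s : 0 < s < t -> `|k s| <= C by move=> st; exact: (@heatop_time_bound _ t).
have ik : mu.-integrable `]0, t[ (EFin \o k) by exact: (integrable_itv mk kC).
(* Expanding the heat flow of [u s] up to time t by [heatop_pmild] leaves an identity about the
   single scalar function [k]. *)
transitivity (chi 0 * heatop t phi x + \int[mu]_(s in `]0, t[)
    (dchi s * (heatop t phi x + \int[mu]_(r in `]0, s[) k r) + chi s * k s)); last first.
  rewrite (heatopZ _ _ (C := B))//; congr (_ + _); apply: eq_Rintegral => s.
  rewrite inE/= in_itv/= => st; have /andP[s0 s1] := st.
  rewrite (heatopD _ (C := D1 * Bu) (C' := D2 * C)); last 4 first.
  - exact: (mfun2_section _ mX).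
  - by move=> y; rewrite normrM ler_pM// ?Dd ?uBt// in01.
  - exact: (mfun2_section _ mY).
  - by move=> y; rewrite normrM ler_pM// ?Dc ?HCt// in01.
  rewrite (heatopZ _ _ (C := Bu)); last 2 first.
  - exact: (mfun2_section _ mu_).
  - by move=> y; exact: uBt.
  rewrite (heatopZ _ _ (C := C)); last 2 first.
  - exact: (mfun2_section _ mH).
  - by move=> y; exact: HCt.
  have ts0 : 0 <= t - s by rewrite subr_ge0 ltW.
  rewrite (@heatop_pmild T phi H u B C (t - s) s x mphi phiB mH HC pu ts0) ?subrK//.
  by rewrite s0 (lt_trans s1 tT').
have iK : mu.-integrable `]0, t[ (EFin \o (fun s => dchi s * \int[mu]_(r in `]0, s[) k r)).
  apply: (@integrable_itv _ _ _ _ (D1 * (C * t))).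
    apply: measurable_funM => //.
    rewrite (_ : (fun _ => _) = (fun s => \int[mu]_r if 0 < r < s then k r else 0)); last first.
      by apply/funext => s; rewrite Rintegral_itv_mkcond.
    apply: (@measurable_Rintegral2 R _ _ R _ mu setT (fun q => if 0 < q.2 < q.1 then k q.2 else 0)) => //.
    apply: measurable_itv_cond => //.
    exact: (measurableT_comp mk).
  move=> s st; have /andP[s0 s1] := st; rewrite normrM ler_pM ?Dd ?in01//.
  have C0 : 0 <= C by exact: (tbound_ge0 t0 HCt).
  have := @normr_Rintegral_itv _ k 0 s C (ltW s0) mk.
  rewrite subr0 => h; apply: le_trans (h _) _; last by rewrite ler_wpM2l// ltW.
  by move=> r /andP[r0 rs]; rewrite kC// r0 (lt_trans rs).
have ick : mu.-integrable `]0, t[ (EFin \o (fun s => chi s * k s)).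
  apply: (@integrable_itv _ _ _ _ (D2 * C)); first exact: measurable_funM.
  by move=> s st; rewrite normrM ler_pM ?Dc ?kC ?in01.
have id : mu.-integrable `]0, t[ (EFin \o dchi).
  by apply: (@integrable_itv _ _ _ _ D1) => // s st; rewrite Dd ?in01.
have idP : mu.-integrable `]0, t[ (EFin \o (fun s => dchi s * heatop t phi x)).
  apply: (@integrable_itv _ _ _ _ (D1 * B)); first exact: measurable_funM.
  by move=> s st; rewrite normrM ler_pM ?Dd ?in01// heatop_bound.
(* On the triangle the double integral acquires the weight chi t - chi r; its second half cancels
   against the source term chi s * k s. *)
have -> : \int[mu]_(s in `]0, t[) (dchi s * (heatop t phi x + \int[mu]_(r in `]0, s[) k r) + chi s * k s) =
    (chi t - chi 0) * heatop t phi x + \int[mu]_(r in `]0, t[) ((chi t - chi r) * k r)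
     + \int[mu]_(s in `]0, t[) (chi s * k s).
  rewrite -(Rintegral_triangle t0 dc cc mk kC).
  have -> : chi t - chi 0 = \int[mu]_(s in `]0, t[) dchi s.
    rewrite -(@Rintegral_derive R dchi chi 0 t t0)//; last by move=> *; exact: cc.
    rewrite -Rintegral_itv_bndo_bndc; last first.
      apply: integrable_bounded => //; last first.
        - move=> s /=; rewrite in_itv/= => /andP[s0 s1]; apply: Dd; rewrite s0; exact: ltW.
        - exact: measurable_funTS.
      have : (mu `[0%R, t[%classic < +oo)%E by rewrite lebesgue_measure_itv/= lte_fin t0 -EFinB ltry.
      exact.
    by rewrite -Rintegral_itv_obnd_cbnd.
  rewrite mulrC -RintegralZl// -RintegralD//; last first.
    by rewrite (_ : (fun _ => _) = (fun s => dchi s * heatop t phi x))//; apply/funext => s; rewrite mulrC.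
  rewrite -RintegralD//; last first.
    apply: integrableDR => //.
    by rewrite (_ : (fun _ => _) = (fun s => dchi s * heatop t phi x))//; apply/funext => s; rewrite mulrC.
  by apply: eq_Rintegral => s _; rewrite mulrDr (mulrC (heatop _ _ _)).
rewrite -addrA -RintegralD//; last first.
  apply: (@integrable_itv _ _ _ _ ((D2 + D2) * C)).
    by apply: measurable_funM => //; exact: measurable_funB.
  move=> s st; rewrite normrM ler_pM ?kC// (le_trans (ler_normB _ _))// lerD//.
    by apply: Dc; rewrite lexx ltW.
  exact/Dc/in01.
under [X in _ = _ + (_ + X)]eq_Rintegral do rewrite mulrBl subrK.
rewrite RintegralZl// pu// -/(k _) /duh mulrDr addrA; congr (_ + _).
by rewrite mulrBl addrC subrK.
Qed.

End duhamel.

Section uniform_convergence.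
Context {R : realType} {U : choiceType}.

Lemma uniform_cvgP (A : set U) (F : set_system (U -> R)) (FF : Filter F) (f : U -> R) :
  (forall e : R, 0 < e -> \forall g \near F, forall y, A y -> `|f y - g y| < e) ->
  {uniform A, F --> f}.
Proof.
move=> h P /uniform_nbhs[D [[e /= e0 eD] DP]].
apply: (filterS _ (h e e0)) => g /= hg; apply: DP => y Ay; apply: eD => /=.
exact: hg.
Qed.

End uniform_convergence.

(** * Moduli of continuity of mild solutions *)

Section duhamel_smoothing.
Context {R : realType} {N : nat}.
Notation mu := (@lebesgue_measure R).
Notation E := 'rV[R]_N.
Notation dir i := (delta_mx ord0 i : 'rV[R]_N).
Implicit Types (phi psi : E -> R) (x y : E) (H u : R -> E -> R) (s t tau T C : R).

Lemma is_derive_sqrt_lag t s : s < t ->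
  is_derive s 1 (fun s => - Num.sqrt (2 * (t - s))) (Num.sqrt (2 * (t - s)))^-1.
Proof.
move=> st; have ts0 : 0 < 2 * (t - s) by rewrite mulr_gt0// subr_gt0.
have d1 : is_derive s 1 (fun s => 2 * (t - s)) (- 2).
  by apply: is_derive_eq; rewrite /GRing.scale/=; ring.
have d2 := is_derive1_sqrt ts0.
have d3 := @is_derive1_comp R Num.sqrt (fun s => 2 * (t - s)) s _ _ d2 d1.
apply: is_derive_eq.
rewrite /GRing.scale/= mulrN opprK invfM mulrAC mulVf ?mul1r//.
Qed.

(** The gradient bound at lag t - s is singular at s = t but integrable, with integral sqrt (2 t).
    The singularity is avoided by bounding a short final piece trivially, up to an arbitrary error
    e. *)
Lemma duh_lip_coord H C t x i (h : R) : 0 < t -> mfun2 H -> tbound t C H ->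
  `|duh H t (x + h *: dir i) - duh H t x| <= C * Num.sqrt (2 * t) * `|h|.
Proof.
move=> t0 mH HC.
have C0 := tbound_ge0 t0 HC.
pose k s := heatop (t - s) (H s) (x + h *: dir i) - heatop (t - s) (H s) x.
have mk : measurable_fun setT k by apply: measurable_funB; exact: measurable_heatop_time.
have kC s : 0 < s < t -> `|k s| <= C + C.
  by move=> st; rewrite (le_trans (ler_normB _ _))// lerD// (@heatop_time_bound _ _ _ t).
have ik : mu.-integrable `]0, t[ (EFin \o k) by exact: (integrable_itv mk kC).
have -> : duh H t (x + h *: dir i) - duh H t x = \int[mu]_(s in `]0, t[) k s.
  by rewrite /duh -RintegralB//; exact: integrable_duh HC.
apply/ler_addgt0Pr => e e0.
(* The last [del] units of time contribute at most (C + C) * del <= e; the + 1 prevents a division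
   by zero. *)
pose del := Num.min (t / 2) (e / (C + C + 1)).
have CC0 : 0 < C + C + 1 by lra.
have del0 : 0 < del by rewrite lt_min !divr_gt0.
have delt : del < t by rewrite gt_min gtr_pMr// invf_lt1// ltr1n.
have dele : (C + C) * del <= e.
  rewrite (@le_trans _ _ ((C + C + 1) * del))//; first by rewrite ler_wpM2r ?ltW//; lra.
  by rewrite mulrC -ler_pdivlMr// ge_min lexx orbT.
rewrite (@Rintegral_itv_cat _ k 0 (t - del) t)//; last by rewrite subr_ge0 ltW//= gerBl ltW.
rewrite (le_trans (ler_normD _ _))// lerD//; last first.
  apply: le_trans (@normr_Rintegral_itv _ k _ _ (C + C) _ mk _) _.
  - by rewrite gerBl ltW.
  - move=> s /andP[s1 s2]; apply: kC; rewrite s2 andbT (lt_trans _ s1)//.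
    by rewrite subr_gt0.
  - by rewrite opprB addrCA subrr addr0.
have tdel0 : 0 < t - del by rewrite subr_gt0.
(* The maximum has no effect for s <= t - del and makes [g] continuous on the whole line. *)
pose g s := C * `|h| * (Num.sqrt (2 * Num.max (t - s) del))^-1.
have gE s : s <= t - del -> g s = C * `|h| * (Num.sqrt (2 * (t - s)))^-1.
  by move=> sd; rewrite /g max_l// lerBrDr addrC -lerBrDr.
have dG s : 0 <= s <= t - del -> is_derive s 1 (fun s => C * `|h| * - Num.sqrt (2 * (t - s))) (g s).
  move=> /andP[_ s1]; have st : s < t by rewrite (le_lt_trans s1)// gtrBl.
  have d1 := is_derive_sqrt_lag st.
  by rewrite gE//; apply: is_derive_eq.
have cg : continuous g.
  move=> s; apply: cvgM; first exact: cvg_cst.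
  apply: cvgV; first by rewrite gt_eqF// sqrtr_gt0 mulr_gt0// lt_max del0 orbT.
  apply: continuous_comp; last exact: sqrt_continuous.
  apply: cvgM; first exact: cvg_cst.
  apply: (@continuous_max _ _ (fun s => t - s) (fun=> del)); last exact: cvg_cst.
  by apply: cvgB; [exact: cvg_cst|exact: cvg_id].
have Ig := @Rintegral_derive R g _ 0 (t - del) tdel0 dG (fun s _ => cg s).
have mg := continuous_itv_measurable cg.
have kg s : 0 < s < t - del -> `|k s| <= g s.
  move=> /andP[s0 sd]; rewrite gE ?(ltW sd)// /k.
  have st : s < t by rewrite (lt_trans sd)// gtrBl.
  have := @heatop_lip_coord R N (t - s) (H s) C x i h.
  rewrite subr_gt0 => /(_ st (mfun2_section s mH)) lip.
  by rewrite (le_trans (lip _))//; [move=> y; apply: HC; rewrite s0|rewrite mulrAC].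
have gb s : `|g s| <= C * `|h| * (Num.sqrt (2 * del))^-1.
  rewrite /g ger0_norm; last by rewrite !mulr_ge0// invr_ge0 sqrtr_ge0.
  rewrite ler_wpM2l ?mulr_ge0// lef_pV2 ?posrE ?sqrtr_gt0 ?mulr_gt0//; last by rewrite lt_max del0 orbT.
  by rewrite ler_wsqrtr// ler_pM2l// le_max lexx orbT.
have ig : mu.-integrable `]0, t - del[ (EFin \o g) by apply: (integrable_itv mg) => s _; exact: gb.
apply: le_trans (normr_Rintegral_dominated _ _ ig _) _ => //.
  exact: measurable_funTS.
have -> : \int[mu]_(s in `]0, t - del[) g s = \int[mu]_(s in `[0, t - del]) g s.
  rewrite Rintegral_itv_obnd_cbnd// Rintegral_itv_bndo_bndc//.
  have mc0 : (mu `[0%R, (t - del)%R[%classic < +oo)%E by rewrite lebesgue_measure_itv/= lte_fin tdel0 -EFinB ltry.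
  apply: (integrable_bounded (C := C * `|h| * (Num.sqrt (2 * del))^-1)) => //.
    exact: measurable_funTS.
rewrite Ig subr0 !mulrN opprK addrC -mulrBr mulrAC ler_wpM2r//  ler_wpM2l//.
by rewrite gerBl sqrtr_ge0.
Qed.

(** Lipschitz in space, and in time the sum of the sqrt modulus of the heat flow of Lipschitz data
    and the linear one of a bounded source. The constant is uniform in x but depends on the compact
    time interval, so that a singularity at time 0 is permitted. *)
Definition tmodulus T u := forall a b, 0 < a -> b < T -> exists2 L : R, 0 <= L &
  (forall t, a <= t <= b -> forall x y, `|u t x - u t y| <= L * `|x - y|) /\
  (forall s t, a <= s -> s <= t -> t <= b -> forall x,
     `|u t x - u s x| <= L * (Num.sqrt (t - s) + (t - s))).

Lemma pmild_lip T phi H u B C t : mfun_row phi -> (forall y, `|phi y| <= B) ->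
  mfun2 H -> tbound T C H -> pmild T phi H u -> 0 < t < T ->
  forall x y, `|u t x - u t y| <= (B / Num.sqrt (2 * t) + C * Num.sqrt (2 * t)) * N%:R * `|x - y|.
Proof.
move=> mphi phiB mH HC pu /[dup] tT /andP[t0 tT'].
have HCt : tbound t C H by apply: tboundS HC; exact: ltW.
have C0 := tbound_ge0 t0 HCt.
have B0 : 0 <= B := le_trans (normr_ge0 _) (phiB 0).
apply: lipschitz_of_coord => [|x i h]; first by rewrite addr_ge0 ?mulr_ge0// invr_ge0 sqrtr_ge0.
rewrite !pu// opprD addrACA (le_trans (ler_normD _ _))// mulrDl lerD//.
  exact: heatop_lip_coord.
exact: duh_lip_coord.
Qed.

Lemma pmild_tmodulus T phi H u B C Bu : mfun_row phi -> (forall y, `|phi y| <= B) ->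
  mfun2 H -> tbound T C H -> pmild T phi H u ->
  (forall t, mfun_row (u t)) -> tbound T Bu u -> tmodulus T u.
Proof.
move=> mphi phiB mH HC pu mu_ uB a b a0 bT.
have [ba|ab] := ltP b a.
  exists 0 => //; split=> [t /andP[at_ tb]|s t as_ st tb].
    by have := le_lt_trans (le_trans at_ tb) ba; rewrite ltxx.
  by have := le_lt_trans (le_trans as_ (le_trans st tb)) ba; rewrite ltxx.
have b0 : 0 < b by exact: lt_le_trans ab.
have T0 : 0 < T by exact: lt_trans bT.
have C0 := tbound_ge0 T0 HC.
have B0 : 0 <= B := le_trans (normr_ge0 _) (phiB 0).
pose L := (B / Num.sqrt (2 * a) + C * Num.sqrt (2 * b)) * N%:R.
have L0 : 0 <= L by rewrite /L mulr_ge0// addr_ge0// mulr_ge0// ?invr_ge0 sqrtr_ge0.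
have lip t : a <= t <= b -> forall x y, `|u t x - u t y| <= L * `|x - y|.
  move=> /andP[at_ tb] x y.
  have t0 : 0 < t by exact: lt_le_trans at_.
  apply: le_trans (pmild_lip mphi phiB mH HC pu _ x y) _; first by rewrite t0 (le_lt_trans tb).
  rewrite ler_wpM2r// /L ler_wpM2r// lerD//.
    rewrite ler_wpM2l// lef_pV2 ?posrE ?sqrtr_gt0 ?mulr_gt0// ler_sqrt ?mulr_gt0//.
      by rewrite ler_pM2l.
    by rewrite mulr_ge0// ltW.
  by rewrite ler_wpM2l// ler_wsqrtr// ler_pM2l.
have D0 := @displ_ge0 R N.
(* The summands come from the spatial bound, from the heat flow of the [L]-Lipschitz function [u s]
   during t - s, and from the source during t - s. *)
exists (L + L * Num.sqrt 2 * @displ R N + C).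
  by rewrite addr_ge0// addr_ge0// mulr_ge0// mulr_ge0// sqrtr_ge0.
split=> [t tab x y|s t as_ st tb x].
  apply: le_trans (lip t tab x y) _; rewrite ler_wpM2r// -addrA lerDl.
  by rewrite addr_ge0// mulr_ge0// mulr_ge0// sqrtr_ge0.
have s0 : 0 < s by exact: lt_le_trans as_.
have sT : 0 < s < T by rewrite s0 (le_lt_trans st)// (le_lt_trans tb).
move: st; rewrite le_eqVlt => /predU1P[<-|st].
  by rewrite !subrr normr0 sqrtr0 addr0 mulr0.
have ts0 : 0 < t - s by rewrite subr_gt0.
have pr := pmild_restart mphi phiB mH HC pu sT.
have HC' : tbound (t - s) C (fun r => H (s + r)).
  move=> r y /andP[r0 r1]; apply: HC; rewrite addr_gt0//=.
  by rewrite -ltrBrDl (lt_trans r1)// ltrD2r (le_lt_trans tb).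
have mH' : mfun2 (fun r => H (s + r)).
  rewrite /mfun2; exact: (mfun2_shift _ mH).
have -> : u t x = heatop (t - s) (u s) x + duh (fun r => H (s + r)) (t - s) x.
  have := pr (t - s) x; rewrite /= (addrC s) subrK; apply.
  by rewrite ts0 ltrD2r (le_lt_trans tb).
rewrite addrAC (le_trans (ler_normD _ _))//.
have h1 : `|heatop (t - s) (u s) x - u s x| <= L * Num.sqrt (2 * (t - s)) * @displ R N.
  apply: (heatop_sub (C := Bu)) => //; [exact: ltW|by move=> y; exact: uB|].
  by apply: lip; rewrite as_ (le_trans (ltW st)).
have h2 := duh_bound x (ltW ts0) mH' HC'.
apply: le_trans (lerD h1 h2) _.
rewrite sqrtrM//.
set q := Num.sqrt (t - s); set w := Num.sqrt 2.
have q0 : 0 <= q by exact: sqrtr_ge0.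
have w0 : 0 <= w by exact: sqrtr_ge0.
have Lq : 0 <= L * q by exact: mulr_ge0.
have Cq : 0 <= C * q by exact: mulr_ge0.
have Lt : 0 <= L * (t - s) by rewrite mulr_ge0// ltW.
have Lwt : 0 <= L * w * @displ R N * (t - s) by rewrite mulr_ge0 ?(ltW ts0)// mulr_ge0// mulr_ge0.
rewrite !mulrDl !mulrDr [L * (w * q)]mulrA (mulrAC _ q).
lra.
Qed.

Lemma tmodulus_continuous T u t x : tmodulus T u -> 0 < t < T ->
  {for (t, x), continuous (fun p : R * E => u p.1 p.2)}.
Proof.
move=> tm /andP[t0 tT].
have [L L0 [lipx lipt]] := tm (t / 2) ((t + T) / 2) ltac:(lra) ltac:(lra).
apply/cvgrPdist_lt => e e0.
pose g (p : R * E) := L * (Num.sqrt `|t - p.1| + `|t - p.1|) + L * `|x - p.2|.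
have cg : g p @[p --> (t, x)] --> g (t, x).
  apply: cvgD; (apply: cvgM; first exact: cvg_cst); last first.
    by apply: cvg_norm; apply: cvgB; [exact: cvg_cst|exact: cvg_snd].
  have h : `|t - p.1| @[p --> (t, x)] --> `|t - t|.
    by apply: cvg_norm; apply: cvgB; [exact: cvg_cst|exact: cvg_fst].
  apply: cvgD => //; apply: (cvg_comp _ _ h); exact: sqrt_continuous.
have g0 : g (t, x) < e by rewrite /g/= !subrr !normr0 sqrtr0 addr0 !mulr0 addr0.
have n1 : \forall p \near (t, x), g p < e by exact: (cvgr_lt _ cg).
have cf : p.1 @[p --> (t, x)] --> t by exact: cvg_fst.
have n2 : \forall p \near (t, x), t / 2 < p.1.
  by apply: (cvgr_gt _ cf); lra.
have n3 : \forall p \near (t, x), p.1 < (t + T) / 2.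
  by apply: (cvgr_lt _ cf); lra.
near=> p.
have p1 : t / 2 <= p.1 by apply: ltW; near: p; exact: n2.
have p2 : p.1 <= (t + T) / 2 by apply: ltW; near: p; exact: n3.
apply: le_lt_trans (_ : g p < e); last by near: p; exact: n1.
rewrite -(subrK (u p.1 x) (u t x)) -addrA (le_trans (ler_normD _ _))// /g lerD//; last first.
  by apply: lipx; rewrite p1.
have [tp|pt] := leP t p.1.
  by rewrite distrC (ler0_norm (_ : t - p.1 <= 0)) ?subr_le0// opprB; apply: lipt => //; lra.
by rewrite (ger0_norm (_ : 0 <= t - p.1)) ?subr_ge0 ?(ltW pt)//; apply: lipt => //; lra.
Unshelve. all: by end_near. Qed.

Lemma tmodulus_C0bu m u (C : R -> R) :
  (forall T, tmodulus T u) -> (forall t, 0 < t -> oddm m (u t)) ->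
  (forall t, 0 < t -> forall x, `|u t x| <= C t) -> continuous_C0bu m u.
Proof.
move=> tm ou uC; split=> [t t0|t t0].
  have [L L0 [lipx _]] := tm (t + 1) t t t0 ltac:(lra).
  by apply: (C0bu_lipschitz (ou t t0) (uC t t0)); apply: lipx; rewrite lexx.
have [L L0 [_ lipt]] := tm (t + 2) (t / 2) (t + 1) ltac:(lra) ltac:(lra).
apply: (@uniform_cvgP _ _ _ (u @ t) (fmap_filter u _)) => e e0.
pose g s := L * (Num.sqrt `|t - s| + `|t - s|).
have cg : g s @[s --> t] --> g t.
  apply: cvgM; first exact: cvg_cst.
  have h : `|t - s| @[s --> t] --> `|t - t|.
    by apply: cvg_norm; apply: cvgB; [exact: cvg_cst|exact: cvg_id].
  apply: cvgD => //; apply: (cvg_comp _ _ h); exact: sqrt_continuous.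
have g0 : g t < e by rewrite /g/= !subrr !normr0 sqrtr0 addr0 mulr0.
have n1 : \forall s \near t, g s < e by exact: (cvgr_lt _ cg).
have n2 : \forall s \near t, t / 2 < s by apply: lt_nbhsr; lra.
have n3 : \forall s \near t, s < t + 1 by apply: (cvgr_lt _ (@cvg_id _ (nbhs t))); lra.
rewrite /prop_near1 /nbhs/=.
change (\forall s \near t, forall y, closure (@Omega R N m) y -> `|u t y - u s y| < e).
near=> s; move=> y _.
have p1 : t / 2 <= s by apply: ltW; near: s; exact: n2.
have p2 : s <= t + 1 by apply: ltW; near: s; exact: n3.
apply: le_lt_trans (_ : g s < e); last by near: s; exact: n1.
have [tp|pt] := leP t s.
  by rewrite distrC /g (ler0_norm (_ : t - s <= 0)) ?subr_le0// opprB; apply: lipt => //; lra.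
by rewrite /g (ger0_norm (_ : 0 <= t - s)) ?subr_ge0 ?(ltW pt)//; apply: lipt => //; lra.
Unshelve. all: by end_near. Qed.

End duhamel_smoothing.

(** * Comparison and existence *)

Section absorption_calculus.
Context {R : realType}.
Variable alpha : R.
Hypothesis alpha0 : 0 < alpha.
Notation f := (@absorption R alpha).
Notation df := (fun r : R => (alpha + 1) * `|r| `^ alpha).

Lemma continuous_norm_powR : continuous (fun r : R => `|r| `^ alpha).
Proof.
move=> r; have [->|r0] := eqVneq r 0.
  apply/cvgrPdist_lt => e e0; rewrite normr0 powR0 ?gt_eqF//.
  have d0 : 0 < e `^ alpha^-1 by exact: powR_gt0.
  near=> x; rewrite sub0r normrN ger0_norm ?powR_ge0//.
  have -> : e = (e `^ alpha^-1) `^ alpha by rewrite -powRrM mulVf ?gt_eqF// powRr1 ?ltW.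
  have ed : e `^ alpha^-1 \is Num.nneg by rewrite nnegrE ltW.
  have xd : `|x| < e `^ alpha^-1.
    by near: x; apply: (@cvgr0_norm_lt _ _ _ _ _ id) => //; exact: cvg_id.
  by apply: gt0_ltr_powR.
apply: (@continuous_comp _ _ _ (fun x : R => `|x|) (fun x : R => x `^ alpha)); first exact: norm_continuous.
apply/differentiable_continuous/derivable1_diffP/derivable_powR.
by rewrite in_itv/= andbT normr_gt0.
Unshelve. all: by end_near. Qed.

Lemma absorptionN r : f (- r) = - f r.
Proof. by rewrite /absorption normrN mulrN. Qed.

Lemma absorption_powR r : 0 <= r -> f r = r `^ (alpha + 1).
Proof.
move=> r0; rewrite /absorption ger0_norm// -(@mulr_powRB1 _ r (alpha + 1))// ?addr_gt0//.
by rewrite addrK mulrC.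
Qed.

Lemma absorption_ge0 r : 0 <= r -> 0 <= f r.
Proof. by move=> r0; rewrite /absorption mulr_ge0// powR_ge0. Qed.

Lemma normr_absorption r : `|f r| = f `|r|.
Proof. by rewrite /absorption normrM normr_id ger0_norm// powR_ge0. Qed.

Lemma continuous_absorption : continuous f.
Proof. by move=> r; apply: cvgM; [exact: continuous_norm_powR|exact: cvg_id]. Qed.

Lemma measurable_absorption : measurable_fun setT f.
Proof. exact: continuous_measurable_fun continuous_absorption. Qed.

Lemma le_absorption_pos r s : 0 <= r -> r <= s -> f r <= f s.
Proof.
move=> r0 rs; rewrite /absorption !ger0_norm ?(le_trans r0 rs)//.
have s0 := le_trans r0 rs.
by rewrite ler_pM ?powR_ge0// ge0_ler_powR// ?nnegrE// ltW.
Qed.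

Lemma le_absorption r s : r <= s -> f r <= f s.
Proof.
move=> rs; have [r0|r0] := leP 0 r; first exact: le_absorption_pos.
have [s0|s0] := leP 0 s.
  by rewrite (@le_trans _ _ 0)// ?absorption_ge0// -oppr_ge0 -absorptionN absorption_ge0// oppr_ge0 ltW.
by rewrite -lerN2 -!absorptionN le_absorption_pos// ?lerN2// oppr_ge0 ltW.
Qed.

Lemma absorption_bound (B r : R) : `|r| <= B -> `|f r| <= f B.
Proof. by move=> rB; rewrite normr_absorption; exact: le_absorption. Qed.

Lemma continuous_dabsorption : continuous df.
Proof. by move=> r; apply: cvgM; [exact: cvg_cst|exact: continuous_norm_powR]. Qed.

Lemma is_derive_absorption (r : R) : is_derive r 1 f (df r).
Proof.
have [r0|r0|<-] := ltgtP 0 r.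
- have h := @is_derive1_powR R (alpha + 1) r r0; rewrite addrK -{2}(gtr0_norm r0) in h.
  apply: near_eq_is_derive h.
  by near=> x; rewrite absorption_powR// ltW//; near: x; exact: lt_nbhsr.
- have r0' : 0 < - r by rewrite oppr_gt0.
  have h := @is_derive1_comp R ((@powR R) ^~ (alpha + 1)) -%R r _ _ (@is_derive1_powR R (alpha + 1) (- r) r0') (is_deriveNid r 1).
  have := is_deriveN h; rewrite addrK mulrN1 opprK -(ltr0_norm r0) => h'.
  apply: near_eq_is_derive h'.
  near=> x; rewrite -[RHS]opprK -absorptionN absorption_powR// oppr_ge0 ltW//.
  by near: x; exact: lt_nbhsl.
(* At 0 the modulus of the difference quotient is |h|^alpha, which tends to 0 since alpha is
   positive. *)
- rewrite normr0 powR0 ?gt_eqF// mulr0.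
  have h : (fun h => h^-1 *: ((f \o shift 0) (h *: 1) - f 0)) @ 0^' --> (0 : R).
    apply/norm_cvg0P.
    apply: (@squeeze_cvgr _ _ _ _ (fun=> 0) (fun h => `|h| `^ alpha)).
    + near=> h; have h0 : h != 0 by near: h; exact: nbhs_dnbhs_neq.
      rewrite normr_ge0/= /shift/= addr0 [h *: 1]mulr1 /absorption mulr0 subr0.
      rewrite /GRing.scale/= mulrCA mulVf// mulr1 ger0_norm// powR_ge0.
    + exact: cvg_cst.
    + have : `|h| `^ alpha @[h --> (0 : R)^'] --> `|0 : R| `^ alpha.
        have h := @continuous_norm_powR 0; apply: cvg_trans h; apply: cvg_app; exact: cvg_within.
      by rewrite normr0 powR0// gt_eqF.
  by apply: DeriveDef; [apply/cvg_ex; exists 0; exact: h|exact/cvg_lim].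
Unshelve. all: by end_near. Qed.

Lemma absorption_lip (B r s : R) : `|r| <= B -> `|s| <= B -> r <= s ->
  f s - f r <= (alpha + 1) * B `^ alpha * (s - r).
Proof.
move=> rB sB; rewrite le_eqVlt => /predU1P[->|rs]; first by rewrite !subrr mulr0.
have [||c] := @MVT R f df r s rs.
- by move=> x _; exact: is_derive_absorption.
- exact/continuous_subspaceT/continuous_absorption.
rewrite in_itv/= => /andP[rc cs] ->.
rewrite ler_wpM2r ?subr_ge0 ?(ltW rs)// ler_wpM2l ?addr_ge0 ?(ltW alpha0)//.
have cB : `|c| <= B.
  by move: rB sB; rewrite !ler_norml => /andP[h1 h2] /andP[h3 h4]; apply/andP; split; lra.
by rewrite ge0_ler_powR ?nnegrE ?(ltW alpha0)// (le_trans _ cB).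
Qed.

End absorption_calculus.

Section comparison.
Context {R : realType} {N : nat}.
Variables (m : nat) (alpha : R).
Hypotheses (mN : (m <= N)%N) (alpha0 : 0 < alpha).
Notation mu := (@lebesgue_measure R).
Notation E := 'rV[R]_N.
Notation Om := (@Omega R N m).
Notation f := (@absorption R alpha).
Notation sgm := (@sgm R N m).
Implicit Types (phi psi delta : E -> R) (x y : E) (H u : R -> E -> R) (s t tau T C B : R).

Lemma oddm_sgm : oddm m sgm.
Proof.
have -> : sgm = oddext m (fun=> 1) by apply/funext => x; rewrite /oddext mulr1.
exact: oddm_oddext.
Qed.

Lemma normr_sgm_le1 x : `|sgm x| <= 1.
Proof. by case: (sgm_absm m x) => [->|[-> _]//]; rewrite normr0. Qed.

Lemma oddm_comp (b : R -> R) phi : (forall r, b (- r) = - b r) -> oddm m phi ->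
  oddm m (fun x => b (phi x)).
Proof. by move=> bN op i im x; rewrite op. Qed.

Lemma oddmZ (c : R) phi : oddm m phi -> oddm m (fun x => c * phi x).
Proof. by move=> op; apply: (oddm_comp (b := fun r => c * r)) => // r; rewrite mulrN. Qed.

Lemma oddmD phi psi : oddm m phi -> oddm m psi -> oddm m (fun x => phi x + psi x).
Proof. by move=> o1 o2 i im x; rewrite o1// o2// opprD. Qed.

Lemma oddmB phi psi : oddm m phi -> oddm m psi -> oddm m (fun x => phi x - psi x).
Proof. by move=> o1 o2 i im x; rewrite o1// o2// opprD. Qed.

Lemma mfun_row_comp (b : R -> R) phi : measurable_fun setT b -> mfun_row phi ->
  mfun_row (fun x => b (phi x)).
Proof. by move=> mb mp; exact: (measurableT_comp mb mp). Qed.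

Lemma mfun2_comp (b : R -> R) H : measurable_fun setT b -> mfun2 H ->
  mfun2 (fun s x => b (H s x)).
Proof. by move=> mb mp; exact: (measurableT_comp mb mp). Qed.

Lemma heatop_sgm_le1 t x : `|heatop t sgm x| <= 1.
Proof. by apply: heatop_bound => [|y]; [exact: measurable_sgm|exact: normr_sgm_le1]. Qed.

Lemma heatop_sgm_ge0 t x : 0 <= t -> Om x -> 0 <= heatop t sgm x.
Proof.
move=> t0 Ox; apply: (@heatop_ge0 R N m mN sgm 1) => //.
- exact: measurable_sgm.
- exact: normr_sgm_le1.
- exact: oddm_sgm.
- by move=> y Oy; rewrite sgm_Omega.
Qed.

Lemma oddm_duh H C t : mfun2 H -> tbound t C H -> (forall s, 0 < s < t -> oddm m (H s)) ->
  oddm m (duh H t).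
Proof.
move=> mH HC oH i im x; rewrite /duh -mulN1r -RintegralZl//; last exact: integrable_duh HC.
apply: eq_Rintegral => s; rewrite inE/= in_itv/= => st.
rewrite mulN1r; apply: (@oddm_heatop R N m (t - s) (H s) C) => //.
- exact: mfun2_section.
- by move=> y; exact: HC.
- exact: oH.
Qed.

Lemma Rintegral_derive_itv (g G : R -> R) t : 0 < t ->
  (forall s : R, 0 <= s <= t -> is_derive s 1 G (g s)) -> continuous g ->
  mu.-integrable `]0, t[ (EFin \o g) /\ \int[mu]_(s in `]0, t[) g s = G t - G 0.
Proof.
move=> t0 dG cg.
have [D D0 Dg] := continuous_itv_bound 0 t cg.
have mg := continuous_itv_measurable cg.
have ig : mu.-integrable `]0, t[ (EFin \o g).
  by apply: (integrable_itv mg (C := D)) => s /andP[? ?]; apply: Dg; rewrite !ltW.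
split=> //; rewrite -(@Rintegral_derive R g G 0 t t0 dG (fun s _ => cg s)).
rewrite Rintegral_itv_obnd_cbnd// Rintegral_itv_bndo_bndc//.
apply: (integrable_bounded (C := D)) => //.
- have : (mu `[0%R, t[%classic < +oo)%E by rewrite lebesgue_measure_itv/= lte_fin t0 -EFinB ltry.
  exact.
- exact: measurable_funTS.
- by move=> s /=; rewrite in_itv/= => /andP[s0 s1]; apply: Dg; rewrite s0 ltW.
Qed.

(** Comparison with a scalar barrier: a pointwise bound of the integrand by a derivative integrates
    exactly. [G] will be an exponential weight, or such a weight times the ODE solution [flat]. *)
Lemma duh_le_derive H C (g G : R -> R) t x A : 0 < t -> mfun2 H -> tbound t C H ->
  (forall s : R, 0 <= s <= t -> is_derive s 1 G (g s)) -> continuous g ->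
  (forall s, 0 < s < t -> heatop (t - s) (H s) x <= g s * A) ->
  duh H t x <= (G t - G 0) * A.
Proof.
move=> t0 mH HC dG cg Hg.
have [ig <-] := Rintegral_derive_itv t0 dG cg.
rewrite mulrC -RintegralZl//; apply: le_Rintegral => //.
- exact: integrable_duh HC.
- exact: integrableZR.
- by move=> s /=; rewrite in_itv/= => /Hg; rewrite mulrC.
Qed.

Lemma duh_ge_derive H C (g G : R -> R) t x A : 0 < t -> mfun2 H -> tbound t C H ->
  (forall s : R, 0 <= s <= t -> is_derive s 1 G (g s)) -> continuous g ->
  (forall s, 0 < s < t -> g s * A <= heatop (t - s) (H s) x) ->
  (G t - G 0) * A <= duh H t x.
Proof.
move=> t0 mH HC dG cg Hg.
have [ig <-] := Rintegral_derive_itv t0 dG cg.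
rewrite mulrC -RintegralZl//; apply: le_Rintegral => //.
- exact: integrableZR.
- exact: integrable_duh HC.
- by move=> s /=; rewrite in_itv/= => /Hg; rewrite mulrC.
Qed.

Lemma le_duh H1 H2 C t x : 0 < t -> mfun2 H1 -> tbound t C H1 -> mfun2 H2 -> tbound t C H2 ->
  (forall s, 0 < s < t -> heatop (t - s) (H1 s) x <= heatop (t - s) (H2 s) x) ->
  duh H1 t x <= duh H2 t x.
Proof.
move=> t0 mH1 HC1 mH2 HC2 h; apply: le_Rintegral => //.
- exact: integrable_duh HC1.
- exact: integrable_duh HC2.
Qed.

Lemma is_derive_expRM (M s : R) : is_derive s 1 (fun s => expR (M * s)) (M * expR (M * s)).
Proof.
have d1 : is_derive s 1 (fun s => M * s) M by apply: is_derive_eq; rewrite /GRing.scale/= mulr1.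
by have := is_derive1_comp (is_derive_expR (M * s)) d1; rewrite mulrC.
Qed.

Lemma continuous_expRM (M : R) : continuous (fun s => expR (M * s)).
Proof. by move=> s; apply/differentiable_continuous/derivable1_diffP; have [] := is_derive_expRM M s. Qed.

Lemma pmild_expR T phi u B Bu (M : R) : mfun_row phi -> (forall y, `|phi y| <= B) ->
  mfun2 u -> tbound T Bu u -> pmild T phi (fun s x => - f (u s x)) u ->
  pmild T phi (fun s x => expR (M * s) * (M * u s x - f (u s x))) (fun s x => expR (M * s) * u s x).
Proof.
move=> mphi phiB mu_ uB pu.
have mf : measurable_fun setT (fun r : R => - f r).
  by apply: measurableT_comp => //; exact: measurable_absorption.
have cd : continuous (fun s => M * expR (M * s)).
  by move=> s; apply: cvgM; [exact: cvg_cst|exact: continuous_expRM].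
have := @pmild_product R N T phi _ u B (f Bu) Bu _ _ (is_derive_expRM M) cd mphi phiB
  (mfun2_comp mf mu_) _ mu_ uB pu.
have tb : tbound T (f Bu) (fun s x => - f (u s x)).
  by move=> s y sT; rewrite normrN absorption_bound// uB.
rewrite mulr0 expR0 => /(_ tb) h t x tT; have -> := h t x tT.
congr (heatop t _ x + _); first by apply/funext => y; rewrite mul1r.
apply: duhE_ext => s _; apply/funext => y.
by ring.
Qed.

Lemma mul_expR_inv (M s r : R) : expR (- M * s) * (expR (M * s) * r) = r.
Proof. by rewrite mulrA -expRD mulNr addNr expR0 mul1r. Qed.

(** Inverse of [pmild_expR], by the integrating factor with opposite exponent: the monotone
    iteration yields a solution of the weighted equation, from which the original one is
    recovered. *)
Lemma expR_pmild T phi u B Bu (M : R) : mfun_row phi -> (forall y, `|phi y| <= B) ->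
  mfun2 u -> tbound T Bu u -> 0 <= M -> 0 < T ->
  pmild T phi (fun s x => expR (M * s) * (M * u s x - f (u s x))) (fun s x => expR (M * s) * u s x) ->
  pmild T phi (fun s x => - f (u s x)) u.
Proof.
move=> mphi phiB mu_ uB M0 T0 pu.
have mf : measurable_fun setT (fun r : R => M * r - f r).
  by apply: measurable_funB; [exact: measurable_funM|exact: measurable_absorption].
have cd : continuous (fun s => - M * expR (- M * s)).
  by move=> s; apply: cvgM; [exact: cvg_cst|exact: continuous_expRM].
have mE : measurable_fun setT (fun s => expR (M * s)) by apply: continuous_itv_measurable; exact: continuous_expRM.
have Bu0 := tbound_ge0 T0 uB.
have eT s : 0 < s < T -> `|expR (M * s)| <= expR (M * T).
  by move=> /andP[s0 sT]; rewrite ger0_norm ?expR_ge0// ler_expR ler_wpM2l// ltW.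
have := @pmild_product R N T phi _ _ B (expR (M * T) * (M * Bu + f Bu)) (expR (M * T) * Bu) _ _
  (is_derive_expRM (- M)) cd mphi phiB (mfun2_scale mE (mfun2_comp mf mu_)) _ 
  (mfun2_scale mE mu_) _ pu.
have tb1 : tbound T (expR (M * T) * (M * Bu + f Bu)) (fun s x => expR (M * s) * (M * u s x - f (u s x))).
  move=> s y sT; rewrite normrM ler_pM ?eT// (le_trans (ler_normB _ _))// lerD//.
    by rewrite normrM ger0_norm// ler_wpM2l// uB.
  by rewrite absorption_bound// uB.
have tb2 : tbound T (expR (M * T) * Bu) (fun s x => expR (M * s) * u s x).
  by move=> s y sT; rewrite normrM ler_pM ?eT// uB.
rewrite mulr0 expR0 => /(_ tb1 tb2) h t x tT.
rewrite -[LHS](mul_expR_inv M t); have -> := h t x tT.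
congr (heatop t _ x + _); first by apply/funext => y; rewrite mul1r.
apply: duhE_ext => s _; apply/funext => y.
by rewrite -mulrA !mul_expR_inv mulNr addrA addNr sub0r.
Qed.

Lemma expr_cvg0 (q A : R) : 0 <= q -> q < 1 -> (forall n, 0 <= A * q ^+ n) -> 
  forall a b : R, (forall n, a <= b + A * q ^+ n) -> a <= b.
Proof.
move=> q0 q1 Aq a b h.
have cv : b + A * q ^+ n @[n --> \oo] --> b + A * 0.
  apply: cvgD; first exact: cvg_cst.
  apply: cvgM; first exact: cvg_cst.
  by apply: cvg_expr; rewrite ger0_norm.
rewrite mulr0 addr0 in cv.
by apply: (@ler_cvg_to _ _ _ _ (fun=> a) _ a b _ cv); [exact: cvg_cst|exact: nearW].
Qed.

(* With the integrating factor [expR (M t)] the source [M u - f u] is increasing in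
   [u], and an excess [k] of [u1 - u2] improves to [k * (1 - expR (- M T))]. *)
Lemma pmild_le T phi1 phi2 delta u1 u2 B : 0 < T ->
  mfun_row phi1 -> (forall y, `|phi1 y| <= B) -> oddm m phi1 ->
  mfun_row phi2 -> (forall y, `|phi2 y| <= B) -> oddm m phi2 ->
  mfun_row delta -> (forall y, `|delta y| <= B) -> oddm m delta ->
  mfun2 u1 -> tbound T B u1 -> (forall s, 0 < s < T -> oddm m (u1 s)) ->
  mfun2 u2 -> tbound T B u2 -> (forall s, 0 < s < T -> oddm m (u2 s)) ->
  pmild T phi1 (fun s x => - f (u1 s x)) u1 ->
  pmild T phi2 (fun s x => - f (u2 s x)) u2 ->
  (forall x, Om x -> 0 <= delta x) ->
  (forall x, Om x -> phi1 x - phi2 x <= delta x) ->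
  forall t x, 0 < t < T -> Om x -> u1 t x - u2 t x <= heatop t delta x.
Proof.
move=> T0 m1 b1 o1 m2 b2 o2 md bd od mu1 ub1 ou1 mu2 ub2 ou2 p1 p2 d0 d12.
have B0 : 0 <= B := tbound_ge0 T0 ub1.
(* A Lipschitz constant of [f] on [-B, B], so that [b] below is nondecreasing there. *)
pose M := (alpha + 1) * B `^ alpha.
have M0 : 0 <= M by rewrite mulr_ge0 ?powR_ge0// addr_ge0// ltW.
pose q := 1 - expR (- M * T).
have eMT : expR (- M * T) <= 1 by rewrite -expR0 ler_expR mulNr oppr_le0 mulr_ge0// ltW.
have q0 : 0 <= q by rewrite subr_ge0.
have q1 : q < 1 by rewrite gtrBl expR_gt0.
have hd t x : 0 <= t -> Om x -> 0 <= heatop t delta x.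
  by move=> t0 Ox; exact: (heatop_ge0 mN t0 md bd od d0).
pose b r := M * r - f r.
have mb : measurable_fun setT b.
  by apply: measurable_funB; [exact: measurable_funM|exact: measurable_absorption].
have bN r : b (- r) = - b r by rewrite /b absorptionN mulrN opprB opprK addrC.
have bB r : `|r| <= B -> `|b r| <= M * B + f B.
  by move=> rB; rewrite (le_trans (ler_normB _ _))// lerD ?absorption_bound// normrM ger0_norm// ler_wpM2l.
(* For r <= s the difference is nonpositive since [b] is nondecreasing; for s < r the increment of
   [f] has the favourable sign and is dropped. *)
have ble (r s k : R) : `|r| <= B -> `|s| <= B -> 0 <= k -> r - s <= k -> b r - b s <= M * k.
  move=> rB sB k0 rsk; have [rs|sr] := leP r s.
    have := absorption_lip alpha0 rB sB rs; rewrite -/M /b => h.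
    have : 0 <= M * k by exact: mulr_ge0.
    by rewrite /b; lra.
  have := le_absorption alpha0 (ltW sr); have : M * (r - s) <= M * k by rewrite ler_wpM2l.
  by rewrite /b; lra.
have step (k : R) : 0 <= k ->
    (forall t x, 0 < t < T -> Om x -> u1 t x - u2 t x <= heatop t delta x + k) ->
    (forall t x, 0 < t < T -> Om x -> u1 t x - u2 t x <= heatop t delta x + k * q).
  move=> k0 h t x tT Ox; have tT' := tT; have /andP[t0 t1] := tT.
  have e1 := @pmild_expR T phi1 u1 B B M m1 b1 mu1 ub1 p1 t x tT.
  have e2 := @pmild_expR T phi2 u2 B B M m2 b2 mu2 ub2 p2 t x tT.
  rewrite -/(b _) in e1 e2.
  have mE : measurable_fun setT (fun s => expR (M * s)) by apply: continuous_itv_measurable; exact: continuous_expRM.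
  pose H1 s y := expR (M * s) * b (u1 s y); pose H2 s y := expR (M * s) * b (u2 s y).
  have mH1 : mfun2 H1 by apply: (mfun2_scale mE); exact: (mfun2_comp mb).
  have mH2 : mfun2 H2 by apply: (mfun2_scale mE); exact: (mfun2_comp mb).
  have eT s : 0 < s < t -> `|expR (M * s)| <= expR (M * t).
    by move=> /andP[s0 sT]; rewrite ger0_norm ?expR_ge0// ler_expR ler_wpM2l// ltW.
  have stT s : 0 < s < t -> 0 < s < T by move=> /andP[-> st]; rewrite (lt_trans st).
  have bH1 : tbound t (expR (M * t) * (M * B + f B)) H1.
    by move=> s y st; rewrite normrM ler_pM ?eT// bB// ub1// stT.
  have bH2 : tbound t (expR (M * t) * (M * B + f B)) H2.
    by move=> s y st; rewrite normrM ler_pM ?eT// bB// ub2// stT.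
  have key : duh (fun s y => H1 s y - H2 s y) t x <= (expR (M * t) - expR (M * 0)) * (heatop t delta x + k).
    have bH12 : tbound t (expR (M * t) * (M * B + f B) + expR (M * t) * (M * B + f B)) (fun s y => H1 s y - H2 s y).
      by move=> s y st; rewrite (le_trans (ler_normB _ _))// lerD// ?bH1 ?bH2.
    apply: (duh_le_derive t0 _ bH12 (G := fun s => expR (M * s)) (g := fun s => M * expR (M * s))).
    - exact: measurable_funB.
    - by move=> s _; exact: is_derive_expRM.
    - by move=> s; apply: cvgM; [exact: cvg_cst|exact: continuous_expRM].
    move=> s st; have /andP[s0 s1] := st; have ts0 : 0 <= t - s by rewrite subr_ge0 ltW.
    have ME0 : 0 <= M * expR (M * s) by rewrite mulr_ge0 ?expR_ge0.
    (* The constant [k] enters as [k * sgm], which is odd and equals [k] on [Om], so that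
       [le_heatop] applies. *)
    pose K y := heatop s delta y + k * sgm y.
    have mK : mfun_row K.
      by apply: measurable_funD; [exact: (mfun2_section _ (mfun2_heatop md))|apply: measurable_funM => //; exact: measurable_sgm].
    have bK y : `|K y| <= B + k.
      rewrite (le_trans (ler_normD _ _))// lerD ?heatop_bound// normrM ger0_norm//.
      by rewrite ler_piMr// normr_sgm_le1.
    have oK : oddm m K.
      by apply: oddmD; [exact: oddm_heatop md bd od|exact/oddmZ/oddm_sgm].
    apply: (@le_trans _ _ (heatop (t - s) (fun y => M * expR (M * s) * K y) x)).
      apply: (@le_heatop R N m mN _ _ _ (M * expR (M * s) * (B + k))) => //.
      + exact: (mfun2_section s (measurable_funB mH1 mH2 : mfun2 (fun s y => H1 s y - H2 s y))).
      + by move=> y; exact: bH12.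
      + by apply: oddmB; apply: oddmZ; apply: oddm_comp => //; [exact: ou1 (stT _ st)|exact: ou2 (stT _ st)].
      + exact: measurable_funM.
      + by move=> y; rewrite normrM (ger0_norm ME0) ler_wpM2l.
      + exact: oddmZ.
      + move=> y Oy; suff : expR (M * s) * (b (u1 s y) - b (u2 s y)) <= expR (M * s) * (M * K y).
          by rewrite mulrBr mulrA (mulrC (expR _) M).
        apply: ler_wpM2l; first exact: expR_ge0.
        apply: ble; rewrite ?ub1 ?ub2 ?stT//.
          by rewrite /K sgm_Omega// mulr1 addr_ge0// hd// ltW.
        by rewrite /K sgm_Omega// mulr1 h// stT.
    rewrite (heatopZ _ _ _ mK bK) ler_wpM2l//.
    rewrite (@heatopD _ _ _ _ _ B k)//; last 4 first.
    - exact: (mfun2_section _ (mfun2_heatop md)).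
    - by move=> y; exact: heatop_bound.
    - apply: measurable_funM => //; exact: measurable_sgm.
    - by move=> y; rewrite normrM ger0_norm// ler_piMr// normr_sgm_le1.
    rewrite (heatop_semigroup ts0 (ltW s0) md bd) subrK lerD2l.
    rewrite (heatopZ _ _ _ (measurable_sgm m) (@normr_sgm_le1)) ler_piMr//.
    exact: le_trans (ler_norm _) (heatop_sgm_le1 _ _).
  have eq12 : expR (M * t) * (u1 t x - u2 t x) = heatop t (fun y => phi1 y - phi2 y) x + duh (fun s y => H1 s y - H2 s y) t x.
    rewrite mulrBr e1 e2 opprD addrACA; congr (_ + _).
      by rewrite (heatopB _ _ m1 b1 m2 b2).
    rewrite /duh -RintegralB//; [|exact: integrable_duh bH1|exact: integrable_duh bH2].
    apply: eq_Rintegral => s; rewrite inE/= in_itv/= => st.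
    rewrite (@heatopB _ _ _ _ _ (expR (M * t) * (M * B + f B)) (expR (M * t) * (M * B + f B)))//.
    - exact: (mfun2_section s mH1).
    - by move=> y; exact: bH1.
    - exact: (mfun2_section s mH2).
    - by move=> y; exact: bH2.
  have d12' : heatop t (fun y => phi1 y - phi2 y) x <= heatop t delta x.
    apply: (@le_heatop R N m mN _ _ (B + B) B); rewrite ?(ltW t0)//.
    - exact: measurable_funB.
    - by move=> y; rewrite (le_trans (ler_normB _ _))// lerD.
    - exact: oddmB.
  have E0 : 0 < expR (M * t) by exact: expR_gt0.
  (* The weighted source contributes the factor expR (M t) - 1. Together with the initial term it
     restores the full heat flow of [delta], whereas [k] is multiplied by 1 - expR (- M t) only,
     which is at most [q]. *)
  have : expR (M * t) * (u1 t x - u2 t x) <= expR (M * t) * (heatop t delta x + k * (1 - expR (- M * t))).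
    rewrite eq12 mulrDr mulrCA mulrBr mulr1 -expRD mulNr addrN expR0.
    apply: le_trans (lerD d12' key) _; rewrite mulr0 expR0; lra.
  rewrite ler_pM2l// => /le_trans; apply; rewrite lerD2l ler_wpM2l// lerD2l lerN2 ler_expR.
  by rewrite !mulNr lerN2 ler_wpM2l// ltW.
(* The iteration starts from the trivial excess B + B. *)
have it n : forall t x, 0 < t < T -> Om x -> u1 t x - u2 t x <= heatop t delta x + (B + B) * q ^+ n.
  elim: n => [t x tT Ox|n IH].
    rewrite expr0 mulr1; have := hd t x; have /andP[t0 _] := tT.
    move=> /(_ (ltW t0) Ox) h.
    have : u1 t x - u2 t x <= B + B.
      by rewrite (le_trans (ler_norm _))// (le_trans (ler_normB _ _))// lerD// ?ub1 ?ub2.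
    lra.
  move=> t x tT Ox; rewrite exprSr mulrA; apply: step => //.
  by rewrite mulr_ge0 ?exprn_ge0// addr_ge0.
move=> t x tT Ox; apply: (@expr_cvg0 q (B + B) q0 q1) => n; last exact: it.
by rewrite mulr_ge0 ?exprn_ge0// addr_ge0.
Qed.

End comparison.

Section limits.
Context {R : realType} {N : nat}.
Notation E := 'rV[R]_N.
Notation gN := (@gauss R N).
Implicit Types (phi : E -> R) (x y : E) (H : R -> E -> R) (s t C : R).

Lemma heatop_cvg (phi_ : nat -> E -> R) phi C t x :
  (forall n, mfun_row (phi_ n)) -> (forall n y, `|phi_ n y| <= C) -> mfun_row phi ->
  (forall y, phi_ n y @[n --> \oo] --> phi y) ->
  heatop t (phi_ n) x @[n --> \oo] --> heatop t phi x.
Proof.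
move=> mp pC mphi h.
apply: (@cvg_Rintegral R _ _ gN setT (fun n z => phi_ n (x + Num.sqrt (2 * t) *: row_of_tuple z)) _ (fun=> C)) => //.
- by move=> n; exact: measurable_heat_arg.
- exact: measurable_heat_arg.
- by apply: (integrable_gauss_bounded (C := C)) => // z; rewrite ger0_norm// (le_trans _ (pC 0 x)).
Qed.

Lemma duh_cvg (H_ : nat -> R -> E -> R) H C t x : 0 <= C ->
  (forall n, mfun2 (H_ n)) -> (forall n, tbound t C (H_ n)) -> mfun2 H ->
  (forall s y, 0 < s < t -> H_ n s y @[n --> \oo] --> H s y) ->
  duh (H_ n) t x @[n --> \oo] --> duh H t x.
Proof.
move=> C0 mH HC mH0 h.
apply: (@cvg_Rintegral R _ _ (@lebesgue_measure R) `]0, t[%classic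
  (fun n s => heatop (t - s) (H_ n s) x) _ (fun=> C)) => //.
- by move=> n; apply: measurable_funTS; exact: measurable_heatop_time.
- by apply: measurable_funTS; exact: measurable_heatop_time.
- move=> s /=; rewrite in_itv/= => st.
  apply: (heatop_cvg (C := C)) => [n|n y||y]; [exact: mfun2_section|exact: HC|exact: mfun2_section|exact: h].
- by apply: (@integrable_itv _ _ _ _ C) => // s _; rewrite ger0_norm.
- move=> s n /=; rewrite in_itv/= => st; exact: (@heatop_time_bound _ _ _ t).
Qed.

Lemma mfun2_cvg (H_ : nat -> R -> E -> R) H :
  (forall n, mfun2 (H_ n)) -> (forall s y, H_ n s y @[n --> \oo] --> H s y) -> mfun2 H.
Proof.
move=> mH h.
apply: (measurable_fun_cvg (h := fun n (p : R * N.-tuple R) => H_ n p.1 (row_of_tuple p.2))) => //.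
Qed.

(** Monotonicity holds on [Omega m] only; oddness expresses every other value as a sign times a
    value there, so convergence spreads to the whole space. *)
Lemma oddm_increasing_limit (m : nat) (v_ : nat -> R -> E -> R) (B : R -> R) :
  (forall n, mfun2 (v_ n)) ->
  (forall n t, 0 < t -> oddm m (v_ n t)) ->
  (forall n t x, 0 < t -> Omega m x -> v_ n t x <= v_ n.+1 t x) ->
  (forall n t x, 0 < t -> Omega m x -> v_ n t x <= B t) ->
  exists v, [/\ mfun2 v, (forall t, 0 < t -> oddm m (v t)) &
    forall t x, 0 < t -> v_ n t x @[n --> \oo] --> v t x].
Proof.
move=> mv_ ov_ vS vB.
(* Setting the sequence to 0 at nonpositive times makes it converge everywhere, as the measurability
   of the limit requires. *)
pose w n t x := if 0 < t then v_ n t x else 0.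
have cw t x : cvgn (fun n => w n t x).
  rewrite /w; have [t0|t0] := boolP (0 < t); last exact: is_cvg_cst.
  have h z : Omega m z -> cvgn (fun n => v_ n t z).
    move=> Oz; apply: nondecreasing_is_cvgn.
      by apply/nondecreasing_seqP => n; exact: vS.
    by exists (B t) => _ [n _ <-]; exact: vB.
  have e n : v_ n t x = sgm m x * v_ n t (absm m x).
    by rewrite {1}(oddmE (ov_ n t t0)).
  rewrite (_ : (fun n => _) = (fun n => sgm m x * v_ n t (absm m x))); last by apply/funext.
  have [->|[_ Oa]] := sgm_absm m x.
    by rewrite (_ : (fun n => _) = (fun=> 0)); [exact: is_cvg_cst|apply/funext => n; rewrite mul0r].
  by apply: is_cvgM; [exact: is_cvg_cst|exact: h].
pose v t x := limn (fun n => w n t x).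
have wv t x : w n t x @[n --> \oo] --> v t x by exact: cw.
have vv t x : 0 < t -> v_ n t x @[n --> \oo] --> v t x.
  by move=> t0; have := wv t x; rewrite /w t0.
have mw n : mfun2 (w n).
  rewrite /mfun2.
  rewrite (_ : (fun _ => _) = (fun p : R * N.-tuple R => if 0 < p.1 then v_ n p.1 (row_of_tuple p.2) else 0)).
    by apply: measurable_fun_ifT => //; [exact: measurable_fun_ltr|exact: mv_].
  by apply/funext => p; rewrite /w; case: ifP.
exists v; split=> //; first exact: mfun2_cvg mw wv.
move=> t t0 i im x; apply: (@cvg_unique _ (@norm_hausdorff _ R) (v_ n t (flip i x) @[n --> \oo])).
  exact: vv.
rewrite (_ : (fun n => _) = (fun n => - v_ n t x)).
  by apply: cvgN; exact: vv.
by apply/funext => n; rewrite ov_.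
Qed.

End limits.

(** * Existence by monotone iteration *)

Section existence.
Context {R : realType} {N : nat}.
Variables (m : nat) (alpha : R).
Hypotheses (mN : (m <= N)%N) (alpha0 : 0 < alpha).
Notation E := 'rV[R]_N.
Notation Om := (@Omega R N m).
Notation f := (@absorption R alpha).
Notation sgm := (@sgm R N m).
Implicit Types (x y : E) (w : R -> E -> R) (s t T : R).

(* Equal to [(1 + alpha t)^(-1/alpha)], the solution of [y' = - f y] with
   [y 0 = 1], for [t >= 0]; the maximum makes it continuous on the whole line. *)
Definition flat t : R := (Num.max (1 + alpha * t) 2^-1) `^ (- alpha^-1).

Lemma flatE t : 0 <= t -> flat t = (1 + alpha * t) `^ (- alpha^-1).
Proof.
move=> t0; rewrite /flat max_l//.
have : 0 <= alpha * t by rewrite mulr_ge0// ltW.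
lra.
Qed.

Lemma flat_gt0 t : 0 < flat t.
Proof. by rewrite powR_gt0// lt_max invr_gt0 ltr0n orbT. Qed.

Lemma flat0 : flat 0 = 1.
Proof. by rewrite flatE// mulr0 addr0 powR1. Qed.

Lemma flat_le1 t : 0 <= t -> flat t <= 1.
Proof.
move=> t0; rewrite flatE// powRN invf_le1 ?powR_gt0//; last first.
  have : 0 <= alpha * t by rewrite mulr_ge0// ltW.
  lra.
rewrite -[leLHS](powRr0 (1 + alpha * t)) ler_powR ?invr_ge0 ?(ltW alpha0)//.
by rewrite lerDl mulr_ge0// ltW.
Qed.

Lemma continuous_flat : continuous flat.
Proof.
move=> t; apply: (@continuous_comp _ _ _ (fun t => Num.max (1 + alpha * t) 2^-1) (fun x : R => x `^ (- alpha^-1))).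
  apply: (@continuous_max _ _ (fun t => 1 + alpha * t) (fun=> 2^-1)); last exact: cvg_cst.
  by apply: cvgD; [exact: cvg_cst|apply: cvgM; [exact: cvg_cst|exact: cvg_id]].
apply/differentiable_continuous/derivable1_diffP/derivable_powR.
by rewrite in_itv/= andbT lt_max invr_gt0 ltr0n orbT.
Qed.

Lemma is_derive_flat t : 0 <= t -> is_derive t 1 flat (- f (flat t)).
Proof.
move=> t0; have p1 : 0 < 1 + alpha * t by rewrite ltr_pwDl// mulr_ge0// ltW.
have d1 : is_derive t 1 (fun t => 1 + alpha * t) alpha.
  by apply: is_derive_eq; rewrite /GRing.scale/=; ring.
have d2 := @is_derive1_comp R (fun x : R => x `^ (- alpha^-1)) (fun t => 1 + alpha * t) t _ _ (@is_derive1_powR R (- alpha^-1) _ p1) d1.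
have -> : f (flat t) = (1 + alpha * t) `^ (- alpha^-1 - 1).
  rewrite absorption_powR//; last exact: ltW (flat_gt0 t).
  rewrite flatE// -powRrM; congr (_ `^ _).
  by rewrite mulrDr mulr1 mulNr mulVf ?gt_eqF// addrC.
set X := (1 + alpha * t) `^ _ in d2 *.
have -> : - X = - alpha^-1 * X * alpha by field; rewrite gt_eqF.
apply: near_eq_is_derive d2.
near=> x; rewrite /flat max_l//.
have : - (2^-1 * alpha^-1) < x.
  near: x; apply: lt_nbhsr; apply: lt_le_trans t0.
  by rewrite oppr_lt0 mulr_gt0// invr_gt0.
rewrite -(ltr_pM2l alpha0) mulrN mulrCA mulfV ?gt_eqF// mulr1 => h; lra.
Unshelve. all: by end_near. Qed.

(** On [0, 1], where the iterates take their values over [Om], the absorption has Lipschitz constant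
    alpha + 1; hence [b] is nondecreasing there. *)
Let M : R := alpha + 1.
Let b (r : R) : R := M * r - f r.

Let M0 : 0 <= M. Proof. by rewrite addr_ge0// ltW. Qed.

Let mb : measurable_fun setT b.
Proof. by apply: measurable_funB; [exact: measurable_funM|exact: measurable_absorption]. Qed.

Let bN r : b (- r) = - b r.
Proof. by rewrite /b absorptionN mulrN opprB opprK addrC. Qed.

Let ble r s : 0 <= r -> r <= s -> s <= 1 -> b r <= b s.
Proof.
move=> r0 rs s1; have s0 := le_trans r0 rs.
have := @absorption_lip R alpha alpha0 1 r s.
rewrite !ger0_norm// => /(_ (le_trans rs s1) s1 rs); rewrite powR1 mulr1 /b /M; lra.
Qed.

Let bB r : `|r| <= 1 -> `|b r| <= M + 1.
Proof.
move=> r1; rewrite (le_trans (ler_normB _ _))// lerD//.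
  by rewrite normrM ger0_norm// ler_piMr.
by rewrite (le_trans (absorption_bound alpha0 r1))// /absorption normr1 powR1 mulr1.
Qed.

Let oddp t : oddm m (heatop t sgm).
Proof. by apply: oddm_heatop; [exact: measurable_sgm|exact: normr_sgm_le1|exact: oddm_sgm]. Qed.

Let G w : R -> E -> R := fun s y => expR (M * s) * b (w s y).
(** One Picard step for the equation weighted by expR (M t), whose source is increasing in the
    unknown. The iteration starts at the subsolution [flat t * heatop t sgm x]. *)
Let vS w : R -> E -> R := fun t x => expR (- M * t) * (heatop t sgm x + duh (G w) t x).
Let v_ (n : nat) : R -> E -> R := iter n vS (fun t x => flat t * heatop t sgm x).

(** The invariants of the iteration; the last one places each iterate between a sub- and a
    supersolution. *)
Let inv w := [/\ mfun2 w, (forall t, 0 < t -> oddm m (w t)) &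
  forall t x, 0 < t -> Om x -> flat t * heatop t sgm x <= w t x <= flat t].

Let inv_ge0 w t x : inv w -> 0 < t -> Om x -> 0 <= w t x <= 1.
Proof.
move=> [_ _ h] t0 Ox; have /andP[h1 h2] := h t x t0 Ox; apply/andP; split.
  apply: le_trans h1; rewrite mulr_ge0//; first exact: ltW (flat_gt0 t).
  exact: heatop_sgm_ge0 (ltW t0) Ox.
by apply: le_trans h2 (flat_le1 _); exact: ltW.
Qed.

Let inv_bound w t x : inv w -> 0 < t -> `|w t x| <= 1.
Proof.
move=> iw t0; have [_ ow _] := iw; apply: (oddm_bound (ow t t0)) => // z Oz.
by have /andP[z0 z1] := inv_ge0 iw t0 Oz; rewrite ger0_norm.
Qed.

Let inv_G w t : inv w -> mfun2 (G w) /\ tbound t (expR (M * t) * (M + 1)) (G w).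
Proof.
move=> iw; have [mw _ _] := iw; split.
  apply: mfun2_scale; last exact: mfun2_comp.
  by apply: continuous_itv_measurable; exact: continuous_expRM.
move=> s y /andP[s0 st]; rewrite normrM ler_pM//; last exact/bB/inv_bound.
by rewrite ger0_norm ?expR_ge0// ler_expR ler_wpM2l// ltW.
Qed.

Let inv_oddG w t : inv w -> 0 < t -> oddm m (G w t).
Proof. by move=> [_ ow _] t0; apply: oddmZ; apply: oddm_comp => //; exact: ow. Qed.

(** The equation of [flat] in weighted form: its source is [b (flat s)], so it is comparable term by
    term with [G w]. *)
Let dEf s : 0 <= s -> is_derive s 1 (fun s => expR (M * s) * flat s) (expR (M * s) * b (flat s)).
Proof.
move=> s0; have d1 := is_derive_expRM M s; have d2 := is_derive_flat s0.
by apply: is_derive_eq; rewrite /GRing.scale/= /b; ring.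
Qed.

Let cEf : continuous (fun s => expR (M * s) * b (flat s)).
Proof.
move=> s; apply: cvgM; first exact: continuous_expRM.
apply: cvgB; first by apply: cvgM; [exact: cvg_cst|exact: continuous_flat].
exact: (continuous_comp (@continuous_flat s) (@continuous_absorption R alpha alpha0 _)).
Qed.

Let heat_bound (c t : R) x : 0 <= t -> 0 <= c -> Om x -> heatop t (fun y => c * sgm y) x <= c.
Proof.
move=> t0 c0 Ox; rewrite (heatopZ _ _ _ (measurable_sgm m) (@normr_sgm_le1 _ _ _)) ler_piMr//.
exact: le_trans (ler_norm _) (heatop_sgm_le1 _ _ _).
Qed.

Let b_flat_ge0 t : 0 <= t -> 0 <= b (flat t).
Proof.
move=> t0; have := @ble 0 (flat t) (lexx 0) (ltW (flat_gt0 t)) (flat_le1 t0).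
by rewrite /b /absorption mulr0 mulr0 subr0.
Qed.

(** Both bounds compare the source with that of the barrier. Above, w <= flat and [b] is
    nondecreasing, so the source is at most a spatial constant. Below, the source dominates b (flat
    s) times the heat flow of [sgm], which the semigroup law carries to time t. *)
Let inv_vS w : inv w -> inv (vS w).
Proof.
move=> iw; have [mw ow hw] := iw.
have mE (c : R) : measurable_fun setT (fun s => expR (c * s)).
  by apply: continuous_itv_measurable; exact: continuous_expRM.
have [mG _] := inv_G 0 iw.
split.
- apply: mfun2_scale => //; apply: mfun2D; last exact: mfun2_duh.
  exact: mfun2_heatop (measurable_sgm m).
- move=> t t0; have [_ bG] := inv_G t iw; apply: oddmZ; apply: oddmD.
    exact: oddp.
  by apply: (oddm_duh mG bG) => s /andP[s0 _]; exact: inv_oddG.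
move=> t x t0 Ox; have [_ bG] := inv_G t iw.
have fE r : expR (- M * t) * (expR (M * t) * r) = r by exact: mul_expR_inv.
have E0 : 0 < expR (- M * t) by exact: expR_gt0.
apply/andP; split.
  rewrite /vS -[leLHS]fE ler_pM2l// mulrA.
  have h := @duh_ge_derive R N (G w) _ (fun s => expR (M * s) * b (flat s)) (fun s => expR (M * s) * flat s) t x (heatop t sgm x) t0 mG bG
     (fun s hs => dEf (andP hs).1) cEf.
  rewrite flat0 mulr0 expR0 mulr1 mulrBl mul1r lerBlDl in h; apply: h => s /andP[s0 st].
  have ts0 : 0 <= t - s by rewrite subr_ge0 ltW.
  have c0 : 0 <= expR (M * s) * b (flat s) by rewrite mulr_ge0 ?expR_ge0// b_flat_ge0// ltW.
  have mh : mfun_row (heatop s sgm) by exact: (mfun2_section _ (mfun2_heatop (measurable_sgm m))).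
  have -> : heatop t sgm x = heatop (t - s) (heatop s sgm) x.
    by rewrite (heatop_semigroup ts0 (ltW s0) (measurable_sgm m) (@normr_sgm_le1 _ _ _)) subrK.
  rewrite -(heatopZ _ _ _ mh (heatop_sgm_le1 m s)).
  apply: (@le_heatop R N m mN _ _ (expR (M * s) * b (flat s) * 1) (expR (M * t) * (M + 1))) => //.
  - exact: measurable_funM.
  - by move=> y; rewrite normrM (ger0_norm c0) ler_wpM2l// heatop_sgm_le1.
  - by apply: oddmZ; exact: oddp.
  - exact: mfun2_section.
  - by move=> y; apply: bG; rewrite s0.
  - exact: inv_oddG.
  - move=> y Oy; rewrite /G -mulrA ler_wpM2l ?expR_ge0//.
    have p0 := heatop_sgm_ge0 mN (ltW s0) Oy.
    have p1 := le_trans (ler_norm _) (heatop_sgm_le1 m s y).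
    have /andP[h1 h2] := hw s y s0 Oy.
    have f0 := flat_gt0 s; have f1 := flat_le1 (ltW s0).
    (* With p = [heatop s sgm y] in [0, 1], homogeneity gives f (flat p) = f (flat) p^(1+alpha) <= f
       (flat) p, hence p b (flat) <= b (flat p). *)
    apply: (@le_trans _ _ (b (flat s * heatop s sgm y))).
      rewrite /b mulrBl -mulrA lerD2l lerN2.
      rewrite /absorption normrM (ger0_norm (ltW f0)) (ger0_norm p0) powRM//; last exact: ltW.
      set a := flat s `^ alpha; set p := heatop s sgm y.
      have a0 : 0 <= a by exact: powR_ge0.
      have pa : p `^ alpha <= 1.
        have := @ge0_ler_powR R alpha (ltW alpha0) p 1; rewrite !nnegrE powR1; exact.
      have -> : a * p `^ alpha * (flat s * p) = (a * flat s * p) * p `^ alpha by ring.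
      by rewrite ler_piMr// mulr_ge0// mulr_ge0// ltW.
    by apply: ble => //; [rewrite mulr_ge0// ltW|exact: le_trans h2 f1].
rewrite /vS -[leRHS]fE ler_pM2l//.
have h := @duh_le_derive R N (G w) _ (fun s => expR (M * s) * b (flat s)) (fun s => expR (M * s) * flat s) t x 1 t0 mG bG
     (fun s hs => dEf (andP hs).1) cEf.
rewrite flat0 mulr0 expR0 mulr1 mulr1 in h.
have hs1 : heatop t sgm x <= 1 by exact: le_trans (ler_norm _) (heatop_sgm_le1 m t x).
suff : duh (G w) t x <= expR (M * t) * flat t - 1 by lra.
apply: h => s /andP[s0 st]; rewrite mulr1.
have ts0 : 0 <= t - s by rewrite subr_ge0 ltW.
have c0 : 0 <= expR (M * s) * b (flat s) by rewrite mulr_ge0 ?expR_ge0// b_flat_ge0// ltW.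
apply: le_trans (heat_bound ts0 c0 Ox).
apply: (@le_heatop R N m mN _ _ (expR (M * t) * (M + 1)) (expR (M * s) * b (flat s) * 1)) => //.
- exact: mfun2_section.
- by move=> y; apply: bG; rewrite s0.
- exact: inv_oddG.
- by apply: measurable_funM => //; exact: measurable_sgm.
- by move=> y; rewrite normrM (ger0_norm c0) ler_wpM2l// normr_sgm_le1.
- by apply: oddmZ; exact: oddm_sgm.
- move=> y Oy; rewrite sgm_Omega// mulr1 ler_wpM2l ?expR_ge0//.
  have /andP[h1 h2] := hw s y s0 Oy; have /andP[w0 _] := inv_ge0 iw s0 Oy.
  by apply: ble => //; apply: flat_le1; exact: ltW.
Qed.

Let inv_v n : inv (v_ n).
Proof.
elim: n => [|n]; last exact: inv_vS.
have mh := mfun2_heatop (measurable_sgm (N := N) (R := R) m).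
split.
- by apply: mfun2_scale => //; apply: continuous_itv_measurable; exact: continuous_flat.
- by move=> t t0; apply: oddmZ; exact: oddp.
- move=> t x t0 Ox; rewrite /v_/= lexx/= ler_piMr//; first exact: ltW (flat_gt0 t).
  exact: le_trans (ler_norm _) (heatop_sgm_le1 m t x).
Qed.

(** The first inequality is the lower bound in [inv] for the first iterate; the monotone source
    propagates it. *)
Let v_S n t x : 0 < t -> Om x -> v_ n t x <= v_ n.+1 t x.
Proof.
elim: n t x => [|n IH] t x t0 Ox.
  by have [_ _ /(_ t x t0 Ox)/andP[]] := inv_v 1.
rewrite /v_ !iterS -/(v_ n.+1) -/(v_ n) /vS ler_pM2l ?expR_gt0// lerD2l.
have [mG1 bG1] := inv_G t (inv_v n); have [mG2 bG2] := inv_G t (inv_v n.+1).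
apply: (le_duh t0 mG1 bG1 mG2 bG2) => s /andP[s0 st].
have ts0 : 0 <= t - s by rewrite subr_ge0 ltW.
apply: (@le_heatop R N m mN _ _ (expR (M * t) * (M + 1)) (expR (M * t) * (M + 1))) => //.
- exact: mfun2_section.
- by move=> y; apply: bG1; rewrite s0.
- exact: inv_oddG (inv_v n) s0.
- exact: mfun2_section.
- by move=> y; apply: bG2; rewrite s0.
- exact: inv_oddG (inv_v n.+1) s0.
- move=> y Oy; rewrite /G ler_wpM2l ?expR_ge0//.
  have /andP[w0 _] := inv_ge0 (inv_v n) s0 Oy; have /andP[_ w1] := inv_ge0 (inv_v n.+1) s0 Oy.
  by apply: ble => //; exact: IH.
Qed.

Lemma exists_pmild : exists v, [/\ mfun2 v, (forall t, 0 < t -> oddm m (v t)),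
  (forall t x, 0 < t -> Om x -> flat t * heatop t sgm x <= v t x <= flat t) &
  forall T, pmild T sgm (fun s x => - f (v s x)) v].
Proof.
have [||||v [mv ov vv]] := @oddm_increasing_limit R N m v_ flat.
- by move=> n; have [] := inv_v n.
- by move=> n; have [] := inv_v n.
- exact: v_S.
- by move=> n t x t0 Ox; have [_ _ /(_ t x t0 Ox)/andP[]] := inv_v n.
have hv t x : 0 < t -> Om x -> flat t * heatop t sgm x <= v t x <= flat t.
  move=> t0 Ox; apply/andP; split.
    apply: (ler_cvg_to (@cvg_cst _ _ _ _ _) (vv t x t0)); apply: nearW => n.
    by have [_ _ /(_ t x t0 Ox)/andP[]] := inv_v n.
  apply: (ler_cvg_to (vv t x t0) (@cvg_cst _ _ _ _ _)); apply: nearW => n.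
  by have [_ _ /(_ t x t0 Ox)/andP[]] := inv_v n.
exists v; split=> //.
have iv : inv v by [].
move=> T t x tT; have /andP[t0 tT'] := tT; have T0 := lt_trans t0 tT'.
have ub : tbound T 1 v by move=> s y /andP[s0 _]; exact: inv_bound.
apply: (expR_pmild alpha0 (measurable_sgm m) (@normr_sgm_le1 _ _ _) mv ub M0 T0) => // {}t {}x {tT t0 tT'} /andP[t0 tT].
have [mG bG] := inv_G t iv.
(* The weighted iterates have two limits, one by convergence of [v_] and one by dominated
   convergence in the recursion; uniqueness of limits is the equation for [v]. *)
have c1 : expR (M * t) * v_ n.+1 t x @[n --> \oo] --> expR (M * t) * v t x.
  apply: cvgM; first exact: cvg_cst.
  by have := vv t x t0; rewrite -(cvg_shiftS (fun n => v_ n t x)).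
have c2 : expR (M * t) * v_ n.+1 t x @[n --> \oo] --> heatop t sgm x + duh (G v) t x.
  rewrite (_ : (fun n => _) = (fun n => heatop t sgm x + duh (G (v_ n)) t x)); last first.
    apply/funext => n; rewrite /v_ iterS -/(v_ n) /vS mulrA -expRD.
    by rewrite mulNr addrN expR0 mul1r.
  apply: cvgD; first exact: cvg_cst.
  apply: (duh_cvg (C := expR (M * t) * (M + 1))) => //.
  - by rewrite mulr_ge0 ?expR_ge0// addr_ge0.
  - by move=> n; have [] := inv_G t (inv_v n).
  - by move=> n; have [] := inv_G t (inv_v n).
  move=> s y /andP[s0 _]; apply: cvgM; first exact: cvg_cst.
  apply: cvgB; first by apply: cvgM; [exact: cvg_cst|exact: vv].
  by apply: continuous_cvg; [exact: continuous_absorption|exact: vv].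
exact: (cvg_unique (@norm_hausdorff _ R) c1 c2).
Qed.

End existence.

(** * The limit of the dilations *)

Section rescaled_limit.
Context {R : realType} {N : nat}.
Variables (m : nat) (alpha : R).
Hypotheses (mN : (m <= N)%N) (alpha0 : 0 < alpha).
Notation mu := (@lebesgue_measure R).
Notation E := 'rV[R]_N.
Notation Om := (@Omega R N m).
Notation f := (@absorption R alpha).
Notation sgm := (@sgm R N m).
Implicit Types (x y : E) (w : R -> E -> R) (s t T : R).
Variable v : R -> E -> R.
Hypotheses (mv : mfun2 v) (ov : forall t, 0 < t -> oddm m (v t)).
Hypothesis hv : forall t x, 0 < t -> Om x ->
  flat alpha t * heatop t sgm x <= v t x <= flat alpha t.
Hypothesis pv : forall T, pmild T sgm (fun s x => - f (v s x)) v.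

Lemma pmild_mono T phi1 phi2 u1 u2 B :
  mfun_row phi1 -> (forall y, `|phi1 y| <= B) -> oddm m phi1 ->
  mfun_row phi2 -> (forall y, `|phi2 y| <= B) -> oddm m phi2 ->
  mfun2 u1 -> tbound T B u1 -> (forall s, 0 < s < T -> oddm m (u1 s)) ->
  mfun2 u2 -> tbound T B u2 -> (forall s, 0 < s < T -> oddm m (u2 s)) ->
  pmild T phi1 (fun s x => - f (u1 s x)) u1 ->
  pmild T phi2 (fun s x => - f (u2 s x)) u2 ->
  (forall x, Om x -> phi1 x <= phi2 x) ->
  forall t x, 0 < t < T -> Om x -> u1 t x <= u2 t x.
Proof.
move=> m1 b1 o1 m2 b2 o2 mu1 ub1 ou1 mu2 ub2 ou2 p1 p2 p12 t x tT Ox.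
have T0 : 0 < T by have /andP[h1 h2] := tT; exact: lt_trans h1 h2.
rewrite -subr_le0 -[X in _ <= X](@heatop_cst R N t 0 x).
apply: (@pmild_le R N m alpha mN alpha0 T phi1 phi2 (fun=> 0) u1 u2 B) => //.
- exact: measurable_cst.
- by move=> y; rewrite normr0 (le_trans _ (b1 y)).
- by move=> i _ y; rewrite oppr0.
- by move=> y Oy; rewrite subr_le0 p12.
Qed.

Let dil l := dilation alpha l v.
Let c l : R := l `^ (2 / alpha).

Let c_gt0 l : 0 < l -> 0 < c l.
Proof. by move=> l0; exact: powR_gt0. Qed.

Let c_alpha l : 0 < l -> c l `^ alpha = l ^+ 2.
Proof. by move=> l0; rewrite /c -powRrM divfK ?gt_eqF// powR_mulrn ?ltW. Qed.

Let cM l k : 0 < l -> 0 < k -> c (l * k) = c l * c k.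
Proof. by move=> l0 k0; rewrite /c powRM ?ltW. Qed.

Let f_c l r : 0 < l -> f (c l * r) = c l * (l ^+ 2 * f r).
Proof.
move=> l0; rewrite /absorption normrM powRM// ger0_norm ?(ltW (c_gt0 l0))// c_alpha//; ring.
Qed.

Let Om_scale l x : 0 < l -> Om (l *: x) <-> Om x.
Proof. by move=> l0; split=> h i im; move: (h i im); rewrite mxE pmulr_rgt0. Qed.

Let sgm_scale l x : 0 < l -> sgm (l *: x) = sgm x.
Proof. by move=> l0; apply: eq_bigr => i _; rewrite mxE sgrM gtr0_sg// mul1r. Qed.

Lemma powR_neg_le (a b p : R) : 0 < a -> a <= b -> 0 <= p -> b `^ (- p) <= a `^ (- p).
Proof.
move=> a0 ab p0; have b0 := lt_le_trans a0 ab.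
by rewrite !powRN lef_pV2 ?posrE ?powR_gt0// ge0_ler_powR// ?nnegrE ltW.
Qed.

(** The dilated [flat] is the ODE solution with initial value [c l]; as l grows it increases to
    (alpha t)^(-1/alpha). *)
Let c_flat l t : 0 < l -> 0 <= t -> c l * flat alpha (l ^+ 2 * t) = (l ^- 2 + alpha * t) `^ (- alpha^-1).
Proof.
move=> l0 t0; have l20 : 0 < l ^+ 2 by exact: exprn_gt0.
rewrite flatE//; last by rewrite mulr_ge0// ltW.
have -> : c l = (l ^- 2) `^ (- alpha^-1).
  by rewrite -powR_invn ?ltW// -powRrM mulrNN.
rewrite -powRM ?invr_ge0 ?(ltW l20)//; last first.
  by rewrite addr_ge0// mulr_ge0 ?(ltW alpha0)// mulr_ge0// ltW.
congr (_ `^ _); field.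
by rewrite gt_eqF.
Qed.

Lemma heatop_sgm_scale l t x : 0 < l -> heatop (l ^+ 2 * t) sgm (l *: x) = heatop t sgm x.
Proof.
move=> l0; rewrite -heatop_scale ?ltW//; congr (heatop t _ x).
by apply/funext => y; rewrite sgm_scale.
Qed.

Let dil_flat l t x : 0 < l -> 0 < t -> Om x ->
  (l ^- 2 + alpha * t) `^ (- alpha^-1) * heatop t sgm x <= dil l t x
    <= (l ^- 2 + alpha * t) `^ (- alpha^-1).
Proof.
move=> l0 t0 Ox; have l2t : 0 < l ^+ 2 * t by rewrite mulr_gt0// exprn_gt0.
have /andP[h1 h2] := hv l2t ((Om_scale x l0).2 Ox).
have c0 := c_gt0 l0; rewrite (heatop_sgm_scale _ _ l0) in h1.
by rewrite -(c_flat l0 (ltW t0)) /dil /dilation -/(c l) -mulrA !ler_pM2l// h2 h1.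
Qed.

Let dil_le l t x : 0 < l -> 0 < t -> Om x -> 0 <= dil l t x <= (alpha * t) `^ (- alpha^-1).
Proof.
move=> l0 t0 Ox; have /andP[h1 h2] := dil_flat l0 t0 Ox; apply/andP; split.
  by apply: le_trans h1; rewrite mulr_ge0 ?powR_ge0//; exact: heatop_sgm_ge0 (ltW t0) Ox.
apply: le_trans h2 _; apply: powR_neg_le; rewrite ?mulr_gt0// ?invr_ge0 ?(ltW alpha0)//.
by rewrite lerDr invr_ge0 exprn_ge0// ltW.
Qed.

Let v_bound t x : 0 < t -> `|v t x| <= 1.
Proof.
move=> t0; apply: (oddm_bound (ov t0)) => // z Oz; have /andP[h1 h2] := hv t0 Oz.
rewrite ger0_norm; first exact: le_trans h2 (flat_le1 alpha0 (ltW t0)).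
apply: le_trans h1; rewrite mulr_ge0 ?(ltW (flat_gt0 _ _))//.
exact: heatop_sgm_ge0 (ltW t0) Oz.
Qed.

Let dil_bound l t x : 0 < l -> 0 < t -> `|dil l t x| <= c l.
Proof.
move=> l0 t0; rewrite /dil /dilation normrM ger0_norm ?powR_ge0// ler_piMr ?powR_ge0//.
by rewrite v_bound// mulr_gt0// exprn_gt0.
Qed.

Let mdil l : 0 < l -> mfun2 (dil l).
Proof.
move=> l0; apply: measurable_funM => //.
apply: (measurable_row_comp2 mv); first exact: measurable_funM.
move=> i; rewrite (_ : (fun _ => _) = (fun p : R * N.-tuple R => l * row_of_tuple p.2 ord0 i)).
  apply: measurable_funM => //; exact: (measurableT_comp (row_coord_measurable i)).
by apply/funext => p; rewrite mxE.
Qed.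

Let odil l t : 0 < l -> 0 < t -> oddm m (dil l t).
Proof.
move=> l0 t0 i im x; rewrite /dil /dilation -flipZ ov ?mulrN//.
by rewrite mulr_gt0// exprn_gt0.
Qed.

Let msgm : mfun_row sgm := measurable_sgm m.
Let bsgm y : `|sgm y| <= 1 := normr_sgm_le1 m y.
Let osgm : oddm m sgm := @oddm_sgm R N m.
Let mf : measurable_fun setT (fun r : R => - f r).
Proof. by apply: measurableT_comp => //; exact: measurable_absorption. Qed.

(** Scale invariance of the equation: the substitution s -> l^2 s in the Duhamel integral produces
    the Jacobian l^2, which is the factor in [f_c]. Since [sgm] is invariant under dilation, the
    initial value changes by the constant [c l] only. *)
Let pdil l T : 0 < l -> pmild T (fun y => c l * sgm y) (fun s x => - f (dil l s x)) (dil l).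
Proof.
move=> l0 t x /andP[t0 tT].
have l2 : 0 < l ^+ 2 by exact: exprn_gt0.
have l2t : 0 < l ^+ 2 * t by rewrite mulr_gt0.
have HC : tbound (l ^+ 2 * t) 1 (fun s x => - f (v s x)).
  move=> s y /andP[s0 _]; rewrite normrN (le_trans (absorption_bound alpha0 (v_bound y s0)))//.
  by rewrite /absorption normr1 powR1 mulr1.
have mH : mfun2 (fun s x => - f (v s x)) by exact: (@mfun2_comp R N (fun r => - f r) v mf mv).
rewrite {1}/dil /dilation -/(c l) (pv (T := l ^+ 2 * t + 1)); last by rewrite l2t ltrDl ltr01.
rewrite mulrDr (heatop_sgm_scale _ _ l0) (heatopZ _ _ _ msgm bsgm); congr (_ + _).
pose k s := heatop (l ^+ 2 * t - s) (fun x => - f (v s x)) (l *: x).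
have -> : duh (fun s x => - f (v s x)) (l ^+ 2 * t) (l *: x) = \int[mu]_(s in `]0, 0 + l ^+ 2 * t[) k s.
  by rewrite add0r.
have mk : measurable_fun setT k by exact: measurable_heatop_time.
have kb s : 0 < s < 0 + l ^+ 2 * t -> `|k s| <= 1.
  by rewrite add0r => st; exact: (@heatop_time_bound R N _ _ _ (l ^+ 2 * t) (l *: x) s mH HC st).
rewrite (Rintegral_affine_itv l2 mk kb) mulrA -RintegralZl//; last first.
  apply: (@integrable_itv _ _ _ _ 1).
    by apply: (measurableT_comp mk); apply: measurable_funD => //; exact: measurable_funM.
  move=> s /andP[s0 st]; apply: kb; rewrite addr0 add0r mulr_gt0//= ltr_pM2l//.
apply: eq_Rintegral => s; rewrite inE/= in_itv/= => /andP[s0 st].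
have l2s : 0 < l ^+ 2 * s by rewrite mulr_gt0.
rewrite /k addr0 -mulrBr -heatop_scale ?ltW// -(heatopZ _ _ (C := 1)); last 2 first.
- apply: (measurable_row_comp (mfun2_section (l ^+ 2 * s) mH)) => i.
  rewrite (_ : (fun _ => _) = (fun z : N.-tuple R => l * row_of_tuple z ord0 i)).
    by apply: measurable_funM => //; exact: row_coord_measurable.
  by apply/funext => p; rewrite mxE.
- move=> y; rewrite normrN (le_trans (absorption_bound alpha0 (v_bound _ l2s)))//.
  by rewrite /absorption normr1 powR1 mulr1.
congr (heatop _ _ x); apply/funext => y.
by rewrite /dil /dilation -/(c l) f_c//; ring.
Qed.

Let dil_mono l k t x : 0 < l -> l <= k -> 0 < t -> Om x -> dil l t x <= dil k t x.
Proof.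
move=> l0 lk t0 Ox; have k0 := lt_le_trans l0 lk.
have clk : c l <= c k.
  by rewrite /c ge0_ler_powR ?nnegrE ?(ltW l0) ?(ltW k0)// divr_ge0// ltW.
apply: (@pmild_mono (t + 1) (fun y => c l * sgm y) (fun y => c k * sgm y) (dil l) (dil k) (c k)) => //.
- exact: measurable_funM.
- by move=> y; rewrite normrM ger0_norm ?powR_ge0// (le_trans _ clk)// ler_piMr ?powR_ge0.
- exact: oddmZ.
- exact: measurable_funM.
- by move=> y; rewrite normrM ger0_norm ?powR_ge0// ler_piMr ?powR_ge0.
- exact: oddmZ.
- exact: mdil.
- by move=> s y /andP[s0 _]; apply: le_trans clk; exact: dil_bound.
- by move=> s /andP[s0 _]; exact: odil.
- exact: mdil.
- by move=> s y /andP[s0 _]; exact: dil_bound.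
- by move=> s /andP[s0 _]; exact: odil.
- exact: pdil.
- exact: pdil.
- by move=> y Oy; rewrite sgm_Omega// !mulr1.
- by rewrite t0 ltrDl ltr01.
Qed.

(** Integer parameters suffice to define the limit; real ones are recovered by monotonicity. *)
Let w n := dil n.+1%:R.
Let n0 n : 0 < n.+1%:R :> R. Proof. by rewrite ltr0n. Qed.

Let pmild_shift_bound T (u : R -> E -> R) tau : 0 < tau ->
  (forall t x, 0 < t -> Om x -> 0 <= u t x <= (alpha * t) `^ (- alpha^-1)) ->
  (forall t, 0 < t -> oddm m (u t)) ->
  forall t x, 0 <= t -> `|u (tau + t) x| <= (alpha * tau) `^ (- alpha^-1).
Proof.
move=> tau0 hu ou t x t0; have tt0 : 0 < tau + t by rewrite ltr_pwDl.
apply: (oddm_bound (ou _ tt0)) => [|z Oz]; first exact: powR_ge0.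
have /andP[h1 h2] := hu _ z tt0 Oz; rewrite ger0_norm//.
apply: le_trans h2 _; apply: powR_neg_le; rewrite ?mulr_gt0// ?invr_ge0 ?(ltW alpha0)//.
by rewrite ler_pM2l// lerDl.
Qed.

(* The rescaled solutions have initial values [l `^ (2 / alpha)], hence increase
   with [l] by comparison, and stay below [(alpha t)^(-1/alpha)]. *)
Lemma exists_rescaled_limit : exists V, [/\ mfun2 V, (forall t, 0 < t -> oddm m (V t)),
    (forall t x, 0 < t -> Om x -> 0 <= V t x <= (alpha * t) `^ (- alpha^-1)),
    (forall tau T, 0 < tau ->
       pmild T (V tau) (fun s x => - f (V (tau + s) x)) (fun s => V (tau + s))) &
    (forall l t x, 0 < l -> 0 < t -> Om x ->
      V (l ^- 2 / alpha + t) x <= dilation alpha l v t x <= V t x) /\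
    (forall t x, 0 < t -> dilation alpha n.+1%:R v t x @[n --> \oo] --> V t x)].
Proof.
have [||||V [mV oV wV]] := @oddm_increasing_limit R N m w (fun t => (alpha * t) `^ (- alpha^-1)).
- by move=> n; exact: mdil.
- by move=> n t t0; exact: odil.
- by move=> n t x t0 Ox; apply: dil_mono => //; rewrite ler_nat.
- by move=> n t x t0 Ox; have /andP[] := dil_le (n0 n) t0 Ox.
have hV t x : 0 < t -> Om x -> 0 <= V t x <= (alpha * t) `^ (- alpha^-1).
  move=> t0 Ox; apply/andP; split.
    apply: (ler_cvg_to (@cvg_cst _ _ _ _ _) (wV t x t0)); apply: nearW => n.
    by have /andP[] := dil_le (n0 n) t0 Ox.
  apply: (ler_cvg_to (wV t x t0) (@cvg_cst _ _ _ _ _)); apply: nearW => n.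
  by have /andP[] := dil_le (n0 n) t0 Ox.
have dn n t x : 0 < t -> Om x -> 0 <= w n t x <= (alpha * t) `^ (- alpha^-1).
  by move=> t0 Ox; exact: dil_le.
have on n t : 0 < t -> oddm m (w n t) by move=> t0; exact: odil.
have mfn n : mfun2 (fun s x => - f (w n s x)) by exact: (@mfun2_comp R N (fun r => - f r) (w n) mf (mdil (n0 n))).
have shift_m (u : R -> E -> R) tau : mfun2 u -> mfun2 (fun s => u (tau + s)).
  move=> mu_; exact: (mfun2_shift _ mu_).
have bsh n tau t x : 0 < tau -> 0 <= t -> `|w n (tau + t) x| <= (alpha * tau) `^ (- alpha^-1).
  by move=> tau0; exact: (@pmild_shift_bound 1 (w n) tau tau0 (dn n) (on n)).
have bwn n tau T : 0 < tau -> tbound (T - tau) ((alpha * tau) `^ (- alpha^-1)) (fun s => w n (tau + s)).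
  by move=> tau0 s y /andP[s0 _]; apply: bsh => //; exact: ltW.
have pw n tau T : 0 < tau -> 
    pmild T (w n tau) (fun s x => - f (w n (tau + s) x)) (fun s => w n (tau + s)).
  move=> tau0 t x /andP[t0 tT].
  have HC : tbound (tau + T) (f (c n.+1%:R)) (fun s x => - f (w n s x)).
    by move=> s y /andP[s0 _]; rewrite normrN absorption_bound// dil_bound.
  have := @pmild_restart R N (tau + T) _ _ (w n) (c n.+1%:R) (f (c n.+1%:R)) tau _ _ (mfn n) HC (pdil (n0 n)).
  apply.
  - exact: measurable_funM.
  - by move=> y; rewrite normrM ger0_norm ?powR_ge0// ler_piMr ?powR_ge0.
  - by rewrite tau0 ltrDl (lt_trans t0).
  - by rewrite t0 addrAC subrr add0r.
exists V; split=> //.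
- move=> tau T tau0 t x /andP[t0 tT].
  have c1 : w n (tau + t) x @[n --> \oo] --> V (tau + t) x by apply: wV; rewrite addr_gt0.
  have c2 : w n (tau + t) x @[n --> \oo] --> heatop t (V tau) x + duh (fun s x => - f (V (tau + s) x)) t x.
    rewrite (_ : (fun n => _) = (fun n => heatop t (w n tau) x + duh (fun s x => - f (w n (tau + s) x)) t x)); last first.
      by apply/funext => n; apply: (pw n tau T tau0); rewrite t0.
    apply: cvgD.
      apply: (heatop_cvg (C := (alpha * tau) `^ (- alpha^-1))).
      + by move=> n; apply: mfun2_section; exact: mdil.
      + by move=> n y; rewrite -{1}[tau]addr0; exact: bsh.
      + exact: mfun2_section.
      + by move=> y; exact: wV.
    apply: (duh_cvg (C := f ((alpha * tau) `^ (- alpha^-1)))).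
    + by apply: absorption_ge0; exact: powR_ge0.
    + by move=> n; exact: (shift_m _ tau (mfn n)).
    + by move=> n s y /andP[s0 _]; rewrite normrN absorption_bound// bsh// ltW.
    + exact: (shift_m _ tau (@mfun2_comp R N (fun r => - f r) V mf mV)).
    + move=> s y /andP[s0 _]; apply: cvgN; apply: continuous_cvg; first exact: continuous_absorption.
      by apply: wV; rewrite addr_gt0.
  exact: (cvg_unique (@norm_hausdorff _ R) c1 c2).
- split=> // l t x l0 t0 Ox; apply/andP; split.
  (* The time at which the universal bound (alpha tau)^(-1/alpha) equals [c l]. There every [w n]
     lies below the initial value of [dil l], so the solution restarted at tau stays below
     [dil l]. *)
  + pose tau := l ^- 2 / alpha.
    have tau0 : 0 < tau by rewrite divr_gt0// invr_gt0 exprn_gt0.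
    have ttau0 : 0 < tau + t by rewrite addr_gt0.
    have ctau : (alpha * tau) `^ (- alpha^-1) = c l.
      rewrite /tau mulrCA mulfV ?gt_eqF// mulr1 -powR_invn ?ltW// -powRrM mulrNN.
      by [].
    (* The comparison is made for each bounded [w n] and passed to the limit. *)
    apply: (ler_cvg_to (wV (tau + t) x ttau0) (@cvg_cst _ _ _ _ _)); apply: nearW => n.
    apply: (@pmild_mono (t + 1) (w n tau) (fun y => c l * sgm y) (fun s => w n (tau + s)) (dil l) (c l)) => //.
    * by apply: mfun2_section; exact: mdil.
    * by move=> y; rewrite -ctau -{1}[tau]addr0; exact: bsh.
    * exact: on.
    * exact: measurable_funM.
    * by move=> y; rewrite normrM ger0_norm ?powR_ge0// ler_piMr ?powR_ge0.
    * exact: oddmZ.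
    * by apply: shift_m; exact: mdil.
    * by move=> s y /andP[s0 _]; rewrite -ctau; apply: bsh => //; exact: ltW.
    * by move=> s /andP[s0 _]; apply: on; rewrite addr_gt0.
    * exact: mdil.
    * by move=> s y /andP[s0 _]; exact: dil_bound.
    * by move=> s /andP[s0 _]; exact: odil.
    * exact: pw.
    * exact: pdil.
    * move=> y Oy; rewrite sgm_Omega// mulr1 -ctau.
      by have /andP[] := dn n tau y tau0 Oy.
    * by rewrite t0 ltrDl ltr01.
  + pose k := Num.bound l.
    apply: (ler_cvg_to (@cvg_cst _ _ _ _ _) (wV t x t0)).
    near=> n; apply: dil_mono => //.
    have : (k <= n)%N by near: n; exact: nbhs_infty_ge.
    rewrite -(ler_nat R) => kn; apply: (@le_trans _ _ k%:R).
      exact/ltW/archi_boundP/ltW.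
    by apply: le_trans kn _; rewrite ler_nat.
Unshelve. all: by end_near. Qed.

Section limit_properties.
Variable V : R -> E -> R.
Hypothesis oV : forall t, 0 < t -> oddm m (V t).
Hypothesis mV : mfun2 V.
Hypothesis hV : forall t x, 0 < t -> Om x -> 0 <= V t x <= (alpha * t) `^ (- alpha^-1).
Hypothesis pV : forall tau T, 0 < tau ->
  pmild T (V tau) (fun s x => - f (V (tau + s) x)) (fun s => V (tau + s)).
Hypothesis sV : forall l t x, 0 < l -> 0 < t -> Om x ->
  V (l ^- 2 / alpha + t) x <= dilation alpha l v t x <= V t x.
Hypothesis cV : forall t x, 0 < t -> dilation alpha n.+1%:R v t x @[n --> \oo] --> V t x.

Lemma rescaled_limit_bound tau t x : 0 < tau -> tau <= t -> `|V t x| <= (alpha * tau) `^ (- alpha^-1).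
Proof.
move=> tau0 tt; have -> : t = tau + (t - tau) by rewrite addrC subrK.
by apply: (@pmild_shift_bound 1 V tau tau0 hV oV); rewrite subr_ge0.
Qed.

(** For a given interval [a, b] the solution is restarted at a / 2, from where on [V] is bounded;
    the constant therefore depends on a. *)
Lemma rescaled_limit_tmodulus T : tmodulus T V.
Proof.
move=> a b a0 bT.
pose tau := a / 2.
have tau0 : 0 < tau by rewrite divr_gt0.
pose B := (alpha * tau) `^ (- alpha^-1).
have mVt : mfun2 (fun s => V (tau + s)) by exact: (mfun2_shift _ mV).
have tm : tmodulus (T - tau) (fun s => V (tau + s)).
  apply: (@pmild_tmodulus R N (T - tau) (V tau) (fun s x => - f (V (tau + s) x)) (fun s => V (tau + s)) B (f B) B).
  - exact: mfun2_section.
  - by move=> y; exact: rescaled_limit_bound.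
  - exact: (@mfun2_comp R N (fun r => - f r) _ mf mVt).
  - by move=> s y /andP[s0 _]; rewrite normrN absorption_bound// rescaled_limit_bound// lerDl ltW.
  - exact: pV.
  - by move=> t; exact: mfun2_section.
  - by move=> s y /andP[s0 _]; rewrite rescaled_limit_bound// lerDl ltW.
have [||L L0 [h1 h2]] := tm (a - tau) (b - tau); last first.
- exists L => //; split.
    move=> t /andP[at_ tb] x y; have := h1 (t - tau) _ x y.
    by rewrite (addrC tau) subrK; apply; rewrite !lerD2r at_.
  move=> s t as_ st tb x; have := h2 (s - tau) (t - tau) _ _ _ x.
  have e1 r : tau + (r - tau) = r by rewrite addrC subrK.
  have e2 : t - tau - (s - tau) = t - s by ring.
  by rewrite !e1 e2; apply; rewrite lerD2r.
- by rewrite ltrD2r.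
- by rewrite subr_gt0 gtr_pMr// invf_lt1// ltr1n.
Qed.

Lemma oddm_eq phi psi x : oddm m phi -> oddm m psi -> (forall y, Om y -> phi y = psi y) ->
  phi x = psi x.
Proof.
move=> o1 o2 h; rewrite (oddmE o1) (oddmE o2) /oddext.
by have [->|[_ /h ->//]] := sgm_absm m x; rewrite !mul0r.
Qed.

(** Dilations compose multiplicatively, so the dilation of [V] is a limit of dilations of [v] with
    parameters (n + 1) l, and each of these is at most [V]. *)
Lemma rescaled_limit_dilation_le l t x : 0 < l -> 0 < t -> Om x -> dilation alpha l V t x <= V t x.
Proof.
move=> l0 t0 Ox; have l2t : 0 < l ^+ 2 * t by rewrite mulr_gt0// exprn_gt0.
have h : c l * dilation alpha n.+1%:R v (l ^+ 2 * t) (l *: x) @[n --> \oo] --> dilation alpha l V t x.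
  by apply: cvgM; [exact: cvg_cst|exact: cV].
apply: (ler_cvg_to h (@cvg_cst _ _ _ _ _)); apply: nearW => n.
have nl : 0 < n.+1%:R * l by rewrite mulr_gt0.
have -> : c l * dilation alpha n.+1%:R v (l ^+ 2 * t) (l *: x) = dilation alpha (n.+1%:R * l) v t x.
  rewrite /dilation -/(c n.+1%:R) -/(c (n.+1%:R * l)) cM// scalerA exprMn !mulrA (mulrC (c l))//.
by have /andP[] := sV nl t0 Ox.
Qed.

(** The preceding inequality for l^-1 at the dilated point is the reverse inequality for l. *)
Lemma rescaled_limit_self_similar l t x : 0 < l -> 0 < t -> dilation alpha l V t x = V t x.
Proof.
move=> l0 t0; have l2 : 0 < l ^+ 2 by exact: exprn_gt0.
have l2t : 0 < l ^+ 2 * t by rewrite mulr_gt0.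
apply: (@oddm_eq (dilation alpha l V t) (V t)); last 2 first.
- exact: oV.
- move=> y Oy; apply/eqP; rewrite eq_le rescaled_limit_dilation_le//=.
  have li0 : 0 < l^-1 by rewrite invr_gt0.
  have := rescaled_limit_dilation_le li0 l2t ((Om_scale y l0).2 Oy).
  rewrite /dilation -/(c l) -/(c l^-1) scalerA mulVf ?gt_eqF// scale1r exprVn mulrA mulVf ?gt_eqF// mul1r.
  rewrite -(ler_pM2l (c_gt0 l0)) mulrA -cM// mulfV ?gt_eqF//.
  by rewrite {1}/c powR1 mul1r.
- move=> i im y; rewrite /dilation -flipZ oV//.
  by rewrite mulrN.
Qed.

Lemma rescaled_limit_lower x : Om x ->
  alpha `^ (- alpha^-1) * heatop 1 sgm x <= V 1 x.
Proof.
move=> Ox.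
have h : (n.+1%:R ^- 2 + alpha * 1) `^ (- alpha^-1) * heatop 1 sgm x @[n --> \oo] -->
    alpha `^ (- alpha^-1) * heatop 1 sgm x.
  apply: cvgM; last exact: cvg_cst.
  have h1 : n.+1%:R ^- 2 + alpha * 1 @[n --> \oo] --> alpha.
    rewrite -[X in _ --> X]add0r; apply: cvgD; last by rewrite mulr1; exact: cvg_cst.
    rewrite (_ : (fun _ => _) = (fun n => n.+1%:R^-1 * n.+1%:R^-1)); last first.
      by apply/funext => n; rewrite expr2 invfM.
    rewrite -[X in _ --> X](mulr0 0); apply: cvgM; exact: cvg_harmonic.
  have hc : {for alpha, continuous (fun x : R => x `^ (- alpha^-1))}; last exact: (cvg_comp _ _ h1 hc).
  apply/differentiable_continuous/derivable1_diffP/derivable_powR.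
  by rewrite in_itv/= andbT.
apply: (ler_cvg_to h (@cvg_cst _ _ _ _ _)); apply: nearW => n.
have /andP[h1 _] := dil_flat (n0 n) ltr01 Ox; apply: le_trans h1 _.
by have /andP[] := sV (n0 n) ltr01 Ox.
Qed.

(* From time [eps] on the absorption is dropped. *)
Lemma rescaled_limit_upper eps x : 0 < eps < 1 -> Om x ->
  V 1 x <= (alpha * eps) `^ (- alpha^-1) * heatop (1 - eps) sgm x.
Proof.
move=> /andP[e0 e1] Ox; have e1' : 0 < 1 - eps by rewrite subr_gt0.
set B := (alpha * eps) `^ (- alpha^-1).
have mfV : mfun2 (fun s x => - f (V s x)) by exact: (@mfun2_comp R N (fun r => - f r) V mf mV).
have mfVe : mfun2 (fun s x => - f (V (eps + s) x)) by exact: (mfun2_shift _ mfV).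
have B0 : 0 <= B by exact: powR_ge0.
have bV t y : 0 <= t -> `|V (eps + t) y| <= B.
  by move=> t0; apply: rescaled_limit_bound => //; rewrite lerDl.
have -> : V 1 x = heatop (1 - eps) (V eps) x + duh (fun s x => - f (V (eps + s) x)) (1 - eps) x.
  have := @pV eps 1 e0 (1 - eps) x; rewrite (addrC eps) subrK; apply.
  by rewrite e1' gtrBl.
rewrite -(heatopZ _ _ _ msgm bsgm) -[leRHS]addr0; apply: lerD.
  apply: (@le_heatop R N m mN _ _ B (B * 1)).
  - exact: ltW.
  - exact: mfun2_section.
  - by move=> y; rewrite -{1}[eps]addr0 bV.
  - exact: oV.
  - exact: measurable_funM.
  - by move=> y; rewrite normrM ger0_norm// ler_wpM2l.
  - exact: oddmZ.
  - by move=> y Oy; rewrite sgm_Omega// mulr1; have /andP[] := hV e0 Oy.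
  - by [].
have HC : tbound (1 - eps) (f B) (fun s x => - f (V (eps + s) x)).
  by move=> s y /andP[s0 _]; rewrite normrN absorption_bound// bV// ltW.
have := @duh_le_derive R N _ _ (fun=> 0) (fun=> 0) (1 - eps) x 1 e1' mfVe HC (fun s _ => is_derive_cst _ _ _) (@cst_continuous _ _ (0 : R)).
rewrite subrr mul0r; apply => s /andP[s0 s1].
rewrite -(@heatop_cst R N (1 - eps - s) 0 x).
apply: (@le_heatop R N m mN _ _ (f B) 0).
- by rewrite subr_ge0 ltW.
- exact: (mfun2_section s mfVe).
- by move=> y; apply: HC; rewrite s0.
- by apply: (@oddm_comp R N m (fun r => - f r)) => [r|]; [rewrite absorptionN|apply: oV; rewrite addr_gt0].
- exact: measurable_cst.
- by move=> y; rewrite normr0.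
- by move=> i _ y; rewrite oppr0.
- move=> y Oy; rewrite oppr_le0; apply: absorption_ge0.
  by have /andP[] := hV (addr_gt0 e0 s0) Oy.
- by [].
Qed.

End limit_properties.

End rescaled_limit.

(** * Regularity *)

Section sequential_continuity.
Context {R : realType}.

Lemma cvg_pairT (T : Type) (F : set_system T) (FF : Filter F) (U V : topologicalType)
    (f : T -> U) (g : T -> V) (a : U) (b : V) :
  f x @[x --> F] --> a -> g x @[x --> F] --> b -> (f x, g x) @[x --> F] --> (a, b).
Proof. by move=> fa gb; exact: (cvg_pair fa gb). Qed.

(** Reduces continuity to sequences, along which dominated convergence is applied. *)
Lemma continuous_seq (T : pseudoMetricType R) (f : T -> R) (p : T) :
  (forall u : nat -> T, u n @[n --> \oo] --> p -> f (u n) @[n --> \oo] --> f p) ->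
  {for p, continuous f}.
Proof.
move=> h; apply/cvgrPdist_lt => e e0; apply: contrapT => nh.
have q n : exists q, ball p n.+1%:R^-1 q /\ ~ (`|f p - f q| < e).
  apply: contrapT => nq; apply: nh; apply/nbhs_ballP; exists n.+1%:R^-1.
    by rewrite /= invr_gt0 ltr0n.
  by move=> q pq; apply: contrapT => nfq; apply: nq; exists q.
have [u hu] := choice q.
have up : u n @[n --> \oo] --> p.
  apply/cvg_ballP => d d0.
  near=> n; apply: (@le_ball _ _ _ n.+1%:R^-1); last by have [] := hu n.
  by apply: ltW; near: n; exact: near_infty_natSinv_lt (PosNum d0).
have := h u up; move=> /cvgrPdist_lt/(_ e e0) [n _ hn].
by have [_ []] := hu n; apply: hn => /=.
Unshelve. all: by end_near. Qed.

End sequential_continuity.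

Section lines.
Context {R : realType} {N : nat}.
Notation mu := (@lebesgue_measure R).
Notation E := 'rV[R]_N.
Implicit Types (F G : E -> R) (x v : E).

Lemma is_derive_line F x v (k df : R) :
  is_derive (x + k *: v) v F df <-> is_derive k (1 : R) (fun h : R => F (x + h *: v)) df.
Proof.
have e : (fun h : R => h^-1 *: ((F \o shift (x + k *: v)) (h *: v) - F (x + k *: v))) =
    (fun h : R => h^-1 *: (((fun h : R => F (x + h *: v)) \o shift k) (h *: 1) - F (x + k *: v))).
  apply/funext => h /=; congr (_ *: (F _ - _)).
  by rewrite /shift/= scalerDl [h *: 1]mulr1 addrCA.
by split=> -[hd hv]; (split; [move: hd; rewrite /derivable e|move: hv; rewrite /derive e]).
Qed.

Lemma is_derive_line0 F x v (df : R) :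
  is_derive x v F df <-> is_derive (0 : R) (1 : R) (fun h : R => F (x + h *: v)) df.
Proof. by rewrite -is_derive_line scale0r addr0. Qed.

Lemma derive_line F G v : continuous G ->
  (forall x (h : R), 0 < h -> F (x + h *: v) - F x = \int[mu]_(k in `[0, h]) G (x + k *: v)) ->
  forall x, is_derive x v F (G x).
Proof.
move=> cG FG x.
(* Increments are known for positive steps only. Moving the base point back by [v] makes the
   parameter 1 an interior point, where the two-sided derivative can be taken. *)
pose g (k : R) := G (x - v + k *: v).
have cg : continuous g.
  move=> k; apply: (@continuous_comp _ _ _ (fun k : R => x - v + k *: v) G); last exact: cG.
  by apply: cvgD; [exact: cvg_cst|apply: cvgZ; [exact: cvg_id|exact: cvg_cst]].
have ig : mu.-integrable `[0, 2] (EFin \o g).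
  apply: continuous_compact_integrable; first exact: segment_compact.
  exact: continuous_subspaceT.
have [dI IE] := @continuous_FTC1_closed R g 0 1 2 ltac:(lra) ig ltac:(lra) (cg 1).
have d1 : is_derive (1 : R) 1 (fun y => \int[mu]_(t in `[0, y]) g t) (G x).
  have -> : G x = g 1 by rewrite /g scale1r subrK.
  by apply: (DeriveDef dI); rewrite -derive1E.
have d2 : is_derive (1 : R) 1 (fun h => F (x - v + h *: v)) (G x).
  have d3 : is_derive (1 : R) 1 (fun y => F (x - v) + \int[mu]_(t in `[0, y]) g t) (0 + G x).
    exact: is_deriveD.
  rewrite add0r in d3; apply: near_eq_is_derive d3.
  near=> y; rewrite -FG; first by rewrite addrC subrK.
  by near: y; apply: lt_nbhsr; lra.
by move/is_derive_line: d2; rewrite scale1r subrK.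
Unshelve. all: by end_near. Qed.

End lines.

Section taylor.
Context {R : realType}.

Lemma MVT_estimate (g g' : R -> R) (b A : R) : 0 <= A ->
  (forall r : R, is_derive r 1 g (g' r)) -> (forall r, `|r| <= `|b| -> `|g' r| <= A) ->
  `|g b - g 0| <= A * `|b|.
Proof.
move=> A0 dg gA.
have cg : continuous g by move=> r; apply/differentiable_continuous/derivable1_diffP; have [] := dg r.
have [b0|b0|->] := ltgtP 0 b.
- have [|c] := @MVT R g g' 0 b b0 (fun x _ => dg x); first exact: continuous_subspaceT.
  rewrite in_itv/= subr0 => /andP[c0 cb] ->; rewrite normrM ler_wpM2r// gA//.
  by rewrite !gtr0_norm ?ltW.
- have [|c] := @MVT R g g' b 0 b0 (fun x _ => dg x); first exact: continuous_subspaceT.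
  rewrite in_itv/= sub0r distrC => /andP[c0 cb] ->; rewrite normrM normrN ler_wpM2r// gA//.
  by rewrite !ltr0_norm// lerN2 ltW.
- by rewrite subrr normr0 mulr_ge0.
Qed.

Lemma taylor2_estimate (g g' g'' : R -> R) (b A e : R) : 0 <= e ->
  (forall r : R, is_derive r 1 g (g' r)) -> (forall r : R, is_derive r 1 g' (g'' r)) ->
  (forall r, `|r| <= `|b| -> `|g'' r - A| <= e) ->
  `|g b - g 0 - g' 0 * b - A * b ^+ 2 / 2| <= e * b ^+ 2.
Proof.
move=> e0 dg dg' gA.
pose G r := g r - g' 0 * r - A * r ^+ 2 / 2.
pose G' r := g' r - g' 0 - A * r.
have dG (r : R) : is_derive r 1 G (G' r).
  have h := dg r; rewrite /G /G'; apply: is_derive_eq.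
  rewrite /GRing.scale/=; by field.
have dG' (r : R) : is_derive r 1 G' (g'' r - A).
  have h := dg' r; rewrite /G'; apply: is_derive_eq.
  by rewrite /GRing.scale/=; ring.
have bG' r : `|r| <= `|b| -> `|G' r| <= e * `|b|.
  move=> rb; have := @MVT_estimate G' _ r e e0 dG' _.
  rewrite [G' 0]/G' mulr0 subrr subr0 subr0 => h.
  apply: le_trans (h _) _; last by rewrite ler_wpM2l.
  by move=> q qr; apply: gA; exact: le_trans rb.
have := @MVT_estimate G G' b (e * `|b|) (mulr_ge0 e0 (normr_ge0 b)) dG bG'.
have -> : G b - G 0 = g b - g 0 - g' 0 * b - A * b ^+ 2 / 2.
  by rewrite /G mulr0 expr0n/= mulr0 mul0r !subr0; ring.
have e2 : `|b| * `|b| = b ^+ 2 by rewrite -normrM -expr2 ger0_norm// sqr_ge0.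
by rewrite -(mulrA e) e2.
Qed.

End taylor.

(** * Duhamel integrals with regularised weights *)

Section weighted.
Context {R : realType} {N : nat}.
Notation mu := (@lebesgue_measure R).
Notation E := 'rV[R]_N.
Notation row := (@row_of_tuple R N).
Notation gN := (@gauss R N).
Implicit Types (K : R -> E -> R) (x y : E) (s t C : R).

Definition jcont K := forall p : R * E, {for p, continuous (fun p : R * E => K p.1 p.2)}.

(** Vanishing at nonpositive times lets the substituted integral run over an interval that does not
    depend on t; continuity across time 0 then makes it continuous in t. *)
Definition causal C K := [/\ jcont K, (forall s x, s <= 0 -> K s x = 0) &
  forall s x, `|K s x| <= C].

Lemma causal_mfun2 C K : causal C K -> mfun2 K.
Proof. by move=> [cK K0 _]; apply: mfun2_continuous => // t x _; exact: cK. Qed.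

Lemma jcont_section K s : jcont K -> continuous (K s).
Proof.
move=> cK x; apply: (@continuous_comp _ _ _ (fun y : E => (s, y)) (fun p : R * E => K p.1 p.2)); last exact: cK.
by apply: (@cvg_pairT E (nbhs x) _ R E (fun=> s) id s x); [exact: cvg_cst|exact: cvg_id].
Qed.

Variable B : R.
Definition dom : set (measurableTypeR R * N.-tuple R) := `]0, B[%classic `*` setT.
Notation nu := (mu \x gN)%E.

(* The Duhamel integral and its derivatives after the substitution
   [s = t - sigma^2 / 2], which removes the singularity of the weights. *)
Definition Phi (w : R * N.-tuple R -> R) K t x : R :=
  \int[nu]_(p in dom) (w p * K (t - p.1 ^+ 2 / 2) (x + p.1 *: row p.2)).

Definition weight (w : R * N.-tuple R -> R) :=
  measurable_fun setT w /\ nu.-integrable dom (EFin \o w).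

Lemma measurable_dom : measurable dom.
Proof. by apply: measurableX => //; exact: measurable_itv. Qed.

Lemma measurable_Phi_arg K t x : mfun2 K ->
  measurable_fun [set: R * N.-tuple R] (fun p => K (t - p.1 ^+ 2 / 2) (x + p.1 *: row p.2)).
Proof.
move=> mK; apply: (measurable_row_comp2 mK).
  by apply: measurable_funB => //; apply: measurable_funM => //; exact: measurable_funX.
move=> i; rewrite (_ : (fun _ => _) = (fun p : R * N.-tuple R => x ord0 i + p.1 * row p.2 ord0 i)).
  apply: measurable_funD => //; apply: measurable_funM => //.
  exact: (measurableT_comp (row_coord_measurable i)).
by apply/funext => p; rewrite !mxE.
Qed.

Lemma integrable_Phi w C K t x : weight w -> causal C K ->
  nu.-integrable dom (EFin \o (fun p => w p * K (t - p.1 ^+ 2 / 2) (x + p.1 *: row p.2))).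
Proof.
move=> [mw iw] cK; have [_ _ bK] := cK.
apply: (@integrable_dominated R _ _ nu dom _ (fun p => C * `|w p|)).
- exact: measurable_dom.
- by apply: measurable_funTS; apply: measurable_funM => //; apply: measurable_Phi_arg (causal_mfun2 cK).
- by apply: integrableZR; [exact: measurable_dom|exact: (integrable_norm iw)].
- by move=> p _; rewrite normrM mulrC ler_wpM2r.
Qed.

Lemma Phi_bound w C K t x : weight w -> causal C K ->
  `|Phi w K t x| <= C * \int[nu]_(p in dom) `|w p|.
Proof.
move=> [mw iw] cK; have [_ _ bK] := cK.
rewrite -RintegralZl; [|exact: measurable_dom|exact: (integrable_norm iw)].
apply: normr_Rintegral_dominated.
- exact: measurable_dom.
- by apply: measurable_funTS; apply: measurable_funM => //; apply: measurable_Phi_arg (causal_mfun2 cK).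
- by apply: integrableZR; [exact: measurable_dom|exact: (integrable_norm iw)].
- by move=> p _; rewrite normrM mulrC ler_wpM2r.
Qed.

Lemma Phi_continuous w C K : weight w -> causal C K -> jcont (Phi w K).
Proof.
move=> hw cK p; have [mw iw] := hw; have [jK _ bK] := cK.
apply: continuous_seq => u up.
have u1 : (u n).1 @[n --> \oo] --> p.1 by apply: cvg_comp up _; exact: cvg_fst.
have u2 : (u n).2 @[n --> \oo] --> p.2 by apply: cvg_comp up _; exact: cvg_snd.
apply: (@cvg_Rintegral R _ _ nu dom (fun n q => w q * K ((u n).1 - q.1 ^+ 2 / 2) ((u n).2 + q.1 *: row q.2)) _ (fun q => C * `|w q|)).
- exact: measurable_dom.
- by move=> n; apply: measurable_funTS; apply: measurable_funM => //; apply: measurable_Phi_arg (causal_mfun2 cK).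
- by apply: measurable_funTS; apply: measurable_funM => //; apply: measurable_Phi_arg (causal_mfun2 cK).
- move=> q _; apply: cvgM; first exact: cvg_cst.
  have h : ((u n).1 - q.1 ^+ 2 / 2, (u n).2 + q.1 *: row q.2) @[n --> \oo] --> (p.1 - q.1 ^+ 2 / 2, p.2 + q.1 *: row q.2).
    apply: cvg_pairT; first by apply: cvgB => //; exact: cvg_cst.
    by apply: cvgD => //; exact: cvg_cst.
  exact: (cvg_comp _ _ h (jK _)).
- by apply: integrableZR; [exact: measurable_dom|exact: (integrable_norm iw)].
- by move=> q n _; rewrite normrM mulrC ler_wpM2r.
Qed.

End weighted.

Section weighted_calculus.
Context {R : realType} {N : nat}.
Notation mu := (@lebesgue_measure R).
Notation E := 'rV[R]_N.
Notation row := (@row_of_tuple R N).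
Notation gN := (@gauss R N).
Notation dir i := (delta_mx ord0 i : 'rV[R]_N).
Notation nu := (mu \x gN)%E.
Implicit Types (K : R -> E -> R) (x y v : E) (s t C B : R) (F : E -> R).

Lemma is_derive_seq (W : normedModType R) (F : W -> R) (x v : W) (df : R) :
  (forall h : nat -> R, (forall n, h n != 0) -> h n @[n --> \oo] --> (0 : R) ->
    (h n)^-1 * (F (x + h n *: v) - F x) @[n --> \oo] --> df) ->
  is_derive x v F df.
Proof.
move=> hd.
have h : (fun h : R => h^-1 *: ((F \o shift x) (h *: v) - F x)) @ 0^' --> df.
  apply/cvgr_dnbhsP => u [u0 uc].
  rewrite (_ : (fun n => _) = (fun n => (u n)^-1 * (F (x + u n *: v) - F x))); first exact: hd.
  by apply/funext => n /=; rewrite /shift/= [u n *: v + x]addrC.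
by apply: DeriveDef; [apply/cvg_ex; exists df; exact: h|exact/cvg_lim].
Qed.

Variable B : R.

Lemma weight_sigma : weight (N := N) B (fun p => p.1).
Proof.
split; first exact: measurable_fst.
have mw : measurable_fun [set: measurableTypeR R * N.-tuple R] (fun p => p.1 : R) by exact: measurable_fst.
have : nu.-integrable (dom B) (EFin \o (fun p : measurableTypeR R * N.-tuple R => p.1 : R)).
  apply: (@integrable_bounded R _ _ nu (dom B) _ B).
  - exact: measurable_dom.
  - apply: product_measure_lty; [exact: measurable_itv|exact: measurableT|exact: itv_oo_fin|exact: gauss_fin].
  - exact: measurable_funTS.
  - by move=> p [/=]; rewrite in_itv/= => /andP[p0 pB] _; rewrite ger0_norm ltW.
exact.
Qed.

Lemma weight_coord (j : 'I_N) : weight (N := N) B (fun p => tnth p.2 j).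
Proof.
have mw : measurable_fun [set: R * N.-tuple R] (fun p => tnth p.2 j).
  by apply: measurable_tnth_comp; exact: measurable_snd.
split=> //.
apply/(integrable_mkcond _ (measurable_dom B)).2.
have mf : measurable_fun [set: measurableTypeR R * N.-tuple R]
    ((EFin \o (fun p : R * N.-tuple R => tnth p.2 j)) \_ (dom B)).
  apply/(measurable_restrictT _ _).1; first exact: measurable_dom.
  by apply: measurable_funTS; exact/measurable_EFinP.
apply/(@integrable12ltyP _ _ _ _ _ mu gN _ mf).2.
have iz := integrable_gauss_abs_coord (R := R) j.
have e (s : measurableTypeR R) : (\int[gN]_y `|((EFin \o (fun p : R * N.-tuple R => tnth p.2 j)) \_ (dom B)) (s, y)|)%E =
    ((fun=> (\int[gN]_y (`|tnth y j|)%:E)%E) \_ `]0, B[%classic) s.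
  rewrite /patch; case: ifPn => sB.
    apply: eq_integral => y _; rewrite /patch ifT//.
    by rewrite inE; split => //; rewrite inE in sB.
  rewrite (eq_integral (fun=> 0%E)) ?integral0// => y _.
  by rewrite /patch ifF ?abse0//; apply/negbTE; apply: contra sB; rewrite !inE => -[].
have -> : (\int[mu]_s \int[gN]_y `|((EFin \o (fun p : R * N.-tuple R => tnth p.2 j)) \_ (dom B)) (s, y)|)%E =
    (\int[mu]_s ((fun=> (\int[gN]_y (`|tnth y j|)%:E)%E) \_ `]0%R, B[%classic) s)%E.
  by apply: eq_integral => s _; exact: e.
rewrite -integral_mkcond integral_cst//.
have := integrable_fin_num measurableT iz.
have i0 : (0 <= \int[gN]_y (`|tnth y j|)%:E)%E by apply: integral_ge0 => y _; rewrite lee_fin.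
move=> fi; have := itv_oo_fin 0 B; rewrite -ge0_fin_numE// => fB.
by rewrite -ge0_fin_numE ?mule_ge0// fin_numM.
Qed.

Lemma Phi_iterated w C K t x : weight B w -> causal C K ->
  Phi B w K t x = \int[mu]_(s in `]0, B[) \int[gN]_z (w (s, z) * K (t - s ^+ 2 / 2) (x + s *: row z)).
Proof.
move=> hw cK.
rewrite /Phi -(@Rintegral12_in R _ _ _ _ mu gN `]0, B[%classic setT (fun p => w p * K (t - p.1 ^+ 2 / 2) (x + p.1 *: row p.2)))//.
exact: integrable_Phi hw cK.
Qed.

(** The Gaussian shift formula at scale sigma costs a factor sigma^-1, which is cancelled by the
    weight sigma of the substitution. What remains is the integrable weight [tnth p.2 j], without
    singularity. *)
Lemma Phi_shift C K t x (j : 'I_N) (h : R) : 0 < h -> causal C K ->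
  Phi B (fun p => p.1) K t (x + h *: dir j) - Phi B (fun p => p.1) K t x =
  \int[mu]_(k in `[0, h]) Phi B (fun p => tnth p.2 j) K t (x + k *: dir j).
Proof.
move=> h0 cK; have [jK K0 bK] := cK; have mK := causal_mfun2 cK.
have C0 : 0 <= C := le_trans (normr_ge0 _) (bK 0 0).
have mKs s : mfun_row (K s) by exact: mfun2_section.
pose A (q : R * R) := \int[gN]_z (tnth z j * K (t - q.1 ^+ 2 / 2) (x + q.2 *: dir j + q.1 *: row z)).
have mA : measurable_fun [set: measurableTypeR R * measurableTypeR R] A.
  apply: (@measurable_Rintegral2 R _ _ (measurableTypeR R * measurableTypeR R)%type _ gN setT
    (fun q => tnth q.2 j * K (t - q.1.1 ^+ 2 / 2) (x + q.1.2 *: dir j + q.1.1 *: row q.2))) => //.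
  have m11 : measurable_fun [set: (measurableTypeR R * measurableTypeR R) * N.-tuple R] (fun q => q.1.1 : R).
    exact: (measurableT_comp measurable_fst measurable_fst).
  have m12 : measurable_fun [set: (measurableTypeR R * measurableTypeR R) * N.-tuple R] (fun q => q.1.2 : R).
    exact: (measurableT_comp measurable_snd measurable_fst).
  apply: measurable_funM; first by apply: measurable_tnth_comp; exact: measurable_snd.
  apply: (measurable_row_comp2 mK).
    by apply: measurable_funB => //; apply: measurable_funM => //; exact: measurable_funX.
  move=> i; rewrite (_ : (fun _ => _) = (fun q : (measurableTypeR R * measurableTypeR R) * N.-tuple R =>
    x ord0 i + q.1.2 * (dir j) ord0 i + q.1.1 * tnth q.2 i)); last by apply/funext => q; rewrite !mxE.
  apply: measurable_funD; first by apply: measurable_funD => //; exact: measurable_funM.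
  by apply: measurable_funM => //; apply: measurable_tnth_comp; exact: measurable_snd.
have mAs (s : R) : measurable_fun [set: measurableTypeR R] (fun k => A (s, k)).
  exact: (measurableT_comp mA (@pair1_measurable _ _ (measurableTypeR R) (measurableTypeR R) s)).
have bA q : `|A q| <= C.
  apply: normr_Rintegral_gauss_coord => [|z]; last exact: bK.
  exact: measurable_heat_arg.
have mcc : measurable (`[0%R, h]%classic : set (measurableTypeR R)) by exact: measurable_itv.
have fcc : (mu `[0%R, h]%classic < +oo)%E.
  by rewrite lebesgue_measure_itv/=; case: ifP => // _; rewrite -EFinB ltry.
have eP x' : Phi B (fun p => p.1) K t x' = \int[mu]_(s in `]0, B[) (s * \int[gN]_z K (t - s ^+ 2 / 2) (x' + s *: row z)).
  rewrite (Phi_iterated _ _ weight_sigma cK); apply: eq_Rintegral => s _.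
  rewrite -RintegralZl//; apply: (integrable_gauss_bounded (C := C)) => [|z]; last exact: bK.
  exact: measurable_heat_arg.
have iP x' : mu.-integrable `]0, B[ (EFin \o (fun s => s * \int[gN]_z K (t - s ^+ 2 / 2) (x' + s *: row z))).
  apply: (@integrable_itv _ _ _ _ (B * C)).
    apply: measurable_funM => //.
    apply: (@measurable_Rintegral2 R _ _ (measurableTypeR R) _ gN setT (fun p => K (t - p.1 ^+ 2 / 2) (x' + p.1 *: row p.2))) => //.
    exact: measurable_Phi_arg.
  move=> s /andP[s0 sB]; rewrite normrM ler_pM// ?(ger0_norm (ltW s0)); first exact: ltW.
  apply: normr_Rintegral_gauss => [|z]; last exact: bK.
  exact: measurable_heat_arg.
rewrite !eP -RintegralB//.
transitivity (\int[mu]_(s in `]0, B[) \int[mu]_(k in `[0, h]) A (s, k)).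
  apply: eq_Rintegral => s; rewrite inE/= in_itv/= => /andP[s0 sB].
  rewrite -mulrBr (Rintegral_gauss_shift _ _ s0 h0 (mKs _) (bK _)) -RintegralZl//; last first.
    apply: integrableZR => //; apply: (integrable_bounded (C := C)) => //.
    - exact: measurable_funTS (mAs s).
    - by move=> k _; exact: (bA (s, k)).
  by apply: eq_Rintegral => k _; rewrite mulrA mulfV ?gt_eqF// mul1r.
rewrite (@Rintegral_fubini R _ _ _ _ mu mu `]0, B[%classic `[0, h]%classic A)//; last first.
  apply: (integrable_bounded (C := C)).
  - by apply: measurableX => //; exact: measurable_itv.
  - by apply: product_measure_lty => //; exact: itv_oo_fin.
  - exact: measurable_funTS.
  - by move=> q _; exact: bA.
by apply: eq_Rintegral => k _; rewrite (Phi_iterated _ _ (weight_coord j) cK).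
Qed.

Lemma is_derive_Phi_sigma C K t x (j : 'I_N) : causal C K ->
  is_derive x (dir j) (Phi B (fun p => p.1) K t) (Phi B (fun p => tnth p.2 j) K t x).
Proof.
move=> cK; apply: derive_line; last by move=> y h h0; exact: Phi_shift h0 cK.
by apply: jcont_section; exact: Phi_continuous (weight_coord j) cK.
Qed.

(** Here the derivative falls on the source, by dominated difference quotients. Combined with
    [is_derive_Phi_sigma], where it falls on the Gaussian, this gives second derivatives from one
    derivative of the source. *)
Lemma is_derive_Phi w C C' K K' t x v : weight B w -> causal C K -> causal C' K' ->
  (forall s y, is_derive y v (K s) (K' s y)) ->
  is_derive x v (Phi B w K t) (Phi B w K' t x).
Proof.
move=> hw cK cK' dK; have [mw iw] := hw; have [_ _ bK'] := cK'.
have C0 : 0 <= C' := le_trans (normr_ge0 _) (bK' 0 0).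
apply: is_derive_seq => h h0 hc.
have mq y : measurable_fun [set: measurableTypeR R * N.-tuple R] (fun p => w p * K (t - p.1 ^+ 2 / 2) (y + p.1 *: row p.2)).
  by apply: measurable_funM => //; exact: measurable_Phi_arg (causal_mfun2 cK).
rewrite (_ : (fun n => _) = (fun n => \int[nu]_(p in dom B) ((h n)^-1 *
    (w p * K (t - p.1 ^+ 2 / 2) (x + h n *: v + p.1 *: row p.2) - w p * K (t - p.1 ^+ 2 / 2) (x + p.1 *: row p.2)))%R)); last first.
  apply/funext => n; rewrite RintegralZl//; [|exact: measurable_dom|].
    rewrite RintegralB//; [exact: measurable_dom|exact: integrable_Phi hw cK|exact: integrable_Phi hw cK].
  have := integrableB (measurable_dom B) (integrable_Phi t (x + h n *: v) hw cK) (integrable_Phi t x hw cK).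
  by apply: eq_integrable; first exact: measurable_dom.
apply: (@cvg_Rintegral R _ _ nu (dom B) _ _ (fun q => C' * `|w q|)).
- exact: measurable_dom.
- by move=> n; apply: measurable_funTS; apply: measurable_funM => //; exact: measurable_funB.
- apply: measurable_funTS; apply: measurable_funM => //.
  exact: measurable_Phi_arg (causal_mfun2 cK').
- move=> p _.
  have d := (is_derive_line0 _ _ _ _).1 (dK (t - p.1 ^+ 2 / 2) (x + p.1 *: row p.2)).
  have [dd dv] := d.
  have h1 : (h n)^-1 * (K (t - p.1 ^+ 2 / 2) (x + p.1 *: row p.2 + h n *: v) - K (t - p.1 ^+ 2 / 2) (x + p.1 *: row p.2)) @[n --> \oo] --> K' (t - p.1 ^+ 2 / 2) (x + p.1 *: row p.2).
    have := dd; rewrite /derivable => /cvg_ex[l hl].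
    have ll : l = K' (t - p.1 ^+ 2 / 2) (x + p.1 *: row p.2).
      by rewrite -dv /derive; apply/esym/cvg_lim.
    move: hl; rewrite ll => /cvgr_dnbhsP/(_ h (conj h0 hc)).
    by under eq_fun do rewrite /= /shift/= addr0 [_ *: 1]mulr1 scale0r addr0.
  rewrite (_ : (fun n => _) = (fun n => w p * ((h n)^-1 * (K (t - p.1 ^+ 2 / 2) (x + p.1 *: row p.2 + h n *: v) - K (t - p.1 ^+ 2 / 2) (x + p.1 *: row p.2))))); last first.
    by apply/funext => n; rewrite -mulrBr mulrCA (addrAC x).
  by apply: cvgM => //; exact: cvg_cst.
- by apply: integrableZR; [exact: measurable_dom|exact: (integrable_norm iw)].
- move=> p n _; rewrite -mulrBr mulrCA normrM mulrC ler_wpM2r// normrM normfV.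
  rewrite mulrC ler_pdivrMr ?normr_gt0// addrAC.
  have := @MVT_estimate R (fun k => K (t - p.1 ^+ 2 / 2) (x + p.1 *: row p.2 + k *: v)) (fun k => K' (t - p.1 ^+ 2 / 2) (x + p.1 *: row p.2 + k *: v)) (h n) C' C0.
  rewrite scale0r addr0; apply => [r|r _]; last exact: bK'.
  by apply/is_derive_line; exact: dK.
Qed.

End weighted_calculus.

(** * Spatial derivatives of mild solutions *)

Section spatial_regularity.
Context {R : realType} {N : nat}.
Variable alpha : R.
Hypothesis alpha0 : 0 < alpha.
Notation mu := (@lebesgue_measure R).
Notation E := 'rV[R]_N.
Notation row := (@row_of_tuple R N).
Notation gN := (@gauss R N).
Notation dir i := (delta_mx ord0 i : 'rV[R]_N).
Notation f := (@absorption R alpha).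
Implicit Types (K u w : R -> E -> R) (x y v : E) (s t T C : R) (F phi : E -> R).

Lemma continuous_heatop_time C K t x : causal C K -> continuous (fun s => heatop (t - s) (K s) x).
Proof.
move=> cK s; have [jK _ bK] := cK; have mK := causal_mfun2 cK.
apply: (@continuous_seq R R (fun s => heatop (t - s) (K s) x)) => r rs.
apply: (@cvg_Rintegral R _ _ gN setT (fun n z => K (r n) (x + Num.sqrt (2 * (t - r n)) *: row z)) _ (fun=> C)) => //.
- by move=> n; apply: measurable_heat_arg; exact: mfun2_section.
- by apply: measurable_heat_arg; exact: mfun2_section.
- move=> z _.
  have h : (r n, x + Num.sqrt (2 * (t - r n)) *: row z) @[n --> \oo] --> (s, x + Num.sqrt (2 * (t - s)) *: row z).
    apply: cvg_pairT => //; apply: cvgD; first exact: cvg_cst.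
    apply: cvgZ; last exact: cvg_cst.
    apply: continuous_cvg; first exact: sqrt_continuous.
    by apply: cvgM; [exact: cvg_cst|apply: cvgB => //; exact: cvg_cst].
  exact: (cvg_comp _ _ h (jK _)).
- by apply: (integrable_gauss_bounded (C := C)) => // z; rewrite ger0_norm// (le_trans _ (bK 0 0)).
Qed.

(* The change of variables [s = t - sigma^2 / 2] is performed on a primitive. *)
Lemma duh_Phi C K t T x : 0 < t -> t <= T -> causal C K ->
  duh K t x = Phi (Num.sqrt (2 * T)) (fun p => p.1) K t x.
Proof.
move=> t0 tT cK; have [jK K0 bK] := cK; have mK := causal_mfun2 cK.
have T0 : 0 < T := lt_le_trans t0 tT.
pose B := Num.sqrt (2 * T); have B0 : 0 < B by rewrite sqrtr_gt0 mulr_gt0.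
have BT : B ^+ 2 / 2 = T by rewrite sqr_sqrtr ?mulr_ge0 ?(ltW T0)//; field.
pose k s := heatop (t - s) (K s) x.
have ck : continuous k := @continuous_heatop_time C K t x cK.
have mk := continuous_itv_measurable ck.
have kC s : `|k s| <= C by apply: heatop_bound => [|y]; [exact: mfun2_section|exact: bK].
have k0 s : s <= 0 -> k s = 0.
  move=> s0; rewrite /k (_ : K s = cst 0) ?heatop_cst//.
  by apply/funext => y; rewrite K0.
(* Strictly below t - T, so that the primitive [F] is differentiable on the whole range of t -
   sigma^2 / 2 for 0 <= sigma <= B. *)
pose a := t - T - 1.
pose F r := \int[mu]_(s in `[a, r]) k s.
have mcc (p q : R) : (mu `[p, q]%classic < +oo)%E.
  by rewrite lebesgue_measure_itv/=; case: ifP => // _; rewrite -EFinB ltry.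
have icc (p q : R) : mu.-integrable `[p, q] (EFin \o k).
  apply: (integrable_bounded (C := C)); [exact: measurable_itv|have := mcc p q; exact| |by move=> z _].
  exact: measurable_funTS.
have dF (r : R) : a < r -> is_derive r 1 F (k r).
  move=> ar; have [d1 d2] := @continuous_FTC1_closed R k a r (r + 1) ltac:(lra) (icc _ _) ar (ck r).
  by apply: (DeriveDef d1); rewrite -derive1E.
have dP (s : R) : 0 <= s <= B -> is_derive s 1 (fun s => - F (t - s ^+ 2 / 2)) (s * k (t - s ^+ 2 / 2)).
  move=> /andP[s0 sB].
  have as_ : a < t - s ^+ 2 / 2.
    have : s ^+ 2 / 2 <= T by rewrite -BT ler_pM2r ?invr_gt0// lerXn2r ?nnegrE// ltW.
    by rewrite /a; lra.
  have d1 : is_derive s 1 (fun s : R => t - s ^+ 2 / 2) (- s).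
    by apply: is_derive_eq; rewrite /GRing.scale/=; field.
  have d2 := is_deriveN (@is_derive1_comp R F (fun s => t - s ^+ 2 / 2) s _ _ (dF _ as_) d1).
  by apply: is_derive_eq; rewrite mulrN opprK mulrC.
have cP (s : R) : 0 <= s <= B -> {for s, continuous (fun s => s * k (t - s ^+ 2 / 2))}.
  move=> _; apply: cvgM; first exact: cvg_id.
  apply: (@continuous_comp _ _ _ (fun s : R => t - s ^+ 2 / 2) k); last exact: ck.
  apply: cvgB; first exact: cvg_cst.
  by apply: cvgM; [exact: exprn_continuous|exact: cvg_cst].
have eI := Rintegral_derive B0 dP cP.
rewrite expr0n/= mul0r subr0 BT in eI.
(* Extending the integral from (0, t) to (t - T, t) adds nothing: t - T <= 0 and [k] vanishes at
   nonpositive times. *)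
have -> : duh K t x = F t - F (t - T).
  rewrite /F Rintegral_itvB//; last 2 first.
  - by rewrite bnd_simp /a; lra.
  - by rewrite bnd_simp; lra.
  rewrite -Rintegral_itv_bndo_bndc; last by apply: (@integrable_itv _ _ _ _ C).
  rewrite /duh !Rintegral_itv_mkcond; apply: eq_Rintegral => s _.
  have [s0|s0] := ltP 0 s; first by rewrite (_ : t - T < s)//; lra.
  by rewrite -/(k s) k0//; case: ifP.
rewrite (Phi_iterated _ _ (weight_sigma B) cK).
transitivity (\int[mu]_(s in `]0, B[) (s * k (t - s ^+ 2 / 2))).
  rewrite (_ : F t - F (t - T) = - F (t - T) - - F t); last by rewrite opprK addrC.
  rewrite -eI.
  have mkk : measurable_fun setT (fun s => s * k (t - s ^+ 2 / 2)).
    apply: measurable_funM => //; apply: (measurableT_comp mk).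
    by apply: measurable_funB => //; apply: measurable_funM => //; exact: measurable_funX.
  have bkk s : 0 <= s <= B -> `|s * k (t - s ^+ 2 / 2)| <= B * C.
    by move=> /andP[s0 sB]; rewrite normrM ler_pM// ger0_norm.
  rewrite -Rintegral_itv_bndo_bndc; last first.
    apply: (integrable_bounded (C := B * C)) => //.
    - have : (mu `[0%R, B[%classic < +oo)%E by rewrite lebesgue_measure_itv/=; case: ifP => // _; rewrite -EFinB ltry.
      exact.
    - exact: measurable_funTS.
    - by move=> s /=; rewrite in_itv/= => /andP[s0 sB]; apply: bkk; rewrite s0 ltW.
  rewrite -Rintegral_itv_obnd_cbnd//.
  by apply: (@integrable_itv _ _ _ _ (B * C)) => // s /andP[s0 sB]; apply: bkk; rewrite !ltW.
apply: eq_Rintegral => s; rewrite inE/= in_itv/= => /andP[s0 sB].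
rewrite -RintegralZl//; last first.
  by apply: (heatop_integrable (C := C)); [exact: mfun2_section|exact: bK].
rewrite subKr; apply: eq_Rintegral => z _.
by rewrite (_ : 2 * (s ^+ 2 / 2) = s ^+ 2) ?sqrtr_sqr ?ger0_norm ?ltW//; field.
Qed.

(** A majorant that depends on time only and vanishes at both ends forces the extension by zero to
    be continuous, uniformly in x. *)
Lemma causal_cutoff T C K (om : R -> R) : 0 < T -> 0 <= C ->
  (forall t x, 0 < t < T -> {for (t, x), continuous (fun p : R * E => K p.1 p.2)}) ->
  continuous om -> om 0 = 0 -> om T = 0 ->
  (forall t x, 0 < t < T -> `|K t x| <= om t) -> (forall t, 0 < t < T -> om t <= C) ->
  causal C (fun t => if 0 < t < T then K t else cst 0).
Proof.
move=> T0 C0 cK com om0 omT Kom omC; split.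
- move=> [t x]; have [tT|ntT] := boolP (0 < t < T).
    have /andP[t0 t1] := tT.
    have cf : p.1 @[p --> (t, x)] --> t by exact: cvg_fst.
    have n1 : \forall p \near (t, x), 0 < p.1 by exact: (cvgr_gt _ cf).
    have n2 : \forall p \near (t, x), p.1 < T by exact: (cvgr_lt _ cf).
    have h : K p.1 p.2 @[p --> (t, x)] --> K t x := cK t x tT.
    rewrite /prop_for /continuous_at/= tT; apply: cvg_trans h.
    apply: near_eq_cvg; near=> p.
    have -> // : 0 < p.1 < T by apply/andP; split; near: p; [exact: n1|exact: n2].
  (* Clamping to [0, T] turns [om] into a continuous majorant on the whole line that is 0 outside
     (0, T), ready for a squeeze. *)
  pose cl (s : R) := Num.min (Num.max s 0) T.
  have ccl : continuous cl.
    move=> s; apply: (@continuous_min _ _ (fun s => Num.max s 0) (fun=> T)); last exact: cvg_cst.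
    by apply: (@continuous_max _ _ id (fun=> 0)); [exact: cvg_id|exact: cvg_cst].
  have e0 : om (cl t) = 0.
    rewrite /cl; move: ntT; rewrite negb_and -!leNgt => /orP[t0|tT].
      by rewrite (max_r t0) (min_l (ltW T0)).
    by rewrite (max_l (le_trans (ltW T0) tT)) (min_r tT).
  rewrite /prop_for /continuous_at/= (negbTE ntT); apply/norm_cvg0P.
  apply: (@squeeze_cvgr _ _ _ _ (fun=> 0) (fun p : R * E => `|om (cl p.1)|)).
  + apply: nearW => p; rewrite normr_ge0/=; case: ifPn => pT; last by rewrite normr0.
    apply: le_trans (Kom _ _ pT) _; have /andP[p0 p1] := pT.
    by rewrite /cl max_l ?(ltW p0)// min_l ?(ltW p1)// ler_norm.
  + exact: cvg_cst.
  + have : `|om (cl p.1)| @[p --> (t, x)] --> `|om (cl t)|.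
      apply: cvg_norm; apply: (cvg_comp (fun p : R * E => p.1) (om \o cl)); first exact: cvg_fst.
      by apply: (@continuous_comp _ _ _ cl om); [exact: ccl|exact: com].
    by rewrite e0 normr0.
- by move=> s x s0; rewrite ltNge s0.
- move=> s x; case: ifPn => sT; last by rewrite normr0.
  exact: le_trans (Kom _ _ sT) (omC _ sT).
Unshelve. all: by end_near. Qed.

Definition lreg T w :=
  (forall t x, 0 < t < T -> {for (t, x), continuous (fun p : R * E => w p.1 p.2)}) /\
  (forall a b, 0 < a -> b < T -> exists2 C : R, 0 <= C &
     forall t x, a <= t <= b -> `|w t x| <= C).

Lemma lreg_ext T w w' : (forall t x, 0 < t < T -> w t x = w' t x) -> lreg T w -> lreg T w'.
Proof.
move=> ww [cw bw]; split.
- move=> t x tT; have /andP[t0 t1] := tT.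
  have cf : p.1 @[p --> (t, x)] --> t by exact: cvg_fst.
  have n1 : \forall p \near (t, x), 0 < p.1 by exact: (cvgr_gt _ cf).
  have n2 : \forall p \near (t, x), p.1 < T by exact: (cvgr_lt _ cf).
  have h : w p.1 p.2 @[p --> (t, x)] --> w t x := cw t x tT.
  rewrite /prop_for /continuous_at/= -ww//; apply: cvg_trans h.
  apply: near_eq_cvg; near=> p; apply/ww.
  by apply/andP; split; near: p; [exact: n1|exact: n2].
- move=> a b a0 bT; have [C C0 h] := bw a b a0 bT; exists C => // t x tab.
  have /andP[at_ tb] := tab.
  by rewrite -ww ?h// (lt_le_trans a0 at_) (le_lt_trans tb bT).
Unshelve. all: by end_near. Qed.

(** The notion is local in time, so it may be checked on solutions restarted at times that depend on
    the interval. *)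
Lemma lreg_shift T w :
  (forall a b, 0 < a -> a <= b -> b < T -> exists tau T', [/\ tau < a, b < tau + T' &
     lreg T' (fun s => w (tau + s))]) -> lreg T w.
Proof.
move=> h; split.
- move=> t x /andP[t0 tT]; have [tau [T' [ta tb [cw _]]]] := h t t t0 (lexx t) tT.
  have tT' : 0 < t - tau < T' by rewrite subr_gt0 ta ltrBlDl.
  have c : w (tau + p.1) p.2 @[p --> (t - tau, x)] --> w (tau + (t - tau)) x := cw (t - tau) x tT'.
  rewrite (addrC tau) subrK in c.
  have c2 : (p.1 - tau, p.2) @[p --> (t, x)] --> (t - tau, x).
    apply: cvg_pairT; last exact: cvg_snd.
    by apply: cvgB; [exact: cvg_fst|exact: cvg_cst].
  have := cvg_comp _ _ c2 c; rewrite /comp/=.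
  by under eq_fun do rewrite (addrC tau) subrK.
- move=> a b a0 bT; have [ab|ba] := leP a b; last first.
    exists 0 => // t x /andP[at_ tb]; by have := le_lt_trans (le_trans at_ tb) ba; rewrite ltxx.
  have [tau [T' [ta tb [_ bw]]]] := h a b a0 ab bT.
  have [C C0 hC] := bw (a - tau) (b - tau) ltac:(by rewrite subr_gt0) ltac:(by rewrite ltrBlDl).
  exists C => // t x /andP[at_ tb']; have := hC (t - tau) x.
  by rewrite (addrC tau) subrK; apply; rewrite !lerD2r at_.
Qed.

(* [cut T] and its derivative vanish at [0] and [T]: the product of [cut T] with a
   solution has initial value [0] and a source continuous on the whole line. *)
Definition cut T s : R := s ^+ 2 * (T - s) ^+ 2.
Definition dcut T s : R := 2 * s * (T - s) ^+ 2 - 2 * s ^+ 2 * (T - s).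

Lemma is_derive_cut T (s : R) : is_derive s 1 (cut T) (dcut T s).
Proof.
rewrite /cut /dcut; apply: is_derive_eq; rewrite /GRing.scale/=; ring.
Qed.

Lemma continuous_cut T : continuous (cut T).
Proof. by move=> s; apply/differentiable_continuous/derivable1_diffP; have [] := is_derive_cut T s. Qed.

Lemma continuous_dcut T : continuous (dcut T).
Proof.
have d (s : R) : is_derive s 1 (dcut T) (2 * (T - s) ^+ 2 - 8 * s * (T - s) + 2 * s ^+ 2).
  rewrite /dcut; apply: is_derive_eq; rewrite /GRing.scale/=; ring.
by move=> s; apply/differentiable_continuous/derivable1_diffP; have [] := d s.
Qed.

Lemma cut_gt0 T s : 0 < s < T -> 0 < cut T s.
Proof. by move=> /andP[s0 sT]; rewrite mulr_gt0// exprn_gt0// subr_gt0. Qed.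

Lemma lreg_cut T C w : 0 < T -> jcont w -> (forall t x, `|w t x| <= C) ->
  lreg T (fun t x => (cut T t)^-1 * w t x).
Proof.
move=> T0 cw bw; split.
- move=> t x tT; apply: cvgM; last exact: cw.
  apply: cvgV; first by rewrite gt_eqF// cut_gt0.
  by apply: (cvg_comp (fun p : R * E => p.1) (cut T)); [exact: cvg_fst|exact: continuous_cut].
- move=> a b a0 bT.
  have C0 : 0 <= C := le_trans (normr_ge0 _) (bw 0 0).
  have [ab|ba] := leP a b; last first.
    exists 0 => // t x /andP[at_ tb]; by have := le_lt_trans (le_trans at_ tb) ba; rewrite ltxx.
  pose c := a ^+ 2 * (T - b) ^+ 2.
  have Tb : 0 < T - b by rewrite subr_gt0.
  have c0 : 0 < c by rewrite mulr_gt0// exprn_gt0.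
  exists (c^-1 * C); first by rewrite mulr_ge0// invr_ge0 ltW.
  move=> t x /andP[at_ tb]; have t0 := lt_le_trans a0 at_; have tT := le_lt_trans tb bT.
  have tc : 0 < cut T t by rewrite cut_gt0// t0.
  rewrite normrM ler_pM// gtr0_norm ?invr_gt0// lef_pV2 ?posrE//.
  rewrite /c /cut ler_pM ?exprn_ge0 ?(ltW a0) ?(ltW Tb)//.
    by rewrite ler_sqr ?nnegrE//; exact: ltW.
  rewrite ler_sqr ?nnegrE ?subr_ge0 ?lerD2l ?lerN2//; exact: ltW.
Qed.

Lemma cutoff_source T w1 w2 A1 A2 : 0 < T -> 0 <= A1 -> 0 <= A2 ->
  (forall t x, 0 < t < T -> {for (t, x), continuous (fun p : R * E => w1 p.1 p.2)}) ->
  (forall t x, 0 < t < T -> {for (t, x), continuous (fun p : R * E => w2 p.1 p.2)}) ->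
  (forall t x, 0 < t < T -> `|w1 t x| <= A1) -> (forall t x, 0 < t < T -> `|w2 t x| <= A2) ->
  exists C, causal C (fun t => if 0 < t < T then (fun x => dcut T t * w1 t x + cut T t * w2 t x) else cst 0).
Proof.
move=> T0 A10 A20 c1 c2 b1 b2.
pose om (s : R) := A1 * `|dcut T s| + A2 * `|cut T s|.
have com : continuous om.
  move=> s; apply: cvgD; (apply: cvgM; first exact: cvg_cst); apply: cvg_norm.
    exact: continuous_dcut.
  exact: continuous_cut.
have [C C0 hC] := continuous_itv_bound 0 T com.
exists C; apply: (@causal_cutoff T C (fun t x => dcut T t * w1 t x + cut T t * w2 t x) om) => //.
- move=> t x tT; apply: cvgD; apply: cvgM.
  + by apply: (cvg_comp (fun p : R * E => p.1) (dcut T)); [exact: cvg_fst|exact: continuous_dcut].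
  + exact: c1.
  + by apply: (cvg_comp (fun p : R * E => p.1) (cut T)); [exact: cvg_fst|exact: continuous_cut].
  + exact: c2.
- by rewrite /om /dcut /cut !expr0n/= !(mulr0, mul0r) subr0 normr0 !mulr0 addr0.
- by rewrite /om /dcut /cut !subrr !expr0n/= !(mulr0, mul0r) subr0 normr0 !mulr0 addr0.
- move=> t x tT; rewrite (le_trans (ler_normD _ _))// /om !normrM lerD// mulrC ler_wpM2r//; [exact: b1|exact: b2].
- by move=> t /andP[t0 tT]; apply: le_trans (ler_norm _) (hC t _); rewrite !ltW.
Qed.

Lemma is_deriveMl c F x v (df : R) :
  is_derive x v F df -> is_derive x v (fun y => c * F y) (c * df).
Proof. exact: is_deriveZ. Qed.

Lemma partialE F i x (df : R) : is_derive x (dir i) F df -> partial i F x = df.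
Proof. by move=> [_]. Qed.

Section mild.
Variables (T : R) (phi : E -> R) (u : R -> E -> R) (Bp Bu : R).
Hypotheses (T0 : 0 < T) (mphi : mfun_row phi) (phiB : forall y, `|phi y| <= Bp).
Hypotheses (mu_ : mfun2 u) (uB : tbound T Bu u).
Hypothesis pu : pmild T phi (fun s x => - f (u s x)) u.
Hypothesis tu : tmodulus T u.

Let Bu0 : 0 <= Bu. Proof. exact: tbound_ge0 T0 uB. Qed.

(** The source of the equation satisfied by [cut T t * u t], as given by [pmild_product]. *)
Let G t : E -> R := if 0 < t < T then (fun x => dcut T t * u t x + cut T t * - f (u t x)) else cst 0.

Let cu t x : 0 < t < T -> {for (t, x), continuous (fun p : R * E => u p.1 p.2)}.
Proof. exact: tmodulus_continuous. Qed.

Let cG : exists C, causal C G.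
Proof.
apply: (@cutoff_source T u (fun t x => - f (u t x)) Bu (f Bu)) => //.
- exact: absorption_ge0.
- move=> t x tT; apply: cvgN; apply: (continuous_cvg _ _ (cu tT)).
  exact: continuous_absorption.
- by move=> t x tT; rewrite normrN absorption_bound// uB.
Qed.

Let BT := Num.sqrt (2 * T).
Let uPhi t x : 0 < t < T -> u t x = (cut T t)^-1 * Phi BT (fun p => p.1) G t x.
Proof.
move=> tT; have /andP[t0 t1] := tT; have [C hC] := cG.
rewrite -(duh_Phi x t0 (ltW t1) hC).
have HC : tbound T (f Bu) (fun s x => - f (u s x)).
  by move=> s y sT; rewrite normrN absorption_bound// uB.
have mH : mfun2 (fun s x => - f (u s x)).
  have mf : measurable_fun setT (fun r : R => - f r).
    by apply: measurableT_comp => //; exact: measurable_absorption.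
  exact: (@mfun2_comp R N (fun r => - f r) u mf mu_).
have := pmild_product (is_derive_cut T) (@continuous_dcut T) mphi phiB mH HC mu_ uB pu x tT.
have -> : cut T 0 = 0 by rewrite /cut expr0n/= mul0r.
have -> : heatop t (fun x0 => 0 * phi x0) x = 0.
  by rewrite (_ : (fun _ => _) = cst 0) ?heatop_cst//; apply/funext => y; rewrite mul0r.
rewrite add0r => e.
have -> : duh G t x = cut T t * u t x.
  rewrite e; apply: duhE_ext => s /andP[s0 st].
  by rewrite /G s0 (lt_trans st t1).
by rewrite mulrA mulVf ?mul1r// gt_eqF// cut_gt0.
Qed.

Let uPhiE t : 0 < t < T -> u t = (fun x => (cut T t)^-1 * Phi BT (fun p => p.1) G t x).
Proof. by move=> tT; apply/funext => x; exact: uPhi. Qed.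

Let is_derive_u i t x : 0 < t < T ->
  is_derive x (dir i) (u t) ((cut T t)^-1 * Phi BT (fun p => tnth p.2 i) G t x).
Proof.
move=> tT; have [C hC] := cG; rewrite uPhiE//.
have := is_derive_Phi_sigma BT t x i hC.
move=> h; exact: is_deriveMl h.
Qed.

Lemma mild_derivable i t x : 0 < t < T -> derivable (u t) x (dir i).
Proof. by move=> tT; have [] := is_derive_u i x tT. Qed.

Lemma mild_partial_lreg i : lreg T (fun t => partial i (u t)).
Proof.
have [C hC] := cG.
apply: (@lreg_ext T (fun t x => (cut T t)^-1 * Phi BT (fun p => tnth p.2 i) G t x)).
  by move=> t x tT; apply/esym/partialE; exact: is_derive_u.
apply: (lreg_cut T0 (Phi_continuous (weight_coord BT i) hC)) => t x.
exact: Phi_bound (weight_coord BT i) hC.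
Qed.

Variable Bd : R.
Hypothesis Bd0 : 0 <= Bd.
Hypothesis dB : forall i t x, 0 < t < T -> `|partial i (u t) x| <= Bd.

Notation df := (fun r : R => (alpha + 1) * `|r| `^ alpha).

(** The derivative of [G] in direction [i]. It is a causal source only if the first derivatives of
    [u] are bounded up to time 0; this is the hypothesis [dB], which a restart at a positive time
    provides. *)
Let Gd i t : E -> R := if 0 < t < T then
  (fun x => dcut T t * partial i (u t) x + cut T t * - (df (u t x) * partial i (u t) x)) else cst 0.

Let cGd i : exists C, causal C (Gd i).
Proof.
have [cd _] := mild_partial_lreg i.
apply: (@cutoff_source T (fun t x => partial i (u t) x) (fun t x => - (df (u t x) * partial i (u t) x)) Bd (df Bu * Bd)) => //.
- by rewrite mulr_ge0// mulr_ge0 ?powR_ge0// addr_ge0// ltW.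
- move=> t x tT; apply: cvgN; apply: cvgM; last exact: cd.
  have h : u p.1 p.2 @[p --> (t, x)] --> u t x := cu tT.
  have hc : continuous df := continuous_dabsorption alpha0.
  have h2 : df (u p.1 p.2) @[p --> (t, x)] --> df (u t x) := cvg_comp _ _ h (hc (u t x)).
  exact: h2.
- exact: dB.
- move=> t x tT; rewrite normrN normrM ler_pM ?dB//.
  have a1 : 0 <= alpha + 1 by rewrite addr_ge0// ltW.
  rewrite normrM (ger0_norm a1) (ger0_norm (powR_ge0 _ _)) (ger0_norm Bu0) ler_wpM2l//.
  by rewrite ge0_ler_powR ?nnegrE ?(ltW alpha0)// uB.
Qed.

Let is_derive_G i s y : is_derive y (dir i) (G s) (Gd i s y).
Proof.
rewrite /G /Gd; case: ifPn => sT; last exact: is_derive_cst.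
have du : is_derive y (dir i) (u s) (partial i (u s) y).
  by apply: DeriveDef => //; exact: mild_derivable.
have df_ : is_derive y (dir i) (fun x => f (u s x)) (df (u s y) * partial i (u s) y).
  apply/is_derive_line0.
  have h := (is_derive_line0 _ _ _ _).1 du.
  have e : u s y = u s (y + 0 *: dir i) by rewrite scale0r addr0.
  have h2 := is_derive_absorption alpha0 (u s (y + 0 *: dir i)).
  have := @is_derive1_comp R f (fun h => u s (y + h *: dir i)) 0 _ _ h2 h.
  by rewrite -e.
have h1 := is_deriveMl (dcut T s) du; have h2 := is_deriveMl (cut T s) (is_deriveN df_).
exact: is_deriveD h1 h2.
Qed.

(** The first derivative is written again with the weight sigma, the source being differentiated, so
    that the next one can fall on the Gaussian. *)
Let partialPhi i t : 0 < t < T ->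
  partial i (u t) = (fun x => (cut T t)^-1 * Phi BT (fun p => p.1) (Gd i) t x).
Proof.
move=> tT; apply/funext => x; apply: partialE; rewrite uPhiE//.
have [C hC] := cG; have [C' hC'] := cGd i.
have h := is_derive_Phi t x (weight_sigma BT) hC hC' (is_derive_G i).
exact: is_deriveMl h.
Qed.

Let is_derive_partial i j t x : 0 < t < T ->
  is_derive x (dir j) (partial i (u t)) ((cut T t)^-1 * Phi BT (fun p => tnth p.2 j) (Gd i) t x).
Proof.
move=> tT; rewrite partialPhi//; have [C hC] := cGd i.
exact: is_deriveMl (is_derive_Phi_sigma BT t x j hC).
Qed.

Lemma mild_partial_derivable i j t x : 0 < t < T -> derivable (partial i (u t)) x (dir j).
Proof. by move=> tT; have [] := is_derive_partial i j x tT. Qed.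

Lemma mild_partial2_lreg i j : lreg T (fun t => partial j (partial i (u t))).
Proof.
have [C hC] := cGd i.
apply: (@lreg_ext T (fun t x => (cut T t)^-1 * Phi BT (fun p => tnth p.2 j) (Gd i) t x)).
  by move=> t x tT; apply/esym/partialE; exact: is_derive_partial.
apply: (lreg_cut T0 (Phi_continuous (weight_coord BT j) hC)) => t x.
exact: Phi_bound (weight_coord BT j) hC.
Qed.

End mild.

End spatial_regularity.

Section generator.
Context {R : realType} {N : nat}.
Notation E := 'rV[R]_N.
Notation row := (@row_of_tuple R N).
Notation gN := (@gauss R N).
Notation dir i := (delta_mx ord0 i : 'rV[R]_N).
Implicit Types (x y v : E) (z : N.-tuple R).

Lemma is_derive_seq_lt (W : normedModType R) (F : W -> R) (x v : W) (df d : R) : 0 < d ->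
  (forall h : nat -> R, (forall n, h n != 0) -> (forall n, `|h n| < d) ->
     h n @[n --> \oo] --> (0 : R) ->
    (h n)^-1 * (F (x + h n *: v) - F x) @[n --> \oo] --> df) ->
  is_derive x v F df.
Proof.
move=> d0 hd; apply: is_derive_seq => h h0 hc.
have hc' : `|h n| @[n --> \oo] --> (0 : R) by rewrite -(normr0 R); exact: cvg_norm.
have [M _ hM] : \forall n \near \oo, `|h n| < d by exact: (cvgr_lt _ hc').
suff : (h (n + M)%N)^-1 * (F (x + h (n + M)%N *: v) - F x) @[n --> \oo] --> df.
  by rewrite (cvg_shiftn M (fun n => (h n)^-1 * (F (x + h n *: v) - F x))).
apply: (hd (fun n => h (n + M)%N)) => [n|n|]; [exact: h0|by apply: hM; exact: leq_addl|].
by rewrite (cvg_shiftn M h).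
Qed.

Definition trunc (i : nat) z : E := \row_(j < N) if (j < i)%N then tnth z j else 0.

Lemma trunc0 z : trunc 0 z = 0.
Proof. by apply/rowP => j; rewrite !mxE. Qed.

Lemma trunc_full z : trunc N z = row z.
Proof. by apply/rowP => j; rewrite !mxE ltn_ord. Qed.

Lemma truncS (i : 'I_N) z : trunc i.+1 z = trunc i z + tnth z i *: dir i.
Proof.
apply/rowP => j; rewrite !mxE eqxx/= ltnS leq_eqVlt.
have [ij|nij] := eqVneq j i; first by rewrite ij eqxx ltnn/= mulr1 add0r.
by rewrite (_ : (j == i :> nat) = false) ?(negbTE nij)/= ?mulr0 ?addr0//; apply: negbTE nij.
Qed.

Lemma measurable_trunc_arg (phi : E -> R) x (a : R) i : mfun_row phi ->
  measurable_fun setT (fun z => phi (x + a *: trunc i z)).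
Proof.
move=> mphi; apply: measurable_row_comp => // j.
rewrite (_ : (fun _ => _) = (fun z => x ord0 j + a * (if (j < i)%N then tnth z j else 0))).
  apply: measurable_funD => //; apply: measurable_funM => //.
  by case: (j < i)%N => //; exact: measurable_tnth.
by apply/funext => z; rewrite !mxE.
Qed.

Lemma Rintegral_gauss_odd (i : 'I_N) (F : N.-tuple R -> R) : measurable_fun setT F ->
  (forall z, F (tflip i z) = - F z) -> gN.-integrable setT (EFin \o F) -> \int[gN]_z F z = 0.
Proof.
move=> mF oF iF; have := Rintegral_gauss_flip i mF.
have -> : \int[gN]_z F (tflip i z) = \int[gN]_z (- F z) by apply: eq_Rintegral => z _; exact: oF.
have -> : \int[gN]_z (- F z) = - \int[gN]_z F z.
  rewrite -mulN1r -RintegralZl//; apply: eq_Rintegral => z _; by rewrite mulN1r.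
by lra.
Qed.

Lemma trunc_tflip (i : 'I_N) z : trunc i (tflip i z) = trunc i z.
Proof.
apply/rowP => j; rewrite !mxE; case: ifP => // ji.
by rewrite tnth_mktuple; case: eqP => // e; rewrite e ltnn in ji.
Qed.

Section cvg.
(** The functions vary with n because the base time moves when the time derivative is taken from the
    left; only near x must their second derivatives approach the limits [A]. *)
Variables (psi : nat -> E -> R) (C : R) (A : 'I_N -> R) (k B D : nat -> R) (x : E).
Hypotheses (k0 : forall n, 0 < k n) (kc : k n @[n --> \oo] --> (0 : R)).
Hypotheses (mpsi : forall n, mfun_row (psi n)) (psiB : forall n y, `|psi n y| <= B n).
Hypothesis d1 : forall n (i : 'I_N) y, derivable (psi n) y (dir i).
Hypothesis d2 : forall n (i : 'I_N) y, derivable (partial i (psi n)) y (dir i).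
Hypothesis mpart : forall n i, mfun_row (partial i (psi n)).
Hypothesis partD : forall n i y, `|partial i (psi n) y| <= D n.
Hypothesis part2C : forall n i y, `|partial i (partial i (psi n)) y| <= C.
Hypothesis part2A : forall i (e : R), 0 < e -> exists2 d : R, 0 < d &
  \forall n \near \oo, forall y, `|y - x| < d -> `|partial i (partial i (psi n)) y - A i| <= e.

Let sg n := Num.sqrt (2 * k n).
Let sg0 n : 0 < sg n. Proof. by rewrite sqrtr_gt0 mulr_gt0. Qed.
Let sg2 n : sg n ^+ 2 = 2 * k n.
Proof. by rewrite sqr_sqrtr// mulr_ge0// ltW. Qed.
Let C0 : 'I_N -> 0 <= C.
Proof. by move=> i; apply: le_trans (part2C 0 i 0). Qed.

Let yy n i z := x + sg n *: trunc i z.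
Let S n i := \int[gN]_z psi n (yy n i z).
(** The increment along coordinate [i] without its first-order part, normalised by the time step. *)
Let Q n (i : 'I_N) z := (k n)^-1 *
  (psi n (yy n i.+1 z) - psi n (yy n i z) - partial i (psi n) (yy n i z) * (sg n * tnth z i)).

Let yyS n (i : 'I_N) z : yy n i.+1 z = yy n i z + (sg n * tnth z i) *: dir i.
Proof. by rewrite /yy truncS scalerDr scalerA addrA. Qed.

Let taylor n (i : 'I_N) z (a e : R) : 0 <= e ->
  (forall r : R, `|r| <= `|sg n * tnth z i| ->
     `|partial i (partial i (psi n)) (yy n i z + r *: dir i) - a| <= e) ->
  `|Q n i z - a * tnth z i ^+ 2| <= 2 * e * tnth z i ^+ 2.
Proof.
move=> e0 h.
have D1 (r : R) : is_derive r 1 (fun r : R => psi n (yy n i z + r *: dir i)) (partial i (psi n) (yy n i z + r *: dir i)).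
  by apply/is_derive_line; apply: DeriveDef => //; exact: d1.
have D2 (r : R) : is_derive r 1 (fun r : R => partial i (psi n) (yy n i z + r *: dir i))
    (partial i (partial i (psi n)) (yy n i z + r *: dir i)).
  by apply/is_derive_line; apply: DeriveDef => //; exact: d2.
have := taylor2_estimate e0 D1 D2 h.
rewrite /= scale0r addr0 -yyS exprMn sg2.
set X := psi n _ - _ - _ => hX.
have kn := k0 n; have kN : k n != 0 by rewrite gt_eqF.
have -> : Q n i z - a * tnth z i ^+ 2 = (k n)^-1 * (X - a * (2 * k n * tnth z i ^+ 2) / 2).
  by rewrite /Q -/X; field.
rewrite normrM gtr0_norm ?invr_gt0// mulrC ler_pdivrMr//.
by apply: le_trans hX _; rewrite le_eqVlt; apply/orP; left; apply/eqP; ring.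
Qed.

(** Taylor's estimate around the value 0 gives an integrable majorant that is uniform in n. *)
Let Q_bound n i z : `|Q n i z| <= 2 * C * tnth z i ^+ 2.
Proof.
have := @taylor n i z 0 C (C0 i); rewrite mul0r subr0; apply=> r _.
by rewrite subr0.
Qed.

Let mpsi_yy n i : measurable_fun setT (fun z => psi n (yy n i z)).
Proof. exact: measurable_trunc_arg. Qed.

Let mpart_yy n (i : 'I_N) : measurable_fun setT (fun z => partial i (psi n) (yy n i z)).
Proof. exact: measurable_trunc_arg. Qed.

Let mQ n i : measurable_fun setT (Q n i).
Proof.
apply: measurable_funM => //; apply: measurable_funB; first exact: measurable_funB.
by apply: measurable_funM => //; apply: measurable_funM => //; exact: measurable_tnth.
Qed.

(** The point [yy n i z] involves the coordinates before [i] only, hence the subtracted term is odd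
    in coordinate [i] and has mean zero. *)
Let Q_int n i : \int[gN]_z Q n i z = (k n)^-1 * (S n i.+1 - S n i).
Proof.
have i1 j : gN.-integrable setT (EFin \o (fun z => psi n (yy n j z))).
  exact: (integrable_gauss_bounded (C := B n)).
have i2 : gN.-integrable setT (EFin \o (fun z => tnth z i * partial i (psi n) (yy n i z))).
  exact: (@integrable_gauss_coord_bounded _ _ i _ (D n)).
have mi2 : measurable_fun setT (fun z => tnth z i * partial i (psi n) (yy n i z)).
  by apply: measurable_funM => //; exact: measurable_tnth.
have z2 : \int[gN]_z (tnth z i * partial i (psi n) (yy n i z)) = 0.
  apply: (@Rintegral_gauss_odd i) => // z.
  by rewrite /yy trunc_tflip tnth_mktuple eqxx mulNr.
transitivity (\int[gN]_z ((k n)^-1 * (psi n (yy n i.+1 z) - psi n (yy n i z)) +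
    (- ((k n)^-1 * sg n)) * (tnth z i * partial i (psi n) (yy n i z)))).
  by apply: eq_Rintegral => z _; rewrite /Q; ring.
have i3 : gN.-integrable setT (EFin \o (fun z => psi n (yy n i.+1 z) - psi n (yy n i z))).
  by have := integrableB measurableT (i1 i.+1) (i1 i); exact: eq_integrable.
rewrite RintegralD//; last 2 first.
- exact: integrableZR.
- exact: integrableZR.
by rewrite !RintegralZl// z2 mulr0 addr0 RintegralB.
Qed.

Let trunc_le n (i : 'I_N) z (r : R) : `|r| <= `|sg n * tnth z i| ->
  `|yy n i z + r *: dir i - x| <= sg n * \sum_j `|tnth z j|.
Proof.
move=> hr; rewrite /yy addrAC [x + _]addrC addrK.
have sumj (j : 'I_N) : `|tnth z j| <= \sum_j `|tnth z j| by rewrite (bigD1 j)//= lerDl sumr_ge0.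
apply: rV_norm_le; first by rewrite mulr_ge0 ?(ltW (sg0 n))// sumr_ge0.
move=> j; rewrite !mxE eqxx/=; have [ji|ji] := eqVneq j i.
  rewrite ji ltnn mulr0 add0r mulr1; apply: le_trans hr _.
  by rewrite normrM (gtr0_norm (sg0 n)) ler_pM2l.
rewrite mulr0 addr0 normrM (gtr0_norm (sg0 n)) ler_pM2l//.
by case: ifP => // _; rewrite normr0 sumr_ge0.
Qed.

Let Q_cvg i z : Q n i z @[n --> \oo] --> A i * tnth z i ^+ 2.
Proof.
have sgc : sg n @[n --> \oo] --> (0 : R).
  rewrite -[X in _ --> X](@sqrtr0 R); apply: continuous_cvg; first exact: sqrt_continuous.
  by rewrite -[X in _ --> X](mulr0 2); apply: cvgM => //; exact: cvg_cst.
apply/cvgrPdist_le => e e0.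
(* Chosen so that the Taylor error 2 e' z_i^2 is at most e. *)
pose e' := e / (2 * (1 + tnth z i ^+ 2)).
have q0 : 0 < 2 * (1 + tnth z i ^+ 2) by rewrite mulr_gt0// ltr_pwDl// sqr_ge0.
have e'0 : 0 < e' by rewrite divr_gt0.
have [d d0 hd] := part2A i e'0.
have hs : sg n * \sum_j `|tnth z j| @[n --> \oo] --> (0 : R).
  by rewrite -[X in _ --> X](mul0r (\sum_j `|tnth z j|)); apply: cvgM => //; exact: cvg_cst.
have hs' : \forall n \near \oo, sg n * \sum_j `|tnth z j| < d by exact: (cvgr_lt _ hs).
near=> n.
have h1 : `|Q n i z - A i * tnth z i ^+ 2| <= 2 * e' * tnth z i ^+ 2.
  apply: taylor; first exact: ltW.
  have hdn : forall y, `|y - x| < d -> `|partial i (partial i (psi n)) y - A i| <= e' by near: n.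
  move=> r hr; apply: hdn; apply: le_lt_trans (trunc_le hr) _.
  by near: n.
rewrite distrC; apply: le_trans h1 _.
have -> : 2 * e' * tnth z i ^+ 2 = e * (tnth z i ^+ 2 / (1 + tnth z i ^+ 2)).
  by rewrite /e'; field; rewrite gt_eqF// ltr_pwDl// sqr_ge0.
rewrite ler_piMr ?(ltW e0)// ler_pdivrMr ?mul1r ?lerDr//.
by rewrite ltr_pwDl// sqr_ge0.
Unshelve. all: by end_near. Qed.

(* The increment of [psi n] along [sqrt (2 k) Z] is telescoped over the
   coordinates; the first-order terms have mean zero by parity. *)
Lemma heatop_generator :
  (k n)^-1 * (heatop (k n) (psi n) x - psi n x) @[n --> \oo] --> \sum_i A i.
Proof.
have isq i : gN.-integrable setT (EFin \o (fun z => tnth z i ^+ 2)).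
  apply: (@integrable_gauss_coord _ _ i (fun w => w ^+ 2)); first exact: measurable_funX.
  exact: integrable_normal_sqr.
have msq (i : 'I_N) : measurable_fun setT (fun z : N.-tuple R => tnth z i ^+ 2).
  by apply: measurable_funX; exact: measurable_tnth.
have QA i : \int[gN]_z Q n i z @[n --> \oo] --> A i.
  have -> : A i = \int[gN]_z (A i * tnth z i ^+ 2).
    rewrite RintegralZl// (@Rintegral_gauss_coord _ _ i (fun w => w ^+ 2)); last exact: measurable_funX.
    by rewrite Rintegral_normal_sqr mulr1.
  apply: (@cvg_Rintegral R _ _ gN setT (fun n => Q n i) _ (fun z => 2 * C * tnth z i ^+ 2)) => //.
  - by apply: measurable_funM.
  - exact: integrableZR.
have -> : (fun n => (k n)^-1 * (heatop (k n) (psi n) x - psi n x)) = (fun n => \sum_i \int[gN]_z Q n i z).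
  apply/funext => n; under eq_bigr do rewrite Q_int.
  rewrite -mulr_sumr.
  have -> : \sum_(i < N) (S n i.+1 - S n i) = S n N - S n 0%N.
    by rewrite -(big_mkord xpredT (fun i => S n i.+1 - S n i)) telescope_sumr.
  have -> : S n N = heatop (k n) (psi n) x by apply: eq_Rintegral => z _; rewrite /yy trunc_full.
  have -> // : S n 0%N = psi n x.
  transitivity (\int[gN]_z psi n x); last exact: Rintegral_gauss_cst.
  by apply: eq_Rintegral => z _; rewrite /yy trunc0 scaler0 addr0.
by apply: cvg_big => //; exact: add_continuous.
Qed.

End cvg.

End generator.

(** * The time derivative and the classical equation *)

Section classical.
Context {R : realType} {N : nat}.
Variables (m : nat) (alpha : R) (V : R -> 'rV[R]_N -> R) (Bf : R -> R).
Hypothesis alpha0 : 0 < alpha.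
Notation mu := (@lebesgue_measure R).
Notation E := 'rV[R]_N.
Notation row := (@row_of_tuple R N).
Notation gN := (@gauss R N).
Notation dir i := (delta_mx ord0 i : 'rV[R]_N).
Notation f := (@absorption R alpha).
Implicit Types (x y : E) (t s tau T : R).
Hypothesis mV : mfun2 V.
Hypothesis pV : forall tau T, 0 < tau ->
  pmild T (V tau) (fun s x => - f (V (tau + s) x)) (fun s => V (tau + s)).
Hypothesis bV : forall tau t x, 0 < tau -> tau <= t -> `|V t x| <= Bf tau.
Hypothesis tV : forall T, tmodulus T V.

Let Bf0 tau : 0 < tau -> 0 <= Bf tau.
Proof. by move=> tau0; apply: le_trans (bV 0 tau0 (lexx _)). Qed.

Let cV t x : 0 < t -> V p.1 p.2 @[p --> (t, x)] --> V t x.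
Proof. have h := @tmodulus_continuous R N (t + 1) V t x (tV (T := t + 1)).
by move=> t0; apply: h; rewrite t0/= ltrDl. Qed.

Let mVt tau : mfun2 (fun s => V (tau + s)).
Proof. exact: (mfun2_shift _ mV). Qed.

Let tVt tau T : 0 < tau -> tmodulus T (fun s => V (tau + s)).
Proof.
move=> tau0 a b a0 bT.
have [L L0 [h1 h2]] := tV (T := tau + T) (a := tau + a) (b := tau + b) ltac:(by rewrite addr_gt0) ltac:(by rewrite ltrD2l).
exists L => //; split=> [t tab x y|s t as_ st tb x].
  by apply: h1; rewrite !lerD2l.
have := h2 (tau + s) (tau + t) _ _ _ x.
by rewrite !lerD2l opprD addrACA subrr add0r; apply.
Qed.

Let bVt tau T : 0 < tau -> tbound T (Bf tau) (fun s => V (tau + s)).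
Proof. by move=> tau0 s x /andP[s0 _]; apply: bV => //; rewrite lerDl ltW. Qed.

(** The estimates for mild solutions need bounded data, so they are applied to [V] restarted at t /
    2. *)
Let d1 i t x : 0 < t -> derivable (V t) x (dir i).
Proof.
move=> t0; have h := @mild_derivable R N alpha alpha0 (t : R) (V (t / 2)) (fun s => V (t / 2 + s)) (Bf (t / 2)) (Bf (t / 2)).
have t20 : 0 < t / 2 by rewrite divr_gt0.
have := h t0 (mfun2_section _ mV) (fun y => bV y t20 (lexx _)) (mVt _) (bVt t20) (pV t20) (tVt t20) i (t / 2) x.
by rewrite -splitr; apply; rewrite t20/= gtr_pMr// invf_lt1// ltr1n.
Qed.

Let r1 T i : lreg T (fun t => partial i (V t)).
Proof.
apply: lreg_shift => a b a0 ab bT; have a20 : 0 < a / 2 by rewrite divr_gt0.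
have b0 : 0 < b := lt_le_trans a0 ab.
exists (a / 2), b; split; first by rewrite gtr_pMr// invf_lt1// ltr1n.
  by rewrite ltrDr.
exact: (mild_partial_lreg alpha0 b0 (mfun2_section _ mV) (fun y => bV y a20 (lexx _)) (mVt _) (bVt a20) (pV a20) (tVt a20) i).
Qed.

Let partial_bound a b : 0 < a -> exists2 C : R, 0 <= C & forall i t x, a <= t <= b -> `|partial i (V t) x| <= C.
Proof.
move=> a0.
have h i : exists C : R, 0 <= C /\ forall t x, a <= t <= b -> `|partial i (V t) x| <= C.
  have [_ bb] := r1 (b + 1) i; have [C C0 hC] := bb a b a0 ltac:(by rewrite ltrDl).
  by exists C.
pose c i := projT1 (cid (h i)).
have [c0 hc] : (forall i, 0 <= c i) /\ forall i t x, a <= t <= b -> `|partial i (V t) x| <= c i.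
  by split=> i; rewrite /c; case: cid => //= ? [].
exists (\sum_i c i); first exact: sumr_ge0.
move=> i t x tab; apply: le_trans (hc i t x tab) _.
by rewrite (bigD1 i)//= lerDl sumr_ge0.
Qed.

(** Bounds for the first derivatives on [a, a + b] are what the second-order stage requires of the
    solution restarted at a. *)
Let stage2 a b : 0 < a -> 0 < b -> exists2 Bd : R, 0 <= Bd &
  forall i t x, 0 < t < b -> `|partial i (V (a + t)) x| <= Bd.
Proof.
move=> a0 b0; have [C C0 hC] := partial_bound (a + b) a0.
by exists C => // i t x /andP[t0 tb]; apply: hC; rewrite lerDl lerD2l !ltW.
Qed.

Let d2 i j t x : 0 < t -> derivable (partial i (V t)) x (dir j).
Proof.
move=> t0; have t20 : 0 < t / 2 by rewrite divr_gt0.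
have [Bd Bd0 hB] := stage2 t20 t0.
have h := mild_partial_derivable alpha0 t0 (mfun2_section _ mV) (fun y => bV y t20 (lexx _)) (mVt _) (bVt t20) (pV t20) (tVt t20) Bd0 hB.
have := h i j (t / 2) x.
by rewrite -splitr; apply; rewrite t20/= gtr_pMr// invf_lt1// ltr1n.
Qed.

Let r2 T i j : lreg T (fun t => partial j (partial i (V t))).
Proof.
apply: lreg_shift => a b a0 ab bT; have a20 : 0 < a / 2 by rewrite divr_gt0.
have b0 : 0 < b := lt_le_trans a0 ab.
exists (a / 2), b; split; first by rewrite gtr_pMr// invf_lt1// ltr1n.
  by rewrite ltrDr.
have [Bd Bd0 hB] := stage2 a20 b0.
exact: (mild_partial2_lreg alpha0 b0 (mfun2_section _ mV) (fun y => bV y a20 (lexx _)) (mVt _) (bVt a20) (pV a20) (tVt a20) Bd0 hB i j).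
Qed.

Let c1 i t x : 0 < t -> partial i (V p.1) p.2 @[p --> (t, x)] --> partial i (V t) x.
Proof. by move=> t0; have [h _] := r1 (t + 1) i; apply: h; rewrite t0/= ltrDl. Qed.

Let c2 i j t x : 0 < t -> partial j (partial i (V p.1)) p.2 @[p --> (t, x)] --> partial j (partial i (V t)) x.
Proof. by move=> t0; have [h _] := r2 (t + 1) i j; apply: h; rewrite t0/= ltrDl. Qed.

Let heat_quotient t x (s k : nat -> R) : 0 < t -> (forall n, 0 < k n) -> (forall n, t / 2 <= s n <= t) ->
  k n @[n --> \oo] --> (0 : R) -> s n @[n --> \oo] --> t ->
  (k n)^-1 * (heatop (k n) (V (s n)) x - V (s n) x) @[n --> \oo] --> laplacian (V t) x.
Proof.
move=> t0 k0 st kc sc; have t20 : 0 < t / 2 by rewrite divr_gt0.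
have s0 n : 0 < s n by have /andP[h _] := st n; exact: lt_le_trans h.
have [Bd Bd0 hB] := partial_bound t t20.
have h i : exists C : R, 0 <= C /\ forall t' x, t / 2 <= t' <= t -> `|partial i (partial i (V t')) x| <= C.
  have [_ bb] := r2 (t + 1) i i; have [C C0 hC] := bb (t / 2) t t20 ltac:(by rewrite ltrDl).
  by exists C.
pose c i := projT1 (cid (h i)).
have [c0 hc] : (forall i, 0 <= c i) /\ forall i t' x, t / 2 <= t' <= t -> `|partial i (partial i (V t')) x| <= c i.
  by split=> i; rewrite /c; case: cid => //= ? [].
apply: (@heatop_generator R N (fun n => V (s n)) (\sum_i c i) (fun i => partial i (partial i (V t)) x) k (fun=> Bf (t / 2)) (fun=> Bd)) => //.
- by move=> n; exact: mfun2_section.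
- by move=> n y; apply: bV => //; have /andP[] := st n.
- by move=> n i y; exact: d1.
- by move=> n i y; exact: d2.
- move=> n i; apply: mfun_row_continuous => y.
  have h1 : (s n, q) @[q --> y] --> (s n, y) by exact: (cvg_pair (@cvg_cst _ (s n) _ _ _) (@cvg_id _ (nbhs y))).
  exact: (cvg_comp _ _ h1 (@c1 i (s n) y (s0 n))).
- by move=> n i y; apply: hB.
- move=> n i y; apply: le_trans (hc i _ y (st n)) _.
  by rewrite (bigD1 i)//= lerDl sumr_ge0.
- move=> i e e0; have /cvgrPdist_le /(_ e e0) := @c2 i i t x t0.
  move=> [[P1 P2] /= [/nbhs_ballP[d1' /= d10 hd1] /nbhs_ballP[d2' /= d20 hd2]] hP].
  exists d2' => //.
  have hs : \forall n \near \oo, `|t - s n| < d1'.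
    by move/cvgrPdist_lt : sc => /(_ d1' d10).
  near=> n => y yx; rewrite distrC; apply: (hP (s n, y)); split => /=.
    by apply: hd1; rewrite /ball/=; near: n.
  by apply: hd2; rewrite -ball_normE/= distrC.
Unshelve. all: by end_near. Qed.

(** Rescaling (0, k n) to (0, 1) absorbs the factor 1 / k n; the limit is then dominated convergence
    in time and in the Gaussian variable. *)
Let source_quotient t x (s k : nat -> R) : 0 < t -> (forall n, 0 < k n) -> (forall n, t / 2 <= s n) ->
  k n @[n --> \oo] --> (0 : R) -> s n @[n --> \oo] --> t ->
  (k n)^-1 * duh (fun r x => - f (V (s n + r) x)) (k n) x @[n --> \oo] --> - f (V t x).
Proof.
move=> t0 k0 st kc sc; have t20 : 0 < t / 2 by rewrite divr_gt0.
have B0 := Bf0 t20.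
have s0 n : 0 < s n by exact: lt_le_trans (st n).
have mf : measurable_fun setT (fun r : R => - f r).
  by apply: measurableT_comp => //; exact: measurable_absorption.
have mH n : mfun2 (fun r x => - f (V (s n + r) x)) by exact: (@mfun2_comp R N (fun r => - f r) _ mf (mVt (s n))).
have HB n r y : 0 <= r -> `|- f (V (s n + r) y)| <= f (Bf (t / 2)).
  move=> r0; rewrite normrN absorption_bound//.
  by apply: bV => //; apply: le_trans (st n) _; rewrite lerDl.
pose w n r := heatop (k n - k n * r) (fun y => - f (V (s n + k n * r) y)) x.
have e n : (k n)^-1 * duh (fun r x => - f (V (s n + r) x)) (k n) x = \int[mu]_(r in `]0, 1[) w n r.
  have kn := k0 n.
  have := @Rintegral_affine_itv R (fun r => heatop (k n - r) (fun y => - f (V (s n + r) y)) x) 0 (k n) 1 (f (Bf (t / 2))) kn.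
  rewrite mulr1 add0r => h; rewrite /duh h.
  - rewrite mulrA mulVf ?gt_eqF// mul1r; apply: eq_Rintegral => r _.
    by rewrite /w addr0.
  - exact: measurable_heatop_time (mH n).
  - move=> r /andP[r0 _]; apply: heatop_bound => [|y]; first exact: mfun2_section (mH n).
    by apply: HB; exact: ltW.
rewrite (_ : (fun n => _) = (fun n => \int[mu]_(r in `]0, 1[) w n r)); last by apply/funext => n; exact: e.
have -> : - f (V t x) = \int[mu]_(r in `]0, 1[) (- f (V t x)).
  by rewrite Rintegral_cst//= lebesgue_measure_itv/= lte_fin ltr01 oppr0 adde0 mulr1.
apply: (@cvg_Rintegral R _ _ mu `]0, 1[%classic w (fun=> - f (V t x)) (fun=> f (Bf (t / 2)))) => //.
- move=> n; apply: measurable_funTS.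
  apply: (measurable_heatop_comp (mH n)) => //.
  + by apply: measurable_funB => //; exact: measurable_funM.
- move=> r /=; rewrite in_itv/= => /andP[r0 r1'].
  have kr : k n * r @[n --> \oo] --> (0 : R).
    by rewrite -[X in _ --> X](mul0r r); apply: cvgM => //; exact: cvg_cst.
  rewrite -[X in _ --> X](@Rintegral_gauss_cst R N).
  apply: (@cvg_Rintegral R _ _ gN setT (fun n z => - f (V (s n + k n * r) (x + Num.sqrt (2 * (k n - k n * r)) *: row z))) _ (fun=> f (Bf (t / 2)))) => //.
  + move=> n; have := measurable_heat_arg x (Num.sqrt (2 * (k n - k n * r))) (mfun2_section (k n * r) (mH n)); exact.
  + move=> z _.
    have h : (s n + k n * r, x + Num.sqrt (2 * (k n - k n * r)) *: row z) @[n --> \oo] --> (t, x).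
      apply: cvg_pairT.
        by rewrite -[X in _ --> X]addr0; exact: cvgD.
      rewrite -[X in _ --> X]addr0; apply: cvgD; first exact: cvg_cst.
      rewrite -[X in _ --> X](scale0r (row z)); apply: cvgZ; last exact: cvg_cst.
      rewrite -[X in _ --> X](@sqrtr0 R); apply: continuous_cvg; first exact: sqrt_continuous.
      rewrite -[X in _ --> X](mulr0 2); apply: cvgM; first exact: cvg_cst.
      by rewrite -[X in _ --> X](subr0 0); exact: cvgB.
    have h2 := cvg_comp _ _ h (@cV t x t0).
    by apply: cvgN; exact: (cvg_comp _ _ h2 (@continuous_absorption R alpha alpha0 _)).
  + apply: (integrable_gauss_bounded (C := f (Bf (t / 2)))) => // z.
    by rewrite ger0_norm// absorption_ge0.
  + by move=> z n _; apply: HB; rewrite mulr_ge0// ltW.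
- apply: (@integrable_itv _ _ _ _ (f (Bf (t / 2)))) => // r _.
  by rewrite ger0_norm// absorption_ge0.
- move=> r n /=; rewrite in_itv/= => /andP[r0 _].
  apply: heatop_bound => [|y]; first exact: mfun2_section (k n * r) (mH n).
  by apply: HB; rewrite mulr_ge0// ltW.
Qed.

Lemma restart_is_derive_time t x : 0 < t ->
  is_derive t 1 (V^~ x) (laplacian (V t) x - f (V t x)).
Proof.
move=> t0; have t20 : 0 < t / 2 by rewrite divr_gt0.
apply: (is_derive_seq_lt t20) => h h0 ht hc.
(* The heat flow runs forward only. A quotient with negative step is therefore written as a forward
   quotient of length [k n] from the earlier time [s n], which also tends to t. *)
pose k n := `|h n|; pose s n := Num.min t (t + h n).
have k0 n : 0 < k n by rewrite normr_gt0.
have kc : k n @[n --> \oo] --> (0 : R) by rewrite -(normr0 R); exact: cvg_norm.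
have sE n : s n = t - (k n - h n) / 2.
  rewrite /s /k; have [hn|hn] := leP 0 (h n).
    by rewrite min_l ?lerDl// ger0_norm// subrr mul0r subr0.
  by rewrite min_r ?gerDl ?ltW// ltr0_norm//; field.
have sc : s n @[n --> \oo] --> t.
  rewrite (_ : s = (fun n => t - (k n - h n) / 2)); last exact/funext.
  rewrite -[X in _ --> X]subr0; apply: cvgB; first exact: cvg_cst.
  rewrite -[X in _ --> X](mul0r 2^-1); apply: cvgM; last exact: cvg_cst.
  by rewrite -[X in _ --> X](subr0 0); exact: cvgB.
have st n : t / 2 <= s n <= t.
  rewrite /s ge_min lexx/= le_min ler_pdivrMr// ler_peMr ?ltW// ?ltr1n//=.
  by have := ht n; rewrite ltr_norml => /andP[]; lra.
have s0 n : 0 < s n by have /andP[h1 _] := st n; exact: lt_le_trans h1.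
have e n : (h n)^-1 * (V (t + h n *: 1) x - V t x) =
    (k n)^-1 * (heatop (k n) (V (s n)) x - V (s n) x) + (k n)^-1 * duh (fun r x => - f (V (s n + r) x)) (k n) x.
  have -> : (h n)^-1 * (V (t + h n *: 1) x - V t x) = (k n)^-1 * (V (s n + k n) x - V (s n) x).
    rewrite [h n *: _]mulr1 /s /k; have [hn|hn] := leP 0 (h n).
      by rewrite min_l ?lerDl// ger0_norm.
    rewrite min_r ?gerDl ?ltW// ltr0_norm// addrK invrN; ring.
  have kT : 0 < k n < k n + 1 by rewrite k0/= ltrDl.
  have -> := pV (s0 n) x kT.
  by rewrite -mulrDr addrAC.
rewrite (_ : (fun n => _) = (fun n => (k n)^-1 * (heatop (k n) (V (s n)) x - V (s n) x) + (k n)^-1 * duh (fun r x => - f (V (s n + r) x)) (k n) x)); last by apply/funext => n; exact: e.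
apply: cvgD; first exact: heat_quotient.
by apply: source_quotient => // n; have /andP[] := st n.
Qed.

Lemma restart_classical : classical_solution alpha m V.
Proof.
have dtE t x : 0 < t -> dt V t x = laplacian (V t) x - f (V t x).
  by move=> t0; rewrite /dt derive1E; have [_] := restart_is_derive_time x t0.
split; last by move=> t x t0 _; rewrite dtE//; ring.
have within (w : R -> E -> R) : (forall t x, 0 < t -> w p.1 p.2 @[p --> (t, x)] --> w t x) ->
    {within `]0, +oo[%classic `*` Omega m, continuous (fun p => w p.1 p.2)}.
  move=> cw; apply: continuous_in_subspaceT => -[t x]; rewrite inE/= in_itv/= andbT => -[t0 _].
  exact: cw.
have cL t x : 0 < t -> laplacian (V p.1) p.2 - f (V p.1 p.2) @[p --> (t, x)] --> laplacian (V t) x - f (V t x).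
  move=> t0; apply: cvgB.
    by apply: cvg_big => [|i _]; [exact: add_continuous|exact: c2].
  exact: (cvg_comp _ _ (@cV t x t0) (@continuous_absorption R alpha alpha0 _)).
split.
- move=> t x; rewrite /= in_itv/= andbT => -[t0 _]; split=> [|i|i j].
  + by have [] := restart_is_derive_time x t0.
  + exact: d1.
  + exact: d2.
- exact: within cV.
- apply: within => t x t0; rewrite dtE//; apply: cvg_trans (cL t x t0).
  apply: near_eq_cvg; near=> p; rewrite dtE//.
  near: p; have cf : p.1 @[p --> (t, x)] --> t by exact: cvg_fst.
  exact: (cvgr_gt _ cf).
- by move=> i; apply: (within (fun t x => partial i (V t) x)) => t x t0; exact: c1.
- by move=> i j; apply: (within (fun t x => partial j (partial i (V t)) x)) => t x t0; exact: c2.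
Unshelve. all: by end_near. Qed.

End classical.

(** * Kernel form and uniqueness *)

Section slices.
Context d1 d2 (T1 : measurableType d1) (T2 : measurableType d2) {R : realType}.
Variables (m1 : {sigma_finite_measure set T1 -> \bar R}).
Variables (m2 : {sigma_finite_measure set T2 -> \bar R}).
Variables (D1 : set T1) (D2 : set T2) (Psi : T1 * T2 -> R).
Hypotheses (mD1 : measurable D1) (mD2 : measurable D2) (mPsi : measurable_fun (D1 `*` D2) Psi).
Hypothesis iPsi : forall s, D1 s -> m2.-integrable D2 (EFin \o (fun z => Psi (s, z))).

Let mD12 : measurable (D1 `*` D2). Proof. exact: measurableX. Qed.

Let mR : measurable_fun [set: T1 * T2] ((EFin \o Psi) \_ (D1 `*` D2)).
Proof. by apply/(measurable_restrictT _ _).1 => //; exact/measurable_EFinP. Qed.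

Let slice s : (\int[m2]_z `|((EFin \o Psi) \_ (D1 `*` D2)) (s, z)|)%E =
  ((fun s => (\int[m2]_(z in D2) `|Psi (s, z)|)%:E) \_ D1) s.
Proof.
rewrite /patch; case: ifPn => sD; last first.
  rewrite (eq_integral (fun=> 0%E)) ?integral0// => z _; rewrite /patch ifF ?abse0//.
  by apply/negbTE; move: sD; apply: contra; rewrite !inE => -[].
rewrite inE in sD.
rewrite fineK; last first.
  by apply: integrable_fin_num => //; have := integrable_norm (iPsi sD).
rewrite [RHS]integral_mkcond; apply: eq_integral => z _; rewrite /patch.
case: ifPn => zD; case: ifPn => zD' //=; rewrite ?abse0//.
- by exfalso; move: zD zD'; rewrite !inE => -[_ h] /negP; apply; rewrite inE.
- by exfalso; move: zD zD'; rewrite !inE => /negP h zD'; apply: h; rewrite inE.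
- by rewrite normr0.
Qed.

Lemma integrable_slice_norm : (m1 \x m2)%E.-integrable (D1 `*` D2) (EFin \o Psi) ->
  m1.-integrable D1 (EFin \o (fun s => \int[m2]_(z in D2) `|Psi (s, z)|)).
Proof.
move=> /(integrable_mkcond _ mD12) /integrable_abse h.
have := integrable_fubini_F h; rewrite /fubini_F => h2.
apply/(integrable_mkcond _ mD1); apply: eq_integrable h2 => // s _.
exact: slice.
Qed.

Lemma integrable_slices (a : T1 -> R) : m1.-integrable D1 (EFin \o a) ->
  (forall s, D1 s -> \int[m2]_(z in D2) `|Psi (s, z)| <= a s) ->
  (m1 \x m2)%E.-integrable (D1 `*` D2) (EFin \o Psi).
Proof.
move=> ia Psia; apply/(integrable_mkcond _ mD12)/(integrable12ltyP _ _ mR).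
rewrite (eq_integral ((fun s => (\int[m2]_(z in D2) `|Psi (s, z)|)%:E) \_ D1)); last by move=> s _; exact: slice.
have ms : measurable_fun setT ((fun s => (\int[m2]_(z in D2) `|Psi (s, z)|)%:E) \_ D1).
  have -> : ((fun s => (\int[m2]_(z in D2) `|Psi (s, z)|)%:E) \_ D1) =
      (fun s => \int[m2]_z `|((EFin \o Psi) \_ (D1 `*` D2)) (s, z)|)%E by apply/funext => s; rewrite slice.
  apply: (@measurable_fun_fubini_tonelli_F _ _ _ _ _ m2 (fun p => `|((EFin \o Psi) \_ (D1 `*` D2)) p|%E)) => //.
  exact: measurableT_comp.
apply: (@le_lt_trans _ _ (\int[m1]_s ((EFin \o a) \_ D1) s)%E).
  apply: ge0_le_integral => //.
  - by move=> s _; rewrite -slice integral_ge0.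
  - by have /(integrable_mkcond _ mD1) /integrableP[] := ia.
  - move=> s _; rewrite /patch; case: ifPn => //; rewrite inE => sD; rewrite /= lee_fin; exact: Psia.
rewrite -integral_mkcond; have := integrable_lty mD1 ia; apply.
Qed.

End slices.

Section kernel_form.
Context {R : realType} {N : nat}.
Variable m : nat.
Hypothesis mN : (m <= N)%N.
Notation mu := (@lebesgue_measure R).
Notation E := 'rV[R]_N.
Notation row := (@row_of_tuple R N).
Notation Om := (@Omega R N m).
Notation lN := (@lebesgue_tuple R N).
Notation OmT := (row @^-1` Om).
Implicit Types (x y : E) (t s tau T C : R) (H : R -> E -> R).

Lemma measurable_heat_kernel t x :
  measurable_fun (`]0, t[%classic `*` OmT : set (measurableTypeR R * N.-tuple R))
    (fun p => heat_kernel m (t - p.1) x (row p.2)).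
Proof.
(* The inverse of the lag is replaced by a power with exponent -1, which is measurable on the whole
   line and agrees with it for p.1 < t. *)
pose K (p : measurableTypeR R * N.-tuple R) : R :=
  (4 * pi * (t - p.1)) `^ (- (N%:R / 2)) *
  (\prod_(j < N | (m <= j)%N) expR (- (`|x 0 j - tnth p.2 j| ^+ 2 * (4 * (t - p.1)) `^ (-1)))) *
  (\prod_(i < N | (i < m)%N)
     (expR (- (`|x 0 i - tnth p.2 i| ^+ 2 * (4 * (t - p.1)) `^ (-1))) -
      expR (- (`|x 0 i + tnth p.2 i| ^+ 2 * (4 * (t - p.1)) `^ (-1))))).
have mfst : measurable_fun setT (fun p : measurableTypeR R * N.-tuple R => t - p.1).
  by apply: measurable_funB => //; exact: measurable_fst.
have mi (a : R) : measurable_fun setT (fun p : measurableTypeR R * N.-tuple R => (4 * (t - p.1)) `^ a).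
  by apply: (measurableT_comp (measurable_powR _)); exact: measurable_funM.
have mz (i : 'I_N) : measurable_fun setT (fun p : measurableTypeR R * N.-tuple R => tnth p.2 i).
  by apply: measurable_tnth_comp; exact: measurable_snd.
have me (h : measurableTypeR R * N.-tuple R -> R) : measurable_fun setT h ->
    measurable_fun setT (fun p => expR (- (`|h p| ^+ 2 * (4 * (t - p.1)) `^ (-1)))).
  move=> mh; apply: (measurableT_comp (@measurable_expR R)); apply: measurableT_comp => //.
  by apply: measurable_funM => //; apply: measurable_funX; exact: measurableT_comp.
have mK : measurable_fun setT K.
  apply: measurable_funM; first apply: measurable_funM.
  - by apply: (measurableT_comp (measurable_powR _)); exact: measurable_funM.
  - under eq_fun do rewrite big_mkcond/=.
    apply: measurable_prod => j _; case: (m <= j)%N => //.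
    by apply: me; exact: measurable_funB.
  - under eq_fun do rewrite big_mkcond/=.
    apply: measurable_prod => j _; case: (j < m)%N => //.
    by apply: measurable_funB; apply: me; [exact: measurable_funB|exact: measurable_funD].
apply: (eq_measurable_fun K); last exact: measurable_funTS.
move=> p; rewrite inE/= in_itv/= => -[/andP[p0 pt] _].
have t4 : (4 * (t - p.1)) `^ (-1) = (4 * (t - p.1))^-1.
  by rewrite powR_inv1// mulr_ge0// subr_ge0 ltW.
rewrite /K t4 /heat_kernel; congr (_ * _ * _); apply: eq_bigr => i _; by rewrite !mxE.
Qed.

(** As the kernel is nonnegative on the sector, the slice integral of the absolute value is the heat
    flow of |H s|, which is at most C. *)
Lemma integrable_heat_duhamel H C t x : 0 < t -> Om x ->
  mfun2 H -> tbound t C H -> (forall s, 0 < s < t -> oddm m (H s)) ->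
  (mu \x lN)%E.-integrable (`]0, t[%classic `*` OmT)
    (fun p => (heat_kernel m (t - p.1) x (row p.2) * H p.1 (row p.2))%:E).
Proof.
move=> t0 Ox mH HC oH; have C0 := tbound_ge0 t0 HC.
have mOT := @measurable_Omega R N m.
have ik s : 0 < s < t -> lN.-integrable OmT (EFin \o (fun z => heat_kernel m (t - s) x (row z) * H s (row z))).
  move=> st; have /andP[s0 s1] := st.
  apply: (@integrable_heat_kernel R N m mN (H s) C) => //.
  - by rewrite subr_gt0.
  - exact: mfun2_section.
  - by move=> y; exact: HC.
  - exact: oH.
apply: (@integrable_slices _ _ (measurableTypeR R) _ R mu lN `]0, t[%classic OmT
  (fun p => heat_kernel m (t - p.1) x (row p.2) * H p.1 (row p.2)) _ _ _ _ (fun=> C)) => //.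
- apply: measurable_funM; first exact: measurable_heat_kernel.
  exact: measurable_funTS.
- apply: (@integrable_itv _ _ _ _ C) => // s _.
  by rewrite ger0_norm.
move=> s /=; rewrite in_itv/= => st; have /andP[s0 s1] := st.
have mHs : mfun_row (oddext m (fun y => `|H s y|)).
  apply: mfun_row_oddext; apply: (mfun_row_comp (b := fun r => `|r|)); first exact: measurableT_comp.
  exact: mfun2_section.
have HsC y : Om y -> `| `|H s y| | <= C by rewrite normr_id => _; exact: HC.
have -> : \int[lN]_(z in OmT) `|heat_kernel m (t - s) x (row z) * H s (row z)| = heat m (t - s) (fun y => `|H s y|) x.
  apply: eq_Rintegral => z /set_mem /= Oz; rewrite normrM ger0_norm//.
  by apply: heat_kernel_ge0 => //; [rewrite subr_gt0|move=> i im; exact/ltW/Ox].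
rewrite (@heat_oddext R N m mN _ C)//; last by rewrite subr_gt0.
apply: le_trans (ler_norm _) _; apply: heatop_bound => // y.
exact: normr_oddext_le.
Qed.

(** Passage from the whole-space formulation to the kernel formulation on the sector; [psi] and its
    odd version [phi] agree on [Om] only. *)
Lemma mild_solution_pmild (alpha : R) psi phi v B : 0 < alpha ->
  mfun_row phi -> (forall y, `|phi y| <= B) -> oddm m phi -> (forall y, Om y -> psi y = phi y) ->
  mfun2 v -> (forall t x, 0 < t -> `|v t x| <= B) -> (forall t, 0 < t -> oddm m (v t)) ->
  (forall T, pmild T phi (fun s x => - absorption alpha (v s x)) v) ->
  continuous_C0bu m v -> mild_solution alpha m psi v.
Proof.
move=> alpha0 mphi phiB ophi psiphi mv vB ov pv cv; split=> // t x t0 Ox.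
have mf : measurable_fun setT (@absorption R alpha) by exact: measurable_absorption.
pose f := @absorption R alpha.
pose H s y := f (v s y).
have mH : mfun2 H by exact: (@mfun2_comp R N f v mf mv).
have HB s y : 0 < s -> `|H s y| <= f B by move=> s0; rewrite absorption_bound// vB.
have oH s : 0 < s -> oddm m (H s).
  by move=> s0; apply: oddm_comp; [exact: absorptionN|exact: ov].
split.
  apply: (@integrable_heat_duhamel H (f B)) => //.
    by move=> s y /andP[s0 _]; exact: HB.
  by move=> s /andP[s0 _]; exact: oH.
have tT : 0 < t < t + 1 by rewrite t0/= ltrDl.
rewrite (pv (t + 1) t x tT) (eq_heat _ _ psiphi) (@heat_heatop R N m mN phi B)//.
have HtB : tbound t (f B) H by move=> s y /andP[s0 _]; exact: HB.
rewrite (duhN x mH HtB).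
suff -> : duh H t x = \int[mu]_(s in `]0, t[) heat m (t - s) (fun y => absorption alpha (v s y)) x by [].
apply: eq_Rintegral => s; rewrite inE/= in_itv/= => /andP[s0 st].
apply/esym/(@heat_heatop R N m mN (H s) (f B)).
- by rewrite subr_gt0.
- exact: mfun2_section.
- by move=> y; exact: HB.
- exact: oH.
Qed.

End kernel_form.

Section slices21.
Context d1 d2 (T1 : measurableType d1) (T2 : measurableType d2) {R : realType}.
Variables (m1 : {sigma_finite_measure set T1 -> \bar R}).
Variables (m2 : {sigma_finite_measure set T2 -> \bar R}).

Lemma integrable_Rintegral21 (D1 : set T1) (D2 : set T2) (Psi : T1 * T2 -> R) :
  measurable D1 -> measurable D2 -> (m1 \x m2)%E.-integrable (D1 `*` D2) (EFin \o Psi) ->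
  (forall z, D2 z -> m1.-integrable D1 (EFin \o (fun s => Psi (s, z)))) ->
  m2.-integrable D2 (EFin \o (fun z => \int[m1]_(s in D1) Psi (s, z))).
Proof.
move=> mD1 mD2 /(integrable_mkcond _ (measurableX mD1 mD2)) h sl.
have mF : measurable_fun setT ((EFin \o Psi) \_ (D1 `*` D2)) by have /integrableP[] := h.
have h2 : m2.-integrable setT (fubini_G m1 ((EFin \o Psi) \_ (D1 `*` D2))).
  apply/integrableP; split; first exact: (measurable_fubini_G h).
  apply: le_lt_trans ((integrable21ltyP m1 m2 mF).1 h).
  apply: ge0_le_integral => //.
  - by apply: measurableT_comp => //; exact: (measurable_fubini_G h).
  - apply: (@measurable_fun_fubini_tonelli_G _ _ _ _ _ m1 (fun p => `|((EFin \o Psi) \_ (D1 `*` D2)) p|%E)) => //.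
    exact: measurableT_comp.
  - move=> z _; apply: le_abse_integral => //.
    by apply: (measurableT_comp mF); exact: pair2_measurable.
rewrite /fubini_G in h2.
apply/(integrable_mkcond _ mD2); apply: eq_integrable h2 => // z _.
rewrite /patch; case: ifPn => zD; last first.
  rewrite (eq_integral (fun=> 0%E)) ?integral0// => s _; rewrite /patch ifF//.
  by apply/negbTE; move: zD; apply: contra; rewrite !inE => -[].
rewrite inE in zD; rewrite /= fineK; last by apply: integrable_fin_num => //; exact: sl.
rewrite [RHS]integral_mkcond; apply: eq_integral => s _; rewrite /patch.
case: ifPn => sD; case: ifPn => sD' //=.
- by exfalso; move: sD sD'; rewrite !inE => -[h' _] /negP; apply; rewrite inE.
- by exfalso; move: sD sD'; rewrite !inE => /negP h' sD'; apply: h'; rewrite inE.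
Qed.

End slices21.

(** * Duhamel integrals of sources unbounded near time 0 *)

Section volterra.
Context {R : realType} {N : nat}.
Variable m : nat.
Hypothesis mN : (m <= N)%N.
Notation mu := (@lebesgue_measure R).
Notation E := 'rV[R]_N.
Notation row := (@row_of_tuple R N).
Notation Om := (@Omega R N m).
Notation lN := (@lebesgue_tuple R N).
Notation OmT := (row @^-1` Om).
Implicit Types (x y : E) (t s tau T C : R).

Lemma mfun_row_heatop (H : R -> E -> R) a b : mfun2 H -> mfun_row (heatop a (H b)).
Proof.
move=> mH; apply: (measurable_heatop_comp mH) => // i.
rewrite (_ : (fun _ => _) = (fun z => tnth z i)); first exact: measurable_tnth.
by apply/funext => z; rewrite mxE.
Qed.

Lemma mfun2_oddext (H : R -> E -> R) : mfun2 H -> mfun2 (fun s => oddext m (H s)).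
Proof.
move=> mH; apply: measurable_funM; first exact: (measurableT_comp (@measurable_sgm R N m) measurable_snd).
apply: (measurable_row_comp2 mH); first exact: measurable_fst.
by move=> i; exact: (measurableT_comp (@measurable_absm_coord R N m i) measurable_snd).
Qed.

(** The triangle inequality for the Dirichlet semigroup: |phi| itself is even, so its restriction to
    the sector is extended oddly. *)
Lemma normr_heatop_le phi C t y : 0 <= t -> mfun_row phi -> (forall x, `|phi x| <= C) -> oddm m phi ->
  Om y -> `|heatop t phi y| <= heatop t (oddext m (fun x => `|phi x|)) y.
Proof.
move=> t0 mphi phiC ophi Oy; set A := oddext m _; have oA : oddm m A by exact: oddm_oddext.
have C0 : 0 <= C := le_trans (normr_ge0 _) (phiC 0).
have mA : mfun_row A by apply: mfun_row_oddext; apply: (mfun_row_comp (b := fun r => `|r|)).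
have AC x : `|A x| <= C by apply: normr_oddext_le => // z _; rewrite normr_id.
rewrite ler_norml; apply/andP; split; last first.
  apply: (le_heatop mN t0 mphi phiC ophi mA AC oA) => // z Oz.
  by rewrite /A oddext_Omega// ler_norm.
have e : - heatop t A y = heatop t (fun z => -1 * A z) y.
  by rewrite (heatopZ _ _ _ mA AC) mulN1r.
rewrite e; apply: (@le_heatop R N m mN _ _ C C) => //.
- have mm : measurable_fun [set: R] (fun r : R => -1 * r) by exact: measurable_funM.
  exact: (mfun_row_comp mm mA).
- by move=> z; rewrite mulN1r normrN.
- exact: oddmZ.
- by move=> z Oz; rewrite /A oddext_Omega// mulN1r lerNl -normrN ler_norm.
Qed.

Section fubini.
Variables (H : R -> E -> R) (s t : R) (x : E).
Hypotheses (t0 : 0 < t) (Ox : Om x) (mH : mfun2 H).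
Hypothesis oH : forall r, 0 < r < s -> oddm m (H r).
Hypothesis bH : forall r, 0 < r < s -> exists C, forall y, `|H r y| <= C.
Hypothesis jH : forall T y, s <= T -> Om y ->
  mu.-integrable `]0, s[ (EFin \o (fun r => heatop (T - r) (oddext m (fun z => `|H r z|)) y)).

Let A r := oddext m (fun z => `|H r z|).

Let mHr r : mfun_row (H r). Proof. exact: mfun2_section. Qed.

Let mA r : mfun_row (A r).
Proof. by apply: mfun_row_oddext; apply: (mfun_row_comp (b := fun r => `|r|)). Qed.

Let bA r : 0 < r < s -> exists C, (forall y, `|H r y| <= C) /\ (forall y, `|A r y| <= C).
Proof.
move=> rs; have [C hC] := bH rs; exists C; split=> // y.
apply: normr_oddext_le => [|z _]; first exact: le_trans (hC 0).
by rewrite normr_id.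
Qed.

Let heatop_dom r T y : 0 < r < s -> r <= T -> Om y -> `|heatop (T - r) (H r) y| <= heatop (T - r) (A r) y.
Proof.
move=> rs rT Oy; have [C hC] := bH rs.
by apply: (normr_heatop_le (C := C)) => //; [rewrite subr_ge0|exact: oH].
Qed.

Let slice T y : s <= T -> Om y ->
  mu.-integrable `]0, s[ (EFin \o (fun r => heatop (T - r) (H r) y)).
Proof.
move=> sT Oy; apply: (integrable_dominated _ _ (jH sT Oy)) => //.
- exact: measurable_funTS (measurable_heatop_time _ _ mH).
- move=> r /=; rewrite in_itv/= => rs; have /andP[_ r1] := rs.
  by apply: heatop_dom => //; rewrite (le_trans (ltW r1)).
Qed.

Let Psi (p : measurableTypeR R * N.-tuple R) := heat_kernel m t x (row p.2) * heatop (s - p.1) (H p.1) (row p.2).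

Let iK (phi : E -> R) C : mfun_row phi -> (forall y, `|phi y| <= C) -> oddm m phi ->
  lN.-integrable OmT (EFin \o (fun z => heat_kernel m t x (row z) * phi (row z))).
Proof. by move=> *; apply: (@integrable_heat_kernel R N m mN phi C). Qed.

Let mr r : mfun_row (heatop (s - r) (H r)).
Proof. exact: mfun_row_heatop mH. Qed.

Let oHr r : 0 < r < s -> oddm m (heatop (s - r) (H r)).
Proof. by move=> rs; have [C hC] := bH rs; apply: (@oddm_heatop R N m (s - r) (H r) C) => //; exact: oH. Qed.

(** By positivity of the kernel and the semigroup law, the slice at time r is at most the heat flow
    of [A r] during t + s - r, and this is integrable in r by [jH]. *)
Let integrable_Psi : (mu \x lN)%E.-integrable (`]0, s[%classic `*` OmT) (EFin \o Psi).
Proof.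
have mOT := @measurable_Omega R N m.
have mK : measurable_fun OmT (fun z => heat_kernel m t x (row z)).
  have /integrableP[/measurable_EFinP h _] := iK (@measurable_sgm R N m) (@normr_sgm_le1 R N m) (@oddm_sgm R N m).
  apply: eq_measurable_fun h => z; rewrite inE => Oz /=.
  by rewrite sgm_Omega// mulr1.
have mrA r : mfun_row (heatop (s - r) (A r)).
  have mAA : mfun2 (fun=> A r).
    by rewrite /mfun2; have := measurableT_comp (mA r) (@measurable_snd _ _ R (N.-tuple R)); exact.
  exact: mfun_row_heatop mAA.
have hr r : 0 < r < s -> exists C, (forall y, `|heatop (s - r) (H r) y| <= C) /\ (forall y, `|heatop (s - r) (A r) y| <= C).
  move=> rs; have [C [hC hA]] := bA rs; exists C.
  by split=> y; exact: heatop_bound.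
apply: (@integrable_slices _ _ (measurableTypeR R) _ R mu lN `]0, s[%classic OmT
  Psi _ _ _ _ (fun r => heatop (t + s - r) (A r) x)) => //.
- apply: measurable_funM.
    apply: (measurable_comp (F := OmT) (f := fun z => heat_kernel m t x (row z)) (g := snd)) => //.
      by move=> _ [[r z] [_ Oz] <-].
    exact: measurable_funTS.
  apply: measurable_funTS; apply: (measurable_heatop_comp mH).
  + by apply: measurable_funB => //; exact: measurable_fst.
  + exact: measurable_fst.
  + move=> i; rewrite (_ : (fun _ => _) = (fun p => tnth p.2 i)); last by apply/funext => z; rewrite mxE.
    by apply: measurable_tnth_comp; exact: measurable_snd.
- move=> r /=; rewrite in_itv/= => rs; have [C [h1 _]] := hr r rs.
  exact: (@iK (heatop (s - r) (H r)) C (mr r) h1 (oHr rs)).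
- apply: jH => //; by rewrite lerDr ltW.
move=> r /=; rewrite in_itv/= => rs; have /andP[r0 rs'] := rs.
have [C [h1 h2]] := hr r rs; have [C' [_ hA]] := bA rs.
have oA : oddm m (heatop (s - r) (A r)).
  by apply: (@oddm_heatop R N m (s - r) (A r) C') => //; exact: oddm_oddext.
have -> : heatop (t + s - r) (A r) x = \int[lN]_(z in OmT) (heat_kernel m t x (row z) * heatop (s - r) (A r) (row z)).
  rewrite -addrA -(@heatop_semigroup _ _ t (s - r) (A r) C') ?ltW// ?subr_gt0//.
  by rewrite -(heat_heatop mN x t0 (mrA r) h2 oA).
apply: le_Rintegral => //.
- have := integrable_norm (@iK (heatop (s - r) (H r)) C (mr r) h1 (oHr rs)); exact.
- exact: (@iK (heatop (s - r) (A r)) C (mrA r) h2 oA).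
move=> z Oz; rewrite normrM.
have K0 : 0 <= heat_kernel m t x (row z) by apply: heat_kernel_ge0 => // i im; exact/ltW/Ox.
by rewrite ger0_norm// ler_wpM2l// heatop_dom// ltW.
Qed.

Let Z z : OmT z -> \int[mu]_(r in `]0, s[) Psi (r, z) =
  heat_kernel m t x (row z) * \int[mu]_(r in `]0, s[) heatop (s - r) (H r) (row z).
Proof. by move=> Oz; rewrite -RintegralZl//; exact: slice. Qed.

Lemma integrable_kernel_duhamel : lN.-integrable OmT
  (EFin \o (fun z => heat_kernel m t x (row z) * \int[mu]_(r in `]0, s[) heatop (s - r) (H r) (row z))).
Proof.
have mOT := @measurable_Omega R N m.
have := @integrable_Rintegral21 _ _ (measurableTypeR R) _ R mu lN `]0, s[%classic OmT Psi _ mOT integrable_Psi.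
move=> /(_ (measurable_itv _)) h.
apply: eq_integrable (h _) => //.
  by move=> z; rewrite inE => Oz /=; rewrite Z.
move=> z Oz; have := @integrableZR R _ (measurableTypeR R) mu `]0, s[%classic (fun r => heatop (s - r) (H r) (row z)) (heat_kernel m t x (row z)).
by apply => //; exact: slice.
Qed.

(** The analogue of [heatop_duh] when [H r] is bounded for each r but not uniformly as r tends to 0;
    absolute convergence takes the place of the bound. *)
Lemma heat_duhamel : heat m t (fun y => \int[mu]_(r in `]0, s[) heatop (s - r) (H r) y) x =
  \int[mu]_(r in `]0, s[) heatop (t + s - r) (H r) x.
Proof.
have mOT := @measurable_Omega R N m.
transitivity (\int[lN]_(z in OmT) \int[mu]_(r in `]0, s[) Psi (r, z)).
  by apply: eq_Rintegral => z; rewrite inE => Oz; rewrite Z.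
have -> := esym (@Rintegral_fubini R _ _ (measurableTypeR R) _ mu lN `]0, s[%classic OmT Psi (measurable_itv _) mOT integrable_Psi).
apply: eq_Rintegral => r; rewrite inE/= in_itv/= => rs; have /andP[r0 rs'] := rs.
have [C hC] := bH rs.
transitivity (heat m t (heatop (s - r) (H r)) x) => //.
rewrite (heat_heatop mN x t0 (mr r) (C := C)).
- by rewrite (@heatop_semigroup _ _ t (s - r) (H r) C) ?(ltW t0) ?subr_ge0 ?(ltW rs')// addrA.
- by move=> y; exact: heatop_bound.
- exact: oHr.
Qed.

End fubini.

End volterra.

Section uniqueness.
Context {R : realType} {N : nat}.
Variables (m : nat) (alpha : R).
Hypotheses (mN : (m <= N)%N) (alpha0 : 0 < alpha).
Notation mu := (@lebesgue_measure R).
Notation E := 'rV[R]_N.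
Notation row := (@row_of_tuple R N).
Notation Om := (@Omega R N m).
Notation sgm := (@sgm R N m).
Notation f := (@absorption R alpha).
Implicit Types (x y : E) (t s tau T C : R).

Variables w v : R -> E -> R.
Hypothesis mw : mfun2 w.
Hypothesis ow : forall t, 0 < t -> oddm m (w t).
Hypothesis bw : forall a b, 0 < a -> exists2 C : R, 0 <= C & forall t x, a <= t <= b -> `|w t x| <= C.
Hypothesis jw : forall T y, 0 < T -> Om y ->
  mu.-integrable `]0, T[ (EFin \o (fun r => heatop (T - r) (oddext m (fun z => `|f (w r z)|)) y)).
Hypothesis ew : forall T x, 0 < T -> Om x ->
  w T x = heatop T sgm x - \int[mu]_(r in `]0, T[) heatop (T - r) (fun y => f (w r y)) x.
Hypothesis mv : mfun2 v.
Hypothesis ov : forall t, 0 < t -> oddm m (v t).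
Hypothesis bv : forall t x, 0 < t -> `|v t x| <= 1.
Hypothesis pv : forall T, pmild T sgm (fun s x => - f (v s x)) v.

Let H r y := f (w r y).
Let A r := oddext m (fun z => `|H r z|).

Let mf : measurable_fun setT f. Proof. exact: measurable_absorption. Qed.
Let mH : mfun2 H. Proof. exact: (@mfun2_comp R N f w mf mw). Qed.
Let mA : mfun2 A.
Proof.
apply: mfun2_oddext; have mn : measurable_fun [set: R] (fun r : R => `|r|) by exact: measurableT_comp.
exact: (@mfun2_comp R N (fun r => `|r|) H mn mH).
Qed.
Let oH r : 0 < r -> oddm m (H r).
Proof. by move=> r0; apply: oddm_comp; [exact: absorptionN|exact: ow]. Qed.
Let oA r : oddm m (A r). Proof. exact: oddm_oddext. Qed.

Let bH a b : 0 < a -> exists2 C : R, 0 <= C & forall r y, a <= r <= b -> `|H r y| <= C.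
Proof.
move=> a0; have [C C0 hC] := bw b a0; exists (f C); first exact: absorption_ge0.
by move=> r y rab; rewrite absorption_bound// hC.
Qed.

Let bH1 r : 0 < r -> exists C, (forall y, `|H r y| <= C) /\ (forall y, `|A r y| <= C).
Proof.
move=> r0; have [C C0 hC] := bH r r0; exists C; split=> y; first by rewrite hC// lexx.
by apply: normr_oddext_le => // z _; rewrite normr_id hC// lexx.
Qed.

Let jA s T y : 0 < s -> s <= T -> Om y ->
  mu.-integrable `]0, s[ (EFin \o (fun r => heatop (T - r) (A r) y)).
Proof.
move=> s0 sT Oy; have T0 := lt_le_trans s0 sT.
by apply: integrableS (jw T0 Oy) => //; apply: subset_itvl; rewrite bnd_simp.
Qed.

Let heatop_dom r T y : 0 < r -> r <= T -> Om y -> `|heatop (T - r) (H r) y| <= heatop (T - r) (A r) y.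
Proof.
move=> r0 rT Oy; have [C [hC _]] := bH1 r0.
apply: (normr_heatop_le mN (C := C)) => //; [by rewrite subr_ge0|exact: mfun2_section|exact: oH].
Qed.

Let jH s T y : 0 < s -> s <= T -> Om y ->
  mu.-integrable `]0, s[ (EFin \o (fun r => heatop (T - r) (H r) y)).
Proof.
move=> s0 sT Oy; apply: (integrable_dominated _ _ (jA s0 sT Oy)) => //.
- exact: measurable_funTS (measurable_heatop_time _ _ mH).
- move=> r /=; rewrite in_itv/= => /andP[r0 rs].
  by apply: heatop_dom => //; rewrite (le_trans (ltW rs)).
Qed.

Let msgm : mfun_row sgm. Proof. exact: measurable_sgm. Qed.
Let osgm : oddm m sgm. Proof. exact: oddm_sgm. Qed.
Let bsgm x : `|sgm x| <= 1. Proof. exact: normr_sgm_le1. Qed.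
Let msg t : mfun_row (heatop t sgm).
Proof.
have h : mfun2 (fun=> sgm) by rewrite /mfun2; exact: (measurableT_comp msgm measurable_snd).
exact: mfun_row_heatop h.
Qed.

(** [pmild_restart] would require [w] to be bounded near time 0. Instead the equation at tau is
    propagated by [heat_duhamel] on the sector, and oddness extends the result to the whole
    space. *)
Let restart tau T : 0 < tau -> pmild T (w tau) (fun s x => - f (w (tau + s) x)) (fun s => w (tau + s)).
Proof.
move=> tau0 t x /andP[t0 tT]; have tt0 : 0 < tau + t by rewrite addr_gt0.
have [C C0 hC] := bw (tau + t) tau0; have [D D0 hD] := bH (tau + t) tau0.
have bwt y : `|w tau y| <= C by rewrite hC// lexx lerDl ltW.
have mwt : mfun_row (w tau) by exact: mfun2_section.
have mHt : mfun2 (fun s => H (tau + s)) by exact: (mfun2_shift _ mH).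
have HtD : tbound t D (fun s => H (tau + s)).
  by move=> s y /andP[s0 st]; rewrite hD// lerDl lerD2l !ltW.
apply: (@oddm_eq R N m (w (tau + t)) (fun x => heatop t (w tau) x + duh (fun s x => - f (w (tau + s) x)) t x)).
- exact: ow.
- apply: oddmD; first by apply: (@oddm_heatop R N m t (w tau) C) => //; exact: ow.
  apply: (@oddm_duh R N m _ D).
  + have mN1 : measurable_fun [set: R] (fun r : R => - r) by exact: measurableT_comp.
    exact: (@mfun2_comp R N (fun r => - r) (fun s => H (tau + s)) mN1 mHt).
  + by move=> s y st; rewrite normrN HtD.
  + move=> s /andP[s0 _]; apply: (@oddm_comp R N m (fun r => - r) (H (tau + s))) => //.
    by apply: oH; rewrite addr_gt0.
move=> y Oy; rewrite (duhN y mHt HtD).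
have -> := ew tt0 Oy.
rewrite (@Rintegral_itv_cat R _ 0 tau (tau + t)); last 2 first.
- by rewrite ltW//= lerDl ltW.
- exact: jH.
have -> : \int[mu]_(s in `]tau, tau + t[) heatop (tau + t - s) (fun z => f (w s z)) y = duh (fun s => H (tau + s)) t y.
  rewrite (@Rintegral_translate_itv R _ tau t D); last 2 first.
  - exact: (measurable_heatop_time _ _ mH).
  - move=> s /andP[s0 s1]; apply: heatop_bound => [|z]; first exact: (mfun2_section s mH).
    by rewrite hD// !ltW.
  apply: eq_Rintegral => s _.
  by have -> : tau + t - (tau + s) = t - s by ring.
have oD : oddm m (fun z => heatop tau sgm z - w tau z).
  move=> i im z; rewrite (oddm_heatop _ msgm bsgm osgm im) (ow tau0 im); ring.
have -> : heatop t (w tau) y = heatop (tau + t) sgm y - \int[mu]_(r in `]0, tau[) heatop (tau + t - r) (H r) y.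
  rewrite [tau + t]addrC.
  rewrite -(@heat_duhamel R N m mN H tau t y t0 Oy mH) //; last 3 first.
  - by move=> r /andP[r0 _]; exact: oH.
  - by move=> r /andP[r0 _]; have [C' [h _]] := bH1 r0; exists C'.
  - by move=> T' z tT' Oz; exact: jA.
  have -> : heat m t (fun z => \int[mu]_(r in `]0, tau[) heatop (tau - r) (H r) z) y =
      heat m t (fun z => heatop tau sgm z - w tau z) y.
    by apply: eq_heat => z Oz; rewrite ew// opprB addrC subrK.
  have b1 z : `|heatop tau sgm z| <= 1 by exact: heatop_bound.
  rewrite (@heat_heatop R N m mN _ (1 + C))//; last 2 first.
  - by apply: measurable_funB; [exact: (msg tau)|exact: mwt].
  - by move=> z; rewrite (le_trans (ler_normB _ _))// lerD.
  rewrite (heatopB _ _ (msg tau) b1 mwt bwt).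
  by rewrite (@heatop_semigroup _ _ t tau sgm 1) ?(ltW t0) ?(ltW tau0)// subKr.
by rewrite opprD addrA.
Qed.

(** At time s the common initial term cancels and two Duhamel integrals over (0, s) remain: that of
    [w] is dominated through [A], that of [v] is at most s because [|f (v r y)| <= 1]. From s on
    both functions are bounded, and [pmild_le], applied in both directions, propagates the
    difference by the heat flow. *)
Let key T x s : 0 < s < T -> Om x -> `|w T x - v T x| <= \int[mu]_(r in `]0, s[) heatop (T - r) (A r) x + s.
Proof.
move=> /andP[s0 sT] Ox; have T0 := lt_trans s0 sT; have Ts0 : 0 < T - s by rewrite subr_gt0.
have [C C0 hC] := bw (T + 1) s0.
have [D [hD hAD]] := bH1 s0.
pose B := Num.max C 1; have CB : C <= B by rewrite le_max lexx.
have B1 : 1 <= B by rewrite le_max lexx orbT.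
pose delta := oddext m (fun y => `|w s y - v s y|).
have sT1 : s <= T + 1 by rewrite (le_trans (ltW sT))// lerDl.
have bws y : `|w s y| <= C by rewrite hC// lexx.
have odelta : oddm m delta by exact: oddm_oddext.
have mdelta : mfun_row delta.
  apply: mfun_row_oddext; apply: (mfun_row_comp (b := fun r => `|r|)) => //.
  by apply: measurable_funB; exact: mfun2_section.
have bdelta y : `|delta y| <= C + 1.
  apply: normr_oddext_le => [|z _]; first by rewrite addr_ge0.
  by rewrite normr_id (le_trans (ler_normB _ _))// lerD// bv.
have mvs : mfun_row (v s) by exact: mfun2_section.
have mws : mfun_row (w s) by exact: mfun2_section.
have mfv : mfun2 (fun r y => - f (v r y)).
  have mfN : measurable_fun setT (fun r : R => - f r) by exact: measurableT_comp.
  exact: (@mfun2_comp R N (fun r => - f r) v mfN mv).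
have f1 : f 1 = 1 by rewrite /absorption normr1 powR1 mulr1.
have bfv T' : tbound T' 1 (fun r y => - f (v r y)).
  by move=> r y /andP[r0 _]; rewrite normrN -[leRHS]f1 absorption_bound// bv.
have d1 y : Om y -> delta y <= \int[mu]_(r in `]0, s[) heatop (s - r) (A r) y + s * sgm y.
  move=> Oy; rewrite /delta oddext_Omega// sgm_Omega// mulr1.
  have ss : 0 < s < s + 1 by rewrite s0/= ltrDl.
  rewrite ew// (pv y ss) opprD addrACA subrr add0r.
  rewrite (le_trans (ler_normB _ _))// normrN lerD//.
    apply: normr_Rintegral_dominated => //; last 2 first.
    - exact: jA.
    - by move=> r /=; rewrite in_itv/= => /andP[r0 rs]; apply: heatop_dom => //; exact: ltW.
    exact: measurable_funTS (measurable_heatop_time _ _ mH).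
  by have := duh_bound y (ltW s0) mfv (bfv s); rewrite mul1r.
have hdelta : heatop (T - s) delta x <= \int[mu]_(r in `]0, s[) heatop (T - r) (A r) x + s.
  (* [A r] is nonnegative on the sector and odd, so it is its own majorant; hence [heat_duhamel]
     applies to [A] in place of [H]. *)
  have AA r : oddext m (fun z => `|A r z|) = A r.
    apply/funext => z; apply: (@oddm_eq R N m (oddext m (fun z => `|A r z|)) (A r) z); [exact: oddm_oddext|exact: oA|] => y Oy.
    by rewrite /A !oddext_Omega// normr_id.
  have A1 : forall r, 0 < r < s -> oddm m (A r) by move=> r _; exact: oA.
  have A2 : forall r, 0 < r < s -> exists C, forall y, `|A r y| <= C.
    by move=> r /andP[r0 _]; have [C' [_ h]] := bH1 r0; exists C'.
  have A3 : forall T' y, s <= T' -> Om y -> mu.-integrable `]0, s[ (EFin \o (fun r => heatop (T' - r) (oddext m (fun z => `|A r z|)) y)).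
    move=> T' y sT' Oy; have := jA s0 sT' Oy.
    by under [X in _ -> _.-integrable _ (EFin \o X)]eq_fun do rewrite AA.
  have i1 := @integrable_kernel_duhamel R N m mN A s (T - s) x Ts0 Ox mA A1 A2 A3.
  have e1 := @heat_duhamel R N m mN A s (T - s) x Ts0 Ox mA A1 A2 A3.
  have mss : mfun_row (fun y => s * sgm y) by exact: measurable_funM.
  have bss y : `|s * sgm y| <= s by rewrite normrM (gtr0_norm s0) ler_piMr// ltW.
  have oss : oddm m (fun y => s * sgm y) by exact: oddmZ.
  have i2 := @integrable_heat_kernel R N m mN (fun y => s * sgm y) s (T - s) x Ts0 mss bss oss.
  have e2 : heat m (T - s) (fun y => s * sgm y) x <= s.
    rewrite (@heat_heatop R N m mN _ s)//; apply: le_trans (ler_norm _) _.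
    exact: heatop_bound.
  rewrite -(@heat_heatop R N m mN delta (C + 1))//.
  rewrite subrK in e1; rewrite -e1.
  apply: le_trans (lerD (lexx _) e2).
  rewrite -RintegralD//; last exact: measurable_Omega.
  apply: le_Rintegral.
  - exact: measurable_Omega.
  - exact: (@integrable_heat_kernel R N m mN delta (C + 1)).
  - by have := integrableD (@measurable_Omega R N m) i1 i2; exact.
  move=> z Oz; rewrite -mulrDr ler_wpM2l//; last exact: d1.
  by apply: heat_kernel_ge0 => // i im; exact/ltW/Ox.
have TT : 0 < T - s < T + 1 - s by rewrite Ts0/= ltrD2r ltrDl.
have TE : s + (T - s) = T by rewrite addrC subrK.
have bfvT : tbound (T + 1) 1 (fun r y => - f (v r y)) by exact: bfv.
have sT1' : 0 < s < T + 1 by rewrite s0/= (lt_trans sT)// ltrDl.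
have pvs := pmild_restart msgm bsgm mfv bfvT (pv (T := T + 1)) sT1'.
have pws := @restart s (T + 1 - s) s0.
have mshift (u : R -> E -> R) : mfun2 u -> mfun2 (fun r => u (s + r)).
  move=> mu_; exact: (mfun2_shift _ mu_).
have W1 := mshift w mw; have V1 := mshift v mv.
have W2 : tbound (T + 1 - s) B (fun r => w (s + r)).
  move=> r y /andP[r0 r1]; apply: le_trans CB; apply: hC.
  by rewrite lerDl (ltW r0)/= -lerBrDl ltW.
have V2 : tbound (T + 1 - s) B (fun r => v (s + r)).
  by move=> r y /andP[r0 r1]; apply: le_trans B1; rewrite bv// addr_gt0.
have W3 r : 0 < r < T + 1 - s -> oddm m (w (s + r)) by move=> /andP[r0 _]; apply: ow; rewrite addr_gt0.
have V3 r : 0 < r < T + 1 - s -> oddm m (v (s + r)) by move=> /andP[r0 _]; apply: ov; rewrite addr_gt0.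
have TT0 : 0 < T + 1 - s by have /andP[h1 h2] := TT; exact: lt_trans h2.
have bws' y : `|w s y| <= B + 1 by rewrite (le_trans (bws y))// (le_trans CB)// lerDl.
have bvs' y : `|v s y| <= B + 1 by rewrite (le_trans (bv _ s0))// (le_trans B1)// lerDl.
have bde' y : `|delta y| <= B + 1 by rewrite (le_trans (bdelta y))// lerD2r.
have W2' : tbound (T + 1 - s) (B + 1) (fun r => w (s + r)) by move=> r y rT; rewrite (le_trans (W2 r y rT))// lerDl.
have V2' : tbound (T + 1 - s) (B + 1) (fun r => v (s + r)) by move=> r y rT; rewrite (le_trans (V2 r y rT))// lerDl.
have d0 y : Om y -> 0 <= delta y by move=> Oy; rewrite /delta oddext_Omega.
have c1 y : Om y -> w s y - v s y <= delta y by move=> Oy; rewrite /delta oddext_Omega// ler_norm.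
have c2 y : Om y -> v s y - w s y <= delta y.
  by move=> Oy; rewrite /delta oddext_Omega// distrC ler_norm.
have ows := ow s0; have ovs := ov s0.
have := pmild_le mN alpha0 TT0 mws bws' ows mvs bvs' ovs mdelta bde' odelta W1 W2' W3 V1 V2' V3 pws pvs d0 c1 TT Ox.
have := pmild_le mN alpha0 TT0 mvs bvs' ovs mws bws' ows mdelta bde' odelta V1 V2' V3 W1 W2' W3 pvs pws d0 c2 TT Ox.
rewrite TE => h1 h2; rewrite ler_norml; apply/andP; split; last exact: le_trans h2 hdelta.
by rewrite lerNl opprB; exact: le_trans h1 hdelta.
Qed.

(* [w] may a priori be unbounded as [t -> 0]. Compared from time [s] on, it differs
   from [v] by at most [s] plus the part of its Duhamel integral over [(0, s)],
   which vanishes as [s -> 0] by absolute convergence. *)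
Lemma mild_unique T x : 0 < T -> Om x -> w T x = v T x.
Proof.
move=> T0 Ox; apply/eqP; rewrite -subr_eq0 -normr_eq0 eq_le normr_ge0 andbT.
pose s n : R := T / n.+2%:R.
have s0 n : 0 < s n by rewrite divr_gt0.
have sT n : s n < T by rewrite ltr_pdivrMr// ltr_pMr// ltr1n.
have sc : s n @[n --> \oo] --> (0 : R).
  rewrite -[X in _ --> X](mulr0 T); apply: cvgM; first exact: cvg_cst.
  have := @cvg_harmonic R; rewrite -(cvg_shiftS (@harmonic R)); exact.
pose a r := heatop (T - r) (A r) x.
have ma : measurable_fun setT a by exact: measurable_heatop_time mA.
have ia : mu.-integrable `]0, T[ (EFin \o a) by exact: jA.
have h : \int[mu]_(r in `]0, s n[) a r + s n @[n --> \oo] --> (0 : R).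
  rewrite -[X in _ --> X]addr0; apply: cvgD => //.
  have -> : (fun n => \int[mu]_(r in `]0, s n[) a r) =
      (fun n => \int[mu]_(r in `]0, T[) (if 0 < r < s n then a r else 0)).
    apply/funext => n; rewrite !Rintegral_itv_mkcond; apply: eq_Rintegral => r _.
    case: ifP => [/andP[r0 rs]|nrs]; last by rewrite if_same.
    by rewrite r0 (lt_trans rs).
  rewrite [X in _ --> X](_ : _ = \int[mu]_(r in `]0, T[) 0); last by rewrite Rintegral_cst//= mul0r.
  apply: (@cvg_Rintegral R _ _ mu `]0, T[%classic (fun n r => if 0 < r < s n then a r else 0) (fun=> 0) (fun r => `|a r|)) => //.
  - by move=> n; apply: measurable_funTS; exact: measurable_itv_cond.
  - move=> r /=; rewrite in_itv/= => /andP[r0 _].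
    have hn : \forall n \near \oo, s n < r by exact: (cvgr_lt _ sc).
    apply: cvg_near_cst; near=> n.
    have nr : s n < r by near: n.
    by rewrite r0 ltNge (ltW nr).
  - exact: integrable_norm ia.
  - by move=> r n _; case: ifP => _; rewrite ?normr0.
apply: (ler_cvg_to (@cvg_cst _ _ _ _ _) h); apply: nearW => n.
by apply: key => //; rewrite s0 sT.
Unshelve. all: by end_near. Qed.

End uniqueness.

(** * Arbitrary mild solutions from the constant 1 *)

Section mild_solutions.
Context {R : realType} {N : nat}.
Variables (m : nat) (alpha : R).
Hypotheses (mN : (m <= N)%N) (alpha0 : 0 < alpha).
Notation mu := (@lebesgue_measure R).
Notation E := 'rV[R]_N.
Notation row := (@row_of_tuple R N).
Notation Om := (@Omega R N m).
Notation sgm := (@sgm R N m).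
Notation absm := (@absm R N m).
Notation lN := (@lebesgue_tuple R N).
Notation OmT := (row @^-1` Om).
Notation f := (@absorption R alpha).
Implicit Types (x y : E) (t s T C : R).

Lemma uniform_cvg_dist (A : set E) (F : set_system (E -> R)) (g : E -> R) :
  {uniform A, F --> g} -> forall e : R, 0 < e -> \forall h \near F, forall y, A y -> `|g y - h y| < e.
Proof.
move=> Fg e e0; apply: Fg; apply/uniform_nbhs.
exists [set p : R * R | `|p.1 - p.2| < e]; split=> //=; last by move=> h hA y Ay; exact: hA.
by exists e.
Qed.

Lemma closure_absm y : closure Om (absm y).
Proof. by apply/closure_Omega => i im; rewrite mxE im. Qed.

Lemma absm_lip x y : `|absm x - absm y| <= `|x - y|.
Proof.
apply: rV_norm_le => // i; apply: le_trans (rV_coord_le (x - y) i).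
by rewrite !mxE; case: ifP => // _; exact: ler_dist_dist.
Qed.

Lemma sgm_near x : Om (absm x) -> \forall y \near x, sgm y = sgm x.
Proof.
move=> Ox.
have h : \forall y \near x, forall i : 'I_N, (i < m)%N -> Num.sg ((y : E) ord0 i) = Num.sg (x ord0 i).
  apply: (@filter_forall _ _ (fun (i : 'I_N) (y : E) => (i < m)%N -> Num.sg (y ord0 i) = Num.sg (x ord0 i)) (nbhs x)) => i.
  have [im|] := boolP (i < m)%N; last by move=> _; exact: nearW.
  have cx : (fun y : E => y ord0 i) @ x --> x ord0 i by exact: coord_continuous.
  have [xi|xi|xi] := ltgtP 0 (x ord0 i).
  - have hn : \forall y \near x, 0 < (y : E) ord0 i by exact: (cvgr_gt _ cx).
    by apply: filterS hn => y yi _; rewrite !gtr0_sg.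
  - have hn : \forall y \near x, (y : E) ord0 i < 0 by exact: (cvgr_lt _ cx).
    by apply: filterS hn => y yi _; rewrite !ltr0_sg.
  - by have := Ox i im; rewrite mxE im -xi normr0 ltxx.
by apply: filterS h => y hy; apply: eq_bigr => i im; exact: hy.
Qed.

Section extension.
Variable v : R -> E -> R.
Hypothesis cv : continuous_C0bu m v.

(** Values of [v] off the closed sector and at nonpositive times are arbitrary, so [v] itself need
    not be measurable; this extension is, and it agrees with [v] on the sector at positive times. *)
Definition timeext t := if 0 < t then oddext m (v t) else cst 0.

Lemma timeext_Omega t x : 0 < t -> Om x -> timeext t x = v t x.
Proof. by move=> t0 Ox; rewrite /timeext t0 oddext_Omega. Qed.

Lemma oddm_timeext t : 0 < t -> oddm m (timeext t).
Proof. by move=> t0; rewrite /timeext t0; exact: oddm_oddext. Qed.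

Let v_absm0 t x : 0 < t -> sgm x = 0 -> v t (absm x) = 0.
Proof.
move=> t0 /eqP/prodf_eq0[i im]; rewrite sgr_eq0 => /eqP xi.
have [[_ _ bd] _] := (cv.1 t t0, tt); apply: bd; split; first exact: closure_absm.
by move=> /interior_subset /(_ i im); rewrite mxE im xi normr0 ltxx.
Qed.

Let near_v t e : 0 < t -> 0 < e -> \forall s \near t, forall y, closure Om y -> `|v t y - v s y| < e.
Proof. by move=> t0 e0; have := uniform_cvg_dist (cv.2 t t0) e0. Qed.

Let continuous_timeext t x : 0 < t -> {for (t, x), continuous (fun p : R * E => timeext p.1 p.2)}.
Proof.
move=> t0; apply/cvgrPdist_lt => e e0; have e20 : 0 < e / 2 by rewrite divr_gt0.
have [_ uc _] := cv.1 t t0; have [d d0 hd] := uc _ e20.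
have cf : p.1 @[p --> (t, x)] --> t by exact: cvg_fst.
have cs : p.2 @[p --> (t, x)] --> x by exact: cvg_snd.
have n0 : \forall p \near (t, x), 0 < p.1 by exact: (cvgr_gt _ cf).
have n1 : \forall p \near (t, x), forall y, closure Om y -> `|v t y - v p.1 y| < e / 2.
  exact: (cf _ (near_v t0 e20)).
have n2 : \forall p \near (t, x), `|x - p.2| < d.
  by move/cvgrPdist_lt : cs => /(_ d d0).
(* The sign is locally constant off the hyperplanes; on them it may jump, but there v t (absm x) = 0
   by the boundary condition. *)
have n3 : \forall p \near (t, x), sgm p.2 * v t (absm x) = sgm x * v t (absm x).
  have [sx|[_ Ox]] := sgm_absm m x.
    by near=> p; rewrite v_absm0// !mulr0.
  have hs : \forall p \near (t, x), sgm p.2 = sgm x by exact: (cs _ (sgm_near Ox)).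
  by near=> p; congr (_ * _); near: p.
near=> p.
have p0 : 0 < p.1 by near: p.
have h1 : forall y, closure Om y -> `|v t y - v p.1 y| < e / 2 by near: p.
have h2 : `|x - p.2| < d by near: p.
have h3 : sgm p.2 * v t (absm x) = sgm x * v t (absm x) by near: p.
rewrite /timeext t0 p0 /oddext -h3 -mulrBr normrM.
apply: (@le_lt_trans _ _ `|v t (absm x) - v p.1 (absm p.2)|).
  by rewrite ler_piMl//; exact: normr_sgm_le1.
have -> : v t (absm x) - v p.1 (absm p.2) = (v t (absm x) - v t (absm p.2)) + (v t (absm p.2) - v p.1 (absm p.2)) by ring.
rewrite (le_lt_trans (ler_normD _ _))// (splitr e) ltrD//; last by apply: h1; exact: closure_absm.
by apply: hd; [exact: closure_absm|exact: closure_absm|exact: le_lt_trans (absm_lip _ _) h2].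
Unshelve. all: by end_near. Qed.

Lemma mfun2_timeext : mfun2 timeext.
Proof.
apply: mfun2_continuous => [t x t0|t x t0]; first exact: continuous_timeext.
by rewrite /timeext ltNge t0.
Qed.

Lemma timeext_bound a b : 0 < a -> exists2 C : R, 0 <= C & forall t x, a <= t <= b -> `|timeext t x| <= C.
Proof.
move=> a0.
pose P (M : R) (t : R) := forall y, `|timeext t y| <= M.
(* Uniform continuity in time gives one bound near each t, and compactness of [a, b] makes it
   common. *)
have /compact_near_coveringP /(_ R (+oo)%R P _) h := @segment_compact R a b.
have : \forall M \near +oo, `[a, b]%classic `<=` P M.
  apply: h => t /=; rewrite in_itv/= => /andP[at_ _]; have t0 := lt_le_trans a0 at_.
  have [[M0 hM0] _ _] := cv.1 t t0.
  have n1 : \forall s \near t, 0 < s by exact: lt_nbhsr.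
  have n2 := near_v t0 ltr01.
  exists ([set s | 0 < s /\ forall y, closure Om y -> `|v t y - v s y| < 1], [set M : R | `|M0| + 1 < M]).
    split => /=; first exact: filterI n1 n2.
    by exists (`|M0| + 1); split => //; exact: num_real.
  move=> [s M] /= [[s0 hs] hM] y; rewrite /timeext s0.
  apply: normr_oddext_le => [|z Oz]; first by rewrite (le_trans _ (ltW hM))// addr_ge0.
  have cz : closure Om z by exact: subset_closure.
  have -> : v s z = v t z - (v t z - v s z) by rewrite subKr.
  rewrite (le_trans (ler_normB _ _))// (le_trans _ (ltW hM))// lerD//.
    by rewrite (le_trans (hM0 z cz))// ler_norm.
  exact/ltW/hs.
move=> [M0 [_ hM]]; exists (`|M0| + 1); first by rewrite addr_ge0.
move=> t x tab; apply: hM; first by rewrite (le_lt_trans (ler_norm _))// ltrDl.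
by rewrite /= in_itv.
Qed.

End extension.

Lemma mild_solution_unique v w : mild_solution alpha m (cst 1) v ->
  mfun2 w -> (forall t, 0 < t -> oddm m (w t)) -> (forall t x, 0 < t -> `|w t x| <= 1) ->
  (forall T, pmild T sgm (fun s x => - f (w s x)) w) ->
  forall t x, 0 < t -> Om x -> v t x = w t x.
Proof.
move=> [cv hv] mw ow bw pw t x t0 Ox.
have mf : measurable_fun setT f by exact: measurable_absorption.
pose u := timeext v; have mu_ := mfun2_timeext cv; have bu := timeext_bound cv.
have ou := @oddm_timeext v.
rewrite -(timeext_Omega v t0 Ox).
have mH r : mfun_row (fun z => f (u r z)) by exact: mfun_row_comp mf (mfun2_section r mu_).
have bH r : 0 < r -> exists2 C : R, 0 <= C & forall z, `|f (u r z)| <= C.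
  move=> r0; have [C C0 hC] := bu r r r0; exists (f C); first exact: absorption_ge0.
  by move=> z; rewrite absorption_bound// hC// lexx.
have oH r : 0 < r -> oddm m (fun z => f (u r z)).
  by move=> r0; apply: oddm_comp; [exact: absorptionN|exact: ou].
have eqv T r y : 0 < r < T -> heat m (T - r) (fun z => f (v r z)) y = heatop (T - r) (fun z => f (u r z)) y.
  move=> /andP[r0 rT]; have [C C0 hC] := bH r r0.
  rewrite (@eq_heat R N m _ (fun z => f (u r z))); last by move=> z Oz; rewrite /u timeext_Omega.
  by apply: (heat_heatop mN _ _ (mH r) hC); [rewrite subr_gt0|exact: oH].
apply: (mild_unique mN alpha0 mu_ ou bu _ _ mw ow bw pw t0 Ox).
(* The integrability clause in the definition of a mild solution is used here: its slices in
   absolute value are the heat flows of |f (v r)|. *)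
- move=> T y T0 Oy; have [iPsi _] := hv T y T0 Oy.
  pose Psi (p : measurableTypeR R * N.-tuple R) := heat_kernel m (T - p.1) y (row p.2) * f (v p.1 (row p.2)).
  have mOT := @measurable_Omega R N m.
  have mPsi : measurable_fun (`]0, T[%classic `*` OmT) Psi.
    by have /integrableP[/measurable_EFinP] := iPsi.
  have sl (r : measurableTypeR R) : `]0, T[%classic r -> lN.-integrable OmT (EFin \o (fun z => Psi (r, z))).
    rewrite /= in_itv/= => /andP[r0 rT]; have [C C0 hC] := bH r r0.
    have Tr : 0 < T - r by rewrite subr_gt0.
    have := @integrable_heat_kernel R N m mN _ C (T - r) y Tr (mH r) hC (oH r r0).
    apply: eq_integrable => // z; rewrite inE => Oz; rewrite /Psi /=.
    by rewrite /u timeext_Omega.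
  have := @integrable_slice_norm _ _ (measurableTypeR R) _ R mu lN `]0, T[%classic OmT Psi (measurable_itv _) mOT sl iPsi.
  apply: eq_integrable => // r; rewrite inE/= in_itv/= => /andP[r0 rT]; congr EFin.
  have [C C0 hC] := bH r r0; have Tr : 0 < T - r by rewrite subr_gt0.
  rewrite -(@heat_oddext R N m mN _ C)//; last 2 first.
  - by apply: mfun_row_oddext; apply: (mfun_row_comp (b := fun r => `|r|)).
  - by move=> z _; rewrite normr_id.
  apply: eq_Rintegral => z /set_mem /= Oz; rewrite normrM /u timeext_Omega//.
  congr (_ * _); apply: ger0_norm.
  by apply: heat_kernel_ge0 => // i im; exact/ltW/Oy.
- move=> T y T0 Oy; have [_] := hv T y T0 Oy; rewrite timeext_Omega// => ->.
  congr (_ - _); last first.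
    by apply: eq_Rintegral => r; rewrite inE/= in_itv/= => rT; exact: eqv.
  rewrite (@eq_heat R N m _ sgm); last by move=> z Oz; rewrite sgm_Omega.
  apply: (@heat_heatop R N m mN sgm 1) => //; [exact: measurable_sgm|exact: normr_sgm_le1|exact: oddm_sgm].
Qed.

End mild_solutions.

(** * The self-similar solution *)

Section assembly.
Context {R : realType} {N : nat}.
Variables (m : nat) (alpha : R).
Hypotheses (mN : (m <= N)%N) (alpha0 : 0 < alpha).
Notation E := 'rV[R]_N.
Notation Om := (@Omega R N m).
Notation sgm := (@sgm R N m).
Notation f := (@absorption R alpha).
Implicit Types (x y : E) (t s T C : R).

Lemma heat_cst1 t x : 0 < t -> heat m t (cst 1) x = heatop t sgm x.
Proof.
move=> t0; rewrite (@eq_heat R N m _ sgm); last by move=> z Oz; rewrite sgm_Omega.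
by apply: (@heat_heatop R N m mN sgm 1) => //; [exact: measurable_sgm|exact: normr_sgm_le1|exact: oddm_sgm].
Qed.

Lemma compact_time_bounds (K : set (R * E)) : compact K -> K `<=` `]0, +oo[%classic `*` setT ->
  exists2 M : R, 0 < M & forall p, K p -> M^-1 <= p.1 <= M.
Proof.
move=> /compact_near_coveringP cK K0.
have /(_ R (+oo)%R (fun (M : R) p => M^-1 <= p.1 <= M) _) h := cK.
have : \forall M \near +oo, K `<=` (fun p => M^-1 <= p.1 <= M).
  apply: h => -[t x] /K0 /= []; rewrite in_itv/= andbT => t0 _.
  have cf : p.1 @[p --> (t, x)] --> t by exact: cvg_fst.
  have n1 : \forall p \near (t, x), t / 2 < p.1.
    by apply: (cvgr_gt _ cf); rewrite gtr_pMr// invf_lt1// ltr1n.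
  have n2 : \forall p \near (t, x), p.1 < t + 1 by apply: (cvgr_lt _ cf); rewrite ltrDl.
  exists ([set p | t / 2 < p.1 /\ p.1 < t + 1], [set M : R | Num.max (2 / t) (t + 1) < M]).
    split => /=; first exact: filterI n1 n2.
    by exists (Num.max (2 / t) (t + 1)); split => //; exact: num_real.
  move=> [[s y] M] /= [[ts st]]; rewrite gt_max => /andP[M1 M2].
  rewrite (le_trans (ltW st) (ltW M2)) andbT (le_trans _ (ltW ts))//.
  have t20 : 0 < 2 / t by rewrite divr_gt0.
  by rewrite -[t / 2]invf_div lef_pV2 ?posrE ?(lt_trans t20 M1)// ltW.
move=> [M0 [_ hM]]; exists (`|M0| + 1); first by rewrite ltr_pwDr.
by move=> p Kp; apply: hM => //; rewrite (le_lt_trans (ler_norm _))// ltrDl.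
Qed.

Lemma continuous_C0bu_shift tau (u : R -> E -> R) : 0 < tau -> continuous_C0bu m u ->
  continuous_C0bu m (fun t => u (tau + t)).
Proof.
move=> tau0 [c1 c2]; split=> t t0; first by apply: c1; rewrite addr_gt0.
have h : tau + s @[s --> t] --> tau + t by apply: cvgD; [exact: cvg_cst|exact: cvg_id].
exact: (cvg_comp _ _ h (c2 (tau + t) (addr_gt0 tau0 t0))).
Qed.

(** The dilation with parameter t^(-1/2) brings time t to time 1, which yields the profile form. *)
Lemma dilation_sqrt (V : R -> E -> R) t x : 0 < t -> dilation alpha (Num.sqrt t)^-1 V t x =
  t `^ (- alpha^-1) * V 1 ((Num.sqrt t)^-1 *: x).
Proof.
move=> t0; rewrite /dilation exprVn sqr_sqrtr ?(ltW t0)// mulVf ?gt_eqF//; congr (_ * _).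
rewrite -powR12_sqrt ?(ltW t0)// -powRN -powRrM; congr (_ `^ _).
by field; rewrite gt_eqF.
Qed.

Lemma cvg_modulus (L : R) :
  L * (Num.sqrt (l ^- 2 / alpha) + l ^- 2 / alpha) @[l --> +oo] --> (0 : R).
Proof.
have iv : l^-1 @[l --> +oo] --> (0 : R).
  apply/(@gtr0_cvgV0 _ _ _ _ id); last exact: cvg_id.
  exact: nbhs_pinfty_gt.
have h : l ^- 2 / alpha @[l --> +oo] --> (0 : R).
  rewrite -[X in _ --> X](mul0r alpha^-1); apply: cvgM; last exact: cvg_cst.
  have -> : (fun l : R => l ^- 2) = (fun l => l^-1 * l^-1) by apply/funext => l; rewrite -exprVn expr2.
  by rewrite -[X in _ --> X](mul0r 0); exact: cvgM.
rewrite -[X in _ --> X](mulr0 L); apply: cvgM; first exact: cvg_cst.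
rewrite -[X in _ --> X]addr0; apply: cvgD => //.
by rewrite -[X in _ --> X](@sqrtr0 R); apply: continuous_cvg => //; exact: sqrt_continuous.
Qed.

(** The first conjunct ensures that the last clause, about every mild solution from 1, is not
    vacuous. *)
Lemma self_similar_attractor :
  (exists v : R -> E -> R, mild_solution alpha m (cst 1) v) /\
  exists (V : R -> E -> R) (g : E -> R),
    [/\ solution alpha m V /\ self_similar alpha m V,
        (forall t x, 0 < t -> closure Om x ->
           V t x = t `^ (- alpha^-1) * g ((Num.sqrt t)^-1 *: x)),
        C0bu m g /\ (forall x, Om x -> 0 <= g x),
        (forall eps : R, 0 < eps < 1 -> forall x, Om x ->
           alpha `^ (- alpha^-1) * heat m 1 (cst 1) x <= g x
             <= (alpha * eps) `^ (- alpha^-1) * heat m (1 - eps) (cst 1) x)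
      & forall v : R -> E -> R, mild_solution alpha m (cst 1) v ->
          cvg_locally_uniformly m (fun lambda => dilation alpha lambda v) V].
Proof.
have [v [mv ov hv pv]] := @exists_pmild R N m alpha mN alpha0.
have bv t x : 0 < t -> `|v t x| <= 1.
  move=> t0; apply: (oddm_bound (ov t t0)) => // y Oy.
  have /andP[h1 h2] := hv t y t0 Oy.
  rewrite ger0_norm; first by apply: le_trans h2 _; apply: flat_le1 => //; exact: ltW.
  apply: le_trans h1; apply: mulr_ge0; last by apply: heatop_sgm_ge0 => //; exact: ltW.
  by apply: ltW; apply: flat_gt0 => //; exact: ltW.
have [V [mV oV hV pV [sV cV]]] := exists_rescaled_limit mN alpha0 mv ov hv pv.
have mf : measurable_fun setT (fun r : R => - f r).
  by apply: measurableT_comp => //; exact: measurable_absorption.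
have f1 : f 1 = 1 by rewrite /absorption normr1 powR1 mulr1.
have tv T : tmodulus T v.
  apply: (@pmild_tmodulus R N T sgm (fun s x => - f (v s x)) v 1 1 1) => //.
  - exact: measurable_sgm.
  - exact: normr_sgm_le1.
  - exact: (@mfun2_comp R N (fun r => - f r) v mf mv).
  - by move=> s x /andP[s0 _]; rewrite normrN -[leRHS]f1 absorption_bound// bv.
  - by move=> t; exact: mfun2_section.
  - by move=> s x /andP[s0 _]; exact: bv.
have cv : continuous_C0bu m v by apply: (tmodulus_C0bu (C := fun=> 1)) => // t t0 x; exact: bv.
have v_mild : mild_solution alpha m (cst 1) v.
  apply: (@mild_solution_pmild R N m mN alpha (cst 1) sgm v 1) => //.
  - exact: measurable_sgm.
  - exact: normr_sgm_le1.
  - exact: oddm_sgm.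
  - by move=> y Oy; rewrite sgm_Omega.
pose Bf tau : R := (alpha * tau) `^ (- alpha^-1).
have bV tau t x : 0 < tau -> tau <= t -> `|V t x| <= Bf tau by move=> tau0 tt; exact: (rescaled_limit_bound alpha0 oV hV x tau0 tt).
have tV T : tmodulus T V by exact: (@rescaled_limit_tmodulus R N m alpha alpha0 V oV mV hV pV T).
have cVV : continuous_C0bu m V.
  by apply: (tmodulus_C0bu (C := Bf)) => // t t0 x; exact: bV.
have ssV l t x : 0 < l -> 0 < t -> dilation alpha l V t x = V t x.
  by move=> l0 t0; exact: (rescaled_limit_self_similar oV sV cV x l0 t0).
split; first by exists v.
exists V, (V 1); split.
- split; last by move=> l l0 t x t0 _; exact: ssV.
  split=> //; first exact: (restart_classical m alpha0 mV pV bV tV).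
  move=> tau tau0.
  apply: (@mild_solution_pmild R N m mN alpha (V tau) (V tau) (fun t => V (tau + t)) (Bf tau)) => //.
  + exact: mfun2_section.
  + by move=> y; exact: bV.
  + exact: oV.
  + exact: (mfun2_shift _ mV).
  + by move=> t x t0; apply: bV => //; rewrite lerDl ltW.
  + by move=> t t0; apply: oV; rewrite addr_gt0.
  + by move=> T; exact: pV.
  + exact: continuous_C0bu_shift.
- move=> t x t0 _; rewrite -dilation_sqrt//; apply/esym/ssV => //.
  by rewrite invr_gt0 sqrtr_gt0.
- split; first exact: cVV.1.
  by move=> x Ox; have /andP[] := hV 1 x ltr01 Ox.
- move=> eps /andP[e0 e1] x Ox; rewrite heat_cst1// heat_cst1 ?subr_gt0//.
  rewrite (rescaled_limit_lower alpha0 hv sV Ox)/=.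
  by apply: (rescaled_limit_upper mN alpha0 oV mV hV pV) => //; rewrite e0.
move=> v' v'_mild K cK K0.
have vv' := mild_solution_unique mN alpha0 v'_mild mv ov bv pv.
have [_ [M M0 hM]] : True /\ exists2 M : R, 0 < M & forall p, K p -> M^-1 <= p.1 <= M.
  by split=> //; apply: compact_time_bounds => // p /K0[].
have Mi : 0 < M^-1 by rewrite invr_gt0.
(* Both t and h + t lie in [1/M, M + 1] once h <= 1, which [n2] guarantees for large l. *)
have [L L0 [_ hL]] := tV (M + 2) M^-1 (M + 1) Mi ltac:(by rewrite ltrD2l ltr1n).
apply: uniform_cvgP => e e0.
have n1 : \forall l \near +oo, L * (Num.sqrt (l ^- 2 / alpha) + l ^- 2 / alpha) < e.
  exact: (cvgr_lt _ (cvg_modulus L)).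
have n2 : \forall l \near +oo, 1 * (Num.sqrt (l ^- 2 / alpha) + l ^- 2 / alpha) < 1.
  exact: (cvgr_lt _ (cvg_modulus 1)).
have n3 : \forall l \near +oo, 0 < l :> R by exact: nbhs_pinfty_gt.
change (\forall l \near +oo, forall p : R * E, K p -> `|V p.1 p.2 - dilation alpha l v' p.1 p.2| < e).
near=> l => -[t x] Kp /=.
have l0 : 0 < l by near: l.
have hl1 : L * (Num.sqrt (l ^- 2 / alpha) + l ^- 2 / alpha) < e by near: l.
have hl2 : 1 * (Num.sqrt (l ^- 2 / alpha) + l ^- 2 / alpha) < 1 by near: l.
pose h := l ^- 2 / alpha.
have h0 : 0 < h by rewrite divr_gt0// invr_gt0 exprn_gt0.
have h1 : h <= 1 by have := sqrtr_ge0 h; move: hl2; rewrite -/h; lra.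
have /andP[t1 t2] := hM _ Kp; have t0 : 0 < t := lt_le_trans Mi t1.
have [_ clx] := K0 _ Kp.
have lt0 : 0 < l ^+ 2 * t by rewrite mulr_gt0// exprn_gt0.
(* On the boundary both functions vanish: [V] by oddness, the dilation of [v'] by membership in
   [C0bu]. *)
have [Ox|[i im xi]] := closure_Omega_cases clx; last first.
  rewrite (oddm_eq0 (oV t t0) im xi) sub0r normrN /dilation.
  have [[_ _ bd] _] := (v'_mild.1.1 _ lt0, tt).
  rewrite bd ?mulr0 ?normr0//; split.
    apply/closure_Omega => j jm; rewrite mxE mulr_ge0 ?(ltW l0)//.
    by have /closure_Omega := clx; apply.
  by move=> /interior_subset /(_ i im); rewrite mxE xi mulr0 ltxx.
have Olx : Om (l *: x) by move=> j jm; rewrite mxE mulr_gt0// Ox.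
rewrite [dilation _ _ _ _ _](_ : _ = dilation alpha l v t x); last first.
  by rewrite /dilation vv'.
have /andP[s1 s2] := sV l t x l0 t0 Ox.
rewrite ger0_norm ?subr_ge0//; apply: le_lt_trans hl1.
apply: (@le_trans _ _ (V t x - V (h + t) x)); first by rewrite lerB.
apply: le_trans (ler_norm _) _; rewrite distrC.
have := hL t (h + t) t1 _ _ x; rewrite addrK; apply; first by rewrite lerDr ltW.
by rewrite addrC lerD.
Unshelve. all: by end_near. Qed.

End assembly.

Theorem proposition6p3 (R : realType) (N m : nat) (alpha : R)
    (hm : (1 <= m <= N)%N) (halpha : 0 < alpha) :
  (exists v : R -> 'rV[R]_N -> R, mild_solution alpha m (cst 1) v) /\
  exists (V : R -> 'rV[R]_N -> R) (g : 'rV[R]_N -> R),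
    [/\ solution alpha m V /\ self_similar alpha m V,
        (forall (t : R) (x : 'rV[R]_N), 0 < t -> closure (Omega m) x ->
           V t x = t `^ (- alpha^-1) * g ((Num.sqrt t)^-1 *: x)),
        C0bu m g /\ (forall x : 'rV[R]_N, Omega m x -> 0 <= g x),
        (forall eps : R, 0 < eps < 1 -> forall x : 'rV[R]_N, Omega m x ->
           alpha `^ (- alpha^-1) * heat m 1 (cst 1) x <= g x
             <= (alpha * eps) `^ (- alpha^-1) * heat m (1 - eps) (cst 1) x)
      & forall v : R -> 'rV[R]_N -> R, mild_solution alpha m (cst 1) v ->
          cvg_locally_uniformly m (fun lambda => dilation alpha lambda v) V].
Proof. by move/andP : hm => [_ mN]; exact: self_similar_attractor. Qed.
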